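(* Let $d>4$ and $p=\frac{2}{d-2}\in(0,1)$ (energy-critical exponent). For $b>0$, let $\lambda=\lambda(b)$ denote the value of $\lambda$ on the solution curve of ground states, i.e. such that the stationary Gross--Pitaevskii equation $$(-\Delta+|x|^2)u-|u|^{2p}u=\lambda u,\qquad x\in\mathbb{R}^d,$$ admits a radial ground state $u=u_b(r)$, $r=|x|$, with $u_b(0)=b$, $u_b'(r)<0$ for $r>0$ and $u_b(r)\to0$ as $r\to\infty$. Then, as $b\to\infty$, $$\lambda(b)\sim C_p\begin{cases} b^{-2(1-p)}, & \tfrac12<p<1,\\ b^{-1}\log b, & p=\tfrac12,\\ b^{-2p}, & 0<p<\tfrac12,\end{cases}$$ where $$C_p=\begin{cases}\displaystyle -\frac{\Gamma\left(\frac{p+1}{2p}\right)\Gamma\left(-\frac1p\right)\Gamma\left(\frac2p\right)}{(1+p)\Gamma\left(\frac{p-1}{2p}\right)\Gamma\left(\frac1p\right)\Gamma\left(\frac1p-1\right)\Gamma\left(\frac1p+1\right)}\left[\frac{4(1+p)}{p^2}\right]^{1/p}, & \tfrac12<p<1,\\[2mm] 144, & p=\tfrac12,\\[1mm] \displaystyle\frac{8(1+p)^2}{p^2(1-2p)}, & 0<p<\tfrac12.\end{cases}$$ Moreover, for every $a\in(0,\frac{p}{1+p})$ there exist $B_a,C_a>0$ such that for every $b\ge B_a$, $$\sup_{r\in[0,b^{-p(1-a)}]} b^{-1}\left|u_b(r)-U_b(r)\right|\le C_a b^{-2p(1-a)},$$ $$\sup_{r\in[b^{-p(1-a)},1]}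 r^{2/p}\left|u_b(r)-c(b)e^{-\frac12 r^2}\mathfrak{U}(r^2;\alpha,\beta)\right|\le C_a|c(b)|^{2p+1}b^{2p(1-a)},$$ $$\sup_{r\in[1,\infty)}\left|e^{\frac12 r^2}r^{\frac{d-\lambda(b)}{2}}u_b(r)-c(b)r^{\frac{d-\lambda(b)}{2}}\mathfrak{U}(r^2;\alpha,\beta)\right|\le C_a|c(b)|^{2p+1},$$ where $\alpha,\beta$ are evaluated at $\lambda=\lambda(b)$, and $c(b)\sim A_p b^{-1}$ as $b\to\infty$ for some constant $A_p>0$.
   Context: Notation: $f(b)\sim g(b)$ means $\lim_{b\to\infty} f(b)/g(b)=1$. The algebraic (Aubin--Talenti) soliton is $U_b(r)=\dfrac{b}{(1+\alpha_p b^{2p}r^2)^{1/p}}$ with $\alpha_p=\dfrac{p^2}{4(1+p)}$; it satisfies $-\Delta U_b=U_b^{2p+1}$ and $U_b(0)=b$. The parameters are $\alpha=\frac{p+1}{2p}-\frac{\lambda}{4}$ and $\beta=1+\frac1p$. $\mathfrak{U}(z;\alpha,\beta)$ denotes the Tricomi confluent hypergeometric function, i.e. the solution of Kummer's equation $zu''+(\beta-z)u'-\alpha u=0$ with $\mathfrak{U}(z;\alpha,\beta)\sim z^{-\alpha}(1+O(z^{-1}))$ as $z\to+\infty$. The quantity $c(b)$ is defined by $c(b)=\lim_{r\to\infty}u_b(r)e^{\frac12 r^2}r^{\frac{d-\lambda(b)}{2}}$. $\Gamma$ is the Gamma function. *)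

(* Defs.v *)
From Stdlib Require Export Reals.
From Coquelicot Require Export Coquelicot.
Open Scope R_scope.

(* |x|^q for q > 0, with the convention 0^q = 0 (Stdlib's Rpower 0 q = 1). *)
Definition apow (x q : R) : R :=
  if Rlt_dec 0 (Rabs x) then Rpower (Rabs x) q else 0.

Fixpoint poch (x : R) (n : nat) : R :=
  match n with
  | O => x
  | S m => poch x m * (x + INR (S m))
  end.

(* Euler's Gamma function via Gauss' product formula
   Gamma x = lim_n n! n^x / (x (x+1) ... (x+n)),  x not in {0,-1,-2,...}. *)
Definition Gamma (x : R) : R :=
  real (Lim_seq (fun n => INR (Factorial.fact n) * Rpower (INR n) x / poch x n)).

(* Specification of the Tricomi function: TU z al be = U(z; al, be) solves
   Kummer's equation z u'' + (be - z) u' - al u = 0 on z > 0, and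
   U(z) = z^{-al} (1 + O(1/z)) as z -> +oo. *)
Definition is_tricomi (TU : R -> R -> R -> R) : Prop :=
  forall al be : R,
    (forall z, 0 < z ->
       ex_derive (fun w => TU w al be) z /\
       ex_derive (Derive (fun w => TU w al be)) z /\
       z * Derive (Derive (fun w => TU w al be)) z
         + (be - z) * Derive (fun w => TU w al be) z - al * TU z al be = 0) /\
    (exists M z0 : R, 0 < z0 /\
       forall z, z0 <= z -> Rabs (TU z al be * Rpower z al - 1) <= M / z).

Definition p_of (d : nat) : R := 2 / (INR d - 2).

(* Radial ground state u (profile in r = |x|) of
   (-Delta + |x|^2) u - |u|^{2p} u = lam u  in R^d, with u(0) = b,
   u' < 0 on r > 0 and u -> 0 at infinity.  In radial form:
   u'' + (d-1)/r u' - r^2 u + |u|^{2p} u + lam u = 0 on r > 0,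
   with u regular at the origin (u(0+) = b, u'(0+) = 0). *)
Definition radial_ground_state (d : nat) (p lam b : R) (u : R -> R) : Prop :=
  u 0 = b /\
  filterlim u (at_right 0) (locally b) /\
  filterlim (Derive u) (at_right 0) (locally 0) /\
  (forall r, 0 < r ->
     ex_derive u r /\ ex_derive (Derive u) r /\
     Derive (Derive u) r + (INR d - 1) / r * Derive u r
       - r ^ 2 * u r + apow (u r) (2 * p) * u r + lam * u r = 0) /\
  (forall r, 0 < r -> Derive u r < 0) /\
  filterlim u (Rbar_locally p_infty) (locally 0).

Definition alpha_p (p : R) : R := p ^ 2 / (4 * (1 + p)).

Definition Ualg (p b r : R) : R :=
  b / Rpower (1 + alpha_p p * Rpower b (2 * p) * r ^ 2) (1 / p).

Definition kalpha (p lam : R) : R := (p + 1) / (2 * p) - lam / 4.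
Definition kbeta (p : R) : R := 1 + 1 / p.

Definition Cconst (p : R) : R :=
  if Rlt_dec (1/2) p then
    - (Gamma ((p + 1) / (2 * p)) * Gamma (- (1 / p)) * Gamma (2 / p))
      / ((1 + p) * Gamma ((p - 1) / (2 * p)) * Gamma (1 / p)
           * Gamma (1 / p - 1) * Gamma (1 / p + 1))
      * Rpower (4 * (1 + p) / p ^ 2) (1 / p)
  else if Req_EM_T p (1/2) then 144
  else 8 * (1 + p) ^ 2 / (p ^ 2 * (1 - 2 * p)).

Definition lam_rate (p b : R) : R :=
  if Rlt_dec (1/2) p then Rpower b (- (2 * (1 - p)))
  else if Req_EM_T p (1/2) then / b * ln b
  else Rpower b (- (2 * p)).

(* Main.v *)
Require Import Defs.
From Stdlib Require Import Lra Lia Ranalysis5 Factorial.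

(* Write [d = m + 2], so that [p = 2/m], and [beta = b^p].  Three tools replace the linearized analysis.
   (1) The Pohozaev function [poho], whose derivative is [r^(m+1) (lam - 2 r^2) u^2], vanishes at 0 and at
   infinity and is nonnegative in between: this gives [0 < lam] and keeps [-r u'/u] near [m] outside the
   inner region, whence a uniform bound [b r^m u <= C].
   (2) The Wronskian of [u] and the Tricomi solution [phi] makes [u / phi] increase to [c(b)], with a
   quantitative bound on [c phi - u] coming from the potential [u^(2p)].
   (3) After rescaling by [beta], a Gronwall inequality compares [u] with the bubble on [r beta <= S].
   Integrating the derivative of [poho] up to a small fixed radius expresses [lam beta^2] through the
   bubble moments of [s^(m+1)] and [s^(m+3)] and the boundary value of [poho].  The moments dominate for
   [d >= 6].  For [d = 5] the boundary value, a quadratic form in the limit profile [phi] at [lam = 0],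
   matters; its small-radius expansion is found from the Mellin recurrence of [phi'' + 4 phi'/r = r^2 phi],
   interpolated by log-convexity, and this produces the ratio of Gamma values. *)

(** * Limits and monotonicity *)

(** A ground state is known only through its equation, its monotonicity and its limits, and the
    Tricomi function only through Kummer's equation and its behaviour at infinity. Its size near 0
    and its continuity in [lam] are therefore not given: the first comes out of the matching,
    together with [Ap], the second out of a Wronskian. The obstacle is circular: the Gronwall
    constant is uniform up to [s] of order [beta] only if [u^(2p)] decays like [s^(-4)], which is
    the bound [b r^m u <= C] that the comparison should help to prove. The circle is broken by
    running Gronwall first on a fixed window, with a constant that depends on it, and by leaving
    this window through the sign of [poho]; the resulting uniform bound allows a second, uniform
    run. Since [d] is a natural number, the three ranges of [p] are [d = 5], [d = 6] and [d >= 7];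
    only [p = 2/3] calls for values of Gamma. Integrals are mostly replaced by monotone quantities:
    an inequality between integrals becomes the sign of the derivative of a difference, together
    with a limit of that difference. *)

Lemma flim_eps (F : (R -> Prop) -> Prop) {FF : Filter F} (f : R -> R) (l : R) :
  filterlim f F (locally l) <->
  (forall eps, 0 < eps -> F (fun x => Rabs (f x - l) < eps)).
Proof.
  rewrite filterlim_locally; split.
  - intros H eps He. exact (H (mkposreal eps He)).
  - intros H [eps He]. exact (H eps He).
Qed.

Lemma flim_plus (F : (R -> Prop) -> Prop) {FF : Filter F} (f g : R -> R) (a b : R) :
  filterlim f F (locally a) -> filterlim g F (locally b) ->
  filterlim (fun x => f x + g x) F (locally (a + b)).
Proof.
  intros Hf Hg.
  exact (filterlim_comp_2 f g (fun x y => plus x y) Hf Hg (filterlim_plus a b)).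
Qed.

Lemma flim_mult (F : (R -> Prop) -> Prop) {FF : Filter F} (f g : R -> R) (a b : R) :
  filterlim f F (locally a) -> filterlim g F (locally b) ->
  filterlim (fun x => f x * g x) F (locally (a * b)).
Proof.
  intros Hf Hg.
  exact (filterlim_comp_2 f g (fun x y => mult x y) Hf Hg (@filterlim_mult R_AbsRing a b)).
Qed.

Lemma flim_const (F : (R -> Prop) -> Prop) {FF : Filter F} (a : R) :
  filterlim (fun _ => a) F (locally a).
Proof. apply filterlim_const. Qed.

Lemma flim_cont (F : (R -> Prop) -> Prop) {FF : Filter F} (h f : R -> R) (a : R) :
  continuous h a -> filterlim f F (locally a) ->
  filterlim (fun x => h (f x)) F (locally (h a)).
Proof. intros Hh Hf. exact (filterlim_comp _ _ _ f h F (locally a) _ Hf Hh). Qed.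

Lemma flim_inv (F : (R -> Prop) -> Prop) {FF : Filter F} (f : R -> R) (a : R) :
  a <> 0 -> filterlim f F (locally a) ->
  filterlim (fun x => / f x) F (locally (/ a)).
Proof.
  intros Ha Hf. apply flim_cont; trivial.
  apply (ex_derive_continuous (fun x => / x)). now auto_derive.
Qed.

Lemma flim_opp (F : (R -> Prop) -> Prop) {FF : Filter F} (f : R -> R) (a : R) :
  filterlim f F (locally a) -> filterlim (fun x => - f x) F (locally (- a)).
Proof.
  intros Hf. apply (flim_cont F (fun x => - x)); trivial.
  apply (ex_derive_continuous (fun x => - x)). now auto_derive.
Qed.

Lemma flim_minus (F : (R -> Prop) -> Prop) {FF : Filter F} (f g : R -> R) (a b : R) :
  filterlim f F (locally a) -> filterlim g F (locally b) ->
  filterlim (fun x => f x - g x) F (locally (a - b)).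
Proof. intros Hf Hg. exact (flim_plus F f (fun x => - g x) a (- b) Hf (flim_opp F g b Hg)). Qed.

Lemma flim_pow (F : (R -> Prop) -> Prop) {FF : Filter F} (f : R -> R) (a : R) n :
  filterlim f F (locally a) -> filterlim (fun x => f x ^ n) F (locally (a ^ n)).
Proof.
  intros Hf. apply (flim_cont F (fun x => x ^ n)); trivial.
  apply (ex_derive_continuous (fun x => x ^ n)). now auto_derive.
Qed.

Lemma flim_ext (F : (R -> Prop) -> Prop) {FF : Filter F} (f g : R -> R) (l : R) :
  F (fun x => f x = g x) -> filterlim f F (locally l) -> filterlim g F (locally l).
Proof. intros H Hf. exact (filterlim_ext_loc f g H Hf). Qed.

Lemma flim_abs_le (F : (R -> Prop) -> Prop) {FF : Filter F} (f g : R -> R) (l : R) :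
  F (fun x => Rabs (f x - l) <= g x) -> filterlim g F (locally 0) ->
  filterlim f F (locally l).
Proof.
  intros H Hg. apply flim_eps; trivial. intros eps He.
  apply flim_eps with (eps := eps) in Hg; trivial.
  generalize (filter_and _ _ H Hg). apply filter_imp.
  intros x [H1 H2]. apply Rabs_def2 in H2. lra.
Qed.

Lemma flim_scal0 (F : (R -> Prop) -> Prop) {FF : Filter F} (f g : R -> R) (M : R) :
  F (fun x => Rabs (f x) <= M) -> filterlim g F (locally 0) ->
  filterlim (fun x => f x * g x) F (locally 0).
Proof.
  intros H Hg. apply (flim_abs_le F _ (fun x => M * Rabs (g x))).
  - revert H; apply filter_imp; intros x Hx.
    rewrite Rminus_0_r, Rabs_mult. apply Rmult_le_compat_r; [apply Rabs_pos | trivial].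
  - replace 0 with (M * Rabs 0) by (rewrite Rabs_R0; ring).
    apply flim_mult; trivial. apply flim_const; trivial.
    apply (flim_cont F Rabs); trivial. apply continuous_Rabs.
Qed.

Lemma flim_le (F : (R -> Prop) -> Prop) {FF : ProperFilter F} (f g : R -> R) (a b : R) :
  F (fun x => f x <= g x) -> filterlim f F (locally a) -> filterlim g F (locally b) ->
  a <= b.
Proof.
  intros H Hf Hg. apply Rnot_lt_le; intros Hab.
  assert (He : 0 < (a - b) / 2) by lra.
  apply flim_eps with (eps := (a - b) / 2) in Hf; [ | typeclasses eauto | trivial].
  apply flim_eps with (eps := (a - b) / 2) in Hg; [ | typeclasses eauto | trivial].
  destruct (filter_ex _ (filter_and _ _ H (filter_and _ _ Hf Hg))) as [x [H1 [H2 H3]]].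
  apply Rabs_def2 in H2. apply Rabs_def2 in H3. lra.
Qed.

Lemma flim_id0 : filterlim (fun x : R => x) (at_right 0) (locally 0).
Proof. apply flim_eps. typeclasses eauto. intros eps He. exists (mkposreal eps He). intros y Hy _. exact Hy. Qed.

Lemma at_right_0_lt (a : R) : 0 < a -> at_right 0 (fun x => 0 < x < a).
Proof.
  intros Ha. exists (mkposreal a Ha). intros y Hy Hy'. split; trivial.
  change (Rabs (y - 0) < a) in Hy. apply Rabs_def2 in Hy. lra.
Qed.

Lemma at_right_0_intro (P : R -> Prop) (a : R) :
  0 < a -> (forall x, 0 < x < a -> P x) -> at_right 0 P.
Proof. intros Ha H. generalize (at_right_0_lt a Ha). apply filter_imp, H. Qed.

Lemma at_right_0_elim (P : R -> Prop) :
  at_right 0 P -> exists a, 0 < a /\ forall x, 0 < x < a -> P x.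
Proof.
  intros [[a Ha] H]. exists a. split; trivial. intros x Hx. apply H.
  - change (Rabs (x - 0) < a). rewrite Rabs_pos_eq; lra.
  - lra.
Qed.

Lemma infty_elim (P : R -> Prop) (a : R) :
  Rbar_locally p_infty P -> exists M, a < M /\ forall x, M <= x -> P x.
Proof.
  intros [M H]. exists (Rmax M a + 1). split.
  - generalize (Rmax_r M a); lra.
  - intros x Hx. apply H. generalize (Rmax_l M a); lra.
Qed.

Lemma infty_intro (P : R -> Prop) (M : R) :
  (forall x, M < x -> P x) -> Rbar_locally p_infty P.
Proof. intros H; exists M; exact H. Qed.

Lemma flim_inv_infty : filterlim Rinv (Rbar_locally p_infty) (locally 0).
Proof.
  apply flim_eps. typeclasses eauto. intros eps He. exists (/ eps). intros x Hx.
  assert (0 < / eps) by now apply Rinv_0_lt_compat.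
  rewrite Rminus_0_r, Rabs_pos_eq.
  - rewrite <- (Rinv_inv eps). apply Rinv_lt_contravar; trivial. apply Rmult_lt_0_compat; lra.
  - left; apply Rinv_0_lt_compat; lra.
Qed.

Lemma is_derive_cont (f : R -> R) (x l : R) : is_derive f x l -> continuous f x.
Proof. intros H; apply (ex_derive_continuous f x); now exists l. Qed.

Lemma derive_incr (f f1 : R -> R) (a b : R) :
  a <= b -> (forall x, a <= x <= b -> is_derive f x (f1 x)) ->
  (forall x, a <= x <= b -> 0 <= f1 x) -> f a <= f b.
Proof.
  intros Hab Hd Hp.
  destruct (MVT_gen f a b f1) as [c [Hc Hfc]].
  - rewrite Rmin_left, Rmax_right by trivial. intros x Hx; apply Hd; lra.
  - rewrite Rmin_left, Rmax_right by trivial. intros x Hx.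
    apply continuity_pt_filterlim, (is_derive_cont f x (f1 x)), Hd, Hx.
  - rewrite Rmin_left, Rmax_right in Hc by trivial.
    specialize (Hp c Hc). nra.
Qed.

Lemma derive_decr (f f1 : R -> R) (a b : R) :
  a <= b -> (forall x, a <= x <= b -> is_derive f x (f1 x)) ->
  (forall x, a <= x <= b -> f1 x <= 0) -> f b <= f a.
Proof.
  intros Hab Hd Hp.
  assert (- f a <= - f b); [ | lra].
  apply (derive_incr (fun x => - f x) (fun x => - f1 x)); trivial.
  - intros x Hx. apply (is_derive_opp f), Hd, Hx.
  - intros x Hx. specialize (Hp x Hx). lra.
Qed.

Lemma derive_le (f f1 g g1 : R -> R) (a b : R) :
  a <= b -> (forall x, a <= x <= b -> is_derive f x (f1 x)) ->
  (forall x, a <= x <= b -> is_derive g x (g1 x)) ->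
  (forall x, a <= x <= b -> f1 x <= g1 x) -> f b - f a <= g b - g a.
Proof.
  intros Hab Hf Hg Hp.
  assert (g a - f a <= g b - f b); [ | lra].
  apply (derive_incr (fun x => g x - f x) (fun x => g1 x - f1 x)); trivial.
  - intros x Hx. apply (is_derive_minus g f); auto.
  - intros x Hx. specialize (Hp x Hx). lra.
Qed.

Lemma derive_incr_lim0 (f f1 : R -> R) (l b : R) :
  0 < b -> (forall x, 0 < x <= b -> is_derive f x (f1 x)) ->
  (forall x, 0 < x <= b -> 0 <= f1 x) ->
  filterlim f (at_right 0) (locally l) -> l <= f b.
Proof.
  intros Hb Hd Hp Hl.
  apply (flim_le (at_right 0) f (fun _ => f b)); trivial.
  - apply (at_right_0_intro _ b Hb). intros x Hx.
    apply (derive_incr f f1); try lra; intros; [apply Hd | apply Hp]; lra.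
  - apply flim_const. typeclasses eauto.
Qed.

Lemma derive_decr_lim0 (f f1 : R -> R) (l b : R) :
  0 < b -> (forall x, 0 < x <= b -> is_derive f x (f1 x)) ->
  (forall x, 0 < x <= b -> f1 x <= 0) ->
  filterlim f (at_right 0) (locally l) -> f b <= l.
Proof.
  intros Hb Hd Hp Hl.
  apply (flim_le (at_right 0) (fun _ => f b) f); trivial.
  - apply (at_right_0_intro _ b Hb). intros x Hx.
    apply (derive_decr f f1); try lra; intros; [apply Hd | apply Hp]; lra.
  - apply flim_const. typeclasses eauto.
Qed.

Lemma derive_incr_nonpos (f f1 h : R -> R) (a : R) :
  (forall x, a <= x -> is_derive f x (f1 x)) ->
  (forall x, a <= x -> 0 <= f1 x) ->
  (forall x, a <= x -> f x <= h x) ->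
  filterlim h (Rbar_locally p_infty) (locally 0) -> f a <= 0.
Proof.
  intros Hd Hp Hh Hl.
  apply (flim_le (Rbar_locally p_infty) (fun _ => f a) h); trivial.
  - apply (infty_intro _ a). intros x Hx.
    apply Rle_trans with (f x); [ | apply Hh; lra].
    apply (derive_incr f f1); try lra; intros; [apply Hd | apply Hp]; lra.
  - apply flim_const. typeclasses eauto.
Qed.

Lemma derive_incr_lim_infty (f f1 : R -> R) (l a : R) :
  (forall x, a <= x -> is_derive f x (f1 x)) ->
  (forall x, a <= x -> 0 <= f1 x) ->
  filterlim f (Rbar_locally p_infty) (locally l) -> f a <= l.
Proof.
  intros Hd Hp Hl.
  apply (flim_le (Rbar_locally p_infty) (fun _ => f a) f); trivial.
  - apply (infty_intro _ a). intros x Hx.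
    apply (derive_incr f f1); try lra; intros; [apply Hd | apply Hp]; lra.
  - apply flim_const. typeclasses eauto.
Qed.

Lemma derive_decr_lim_infty (f f1 : R -> R) (l a : R) :
  (forall x, a <= x -> is_derive f x (f1 x)) ->
  (forall x, a <= x -> f1 x <= 0) ->
  filterlim f (Rbar_locally p_infty) (locally l) -> l <= f a.
Proof.
  intros Hd Hp Hl.
  apply (flim_le (Rbar_locally p_infty) f (fun _ => f a)); trivial.
  - apply (infty_intro _ a). intros x Hx.
    apply (derive_decr f f1); try lra; intros; [apply Hd | apply Hp]; lra.
  - apply flim_const. typeclasses eauto.
Qed.

(** The form in which a wrong sign is refuted at infinity: a Wronskian of the wrong sign would give
    some positive quotient such a slope. *)
Lemma derive_neg_absurd (f f1 : R -> R) (a w l : R) :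
  0 < w -> (forall x, a <= x -> is_derive f x (f1 x)) ->
  (forall x, a <= x -> f1 x <= - w) -> (forall x, a <= x -> l <= f x) -> False.
Proof.
  intros Hw Hd Hp Hl.
  (* At this point the line of slope [- w] through the value at [a] has come down to [l - 1]. *)
  set (x := a + (f a - l + 1) / w).
  assert (Hx : a <= x).
  { unfold x. assert (0 <= (f a - l + 1) / w); [ | lra].
    apply Rdiv_le_0_compat; trivial. specialize (Hl a (Rle_refl a)). lra. }
  assert (H := derive_le f f1 (fun x => - w * x) (fun _ => - w) a x Hx).
  assert (f x - f a <= - w * x - - w * a).
  { apply H; intros; [apply Hd; lra | | apply Hp; lra].
    auto_derive; trivial. ring. }
  assert (w * (x - a) = f a - l + 1) by (unfold x; field; lra).
  specialize (Hl x Hx). nra.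
Qed.

Lemma incr_bounded_lim (f f1 : R -> R) (a M : R) :
  (forall x, a <= x -> is_derive f x (f1 x)) ->
  (forall x, a <= x -> 0 <= f1 x) -> (forall x, a <= x -> f x <= M) ->
  exists l, filterlim f (Rbar_locally p_infty) (locally l) /\ forall x, a <= x -> f x <= l.
Proof.
  intros Hd Hp HM.
  assert (Hmono : forall x y, a <= x -> x <= y -> f x <= f y).
  { intros x y Hx Hxy. apply (derive_incr f f1); trivial; intros; [apply Hd | apply Hp]; lra. }
  destruct (completeness (fun y => exists x, a <= x /\ y = f x)) as [l [Hub Hlub]].
  - exists M. intros y [x [Hx ->]]. now apply HM.
  - exists (f a), a. split; [apply Rle_refl | trivial].
  - exists l. assert (Hle : forall x, a <= x -> f x <= l).
    { intros x Hx. apply Hub. now exists x. }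
    split; trivial. apply flim_eps. typeclasses eauto. intros eps He.
    destruct (Classical_Prop.classic (exists x, a <= x /\ l - eps < f x)) as [[x [Hx Hx']] | Hn].
    + exists x. intros y Hy. specialize (Hmono x y Hx (Rlt_le _ _ Hy)).
      assert (Hy' : a <= y) by lra. specialize (Hle y Hy').
      rewrite Rabs_left1; lra.
    + exfalso. assert (l <= l - eps); [ | lra]. apply Hlub.
      intros y [x [Hx ->]]. apply Rnot_lt_le. intros H. apply Hn. now exists x.
Qed.

(** * Powers against exponentials and Gaussians *)

Lemma exp_pow_bound (n : nat) : exists C, 0 < C /\ forall x, 0 <= x -> x ^ n <= C * exp x.
Proof.
  induction n as [ | n [C [HC IH]]].
  - exists 1. split; [lra | ]. intros x Hx. simpl. generalize (exp_ineq1_le x); lra.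
  - exists (INR (S n) * C + 1). assert (Hn := pos_INR (S n)).
    remember (INR (S n)) as c eqn:Ec.
    assert (HnC : 0 <= c * C) by (apply Rmult_le_pos; lra).
    split; [lra | ]. intros x Hx.
    assert (x ^ S n - 0 ^ S n <= c * C * exp x - c * C * exp 0).
    { apply (derive_le (fun x => x ^ S n) (fun x => c * x ^ n) (fun x => c * C * exp x) (fun x => c * C * exp x)); trivial.
      - intros y _. auto_derive; trivial. rewrite Ec. change (1 * (INR (S n) * y ^ n) = INR (S n) * y ^ n). ring.
      - intros y _. auto_derive; trivial. ring.
      - intros y Hy. specialize (IH y (proj1 Hy)). nra. }
    rewrite exp_0, pow_ne_zero in H by discriminate.
    generalize (exp_pos x). nra.
Qed.

Lemma exp_le_compat (x y : R) : x <= y -> exp x <= exp y.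
Proof. intros [H | ->]; [left; now apply exp_increasing | apply Rle_refl]. Qed.

(** The power is at most [C exp r], and [r - r^2/2 <= 1/2] by the square of [r - 1]. *)
Lemma gauss_pow_bound (n : nat) :
  exists C, 0 < C /\ forall r, 0 <= r -> r ^ n * exp (- (r ^ 2) / 2) <= C.
Proof.
  destruct (exp_pow_bound n) as [C [HC H]].
  exists (C * exp (1 / 2)). split.
  - apply Rmult_lt_0_compat; trivial. apply exp_pos.
  - intros r Hr. specialize (H r Hr).
    apply Rle_trans with (C * exp r * exp (- r ^ 2 / 2)).
    + apply Rmult_le_compat_r; trivial. left; apply exp_pos.
    + rewrite Rmult_assoc, <- exp_plus. apply Rmult_le_compat_l; [lra | ].
      apply exp_le_compat. generalize (Rle_0_sqr (r - 1)). unfold Rsqr. lra.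
Qed.

Lemma is_derive_val (f : R -> R) (x l l' : R) : is_derive f x l -> l = l' -> is_derive f x l'.
Proof. now intros H <-. Qed.

Lemma pow_pred (m : nat) (r : R) : r <> 0 -> INR m * r ^ pred m = INR m * r ^ m / r.
Proof. intros Hr. destruct m as [ | m]; simpl; field; trivial. Qed.

Lemma Rpower_pos (x y : R) : 0 < Rpower x y.
Proof. apply exp_pos. Qed.

Lemma is_derive_Rpower (f : R -> R) (x l y : R) :
  0 < f x -> is_derive f x l ->
  is_derive (fun t => Rpower (f t) y) x (y * Rpower (f x) y * l / f x).
Proof.
  intros Hf Hd. unfold Rpower. auto_derive.
  - split; [now exists l | tauto].
  - replace (Derive (fun x0 => f x0) x) with l by (symmetry; now apply is_derive_unique).
    field. lra.
Qed.

Lemma cont_right (h : R -> R) (x : R) :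
  continuous h x -> filterlim h (at_right x) (locally (h x)).
Proof. intros Hh P HP. destruct (Hh P HP) as [e He]. exists e. intros y Hy _. exact (He y Hy). Qed.

Lemma flim_val (F : (R -> Prop) -> Prop) (f : R -> R) (a b : R) :
  filterlim f F (locally a) -> a = b -> filterlim f F (locally b).
Proof. now intros H <-. Qed.

Ltac flims :=
  repeat first [ assumption | apply flim_id0 | apply flim_inv_infty | apply flim_const
    | apply flim_pow | apply flim_plus | apply flim_minus | apply flim_opp | apply flim_mult
    | typeclasses eauto ].

(** * The Tricomi solution in radial form *)

(** The quantity [z^c0 exp(- z) e e'] has the derivative [z^c0 exp(- z) (e'^2 + ga e^2/z^2) >= 0].
    If [e e'] were positive once, it would stay positive, and beyond [c0], where the weight
    decreases, it would be bounded below: [e^2] would grow linearly instead of tending to 1. Hence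
    [e^2] decreases to 1; then [e] has no zero, and its sign is that of its limit. *)
Lemma kummer_decay (c0 ga : R) (e e1 : R -> R) :
  0 <= c0 -> 0 < ga ->
  (forall z, 0 < z -> is_derive e z (e1 z) /\
     is_derive e1 z ((1 - c0 / z) * e1 z + ga * e z / z ^ 2)) ->
  filterlim e (Rbar_locally p_infty) (locally 1) ->
  forall z, 0 < z -> 1 <= e z /\ e1 z <= 0.
Proof.
  intros Hc Hg Hd Hl.
  assert (Hee : forall z, 0 < z -> e z * e1 z <= 0).
  { intros z1 Hz1. apply Rnot_lt_le. intros Hpos.
    assert (Hev : Rbar_locally p_infty (fun z => Rabs (e z - 1) < 1)).
    { apply flim_eps with (eps := 1) in Hl; [trivial | typeclasses eauto | lra]. }
    destruct (infty_elim _ (Rmax z1 c0) Hev) as [a [Ha Hev']].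
    assert (Hz1a : z1 < a) by (generalize (Rmax_l z1 c0); lra).
    assert (Hc0a : c0 < a) by (generalize (Rmax_r z1 c0); lra).
    set (G := fun z => Rpower z c0 * exp (- z) * (e z * e1 z)).
    assert (HG : forall z, z1 <= z -> G z1 <= G z).
    { intros z Hz.
      apply (derive_incr G (fun z => Rpower z c0 * exp (- z) * (e1 z ^ 2 + ga * e z ^ 2 / z ^ 2))); trivial.
      - intros x Hx. assert (Hx0 : 0 < x) by lra. destruct (Hd x Hx0) as [H1 H2].
        unfold G, Rpower. auto_derive.
        + repeat split; trivial; eexists; eassumption.
        + replace (Derive (fun t => e t) x) with (e1 x) by (symmetry; now apply is_derive_unique).
          replace (Derive (fun t => e1 t) x) with ((1 - c0 / x) * e1 x + ga * e x / x ^ 2)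
            by (symmetry; now apply is_derive_unique).
          field. lra.
      - intros x Hx. assert (Hx0 : 0 < x) by lra.
        apply Rmult_le_pos.
        + apply Rmult_le_pos; left; [apply Rpower_pos | apply exp_pos].
        + assert (0 <= ga * e x ^ 2 / x ^ 2); [ | nra].
          apply Rdiv_le_0_compat; [nra | nra]. }
    set (Z := fun z => Rpower z c0 * exp (- z)).
    assert (HZ : forall z, a <= z -> Z z <= Z a).
    { intros z Hz. apply (derive_decr Z (fun z => Z z * (c0 / z - 1))); trivial.
      - intros x Hx. unfold Z, Rpower. auto_derive; [lra | field; lra].
      - intros x Hx. assert (0 < Z x) by (apply Rmult_lt_0_compat; [apply Rpower_pos | apply exp_pos]).
        assert (c0 / x <= 1); [ | nra].
        apply Rmult_le_reg_r with x; [lra | ]. field_simplify; lra. }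
    assert (HZp : forall z, 0 < Z z)
      by (intros; apply Rmult_lt_0_compat; [apply Rpower_pos | apply exp_pos]).
    assert (HG1 : 0 < G z1) by (apply (Rmult_lt_0_compat (Z z1)); trivial).
    apply (derive_neg_absurd (fun z => - (e z * e z)) (fun z => - (2 * (e z * e1 z))) a (2 * (G z1 / Z a)) (- 4)).
    - assert (0 < G z1 / Z a) by (apply Rdiv_lt_0_compat; auto). lra.
    - intros x Hx. destruct (Hd x) as [H1 _]; [lra | ].
      auto_derive; [repeat split; eexists; eassumption | ].
      replace (Derive (fun t => e t) x) with (e1 x) by (symmetry; now apply is_derive_unique). ring.
    - intros x Hx. assert (G z1 <= Z x * (e x * e1 x)) by (apply (HG x); lra).
      specialize (HZ x Hx). specialize (HZp x) as Hp. specialize (HZp a) as Hpa.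
      assert (G z1 / Z a <= e x * e1 x); [ | lra].
      apply Rle_trans with (G z1 / Z x).
      + apply Rmult_le_compat_l; [lra | ]. apply Rinv_le_contravar; trivial.
      + apply Rmult_le_reg_l with (Z x); trivial. field_simplify; lra.
    - intros x Hx. specialize (Hev' x Hx). apply Rabs_def2 in Hev'. nra. }
  assert (Hsq : forall z, 0 < z -> 1 <= e z * e z).
  { intros z Hz. apply (derive_decr_lim_infty (fun z => e z * e z) (fun z => 2 * (e z * e1 z))).
    - intros x Hx. destruct (Hd x) as [H1 _]; [lra | ].
      auto_derive; [repeat split; eexists; eassumption | ].
      replace (Derive (fun t => e t) x) with (e1 x) by (symmetry; now apply is_derive_unique). ring.
    - intros x Hx. specialize (Hee x). nra.
    - replace 1 with (1 * 1) by ring. apply flim_mult; trivial. typeclasses eauto. }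
  assert (Hpos : forall z, 0 < z -> 0 < e z).
  { intros z Hz. apply Rnot_le_lt. intros Hneg.
    assert (e z < 0) by (specialize (Hsq z Hz); nra).
    apply flim_eps with (eps := 1) in Hl; [ | typeclasses eauto | lra].
    destruct (infty_elim _ z Hl) as [a [Ha Hev]].
    specialize (Hev a (Rle_refl a)). apply Rabs_def2 in Hev.
    destruct (IVT_interv e z a) as [x [Hx Hx0]]; try lra.
    - intros y Hy. apply continuity_pt_filterlim. destruct (Hd y) as [H1 _]; [lra | ].
      now apply is_derive_cont with (e1 y).
    - specialize (Hsq x). rewrite Hx0 in Hsq. lra. }
  intros z Hz. specialize (Hsq z Hz). specialize (Hpos z Hz). specialize (Hee z Hz).
  split; nra.
Qed.

(** For [y = z^2 e' + ga e] one has [(exp(- z) y)' = exp(- z) ((2 - c0) z + ga) e' <= 0], which is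
    where [c0 <= 2] enters. A negative value of [y] would grow like [- exp z] and drive [e] below 1.
    So [y >= 0], which says that [e exp(- ga/z)] increases, to the limit 1. *)
Lemma kummer_upper (c0 ga : R) (e e1 : R -> R) :
  0 <= c0 <= 2 -> 0 < ga ->
  (forall z, 0 < z -> is_derive e z (e1 z) /\
     is_derive e1 z ((1 - c0 / z) * e1 z + ga * e z / z ^ 2)) ->
  filterlim e (Rbar_locally p_infty) (locally 1) ->
  forall z, 0 < z -> 0 <= z ^ 2 * e1 z + ga * e z /\ e z <= exp (ga / z).
Proof.
  intros Hc Hg Hd Hl.
  assert (Hk := kummer_decay c0 ga e e1 (proj1 Hc) Hg Hd Hl).
  assert (Hy : forall z, 0 < z -> 0 <= z ^ 2 * e1 z + ga * e z).
  { intros a Ha. apply Rnot_lt_le. intros Hneg.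
    set (w := - (a ^ 2 * e1 a + ga * e a)) in *.
    assert (Hyz : forall z, a <= z -> z ^ 2 * e1 z + ga * e z <= - w * exp (z - a)).
    { intros z Hz.
      assert (H : exp (- z) * (z ^ 2 * e1 z + ga * e z) <= exp (- a) * (a ^ 2 * e1 a + ga * e a)).
      { apply (derive_decr (fun z => exp (- z) * (z ^ 2 * e1 z + ga * e z))
          (fun z => exp (- z) * (((2 - c0) * z + ga) * e1 z))); trivial.
        - intros x Hx. destruct (Hd x) as [H1 H2]; [lra | ].
          auto_derive; [repeat split; eexists; eassumption | ].
          replace (Derive (fun t => e t) x) with (e1 x) by (symmetry; now apply is_derive_unique).
          replace (Derive (fun t => e1 t) x) with ((1 - c0 / x) * e1 x + ga * e x / x ^ 2)
            by (symmetry; now apply is_derive_unique).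
          field. lra.
        - intros x Hx. destruct (Hk x) as [_ H1]; [lra | ].
          assert (Hp := exp_pos (- x)).
          assert (0 <= (2 - c0) * x + ga) by nra.
          assert (((2 - c0) * x + ga) * e1 x <= 0) by nra. nra. }
      replace (z - a) with (z + - a) by ring. rewrite exp_plus.
      apply Rmult_le_reg_l with (exp (- z)); [apply exp_pos | ].
      replace (exp (- z) * (- w * (exp z * exp (- a)))) with (exp (- z) * exp z * (- w * exp (- a))) by ring.
      rewrite <- exp_plus. replace (- z + z) with 0 by ring. rewrite exp_0.
      unfold w. lra. }
    (* Against [z^2 <= C exp z], the exponential growth of [- y] leaves a slope of [e] bounded away
       from 0. *)
    destruct (exp_pow_bound 2) as [C [HC HCe]].
    apply (derive_neg_absurd e e1 a (w * exp (- a) / C) 1).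
    - apply Rdiv_lt_0_compat; trivial. apply Rmult_lt_0_compat; [unfold w; lra | apply exp_pos].
    - intros x Hx. apply Hd. lra.
    - intros x Hx. specialize (Hyz x Hx). destruct (Hk x) as [H1 _]; [lra | ].
      specialize (HCe x). assert (0 <= x) by lra. specialize (HCe H).
      assert (Hx2 : 0 < x ^ 2) by nra.
      replace (x - a) with (x + - a) in Hyz by ring. rewrite exp_plus in Hyz.
      assert (Hea := exp_pos (- a)). assert (Hw : 0 < w) by (unfold w; lra).
      apply Rmult_le_reg_l with (x ^ 2); trivial.
      apply Rle_trans with (- w * (exp x * exp (- a))); [nra | ].
      assert (x ^ 2 / C <= exp x).
      { apply Rmult_le_reg_l with C; trivial. field_simplify; lra. }
      assert (Hwe : 0 < w * exp (- a)) by now apply Rmult_lt_0_compat.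
      replace (x ^ 2 * - (w * exp (- a) / C)) with (- (w * exp (- a)) * (x ^ 2 / C)) by (field; lra).
      nra.
    - intros x Hx. apply Hk. lra. }
  intros z Hz. split; [now apply Hy | ].
  assert (H : e z * exp (- ga / z) <= 1).
  { apply (derive_incr_lim_infty (fun z => e z * exp (- ga / z))
      (fun z => exp (- ga / z) * (z ^ 2 * e1 z + ga * e z) / z ^ 2)).
    - intros x Hx. destruct (Hd x) as [H1 _]; [lra | ].
      auto_derive; [repeat split; try (eexists; eassumption); lra | ].
      replace (Derive (fun t => e t) x) with (e1 x) by (symmetry; now apply is_derive_unique).
      unfold Rdiv. field. lra.
    - intros x Hx. apply Rdiv_le_0_compat; [ | nra].
      apply Rmult_le_pos; [left; apply exp_pos | apply Hy; lra].
    - replace 1 with (1 * exp (- ga * 0)) by (rewrite Rmult_0_r, exp_0; ring).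
      apply flim_mult; [typeclasses eauto | trivial | ].
      apply (flim_cont _ exp (fun z => - ga / z)).
      + apply continuity_pt_filterlim, derivable_continuous_pt, derivable_pt_exp.
      + apply flim_mult; [typeclasses eauto | apply flim_const; typeclasses eauto | apply flim_inv_infty]. }
  apply Rmult_le_reg_r with (exp (- ga / z)); [apply exp_pos | ].
  rewrite <- exp_plus. replace (ga / z + - ga / z) with 0 by (field; lra). now rewrite exp_0.
Qed.

Ltac dsolve :=
  repeat match goal with
  | |- _ /\ _ => split
  | |- True => exact I
  | |- ex_derive _ _ => eexists; eassumption
  end.

Ltac drw H :=
  match type of H with
  | is_derive ?f ?x ?l =>
      try replace (Derive (fun t : R => f t) x) with l by (symmetry; apply is_derive_unique; exact H)
  end.

(* [auto_derive] unfolds let-bound functions; this makes one opaque to it. *)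
Lemma is_derive_opaque (f : R -> R) (x l : R) :
  is_derive f x l -> exists P : R -> R, (forall y, P y = f y) /\ is_derive P x l.
Proof. intros H. now exists f. Qed.

(** Radial solutions of [Delta f = V f] in dimension [m + 2], as a first-order system: the
    derivative is a separate function, so that an explicit or rescaled one can be used as it is. *)
Definition radsol (m : nat) (V f f1 : R -> R) : Prop :=
  forall r, 0 < r -> is_derive f r (f1 r) /\
    is_derive f1 r (V r * f r - (INR m + 1) / r * f1 r).

(** The weight is [r^(d-1)], and the sign is such that a nonnegative value means that [f / g]
    increases. The factor [r] is kept apart so that [pow_pred] simplifies derivatives. *)
Definition wronsk (m : nat) (f f1 g g1 : R -> R) (r : R) : R :=
  r * r ^ m * (f1 r * g r - f r * g1 r).

Lemma wronsk_derive (m : nat) (V Vg f f1 g g1 : R -> R) (r : R) :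
  radsol m V f f1 -> radsol m Vg g g1 -> 0 < r ->
  is_derive (wronsk m f f1 g g1) r (r * r ^ m * ((V r - Vg r) * f r * g r)).
Proof.
  intros Hf Hg Hr. destruct (Hf r Hr) as [F0 F1], (Hg r Hr) as [G0 G1].
  unfold wronsk. auto_derive; [dsolve | ].
  drw F0; drw F1; drw G0; drw G1.
  rewrite pow_pred by lra. field. lra.
Qed.

Lemma ratio_derive (m : nat) (V Vg f f1 g g1 : R -> R) (r : R) :
  radsol m V f f1 -> radsol m Vg g g1 -> 0 < r -> 0 < g r ->
  is_derive (fun r => f r / g r) r (wronsk m f f1 g g1 r / (r * r ^ m * g r ^ 2)).
Proof.
  intros Hf Hg Hr Hgp. destruct (Hf r Hr) as [F0 F1], (Hg r Hr) as [G0 G1].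
  auto_derive; [dsolve; lra | ].
  drw F0; drw G0.
  unfold wronsk. field. repeat split; try lra. apply pow_nonzero; lra.
Qed.

(* [exp (r^2/2) * r^k * phi r] with [k = (m+2-lam)/2] is [z^al * U(z; al, be)] at [z = r^2];
   it decreases to 1, which gives the two-sided control of [phi] and [phi1]. *)
Definition outer (m : nat) (lam : R) (phi phi1 : R -> R) : Prop :=
  let E := fun r => exp (r ^ 2 / 2) * Rpower r ((INR m + 2 - lam) / 2) * phi r in
  let Ga := (INR m + 2) ^ 2 in
  radsol m (fun r => r ^ 2 - lam) phi phi1 /\
  filterlim E (Rbar_locally p_infty) (locally 1) /\
  (forall r, 0 < r -> 1 <= E r) /\
  (forall r, 0 < r -> r * phi1 r <= - (r ^ 2 + (INR m + 2 - lam) / 2) * phi r) /\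
  (lam <= 4 -> forall r, 0 < r -> E r <= exp (Ga / r ^ 2) /\
     - (r ^ 2 + (INR m + 2 - lam) / 2 + 2 * Ga / r ^ 2) * phi r <= r * phi1 r).

Lemma is_derive_gauss_mult (A : R -> R) (r a : R) :
  is_derive A r a ->
  is_derive (fun r => exp (- (r ^ 2) / 2) * A r) r (exp (- (r ^ 2) / 2) * (a - r * A r)).
Proof.
  intros H.
  assert (G : is_derive (fun r => exp (- (r ^ 2) / 2)) r (- r * exp (- (r ^ 2) / 2))).
  { auto_derive; trivial. unfold Rdiv. rewrite ?Rmult_1_r. simpl. rewrite ?Rmult_1_r. field. }
  eapply is_derive_val.
  - apply (is_derive_mult (fun r => exp (- (r ^ 2) / 2)) A r _ _ G H).
    intros x y. apply Rmult_comm.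
  - cbv [plus mult]; simpl. ring.
Qed.

Lemma is_derive_comp_sqr (A : R -> R) (r a : R) :
  is_derive A (r ^ 2) a -> is_derive (fun r => A (r ^ 2)) r (2 * r * a).
Proof.
  intros H. eapply is_derive_val.
  - apply (is_derive_comp A (fun r => r ^ 2) r a (2 * r)); trivial.
    auto_derive; trivial. ring.
  - cbv [scal mult]; simpl. cbv [mult]; simpl. ring.
Qed.

(** The Gaussian factor and [z = r^2] turn Kummer's equation into the radial equation with potential
    [r^2 - lam]. Multiplying the Tricomi function by [z^al] instead gives the equation of
    [kummer_decay], so all bounds on [phi] are read off [e] at [r^2]. *)
Lemma tricomi_outer (TU : R -> R -> R -> R) (m : nat) (lam : R) :
  is_tricomi TU -> (3 <= m)%nat -> 0 <= lam < INR m + 2 ->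
  exists phi1, outer m lam
    (fun r => exp (- (r ^ 2) / 2) * TU (r ^ 2) ((INR m + 2 - lam) / 4) (1 + INR m / 2)) phi1.
Proof.
  intros HT Hm Hlam.
  assert (HM : 3 <= INR m) by (apply (le_INR 3) in Hm; simpl in Hm; lra).
  set (M := INR m) in *.
  set (al := (M + 2 - lam) / 4). set (be := 1 + M / 2).
  destruct (HT al be) as [Hk [B [z0 [Hz0 HB]]]].
  set (U := fun z => TU z al be) in *. set (U1 := Derive U).
  assert (HU : forall z, 0 < z -> is_derive U z (U1 z) /\
     is_derive U1 z (((z - be) * U1 z + al * U z) / z)).
  { intros z Hz. destruct (Hk z Hz) as [H1 [H2 H3]]. split.
    - now apply Derive_correct.
    - apply is_derive_val with (Derive U1 z); [now apply Derive_correct | ].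
      change (z * Derive U1 z + (be - z) * U1 z - al * U z = 0) in H3.
      assert (H4 : z * Derive U1 z = (z - be) * U1 z + al * U z) by lra.
      rewrite <- H4. simpl. field. lra. }
  (* Here [be - 1 - al = (m - 2 + lam)/4] and [c0 = lam/2]. The first makes [ga] positive for
     [m >= 3]; the second turns [c0 <= 2] into the condition [lam <= 4] of [outer]. *)
  set (ga := al * (be - 1 - al)). set (c0 := be - 2 * al).
  assert (Hal : 0 < al) by (unfold al; lra).
  assert (Hba : 0 < be - 1 - al) by (unfold be, al; lra).
  assert (Hga : 0 < ga) by now apply Rmult_lt_0_compat.
  assert (Hc0 : c0 = lam / 2) by (unfold c0, be, al; field).
  set (e := fun z => Rpower z al * U z).
  set (e1 := fun z => Rpower z al * (U1 z + al * U z / z)).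
  assert (He : forall z, 0 < z -> is_derive e z (e1 z) /\
     is_derive e1 z ((1 - c0 / z) * e1 z + ga * e z / z ^ 2)).
  { intros z Hz. destruct (HU z Hz) as [D0 D1].
    assert (DR : is_derive (fun z => Rpower z al) z (al * Rpower z al / z)).
    { eapply is_derive_val; [apply (is_derive_Rpower (fun z => z) z 1 al Hz) | field; lra].
      auto_derive; trivial. }
    destruct (is_derive_opaque _ _ _ DR) as [P [EP DP]]. split.
    - unfold e, e1. apply (is_derive_ext (fun z => P z * U z)); [intros t; now rewrite EP | ].
      auto_derive; [dsolve | ].
      drw DP; drw D0.
      rewrite EP. field. lra.
    - unfold e, e1, c0, ga. apply (is_derive_ext (fun z => P z * (U1 z + al * U z / z))); [intros t; now rewrite EP | ].
      auto_derive; [dsolve; lra | ].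
      drw DP; drw D0; drw D1.
      rewrite EP. field. lra. }
  assert (Hel : filterlim e (Rbar_locally p_infty) (locally 1)).
  { apply (flim_abs_le _ _ (fun z => B * / z)).
    - apply (infty_intro _ z0). intros z Hz. unfold e. rewrite Rmult_comm. apply HB. lra.
    - replace 0 with (B * 0) by ring. apply flim_mult; [typeclasses eauto | apply flim_const; typeclasses eauto | apply flim_inv_infty]. }
  assert (H0c : 0 <= c0) by lra.
  assert (Hdec := kummer_decay c0 ga e e1 H0c Hga He Hel).
  set (E := fun r => exp (- (r ^ 2) / 2)).
  exists (fun r => E r * (2 * r * U1 (r ^ 2) - r * U (r ^ 2))).
  assert (HEe : forall r, 0 < r ->
    exp (r ^ 2 / 2) * Rpower r ((M + 2 - lam) / 2) * (exp (- (r ^ 2) / 2) * U (r ^ 2)) = e (r ^ 2)).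
  { intros r Hr. unfold e.
    replace (Rpower (r ^ 2) al) with (Rpower r ((M + 2 - lam) / 2)).
    - replace (exp (- (r ^ 2) / 2)) with (/ exp (r ^ 2 / 2)).
      + field. apply Rgt_not_eq, exp_pos.
      + rewrite <- exp_Ropp. f_equal. field.
    - rewrite <- Rpower_pow, Rpower_mult by trivial. f_equal. simpl INR. unfold al. field. }
  assert (Hr2 : forall r, 0 < r -> 0 < r ^ 2) by (intros; nra).
  unfold outer. fold M. split; [ | split; [ | split; [ | split]]].
  - intros r Hr. destruct (HU (r ^ 2) (Hr2 r Hr)) as [D0 D1].
    apply is_derive_comp_sqr in D0. apply is_derive_comp_sqr in D1.
    split.
    + eapply is_derive_val; [apply is_derive_gauss_mult, D0 | unfold E, U; ring].
    + destruct (is_derive_opaque _ _ _ D0) as [P0 [E0 D0']]. destruct (is_derive_opaque _ _ _ D1) as [P1 [E1 D1']].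
      eapply is_derive_val.
      * apply is_derive_gauss_mult.
        apply (is_derive_ext (fun r => 2 * r * P1 r - r * P0 r)); [intros t; now rewrite E0, E1 | ].
        auto_derive; [dsolve | ].
        drw D0'; drw D1'. reflexivity.
      * change (TU (r ^ 2) al be) with (U (r ^ 2)). rewrite E0, E1. unfold E, al, be. fold M. field. lra.
  - apply (flim_ext _ (fun r => e (r ^ 2))).
    + apply (infty_intro _ 0). intros r Hr. symmetry. now apply HEe.
    + apply flim_eps; [typeclasses eauto | ]. intros eps Heps.
      apply flim_eps with (eps := eps) in Hel; [ | typeclasses eauto | trivial].
      destruct (infty_elim _ 1 Hel) as [A [HA HA']]. apply (infty_intro _ A).
      intros x Hx. apply HA'. nra.
  - intros r Hr. change (1 <= exp (r ^ 2 / 2) * Rpower r ((M + 2 - lam) / 2) * (exp (- (r ^ 2) / 2) * U (r ^ 2))). rewrite (HEe r Hr). now apply Hdec, Hr2.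
  - intros r Hr. destruct (Hdec (r ^ 2) (Hr2 r Hr)) as [_ H1]. unfold e1 in H1.
    change (TU (r ^ 2) al be) with (U (r ^ 2)).
    assert (Hp := Rpower_pos (r ^ 2) al). assert (HE := exp_pos (- (r ^ 2) / 2)).
    assert (H2 : U1 (r ^ 2) + al * U (r ^ 2) / r ^ 2 <= 0) by nra.
    assert (H3 : r ^ 2 * U1 (r ^ 2) + al * U (r ^ 2) <= 0).
    { replace (r ^ 2 * U1 (r ^ 2) + al * U (r ^ 2)) with (r ^ 2 * (U1 (r ^ 2) + al * U (r ^ 2) / r ^ 2)) by (field; lra).
      specialize (Hr2 r Hr). nra. }
    assert (exp (- (r ^ 2) / 2) * (2 * (r ^ 2 * U1 (r ^ 2) + al * U (r ^ 2))) <= 0) by nra.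
    replace ((M + 2 - lam) / 2) with (2 * al) by (unfold al; field). unfold E. lra.
  - intros Hl4 r Hr.
    assert (Hc2 : 0 <= c0 <= 2) by lra.
    destruct (kummer_upper c0 ga e e1 Hc2 Hga He Hel (r ^ 2) (Hr2 r Hr)) as [H1 H2].
    destruct (Hdec (r ^ 2) (Hr2 r Hr)) as [H3 _].
    (* A bound on [ga] that is uniform in [lam], so that [outer] has a single constant. *)
    assert (HgG : ga <= (M + 2) ^ 2) by (unfold ga, al, be; nra).
    specialize (Hr2 r Hr).
    split.
    + change (exp (r ^ 2 / 2) * Rpower r ((M + 2 - lam) / 2) * (exp (- (r ^ 2) / 2) * U (r ^ 2)) <= exp ((M + 2) ^ 2 / r ^ 2)).
      rewrite (HEe r Hr). apply Rle_trans with (1 := H2). apply exp_le_compat.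
      apply Rmult_le_compat_r; trivial. left; now apply Rinv_0_lt_compat.
    + change (TU (r ^ 2) al be) with (U (r ^ 2)).
      assert (Hp := Rpower_pos (r ^ 2) al). assert (HE := exp_pos (- (r ^ 2) / 2)).
      assert (H4 : 0 <= (r ^ 2) ^ 2 * e1 (r ^ 2) + (M + 2) ^ 2 * e (r ^ 2)) by nra.
      unfold e1, e in H4.
      assert (H5 : 0 <= (r ^ 2) ^ 2 * (U1 (r ^ 2) + al * U (r ^ 2) / r ^ 2) + (M + 2) ^ 2 * U (r ^ 2)) by nra.
      assert (H6 : 0 <= r ^ 2 * U1 (r ^ 2) + al * U (r ^ 2) + (M + 2) ^ 2 / r ^ 2 * U (r ^ 2)).
      { apply Rmult_le_reg_l with (r ^ 2); trivial. rewrite Rmult_0_r.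
        eapply Rle_trans; [exact H5 | right; field; lra]. }
      replace ((M + 2 - lam) / 2) with (2 * al) by (unfold al; field). unfold E.
      assert (0 <= exp (- r ^ 2 / 2) * (2 * (r ^ 2 * U1 (r ^ 2) + al * U (r ^ 2) + (M + 2) ^ 2 / r ^ 2 * U (r ^ 2)))).
      { apply Rmult_le_pos; lra. }
      unfold Rdiv in *. lra.
Qed.

Lemma outer_pos (m : nat) (lam : R) (phi phi1 : R -> R) (r : R) :
  outer m lam phi phi1 -> 0 < r -> 0 < phi r.
Proof.
  intros [_ [_ [H _]]] Hr. specialize (H r Hr). apply Rnot_le_lt; intros Hn.
  assert (0 < exp (r ^ 2 / 2) * Rpower r ((INR m + 2 - lam) / 2))
    by (apply Rmult_lt_0_compat; [apply exp_pos | apply Rpower_pos]).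
  nra.
Qed.

Lemma outer_neg (m : nat) (lam : R) (phi phi1 : R -> R) (r : R) :
  outer m lam phi phi1 -> lam < INR m + 2 -> 0 < r -> phi1 r < 0.
Proof.
  intros H Hl Hr. assert (Hp := outer_pos _ _ _ _ r H Hr).
  destruct H as [_ [_ [_ [H _]]]]. specialize (H r Hr).
  assert (0 < (r ^ 2 + (INR m + 2 - lam) / 2) * phi r) by (apply Rmult_lt_0_compat; nra). nra.
Qed.

(** Beyond [1 + lam] the potential [r^2 - lam] is nonnegative, and three monotone quantities give
    the bounds. They control Wronskians at infinity, even against a function of which only the limit
    0 is known. *)
Lemma outer_bounds (m : nat) (lam : R) (phi phi1 : R -> R) :
  outer m lam phi phi1 -> 0 <= lam < INR m + 2 ->
  exists B R0, 0 < B /\ 1 <= R0 /\ forall r, R0 <= r ->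
    r * r ^ m * phi r ^ 2 <= B /\ - (r * r ^ m * phi1 r) <= B /\ phi r <= B * / r.
Proof.
  intros H Hl.
  assert (Hp := fun r => outer_pos _ _ _ _ r H).
  assert (Hn := fun r => outer_neg _ _ _ _ r H (proj2 Hl)).
  destruct H as [Hs [_ [_ [H _]]]].
  set (R0 := 1 + lam).
  set (b1 := R0 * R0 ^ m * phi R0 ^ 2). set (b2 := - (R0 * R0 ^ m * phi1 R0)). set (b3 := R0 * phi R0).
  assert (HR0 : 1 <= R0) by (unfold R0; lra).
  assert (HR : 0 < R0 ^ m) by (apply pow_lt; lra).
  assert (H1 : 0 <= b1) by (unfold b1; apply Rmult_le_pos; [nra | apply pow2_ge_0]).
  assert (H2 : 0 <= b2) by (unfold b2; specialize (Hn R0); assert (0 <= R0 * R0 ^ m) by nra; nra).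
  assert (H3 : 0 < b3) by (apply Rmult_lt_0_compat; [lra | apply Hp; lra]).
  exists (b1 + b2 + b3), R0. split; [lra | ]. split; [trivial | ].
  assert (Hsq : forall x, R0 <= x -> lam <= x ^ 2) by (unfold R0; intros; nra).
  intros r Hr. split; [ | split].
  - apply Rle_trans with b1; [ | lra].
    apply (derive_decr (fun r => r * r ^ m * phi r ^ 2)
      (fun r => r ^ m * phi r * ((INR m + 1) * phi r + 2 * (r * phi1 r)))); trivial.
    + intros x Hx. destruct (Hs x) as [F0 _]; [lra | ].
      auto_derive; [dsolve | ]. drw F0. rewrite pow_pred by lra. field. lra.
    + intros x Hx. assert (Hx0 : 0 < x) by lra. specialize (H x Hx0). specialize (Hp x Hx0).
      assert (Hx2 := Hsq x (proj1 Hx)).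
      assert (0 < x ^ m) by (apply pow_lt; lra).
      assert ((INR m + 1) * phi x + 2 * (x * phi1 x) <= 0) by nra.
      assert (0 < x ^ m * phi x) by nra. nra.
  - apply Rle_trans with b2; [ | lra]. unfold b2. apply Ropp_le_contravar.
    apply (derive_incr (fun r => r * r ^ m * phi1 r)
      (fun r => r * r ^ m * ((r ^ 2 - lam) * phi r))); trivial.
    + intros x Hx. destruct (Hs x) as [F0 F1]; [lra | ].
      auto_derive; [dsolve | ]. drw F1. rewrite pow_pred by lra. field. lra.
    + intros x Hx. assert (Hx0 : 0 < x) by lra. specialize (Hp x Hx0).
      assert (Hx2 := Hsq x (proj1 Hx)).
      assert (0 < x ^ m) by (apply pow_lt; lra).
      apply Rmult_le_pos; [nra | ]. apply Rmult_le_pos; lra.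
  - apply Rle_trans with (b3 * / r).
    + assert (r * phi r <= b3).
      { apply (derive_decr (fun r => r * phi r) (fun r => phi r + r * phi1 r)); trivial.
        - intros x Hx. destruct (Hs x) as [F0 F1]; [lra | ].
          auto_derive; [dsolve | ]. drw F0. ring.
        - intros x Hx. assert (Hx0 : 0 < x) by lra. specialize (H x Hx0). specialize (Hp x Hx0).
          assert (1 <= x ^ 2) by nra. nra. }
      apply Rmult_le_reg_l with r; [lra | ]. field_simplify; lra.
    + apply Rmult_le_compat_r; [left; apply Rinv_0_lt_compat | ]; lra.
Qed.

Lemma outer_lim (m : nat) (lam : R) (phi phi1 : R -> R) :
  outer m lam phi phi1 -> 0 <= lam < INR m + 2 ->
  filterlim phi (Rbar_locally p_infty) (locally 0).
Proof.
  intros H Hl. assert (Hp := fun r => outer_pos _ _ _ _ r H).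
  destruct (outer_bounds _ _ _ _ H Hl) as [B [R0 [HB [HR0 Hb]]]].
  apply (flim_abs_le _ _ (fun r => B * / r)).
  - apply (infty_intro _ R0). intros r Hr. destruct (Hb r) as [_ [_ H3]]; [lra | ].
    rewrite Rminus_0_r, Rabs_pos_eq; trivial. left; apply Hp. lra.
  - replace 0 with (B * 0) by ring. apply flim_mult; [typeclasses eauto | apply flim_const; typeclasses eauto | apply flim_inv_infty].
Qed.

(** The Wronskian decreases because [V <= r^2 - lam]. If it were negative once, the slope of
    [f / phi] would stay below a negative constant, since [r^(m+1) phi^2] is bounded, and [f] would
    change sign. It is also at most [B f] far out, because [f1 <= 0]; so it decreases to 0, without
    any rate for [f]. *)
Lemma wronsk_outer (m : nat) (lam : R) (V f f1 phi phi1 : R -> R) :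
  outer m lam phi phi1 -> 0 <= lam < INR m + 2 ->
  radsol m V f f1 ->
  (forall r, 0 < r -> 0 < f r /\ f1 r <= 0 /\ V r <= r ^ 2 - lam) ->
  filterlim f (Rbar_locally p_infty) (locally 0) ->
  (forall r, 0 < r -> 0 <= wronsk m f f1 phi phi1 r) /\
  exists h, filterlim h (Rbar_locally p_infty) (locally 0) /\
    exists R0, forall r, R0 <= r -> wronsk m f f1 phi phi1 r <= h r.
Proof.
  intros Ho Hl Hf Hfp Hf0.
  assert (Hp := fun r => outer_pos _ _ _ _ r Ho).
  destruct (outer_bounds _ _ _ _ Ho Hl) as [B [R0 [HB [HR0 Hb]]]].
  assert (Hs := proj1 Ho).
  assert (HP : forall x, 0 < x -> 0 < x * x ^ m)
    by (intros; apply Rmult_lt_0_compat; [ | apply pow_lt]; lra).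
  split.
  - intros r Hr. apply Rnot_lt_le. intros Hneg.
    set (W := wronsk m f f1 phi phi1) in *.
    assert (Hdec : forall x, r <= x -> W x <= W r).
    { intros x Hx.
      apply (derive_decr W (fun r => r * r ^ m * ((V r - (r ^ 2 - lam)) * f r * phi r))); trivial.
      - intros y Hy. apply (wronsk_derive m V (fun r => r ^ 2 - lam)); trivial. lra.
      - intros y Hy. assert (Hy0 : 0 < y) by lra. destruct (Hfp y Hy0) as [A1 [A2 A3]].
        specialize (HP y Hy0). specialize (Hp y Hy0).
        assert ((V y - (y ^ 2 - lam)) * f y <= 0) by nra.
        assert ((V y - (y ^ 2 - lam)) * f y * phi y <= 0) by nra. nra. }
    set (a := Rmax r R0).
    assert (Har : r <= a) by apply Rmax_l. assert (HaR : R0 <= a) by apply Rmax_r.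
    apply (derive_neg_absurd (fun r => f r / phi r) (fun r => W r / (r * r ^ m * phi r ^ 2)) a (- W r / B) 0).
    + apply Rdiv_lt_0_compat; lra.
    + intros x Hx. assert (Hx0 : 0 < x) by lra. apply (ratio_derive m V (fun r => r ^ 2 - lam)); auto.
    + intros x Hx. assert (Hx0 : 0 < x) by lra. destruct (Hb x) as [B1 _]; [lra | ].
      specialize (HP x Hx0). specialize (Hp x Hx0).
      assert (Hd : 0 < x * x ^ m * phi x ^ 2) by (apply Rmult_lt_0_compat; [trivial | nra]).
      assert (Hdx : r <= x) by lra. specialize (Hdec x Hdx).
      apply Rle_trans with (W r / (x * x ^ m * phi x ^ 2)).
      * apply Rmult_le_compat_r; trivial. left; now apply Rinv_0_lt_compat.
      * assert (/ B <= / (x * x ^ m * phi x ^ 2)) by now apply Rinv_le_contravar.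
        unfold Rdiv. nra.
    + intros x Hx. assert (Hx0 : 0 < x) by lra. left. apply Rdiv_lt_0_compat; [apply Hfp | apply Hp]; trivial.
  - exists (fun r => B * f r). split.
    + replace 0 with (B * 0) by ring. apply flim_mult; [typeclasses eauto | apply flim_const; typeclasses eauto | trivial].
    + exists R0. intros r Hr. assert (Hr0 : 0 < r) by lra. destruct (Hb r Hr) as [_ [B2 _]].
      destruct (Hfp r Hr0) as [A1 [A2 _]]. specialize (HP r Hr0). specialize (Hp r Hr0).
      unfold wronsk.
      assert (r * r ^ m * (f1 r * phi r) <= 0) by (assert (f1 r * phi r <= 0) by nra; nra).
      assert (- (r * r ^ m * phi1 r) * f r <= B * f r) by (apply Rmult_le_compat_r; lra). nra.
Qed.

(** This replaces the integration of the derivative of the Wronskian up to infinity: [W - F]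
    increases and lies below a function that tends to 0. *)
Lemma wronsk_outer_le (m : nat) (lam : R) (V f f1 phi phi1 F F1 : R -> R) (r : R) :
  outer m lam phi phi1 -> 0 <= lam < INR m + 2 ->
  radsol m V f f1 ->
  (forall r, 0 < r -> 0 < f r /\ f1 r <= 0 /\ V r <= r ^ 2 - lam) ->
  filterlim f (Rbar_locally p_infty) (locally 0) ->
  0 < r ->
  (forall x, r <= x -> 0 <= F x /\ is_derive F x (F1 x) /\
     F1 x <= - (x * x ^ m * ((x ^ 2 - lam - V x) * f x * phi x))) ->
  wronsk m f f1 phi phi1 r <= F r.
Proof.
  intros Ho Hl Hf Hfp Hf0 Hr HF.
  destruct (wronsk_outer _ _ _ _ _ _ _ Ho Hl Hf Hfp Hf0) as [_ [h [Hh [R0 Hw]]]].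
  set (W := wronsk m f f1 phi phi1) in *.
  assert (Hd : forall x, r <= x -> is_derive (fun x => W x - F x) x
    (x * x ^ m * ((V x - (x ^ 2 - lam)) * f x * phi x) - F1 x)).
  { intros x Hx. apply (is_derive_minus W F); [ | now apply HF].
    apply (wronsk_derive m V (fun r => r ^ 2 - lam)); trivial; [apply Ho | lra]. }
  assert (Hd0 : forall x, r <= x -> 0 <= x * x ^ m * ((V x - (x ^ 2 - lam)) * f x * phi x) - F1 x).
  { intros x Hx. destruct (HF x Hx) as [_ [_ H]].
    replace ((V x - (x ^ 2 - lam)) * f x * phi x) with (- ((x ^ 2 - lam - V x) * f x * phi x)) by ring. lra. }
  set (a := Rmax r R0).
  assert (Har : r <= a) by apply Rmax_l. assert (HaR : R0 <= a) by apply Rmax_r.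
  assert (W a - F a <= 0).
  { apply (derive_incr_nonpos (fun x => W x - F x) (fun x => x * x ^ m * ((V x - (x ^ 2 - lam)) * f x * phi x) - F1 x) h); trivial.
    - intros x Hx. apply Hd. lra.
    - intros x Hx. apply Hd0. lra.
    - intros x Hx. assert (r <= x) by lra. destruct (HF x H) as [H1 _].
      assert (W x <= h x) by (apply Hw; lra). lra. }
  assert (W r - F r <= W a - F a); [ | lra].
  apply (derive_incr (fun x => W x - F x) (fun x => x * x ^ m * ((V x - (x ^ 2 - lam)) * f x * phi x) - F1 x)); trivial.
  - intros x Hx. apply Hd. lra.
  - intros x Hx. apply Hd0. lra.
Qed.

(** * Ground states and the Pohozaev function *)

Lemma derive_incr_strict (f f1 : R -> R) (a b : R) :
  a < b -> (forall x, a <= x <= b -> is_derive f x (f1 x)) ->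
  (forall x, a <= x <= b -> 0 < f1 x) -> f a < f b.
Proof.
  intros Hab Hd Hp.
  destruct (MVT_gen f a b f1) as [c [Hc Hfc]].
  - rewrite Rmin_left, Rmax_right by lra. intros x Hx; apply Hd; lra.
  - rewrite Rmin_left, Rmax_right by lra. intros x Hx.
    apply continuity_pt_filterlim, (is_derive_cont f x (f1 x)), Hd, Hx.
  - rewrite Rmin_left, Rmax_right in Hc by lra.
    specialize (Hp c Hc). nra.
Qed.

(** The exponent [4 / INR m] is [2p], and no absolute value is left because [u > 0]. *)
Definition gstate (m : nat) (lam b : R) (u u1 : R -> R) : Prop :=
  radsol m (fun r => r ^ 2 - lam - Rpower (u r) (4 / INR m)) u u1 /\
  (forall r, 0 < r -> 0 < u r <= b /\ u1 r < 0) /\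
  filterlim u (at_right 0) (locally b) /\
  filterlim u1 (at_right 0) (locally 0) /\
  filterlim u (Rbar_locally p_infty) (locally 0).

(** A strictly decreasing function with limit 0 is positive; this removes [apow]. *)
Lemma radial_gstate (m : nat) (lam b : R) (u : R -> R) :
  (3 <= m)%nat -> radial_ground_state (S (S m)) (p_of (S (S m))) lam b u ->
  gstate m lam b u (Derive u).
Proof.
  intros Hm [H0 [H1 [H2 [H3 [H4 H5]]]]].
  assert (HM : 3 <= INR m) by (apply (le_INR 3) in Hm; simpl in Hm; lra).
  assert (Hd : forall x, 0 < x -> is_derive u x (Derive u x)).
  { intros x Hx. apply Derive_correct, H3, Hx. }
  assert (Hdec : forall x y, 0 < x -> x < y -> u y < u x).
  { intros x y Hx Hxy. assert (- u x < - u y); [ | lra].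
    apply (derive_incr_strict (fun x => - u x) (fun x => - Derive u x)); trivial.
    - intros z Hz. apply (is_derive_opp u), Hd. lra.
    - intros z Hz. assert (Hz0 : 0 < z) by lra. specialize (H4 z Hz0). lra. }
  assert (Hpos : forall r, 0 < r -> 0 < u r).
  { intros r Hr. assert (0 <= u (r + 1)).
    - apply (derive_decr_lim_infty u (Derive u)); trivial.
      + intros x Hx. apply Hd. lra.
      + intros x Hx. left. apply H4. lra.
    - assert (u (r + 1) < u r) by (apply Hdec; lra). lra. }
  split; [ | split; [ | split; [ | split]]]; trivial.
  - intros r Hr. split; [now apply Hd | ].
    destruct (H3 r Hr) as [_ [D2 E]].
    apply is_derive_val with (Derive (Derive u) r); [now apply Derive_correct | ].
    unfold apow in E. assert (Hu := Hpos r Hr).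
    rewrite Rabs_pos_eq in E by lra.
    destruct (Rlt_dec 0 (u r)) as [_ | Hn]; [ | lra].
    unfold p_of in E. rewrite !S_INR in E.
    replace (2 * (2 / (INR m + 1 + 1 - 2))) with (4 / INR m) in E by (field; lra).
    replace (INR m + 1 + 1 - 1) with (INR m + 1) in E by ring. lra.
  - intros r Hr. split; [split | ]; auto.
    apply (derive_decr_lim0 u (Derive u)); trivial.
    + intros x Hx. apply Hd. lra.
    + intros x Hx. left. apply H4. lra.
Qed.

Lemma wronsk_lim0 (m : nat) (f f1 g g1 : R -> R) (a a1 c c1 : R) :
  filterlim f (at_right 0) (locally a) -> filterlim f1 (at_right 0) (locally a1) ->
  filterlim g (at_right 0) (locally c) -> filterlim g1 (at_right 0) (locally c1) ->
  filterlim (wronsk m f f1 g g1) (at_right 0) (locally 0).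
Proof.
  intros Hf Hf1 Hg Hg1. unfold wronsk.
  apply flim_val with (0 * 0 ^ m * (a1 * c - a * c1)); [ | ring].
  repeat first [ assumption | apply flim_id0 | apply flim_mult | apply flim_minus | apply flim_pow | typeclasses eauto ].
Qed.

(** The ground state of the harmonic oscillator, with eigenvalue [d = m + 2]: the comparison
    function for the decay of [u] and for the upper bound on [lam]. *)
Lemma gauss_radsol (m : nat) :
  radsol m (fun r => r ^ 2 - (INR m + 2)) (fun r => exp (- (r ^ 2) / 2))
    (fun r => - r * exp (- (r ^ 2) / 2)).
Proof.
  intros r Hr. split.
  - eapply is_derive_val; [auto_derive; trivial | ]. unfold Rdiv. simpl. rewrite ?Rmult_1_r. field.
  - eapply is_derive_val; [auto_derive; trivial | ]. unfold Rdiv. simpl. rewrite ?Rmult_1_r. field. lra.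
Qed.

(** Where [u^(2p) <= m + 2 - lam], the potential of [u] is at least that of the Gaussian [g], so
    their Wronskian increases. It is never positive, being at most [r^(m+2) g u], which tends to 0
    because [u <= b]. So [u / g] decreases. *)
Lemma gs_gauss_decr (m : nat) (lam b : R) (u u1 : R -> R) (r0 r : R) :
  gstate m lam b u u1 -> 0 < r0 ->
  (forall x, r0 <= x -> Rpower (u x) (4 / INR m) <= INR m + 2 - lam) ->
  r0 <= r -> u r * exp (r ^ 2 / 2) <= u r0 * exp (r0 ^ 2 / 2).
Proof.
  intros [Hs [Hu [_ [_ _]]]] Hr0 HK Hr.
  set (g := fun r => exp (- (r ^ 2) / 2)). set (g1 := fun r => - r * exp (- (r ^ 2) / 2)).
  assert (Hg : radsol m (fun r => r ^ 2 - (INR m + 2)) g g1) by apply gauss_radsol.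
  assert (Hgp : forall x, 0 < g x) by (intros; apply exp_pos).
  assert (HP : forall x, 0 < x -> 0 < x * x ^ m)
    by (intros; apply Rmult_lt_0_compat; [ | apply pow_lt]; lra).
  set (W := wronsk m u u1 g g1).
  assert (HW : forall x y, r0 <= x -> x <= y -> W x <= W y).
  { intros x y Hx Hxy. eapply (derive_incr W); trivial.
    - intros z Hz. apply (wronsk_derive m _ _ _ _ _ _ z Hs Hg). lra.
    - intros z Hz. assert (Hz0 : 0 < z) by lra. assert (Hzr : r0 <= z) by lra.
      specialize (HK z Hzr). destruct (Hu z Hz0) as [[A _] _]. specialize (Hgp z). specialize (HP z Hz0).
      assert (0 <= z ^ 2 - lam - Rpower (u z) (4 / INR m) - (z ^ 2 - (INR m + 2))) by lra.
      apply Rmult_le_pos; [lra | ]. apply Rmult_le_pos; [ | lra]. apply Rmult_le_pos; lra. }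
  assert (HW0 : forall a, r0 <= a -> W a <= 0).
  { intros a Ha. apply Rnot_lt_le. intros Hpos.
    destruct (gauss_pow_bound (m + 3)) as [C [HC HCb]].
    (* Chosen so that [x * W a] exceeds [C * b], while [r^(m+3) g <= C] and [u <= b] bound it by
       [C * b]. *)
    set (x := a + C * b / W a + 1).
    assert (Hb : 0 < b) by (destruct (Hu 1); lra).
    assert (HCW : 0 < C * b / W a) by (apply Rdiv_lt_0_compat; [apply Rmult_lt_0_compat | ]; lra).
    assert (Hax : a <= x) by (unfold x; lra). assert (Hx0 : 0 < x) by lra.
    specialize (HW a x Ha Hax). destruct (Hu x Hx0) as [[A1 A2] A3].
    specialize (HCb x (Rlt_le _ _ Hx0)). fold (g x) in HCb.
    assert (H1 : W a <= x * x ^ m * (x * g x) * u x).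
    { apply Rle_trans with (1 := HW). unfold W, wronsk, g1. fold (g x).
      specialize (Hgp x). specialize (HP x Hx0).
      assert (x * x ^ m * (u1 x * g x) <= 0) by (assert (u1 x * g x <= 0) by nra; nra). lra. }
    assert (H2 : x * W a <= C * b).
    { apply Rle_trans with (x * (x * x ^ m * (x * g x) * u x)); [apply Rmult_le_compat_l; lra | ].
      replace (x * (x * x ^ m * (x * g x) * u x)) with (x ^ (m + 3) * g x * u x) by (rewrite pow_add; ring).
      apply Rmult_le_compat; try lra. apply Rmult_le_pos; [apply pow_le; lra | left; apply Hgp]. }
    assert (C * b < x * W a); [ | lra].
    apply Rle_lt_trans with (C * b / W a * W a); [right; field; lra | ].
    apply Rmult_lt_compat_r; trivial. unfold x; lra. }
  assert (Hq : u r / g r <= u r0 / g r0).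
  { eapply (derive_decr (fun r => u r / g r)); trivial.
    - intros x Hx. apply (ratio_derive m _ _ _ _ _ _ x Hs Hg); [lra | apply Hgp].
    - intros x Hx. assert (Hx0 : 0 < x) by lra. specialize (HP x Hx0). specialize (Hgp x).
      assert (W x <= 0) by (apply HW0; lra). fold W.
      assert (0 < / (x * x ^ m * g x ^ 2)) by (apply Rinv_0_lt_compat, Rmult_lt_0_compat; [lra | nra]).
      unfold Rdiv. nra. }
  assert (Hgi : forall x, / g x = exp (x ^ 2 / 2)).
  { intros x. unfold g. rewrite <- exp_Ropp. f_equal. field. }
  unfold Rdiv in Hq. now rewrite !Hgi in Hq.
Qed.

(** If [lam >= m + 2], the Wronskian with the Gaussian starts at 0 and strictly decreases, so the
    slope of [u / g] stays below a negative constant and [u] could not remain positive. *)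
Lemma gs_lam_lt (m : nat) (lam b : R) (u u1 : R -> R) :
  gstate m lam b u u1 -> lam < INR m + 2.
Proof.
  intros [Hs [Hu [Hl0 [Hl1 _]]]]. apply Rnot_le_lt. intros Hl.
  set (g := fun r => exp (- (r ^ 2) / 2)). set (g1 := fun r => - r * exp (- (r ^ 2) / 2)).
  assert (Hg : radsol m (fun r => r ^ 2 - (INR m + 2)) g g1) by apply gauss_radsol.
  assert (Hgp : forall x, 0 < g x) by (intros; apply exp_pos).
  assert (HP : forall x, 0 < x -> 0 < x * x ^ m)
    by (intros; apply Rmult_lt_0_compat; [ | apply pow_lt]; lra).
  set (W := wronsk m u u1 g g1).
  assert (HWd : forall z, 0 < z -> is_derive W z (z * z ^ m *
     ((z ^ 2 - lam - Rpower (u z) (4 / INR m) - (z ^ 2 - (INR m + 2))) * u z * g z))).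
  { intros z Hz. apply (wronsk_derive m _ _ _ _ _ _ z Hs Hg Hz). }
  assert (HWn : forall z, 0 < z -> z * z ^ m *
     ((z ^ 2 - lam - Rpower (u z) (4 / INR m) - (z ^ 2 - (INR m + 2))) * u z * g z) < 0).
  { intros z Hz. assert (Hk := Rpower_pos (u z) (4 / INR m)). specialize (HP z Hz).
    destruct (Hu z Hz) as [[A _] _]. specialize (Hgp z).
    assert (0 < u z * g z) by nra.
    assert ((z ^ 2 - lam - Rpower (u z) (4 / INR m) - (z ^ 2 - (INR m + 2))) * (u z * g z) < 0) by nra.
    nra. }
  (* The limit at 0 gives a weak inequality at 1/2; strictness is gained between 1/2 and 1. *)
  assert (HW1 : W 1 < 0).
  { assert (W (1/2) <= 0).
    - eapply (derive_decr_lim0 W); [lra | intros x Hx; apply HWd; lra | intros x Hx; left; apply HWn; lra | ].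
      assert (Hgc : forall (h : R -> R) (h1 : R), is_derive h 0 h1 -> filterlim h (at_right 0) (locally (h 0))).
      { intros h h1 Hh. exact (cont_right h 0 (is_derive_cont h 0 h1 Hh)). }
      apply (wronsk_lim0 m u u1 g g1 b 0 (g 0) (g1 0)); trivial.
      + apply (Hgc g (- 0 * exp (- (0 ^ 2) / 2))). unfold g. auto_derive; trivial. unfold Rdiv; simpl; field.
      + eapply (Hgc g1). unfold g1. auto_derive; trivial.
    - assert (- W (1/2) < - W 1); [ | lra].
      eapply (derive_incr_strict (fun x => - W x)); [lra | | ].
      + intros x Hx. apply (is_derive_opp W), HWd. lra.
      + intros x Hx. assert (Hx0 : 0 < x) by lra. specialize (HWn x Hx0). cbv [opp]; simpl. lra. }
  assert (HW : forall x, 1 <= x -> W x <= W 1).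
  { intros x Hx. eapply (derive_decr W); [trivial | intros y Hy; apply HWd; lra | intros y Hy; left; apply HWn; lra]. }
  destruct (gauss_pow_bound (m + 1)) as [C [HC HCb]].
  eapply (derive_neg_absurd (fun r => u r / g r) _ 1 (- W 1 / C) 0).
  - apply Rdiv_lt_0_compat; lra.
  - intros x Hx. apply (ratio_derive m _ _ _ _ _ _ x Hs Hg); [lra | apply Hgp].
  - intros x Hx. assert (Hx0 : 0 < x) by lra. specialize (HW x Hx). fold W.
    specialize (HCb x (Rlt_le _ _ Hx0)). fold (g x) in HCb. specialize (HP x Hx0). specialize (Hgp x).
    assert (Hg1 : g x <= 1).
    { unfold g. rewrite <- exp_0. apply exp_le_compat. assert (0 <= x ^ 2) by nra. lra. }
    assert (Hd : 0 < x * x ^ m * g x ^ 2) by (apply Rmult_lt_0_compat; [trivial | nra]).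
    assert (Hd2 : x * x ^ m * g x ^ 2 <= C).
    { apply Rle_trans with (2 := HCb). replace (x ^ (m + 1) * g x) with (x * x ^ m * g x) by (rewrite pow_add; ring).
      apply Rmult_le_compat_l; [lra | nra]. }
    apply Rle_trans with (W 1 / (x * x ^ m * g x ^ 2)).
    + apply Rmult_le_compat_r; trivial. left; now apply Rinv_0_lt_compat.
    + assert (/ C <= / (x * x ^ m * g x ^ 2)) by now apply Rinv_le_contravar.
      unfold Rdiv. nra.
  - intros x Hx. left. apply Rdiv_lt_0_compat; [apply Hu; lra | apply Hgp].
Qed.

Lemma gs_gauss_decay (m : nat) (lam b : R) (u u1 : R -> R) :
  (3 <= m)%nat -> gstate m lam b u u1 ->
  exists C R0, 0 < C /\ 0 < R0 /\ forall r, R0 <= r -> u r * exp (r ^ 2 / 2) <= C.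
Proof.
  intros Hm H. assert (Hl := gs_lam_lt _ _ _ _ _ H).
  assert (HM : 3 <= INR m) by (apply (le_INR 3) in Hm; simpl in Hm; lra).
  assert (Hu := proj1 (proj2 H)).
  assert (Hlim := proj2 (proj2 (proj2 (proj2 H)))).
  set (e := Rpower (INR m + 2 - lam) (INR m / 4)).
  apply flim_eps with (eps := e) in Hlim; [ | typeclasses eauto | apply Rpower_pos].
  destruct (infty_elim _ 1 Hlim) as [R0 [HR0 He]].
  exists (u R0 * exp (R0 ^ 2 / 2)), R0. split; [ | split; [lra | ]].
  - apply Rmult_lt_0_compat; [apply Hu; lra | apply exp_pos].
  - intros r Hr. apply (gs_gauss_decr m lam b u u1); trivial; [lra | ].
    intros x Hx. specialize (He x Hx). destruct (Hu x) as [[A _] _]; [lra | ].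
    apply Rabs_def2 in He.
    replace (INR m + 2 - lam) with (Rpower e (4 / INR m)).
    + apply Rle_Rpower_l; [ | lra]. apply Rdiv_le_0_compat; lra.
    + unfold e. rewrite Rpower_mult. replace (INR m / 4 * (4 / INR m)) with 1 by (field; lra).
      apply Rpower_1. lra.
Qed.

(** The multiplier is [r u' + (m/2) u]. With [m/2 = (d-2)/2] the kinetic terms of the derivative
    cancel, and since [(m+2)/(4/m + 2) = m/2] so do the power terms: this is where
    energy-criticality is used. *)
Definition poho (m : nat) (lam : R) (u u1 : R -> R) (r : R) : R :=
  r ^ 2 * r ^ m * (u1 r ^ 2 / 2 + Rpower (u r) (4 / INR m) * u r ^ 2 / (4 / INR m + 2)
     + (lam - r ^ 2) * u r ^ 2 / 2) + INR m / 2 * (r * r ^ m * u r * u1 r).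

Lemma poho_derive (m : nat) (lam b : R) (u u1 : R -> R) (r : R) :
  (3 <= m)%nat -> gstate m lam b u u1 -> 0 < r ->
  is_derive (poho m lam u u1) r (r * r ^ m * (lam - 2 * r ^ 2) * u r ^ 2).
Proof.
  intros Hm [Hs [Hu _]] Hr.
  assert (HM : 3 <= INR m) by (apply (le_INR 3) in Hm; simpl in Hm; lra).
  destruct (Hs r Hr) as [F0 F1]. destruct (Hu r Hr) as [[Hp _] _].
  assert (HK := is_derive_Rpower u r (u1 r) (4 / INR m) Hp F0).
  destruct (is_derive_opaque _ _ _ HK) as [K [EK DK]].
  unfold poho.
  apply (is_derive_ext (fun r => r ^ 2 * r ^ m * (u1 r ^ 2 / 2 + K r * u r ^ 2 / (4 / INR m + 2)
     + (lam - r ^ 2) * u r ^ 2 / 2) + INR m / 2 * (r * r ^ m * u r * u1 r))).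
  { intros t. now rewrite EK. }
  auto_derive; [dsolve | ].
  drw F0; drw F1; drw DK.
  rewrite !EK, pow_pred by lra. field. repeat split; lra.
Qed.

Lemma poho_lim0 (m : nat) (lam b : R) (u u1 : R -> R) :
  0 < b -> gstate m lam b u u1 -> filterlim (poho m lam u u1) (at_right 0) (locally 0).
Proof.
  intros Hb [_ [_ [H0 [H1 _]]]].
  assert (HK : filterlim (fun r => Rpower (u r) (4 / INR m)) (at_right 0) (locally (Rpower b (4 / INR m)))).
  { apply (flim_cont _ (fun x => Rpower x (4 / INR m))); trivial.
    apply (ex_derive_continuous (fun x => Rpower x (4 / INR m))).
    eexists. apply (is_derive_Rpower (fun x => x) b 1); trivial. auto_derive; trivial. }
  apply flim_val with (0 ^ 2 * 0 ^ m * (0 ^ 2 * / 2 + Rpower b (4 / INR m) * b ^ 2 * / (4 / INR m + 2)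
     + (lam - 0 ^ 2) * b ^ 2 * / 2) + INR m / 2 * (0 * 0 ^ m * b * 0)); [ | ring].
  unfold poho. unfold Rdiv at 1 2 3.
  flims.
Qed.

(** Completing the square in [r u' + (m/2) u] leaves a bound in terms of [u] alone, the function for
    which Gaussian decay is known. *)
Lemma poho_below (m : nat) (lam : R) (u u1 : R -> R) (r : R) :
  (3 <= m)%nat -> 1 <= r -> 0 < u r ->
  - poho m lam u u1 r <= (1 + Rabs lam + INR m ^ 2) * (r ^ 4 * r ^ m * u r ^ 2).
Proof.
  intros Hm Hr Hu. unfold poho.
  assert (HM : 3 <= INR m) by (apply (le_INR 3) in Hm; simpl in Hm; lra).
  assert (HP : 0 < r ^ m) by (apply pow_lt; lra).
  assert (HK : 0 <= Rpower (u r) (4 / INR m) * u r ^ 2 / (4 / INR m + 2)).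
  { assert (Hk := Rpower_pos (u r) (4 / INR m)).
    apply Rmult_le_pos; [nra | ]. left; apply Rinv_0_lt_compat.
    assert (0 <= 4 / INR m) by (apply Rdiv_le_0_compat; lra). lra. }
  set (k := Rpower (u r) (4 / INR m) * u r ^ 2 / (4 / INR m + 2)) in *.
  set (M := INR m) in *. set (P := r ^ m) in *. set (x := u r) in *. set (y := u1 r).
  apply Rle_trans with (P * ((1 + Rabs lam + M ^ 2) * (r ^ 4 * x ^ 2))); [ | right; ring].
  replace (- (r ^ 2 * P * (y ^ 2 / 2 + k + (lam - r ^ 2) * x ^ 2 / 2) + M / 2 * (r * P * x * y)))
    with (P * - (r ^ 2 * (y ^ 2 / 2 + k + (lam - r ^ 2) * x ^ 2 / 2) + M / 2 * (r * x * y))) by ring.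
  apply Rmult_le_compat_l; [lra | ].
  assert (Hl := Rabs_maj2 lam).
  assert (H1 : 1 <= r ^ 2) by nra. assert (H2 : r ^ 2 <= r ^ 4) by nra.
  assert (H3 : 0 <= r ^ 2 * k) by (apply Rmult_le_pos; lra).
  assert (H4 : 0 <= (r * y + M / 2 * x) ^ 2) by apply pow2_ge_0.
  assert (H5 : - lam * (r ^ 2 * x ^ 2) <= Rabs lam * (r ^ 4 * x ^ 2)).
  { apply Rle_trans with (Rabs lam * (r ^ 2 * x ^ 2)).
    - apply Rmult_le_compat_r; [nra | lra].
    - apply Rmult_le_compat_l; [apply Rabs_pos | nra]. }
  assert (H6 : M ^ 2 * x ^ 2 <= M ^ 2 * (r ^ 4 * x ^ 2)).
  { apply Rmult_le_compat_l; nra. }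
  assert (H7 : 0 <= Rabs lam * (r ^ 4 * x ^ 2)) by (apply Rmult_le_pos; [apply Rabs_pos | nra]).
  assert (H8 : 0 <= M ^ 2 * x ^ 2) by nra.
  assert (H9 : 0 <= r ^ 4 * x ^ 2) by nra.
  lra.
Qed.

(** Beyond [r0] the derivative [r^(m+1) (lam - 2 r^2) u^2] is nonpositive, so a negative value would
    persist; by [poho_below] and Gaussian decay, negative values tend to 0 at infinity. *)
Lemma poho_nonneg_far (m : nat) (lam b : R) (u u1 : R -> R) (r0 : R) :
  (3 <= m)%nat -> gstate m lam b u u1 -> 0 < r0 -> lam <= 2 * r0 ^ 2 ->
  0 <= poho m lam u u1 r0.
Proof.
  intros Hm H Hr0 Hlr. apply Rnot_lt_le. intros Hneg.
  assert (Hu := proj1 (proj2 H)).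
  set (h := - poho m lam u u1 r0).
  destruct (gs_gauss_decay m lam b u u1 Hm H) as [C [R0 [HC [HR0 HCb]]]].
  destruct (gauss_pow_bound (m + 5)) as [C2 [HC2 HCb2]].
  set (A := 1 + Rabs lam + INR m ^ 2).
  assert (HA : 0 < A) by (unfold A; generalize (Rabs_pos lam) (pow2_ge_0 (INR m)); lra).
  (* The last term makes [r * h] exceed the bound [A * C ^ 2 * C2] obtained in [H3]. *)
  set (r := 1 + r0 + R0 + A * C ^ 2 * C2 / h).
  assert (HAC : 0 < A * C ^ 2 * C2) by (repeat apply Rmult_lt_0_compat; nra).
  assert (Hq : 0 < A * C ^ 2 * C2 / h) by (apply Rdiv_lt_0_compat; unfold h; lra).
  assert (Hr1 : 1 <= r) by (unfold r; lra).
  assert (Hrr0 : r0 <= r) by (unfold r; lra).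
  assert (HrR0 : R0 <= r) by (unfold r; lra).
  assert (Hr : 0 < r) by lra.
  assert (H1 : poho m lam u u1 r <= poho m lam u u1 r0).
  { eapply (derive_decr (poho m lam u u1)); trivial.
    - intros x Hx. apply (poho_derive m lam b); trivial. lra.
    - intros x Hx. assert (0 < x ^ m) by (apply pow_lt; lra).
      assert (lam - 2 * x ^ 2 <= 0) by nra.
      assert (0 <= x * x ^ m * u x ^ 2) by (apply Rmult_le_pos; nra). nra. }
  destruct (Hu r Hr) as [[A1 A2] A3].
  assert (H2 := poho_below m lam u u1 r Hm Hr1 A1). fold A in H2.
  specialize (HCb r HrR0). specialize (HCb2 r (Rlt_le _ _ Hr)).
  assert (Hg : exp (r ^ 2 / 2) * exp (- (r ^ 2) / 2) = 1).
  { rewrite <- exp_plus. replace (r ^ 2 / 2 + - r ^ 2 / 2) with 0 by field. apply exp_0. }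
  set (g := exp (- (r ^ 2) / 2)) in *.
  assert (Hgp : 0 < g) by apply exp_pos.
  assert (Hg1 : g <= 1).
  { unfold g. rewrite <- exp_0. apply exp_le_compat. assert (0 <= r ^ 2) by nra. lra. }
  assert (Hug : u r <= C * g).
  { replace (u r) with (u r * exp (r ^ 2 / 2) * g) by (rewrite Rmult_assoc, Hg; ring).
    apply Rmult_le_compat_r; lra. }
  assert (Hu2 : u r ^ 2 <= C ^ 2 * g).
  { apply Rle_trans with ((C * g) ^ 2); [apply pow_incr; lra | ].
    replace ((C * g) ^ 2) with (C ^ 2 * (g * g)) by ring.
    apply Rmult_le_compat_l; nra. }
  assert (HP : 0 < r ^ 4 * r ^ m) by (apply Rmult_lt_0_compat; apply pow_lt; lra).
  assert (H3 : r * h <= A * C ^ 2 * C2).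
  { apply Rle_trans with (r * (A * (r ^ 4 * r ^ m * (C ^ 2 * g)))).
    - apply Rmult_le_compat_l; [lra | ]. apply Rle_trans with (A * (r ^ 4 * r ^ m * u r ^ 2)).
      + unfold h; lra.
      + apply Rmult_le_compat_l; [lra | ]. apply Rmult_le_compat_l; lra.
    - replace (r * (A * (r ^ 4 * r ^ m * (C ^ 2 * g)))) with (A * C ^ 2 * (r ^ (m + 5) * g)) by (rewrite pow_add; ring).
      apply Rmult_le_compat_l; [nra | trivial]. }
  assert (A * C ^ 2 * C2 < r * h); [ | lra].
  apply Rle_lt_trans with (A * C ^ 2 * C2 / h * h); [right; field; unfold h; lra | ].
  apply Rmult_lt_compat_r; [unfold h; lra | ]. unfold r; lra.
Qed.

(** For [lam <= 0] the function [poho] would decrease strictly from its limit 0, against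
    [poho_nonneg_far]. *)
Lemma gs_lam_pos (m : nat) (lam b : R) (u u1 : R -> R) :
  (3 <= m)%nat -> 0 < b -> gstate m lam b u u1 -> 0 < lam.
Proof.
  intros Hm Hb H. apply Rnot_le_lt. intros Hl.
  assert (Hu := proj1 (proj2 H)).
  assert (Hd : forall x, 0 < x -> x * x ^ m * (lam - 2 * x ^ 2) * u x ^ 2 < 0).
  { intros x Hx. assert (0 < x ^ m) by (apply pow_lt; lra). destruct (Hu x Hx) as [[A _] _].
    assert (0 < x * x ^ m * u x ^ 2) by (apply Rmult_lt_0_compat; nra).
    assert (lam - 2 * x ^ 2 < 0) by nra. nra. }
  assert (poho m lam u u1 (1 / 2) <= 0).
  { eapply (derive_decr_lim0 (poho m lam u u1)); [lra | | | now apply poho_lim0 with b].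
    - intros x Hx. apply (poho_derive m lam b); trivial; lra.
    - intros x Hx. left. apply Hd. lra. }
  assert (- poho m lam u u1 (1 / 2) < - poho m lam u u1 1).
  { eapply (derive_incr_strict (fun x => - poho m lam u u1 x)); [lra | | ].
    - intros x Hx. apply (is_derive_opp (poho m lam u u1)), (poho_derive m lam b); trivial; lra.
    - intros x Hx. assert (Hx0 : 0 < x) by lra. specialize (Hd x Hx0). cbv [opp]; simpl. simpl in Hd. lra. }
  assert (0 <= poho m lam u u1 1) by (apply (poho_nonneg_far m lam b); trivial; lra). lra.
Qed.

Lemma poho_nonneg (m : nat) (lam b : R) (u u1 : R -> R) (r : R) :
  (3 <= m)%nat -> 0 < b -> gstate m lam b u u1 -> 0 < r -> 0 <= poho m lam u u1 r.
Proof.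
  intros Hm Hb H Hr. destruct (Rle_lt_dec lam (2 * r ^ 2)) as [Hl | Hl].
  - now apply (poho_nonneg_far m lam b).
  - eapply (derive_incr_lim0 (poho m lam u u1)); [trivial | | | now apply poho_lim0 with b].
    + intros x Hx. apply (poho_derive m lam b); trivial; lra.
    + intros x Hx. assert (0 < x ^ m) by (apply pow_lt; lra).
      apply Rmult_le_pos; [ | apply pow2_ge_0]. apply Rmult_le_pos; nra.
Qed.

(** * Comparison with the Tricomi solution *)

Lemma gs_potential_le (m : nat) (lam b : R) (u u1 : R -> R) :
  gstate m lam b u u1 ->
  forall r, 0 < r -> 0 < u r /\ u1 r <= 0 /\
    r ^ 2 - lam - Rpower (u r) (4 / INR m) <= r ^ 2 - lam.
Proof.
  intros [_ [Hu _]] r Hr. destruct (Hu r Hr) as [[A1 A2] A3].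
  assert (Hk := Rpower_pos (u r) (4 / INR m)). repeat split; lra.
Qed.

Lemma gs_pow_potential (m : nat) (lam b : R) (u u1 : R -> R) :
  (3 <= m)%nat -> gstate m lam b u u1 ->
  exists B R0, 0 < B /\ 1 <= R0 /\
    forall r, R0 <= r -> r ^ (m + 2) * Rpower (u r) (4 / INR m) <= B.
Proof.
  intros Hm H. assert (Hu := proj1 (proj2 H)).
  assert (HM : 3 <= INR m) by (apply (le_INR 3) in Hm; simpl in Hm; lra).
  destruct (gs_gauss_decay m lam b u u1 Hm H) as [C [R0 [HC [HR0 HCb]]]].
  (* With this exponent [(r^n)^(4/m) = r^(4(m+2))], which dominates [r^(m+2)] for [r >= 1]. *)
  set (n := (m * (m + 2))%nat).
  destruct (gauss_pow_bound n) as [C2 [HC2 HCb2]].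
  exists (Rpower (C * C2) (4 / INR m)), (1 + R0). split; [apply Rpower_pos | split; [lra | ]].
  intros r Hr. assert (Hr0 : 0 < r) by lra. assert (HrR : R0 <= r) by lra.
  destruct (Hu r Hr0) as [[A1 A2] A3].
  specialize (HCb r HrR). specialize (HCb2 r (Rlt_le _ _ Hr0)).
  assert (Hg : exp (r ^ 2 / 2) * exp (- (r ^ 2) / 2) = 1).
  { rewrite <- exp_plus. replace (r ^ 2 / 2 + - r ^ 2 / 2) with 0 by field. apply exp_0. }
  set (g := exp (- (r ^ 2) / 2)) in *.
  assert (Hgp : 0 < g) by apply exp_pos.
  assert (Hrn : 0 < r ^ n) by (apply pow_lt; lra).
  assert (Hb : r ^ n * u r <= C * C2).
  { replace (r ^ n * u r) with ((u r * exp (r ^ 2 / 2)) * (r ^ n * g))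
      by (replace (u r * exp (r ^ 2 / 2) * (r ^ n * g)) with (u r * r ^ n * (exp (r ^ 2 / 2) * g)) by ring;
          rewrite Hg; ring).
    apply Rmult_le_compat; trivial; left; apply Rmult_lt_0_compat; trivial. apply exp_pos. }
  assert (Hs : 0 <= 4 / INR m) by (apply Rdiv_le_0_compat; lra).
  apply Rle_trans with (Rpower (r ^ n * u r) (4 / INR m)).
  - rewrite <- Rpower_mult_distr by trivial.
    apply Rmult_le_compat_r; [left; apply Rpower_pos | ].
    rewrite <- (Rpower_pow n) by trivial. rewrite Rpower_mult.
    replace (INR n * (4 / INR m)) with (INR (4 * (m + 2))).
    + rewrite Rpower_pow by trivial. apply Rle_pow; [lra | lia].
    + unfold n. rewrite !mult_INR. change (INR 4) with (1 + 1 + 1 + 1). field. lra.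
  - apply Rle_Rpower_l; trivial. split; trivial. apply Rmult_lt_0_compat; trivial.
Qed.

(** The quotient [u / phi] increases because the Wronskian is nonnegative. It is bounded because the
    comparison function [B r^(-2) u phi] for the Wronskian yields [(u/phi)' <= (B/r^2) (u/phi)], so
    that [(u/phi) exp(B/r)] decreases far out. *)
Lemma gs_ratio_lim (m : nat) (lam b : R) (u u1 phi phi1 : R -> R) :
  (3 <= m)%nat -> 0 < b -> gstate m lam b u u1 -> outer m lam phi phi1 ->
  exists c, 0 < c /\ filterlim (fun r => u r / phi r) (Rbar_locally p_infty) (locally c) /\
    forall r, 0 < r -> u r <= c * phi r.
Proof.
  intros Hm Hb H Ho.
  assert (Hl : 0 <= lam < INR m + 2).
  { split; [left; now apply (gs_lam_pos m lam b u u1) | now apply (gs_lam_lt m lam b u u1)]. }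
  assert (Hp := fun r => outer_pos _ _ _ _ r Ho).
  assert (HV := gs_potential_le m lam b u u1 H).
  destruct (gs_pow_potential m lam b u u1 Hm H) as [B [R0 [HB [HR0 HBb]]]].
  destruct H as [Hs [Hu [_ [_ Hu0]]]].
  destruct (wronsk_outer m lam _ u u1 phi phi1 Ho Hl Hs HV Hu0) as [HW _].
  set (W := wronsk m u u1 phi phi1) in *.
  assert (Hs2 := proj1 Ho).
  assert (HP : forall x, 0 < x -> 0 < x ^ m) by (intros; apply pow_lt; lra).
  set (q := fun r => u r / phi r).
  set (q1 := fun r => W r / (r * r ^ m * phi r ^ 2)).
  assert (Hq : forall x, 0 < x -> is_derive q x (q1 x)).
  { intros x Hx. apply (ratio_derive m _ _ _ _ _ _ x Hs Hs2); auto. }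
  assert (Hqp : forall x, 0 < x -> 0 < q x).
  { intros x Hx. apply Rdiv_lt_0_compat; [apply Hu | apply Hp]; trivial. }
  assert (Hden : forall x, 0 < x -> 0 < x * x ^ m * phi x ^ 2).
  { intros x Hx. specialize (HP x Hx). specialize (Hp x Hx).
    apply Rmult_lt_0_compat; nra. }
  assert (Hq1 : forall x, 0 < x -> 0 <= q1 x).
  { intros x Hx. apply Rdiv_le_0_compat; auto. }
  assert (HWB : forall r, R0 <= r -> W r <= B * / r ^ 2 * (u r * phi r)).
  { intros r Hr. apply (wronsk_outer_le m lam (fun r => r ^ 2 - lam - Rpower (u r) (4 / INR m)) u u1 phi phi1
      (fun x => B * / x ^ 2 * (u x * phi x))
      (fun x => B * (- 2 / x ^ 3 * (u x * phi x) + / x ^ 2 * (u1 x * phi x + u x * phi1 x)))); trivial; [lra | ].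
    intros x Hx. assert (Hx0 : 0 < x) by lra. assert (HxR : R0 <= x) by lra.
    destruct (Hs x Hx0) as [F0 _]. destruct (Hs2 x Hx0) as [G0 _].
    specialize (HV x Hx0). specialize (Hp x Hx0). specialize (HBb x HxR).
    assert (Hup : 0 < u x * phi x) by (apply Rmult_lt_0_compat; lra).
    assert (Hi : 0 < / x ^ 2) by (apply Rinv_0_lt_compat; nra).
    split; [ | split].
    - apply Rmult_le_pos; [apply Rmult_le_pos; lra | lra].
    - auto_derive; [dsolve; nra | ]. drw F0; drw G0. field. lra.
    - replace (x ^ 2 - lam - (x ^ 2 - lam - Rpower (u x) (4 / INR m))) with (Rpower (u x) (4 / INR m)) by ring.
      assert (E1 : x * phi1 x <= - x ^ 2 * phi x).
      { destruct Ho as [_ [_ [_ [Ho _]]]]. specialize (Ho x Hx0). nra. }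
      assert (E2 : x * (u1 x * phi x + u x * phi1 x) <= - x ^ 2 * (u x * phi x)).
      { assert (x * (u1 x * phi x) <= 0) by (assert (u1 x * phi x <= 0) by nra; nra).
        assert (u x * (x * phi1 x) <= u x * (- x ^ 2 * phi x)) by (apply Rmult_le_compat_l; lra). lra. }
      assert (E3 : x * (x * x ^ m * (Rpower (u x) (4 / INR m) * u x * phi x)) <= B * (u x * phi x)).
      { replace (x * (x * x ^ m * (Rpower (u x) (4 / INR m) * u x * phi x)))
          with (x ^ (m + 2) * Rpower (u x) (4 / INR m) * (u x * phi x)) by (rewrite pow_add; ring).
        apply Rmult_le_compat_r; lra. }
      apply Rmult_le_reg_l with x; trivial.
      replace (x * (B * (-2 / x ^ 3 * (u x * phi x) + / x ^ 2 * (u1 x * phi x + u x * phi1 x))))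
        with (B * / x ^ 2 * (- 2 * (u x * phi x) + x * (u1 x * phi x + u x * phi1 x))) by (field; lra).
      assert (B * / x ^ 2 * (- 2 * (u x * phi x) + x * (u1 x * phi x + u x * phi1 x))
        <= B * / x ^ 2 * (- x ^ 2 * (u x * phi x))).
      { apply Rmult_le_compat_l; [apply Rmult_le_pos | ]; lra. }
      replace (B * / x ^ 2 * (- x ^ 2 * (u x * phi x))) with (- (B * (u x * phi x))) in H by (field; lra).
      lra. }
  assert (Hbd : forall x, R0 <= x -> q x <= q R0 * exp (B / R0)).
  { intros x Hx.
    apply Rle_trans with (q x * exp (B / x)).
    - rewrite <- (Rmult_1_r (q x)) at 1. apply Rmult_le_compat_l; [left; apply Hqp; lra | ].
      rewrite <- exp_0. apply exp_le_compat. apply Rdiv_le_0_compat; lra.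
    - apply (derive_decr (fun x => q x * exp (B / x)) (fun x => exp (B / x) * (q1 x - B / x ^ 2 * q x))); trivial.
      + intros y Hy. assert (Hy0 : 0 < y) by lra. assert (D0 := Hq y Hy0).
        destruct (is_derive_opaque _ _ _ D0) as [Q [EQ DQ]].
        apply (is_derive_ext (fun x => Q x * exp (B / x))); [intros t; now rewrite EQ | ].
        auto_derive; [dsolve; lra | ]. drw DQ. rewrite EQ. unfold Rdiv. field. lra.
      + intros y Hy. assert (Hy0 : 0 < y) by lra. assert (HyR : R0 <= y) by lra.
        assert (q1 y <= B / y ^ 2 * q y).
        { unfold q1, q. specialize (HWB y HyR). specialize (Hp y Hy0). specialize (HP y Hy0). specialize (Hqp y Hy0).
          destruct (Hu y Hy0) as [[A1 _] _].
          assert (1 <= y ^ m) by (apply pow_R1_Rle; lra).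
          apply Rle_trans with (B * / y ^ 2 * (u y * phi y) / (y * y ^ m * phi y ^ 2)).
          - apply Rmult_le_compat_r; trivial. left; apply Rinv_0_lt_compat; auto.
          - replace (B * / y ^ 2 * (u y * phi y) / (y * y ^ m * phi y ^ 2))
              with (B / y ^ 2 * (u y / phi y) * / (y * y ^ m)) by (field; repeat split; lra).
            rewrite <- (Rmult_1_r (B / y ^ 2 * (u y / phi y))) at 2.
            apply Rmult_le_compat_l.
            + apply Rmult_le_pos; [apply Rdiv_le_0_compat; nra | left; trivial].
            + rewrite <- Rinv_1. apply Rinv_le_contravar; nra. }
        assert (Hexp := exp_pos (B / y)). nra. }
  destruct (incr_bounded_lim q q1 R0 (q R0 * exp (B / R0))) as [c [Hc Hcle]]; trivial.
  - intros x Hx. apply Hq. lra.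
  - intros x Hx. apply Hq1. lra.
  - assert (Hall : forall r, 0 < r -> q r <= c).
    { intros r Hr. apply (derive_incr_lim_infty q q1); trivial.
      - intros x Hx. apply Hq. lra.
      - intros x Hx. apply Hq1. lra. }
    exists c. split; [ | split; [trivial | ]].
    + apply Rlt_le_trans with (q 1); [apply Hqp; lra | apply Hall; lra].
    + intros r Hr. specialize (Hall r Hr). specialize (Hp r Hr). unfold q in Hall.
      replace (u r) with (u r / phi r * phi r) by (field; lra). apply Rmult_le_compat_r; lra.
Qed.

(* The decay rate [r^(m-2) phi^2] of the comparison function is what makes
   [c - u/phi = O(r^-2)] near 0 and at infinity at once. *)
Lemma gs_ratio_quant (m : nat) (lam b kap c : R) (u u1 phi phi1 : R -> R) :
  (3 <= m)%nat -> 0 < b -> gstate m lam b u u1 -> outer m lam phi phi1 -> lam <= 2 ->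
  0 <= kap -> (forall r, 0 < r -> r ^ 4 * Rpower (u r) (4 / INR m) <= kap) ->
  0 < c -> filterlim (fun r => u r / phi r) (Rbar_locally p_infty) (locally c) ->
  (forall r, 0 < r -> u r <= c * phi r) ->
  forall r, 0 < r ->
    0 <= r * u1 r * phi r - u r * (r * phi1 r) <= kap * c / 2 * phi r ^ 2 / r ^ 2 /\
    c * phi r - u r <= kap * c / 4 * phi r / r ^ 2.
Proof.
  intros Hm Hb H Ho Hl2 Hk0 Hk Hc0 Hc Huc.
  assert (Hl : 0 <= lam < INR m + 2).
  { split; [left; now apply (gs_lam_pos m lam b u u1) | now apply (gs_lam_lt m lam b u u1)]. }
  assert (Hp := fun r => outer_pos _ _ _ _ r Ho).
  assert (HV := gs_potential_le m lam b u u1 H).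
  destruct H as [Hs [Hu [_ [_ Hu0]]]].
  destruct (wronsk_outer m lam _ u u1 phi phi1 Ho Hl Hs HV Hu0) as [HW _].
  assert (Hs2 := proj1 Ho).
  assert (HP : forall x, 0 < x -> 0 < x ^ m) by (intros; apply pow_lt; lra).
  assert (HWB : forall r, 0 < r -> wronsk m u u1 phi phi1 r <= kap * c / 2 * (r ^ m / r ^ 2 * phi r ^ 2)).
  { intros r Hr. apply (wronsk_outer_le m lam (fun r => r ^ 2 - lam - Rpower (u r) (4 / INR m)) u u1 phi phi1
      (fun x => kap * c / 2 * (x ^ m / x ^ 2 * phi x ^ 2))
      (fun x => kap * c / 2 * (x ^ m / x ^ 3 * phi x * ((INR m - 2) * phi x + 2 * (x * phi1 x))))); trivial.
    intros x Hx. assert (Hx0 : 0 < x) by lra.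
    destruct (Hs2 x Hx0) as [G0 _]. specialize (HV x Hx0). specialize (Hp x Hx0). specialize (Hk x Hx0).
    specialize (HP x Hx0). specialize (Huc x Hx0).
    assert (Hi : 0 < / x ^ 3) by (apply Rinv_0_lt_compat, pow_lt; trivial).
    assert (Hi2 : 0 < / x ^ 2) by (apply Rinv_0_lt_compat, pow_lt; trivial).
    assert (Hkc : 0 <= kap * c) by nra.
    split; [ | split].
    - apply Rmult_le_pos; [lra | ]. apply Rmult_le_pos; [ | nra].
      apply Rmult_le_pos; lra.
    - auto_derive; [dsolve; nra | ]. drw G0. rewrite pow_pred by lra. field. lra.
    - replace (x ^ 2 - lam - (x ^ 2 - lam - Rpower (u x) (4 / INR m))) with (Rpower (u x) (4 / INR m)) by ring.
      (* By the upper bound on [phi1] in [outer], the left side is at most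
         [(lam - 4 - 2 x^2) phi x]; here [lam <= 2] is used. *)
      assert (E1 : (INR m - 2) * phi x + 2 * (x * phi1 x) <= - 2 * phi x).
      { destruct Ho as [_ [_ [_ [Ho _]]]]. specialize (Ho x Hx0). nra. }
      assert (E2 : x ^ m / x ^ 3 * phi x * ((INR m - 2) * phi x + 2 * (x * phi1 x))
        <= x ^ m / x ^ 3 * phi x * (- 2 * phi x)).
      { apply Rmult_le_compat_l; trivial. apply Rmult_le_pos; [apply Rmult_le_pos | ]; lra. }
      assert (E3 : x * x ^ m * (Rpower (u x) (4 / INR m) * u x * phi x) <= kap * c * (x ^ m / x ^ 3 * phi x ^ 2)).
      { replace (x * x ^ m * (Rpower (u x) (4 / INR m) * u x * phi x))
          with (x ^ 4 * Rpower (u x) (4 / INR m) * u x * (x ^ m / x ^ 3 * phi x)) by (field; lra).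
        replace (kap * c * (x ^ m / x ^ 3 * phi x ^ 2)) with (kap * (c * phi x) * (x ^ m / x ^ 3 * phi x)) by ring.
        apply Rmult_le_compat_r; [apply Rmult_le_pos; [apply Rmult_le_pos | ]; lra | ].
        apply Rmult_le_compat; try lra. assert (0 < x ^ 4) by (apply pow_lt; lra). nra. }
      apply Rle_trans with (kap * c / 2 * (x ^ m / x ^ 3 * phi x * (- 2 * phi x))).
      + apply Rmult_le_compat_l; lra.
      + lra. }
  intros r Hr. split; [split | ].
  - specialize (HW r Hr). unfold wronsk in HW. specialize (HP r Hr).
    apply Rmult_le_reg_l with (r ^ m); trivial. lra.
  - specialize (HWB r Hr). unfold wronsk in HWB. specialize (HP r Hr).
    apply Rmult_le_reg_l with (r ^ m); trivial. unfold Rdiv in *. lra.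
  - specialize (Hp r Hr) as Hpr.
    assert (c <= u r / phi r + kap * c / 4 / r ^ 2).
    (* The derivative of the correction is minus the bound on that of [u / phi], and the correction
       vanishes at infinity, where [u / phi] tends to [c]. *)
    { apply (derive_decr_lim_infty (fun r => u r / phi r + kap * c / 4 / r ^ 2)
        (fun r => wronsk m u u1 phi phi1 r / (r * r ^ m * phi r ^ 2) - kap * c / 2 / r ^ 3)).
      - intros x Hx. assert (Hx0 : 0 < x) by lra.
        assert (D0 := ratio_derive m _ _ _ _ _ _ x Hs Hs2 Hx0 (Hp x Hx0)).
        destruct (is_derive_opaque _ _ _ D0) as [Q [EQ DQ]].
        apply (is_derive_ext (fun x => Q x + kap * c / 4 / x ^ 2)); [intros t; now rewrite EQ | ].
        auto_derive; [dsolve; nra | ]. drw DQ. field.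
        assert (0 < x ^ m) by auto. specialize (Hp x Hx0). repeat split; lra.
      - intros x Hx. assert (Hx0 : 0 < x) by lra. specialize (HWB x Hx0). specialize (HP x Hx0). specialize (Hp x Hx0).
        assert (wronsk m u u1 phi phi1 x / (x * x ^ m * phi x ^ 2) <= kap * c / 2 / x ^ 3); [ | lra].
        apply Rle_trans with (kap * c / 2 * (x ^ m / x ^ 2 * phi x ^ 2) / (x * x ^ m * phi x ^ 2)).
        + apply Rmult_le_compat_r; trivial. left. apply Rinv_0_lt_compat, Rmult_lt_0_compat; nra.
        + right. field. repeat split; lra.
      - apply flim_val with (c + kap * c / 4 * 0 ^ 2); [ | ring].
        apply flim_plus; [typeclasses eauto | trivial | ].
        apply (flim_ext _ (fun x => kap * c / 4 * (/ x) ^ 2)).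
        + apply (infty_intro _ 0). intros x Hx. field. lra.
        + flims. }
    apply Rmult_le_reg_r with (/ phi r); [now apply Rinv_0_lt_compat | ].
    replace ((c * phi r - u r) * / phi r) with (c - u r / phi r) by (field; lra).
    replace (kap * c / 4 * phi r / r ^ 2 * / phi r) with (kap * c / 4 / r ^ 2) by (field; lra). lra.
Qed.

(** The Wronskian of [phi] and [f] admits the comparison function [(lam/2) r^m phi f]. Hence
    [phi / f] increases, while [r^(- lam/2) phi / f], a quotient of two functions tending to 1,
    decreases; the two bounds on [phi / f] express these monotonicities. *)
Lemma outer_compare (m : nat) (lam : R) (phi phi1 f f1 : R -> R) :
  (3 <= m)%nat -> 0 <= lam <= 4 -> outer m lam phi phi1 -> outer m 0 f f1 ->
  (forall r, 0 < r -> 0 <= r * phi1 r * f r - phi r * (r * f1 r) <= lam / 2 * (phi r * f r)) /\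
  (forall r R, 0 < r -> r <= R ->
     Rpower r (lam / 2) <= phi r / f r <= Rpower R (lam / 2) * exp ((INR m + 2) ^ 2 / R ^ 2)).
Proof.
  intros Hm Hlam Ho Hf.
  assert (HM : 3 <= INR m) by (apply (le_INR 3) in Hm; simpl in Hm; lra).
  assert (Hl : 0 <= lam < INR m + 2) by lra.
  assert (H0 : 0 <= 0 < INR m + 2) by lra.
  assert (Hp := fun r => outer_pos _ _ _ _ r Ho).
  assert (Hn := fun r => outer_neg _ _ _ _ r Ho (proj2 Hl)).
  assert (Hq := fun r => outer_pos _ _ _ _ r Hf).
  assert (HV : forall r, 0 < r -> 0 < phi r /\ phi1 r <= 0 /\ r ^ 2 - lam <= r ^ 2 - 0).
  { intros r Hr. specialize (Hn r Hr). repeat split; auto; lra. }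
  assert (Hlim := outer_lim m lam phi phi1 Ho Hl).
  assert (Hs := proj1 Ho). assert (Hsf := proj1 Hf).
  destruct (wronsk_outer m 0 _ phi phi1 f f1 Hf H0 Hs HV Hlim) as [HW _].
  assert (HP : forall x, 0 < x -> 0 < x ^ m) by (intros; apply pow_lt; lra).
  assert (HWB : forall r, 0 < r -> wronsk m phi phi1 f f1 r <= lam / 2 * (r ^ m * (phi r * f r))).
  { intros r Hr. apply (wronsk_outer_le m 0 (fun r => r ^ 2 - lam) phi phi1 f f1
      (fun x => lam / 2 * (x ^ m * (phi x * f x)))
      (fun x => lam / 2 * (x ^ m / x * (INR m * (phi x * f x) + x * phi1 x * f x + phi x * (x * f1 x))))); trivial.
    intros x Hx. assert (Hx0 : 0 < x) by lra.
    destruct (Hs x Hx0) as [F0 _]. destruct (Hsf x Hx0) as [G0 _].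
    specialize (HP x Hx0). specialize (Hp x Hx0). specialize (Hq x Hx0).
    assert (Hpf : 0 < phi x * f x) by now apply Rmult_lt_0_compat.
    split; [ | split].
    - apply Rmult_le_pos; [lra | nra].
    - auto_derive; [dsolve | ]. drw F0; drw G0. rewrite pow_pred by lra. field. lra.
    - destruct Ho as [_ [_ [_ [Ho _]]]]. specialize (Ho x Hx0).
      destruct Hf as [_ [_ [_ [Hf _]]]]. specialize (Hf x Hx0).
      assert (E1 : INR m * (phi x * f x) + x * phi1 x * f x + phi x * (x * f1 x) <= - (2 * x ^ 2) * (phi x * f x)).
      { assert (x * phi1 x * f x <= - (x ^ 2 + (INR m + 2 - lam) / 2) * phi x * f x) by (apply Rmult_le_compat_r; lra).
        assert (phi x * (x * f1 x) <= phi x * (- (x ^ 2 + (INR m + 2 - 0) / 2) * f x)) by (apply Rmult_le_compat_l; lra).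
        assert (0 <= (4 - lam) / 2 * (phi x * f x)) by (apply Rmult_le_pos; lra). lra. }
      apply Rle_trans with (lam / 2 * (x ^ m / x * (- (2 * x ^ 2) * (phi x * f x)))).
      + apply Rmult_le_compat_l; [lra | ]. apply Rmult_le_compat_l; trivial.
        apply Rdiv_le_0_compat; lra.
      + right. field. lra. }
  assert (Hw : forall r, wronsk m phi phi1 f f1 r = r ^ m * (r * phi1 r * f r - phi r * (r * f1 r)))
    by (intros; unfold wronsk; ring).
  assert (H1 : forall r, 0 < r -> 0 <= r * phi1 r * f r - phi r * (r * f1 r) <= lam / 2 * (phi r * f r)).
  { intros r Hr. specialize (HW r Hr). specialize (HWB r Hr). specialize (HP r Hr).
    rewrite Hw in HW, HWB. split; apply Rmult_le_reg_l with (r ^ m); trivial; lra. }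
  split; trivial.
  set (E := fun r => exp (r ^ 2 / 2) * Rpower r ((INR m + 2 - lam) / 2) * phi r).
  set (E0 := fun r => exp (r ^ 2 / 2) * Rpower r ((INR m + 2 - 0) / 2) * f r).
  assert (HT : forall r, 0 < r -> phi r / f r = Rpower r (lam / 2) * (E r / E0 r)).
  { intros r Hr. specialize (Hp r Hr). specialize (Hq r Hr). unfold E, E0.
    replace ((INR m + 2 - 0) / 2) with (lam / 2 + (INR m + 2 - lam) / 2) by field.
    rewrite Rpower_plus. assert (Ea := Rpower_pos r (lam / 2)). assert (Eb := Rpower_pos r ((INR m + 2 - lam) / 2)).
    assert (Ec := exp_pos (r ^ 2 / 2)). field. repeat split; lra. }
  assert (HE : forall r, 0 < r -> 1 <= E r) by apply Ho.
  assert (HE0 : forall r, 0 < r -> 1 <= E0 r) by apply Hf.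
  intros r R1 Hr HrR. split.
  - assert (1 <= E r / E0 r).
    { apply (derive_decr_lim_infty (fun r => E r / E0 r)
        (fun r => Rpower r (- (lam / 2)) / r / f r ^ 2 * (r * phi1 r * f r - phi r * (r * f1 r) - lam / 2 * (phi r * f r)))).
      - intros x Hx. assert (Hx0 : 0 < x) by lra.
        destruct (Hs x Hx0) as [F0 _]. destruct (Hsf x Hx0) as [G0 _]. specialize (Hq x Hx0) as Hqx.
        assert (HR : is_derive (fun x => Rpower x (- (lam / 2))) x (- (lam / 2) * Rpower x (- (lam / 2)) * 1 / x)).
        { apply (is_derive_Rpower (fun x => x) x 1); trivial. auto_derive; trivial. }
        destruct (is_derive_opaque _ _ _ HR) as [Pw [EP DP]].
        apply (is_derive_ext_loc (fun x => Pw x * (phi x / f x))).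
        + exists (mkposreal x Hx0). intros t Ht. change (Rabs (t - x) < x) in Ht. apply Rabs_def2 in Ht.
          assert (Heq : Pw t * (phi t / f t) = E t / E0 t); [ | exact Heq].
          rewrite EP, HT by lra. rewrite <- Rmult_assoc, <- Rpower_plus.
          replace (- (lam / 2) + lam / 2) with 0 by ring. rewrite Rpower_O by lra. ring.
        + auto_derive; [dsolve; lra | ]. drw F0; drw G0; drw DP. rewrite EP. field. lra.
      - intros x Hx. assert (Hx0 : 0 < x) by lra. destruct (H1 x Hx0) as [_ H2]. specialize (Hq x Hx0).
        assert (0 <= Rpower x (- (lam / 2)) / x / f x ^ 2).
        { apply Rdiv_le_0_compat; [ | nra]. apply Rdiv_le_0_compat; [ | lra]. left; apply Rpower_pos. }
        nra.
      - apply flim_val with (1 * / 1); [ | field].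
        apply flim_mult; [typeclasses eauto | apply Ho | ]. apply flim_inv; [typeclasses eauto | lra | apply Hf]. }
    rewrite HT by trivial. assert (Ea := Rpower_pos r (lam / 2)). nra.
  - apply Rle_trans with (phi R1 / f R1).
    + eapply (derive_incr (fun r => phi r / f r)); trivial.
      * intros x Hx. apply (ratio_derive m _ _ _ _ _ _ x Hs Hsf); [lra | apply Hq; lra].
      * intros x Hx. assert (Hx0 : 0 < x) by lra. specialize (HW x Hx0). specialize (HP x Hx0). specialize (Hq x Hx0).
        apply Rdiv_le_0_compat; trivial. apply Rmult_lt_0_compat; nra.
    + assert (HR0 : 0 < R1) by lra. rewrite HT by trivial.
      apply Rmult_le_compat_l; [left; apply Rpower_pos | ].
      assert (HR1 := HE0 R1 HR0). assert (HR2 := HE R1 HR0).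
      destruct Ho as [_ [_ [_ [_ Ho]]]]. destruct (Ho (proj2 Hlam) R1 HR0) as [Ho1 _]. fold (E R1) in Ho1.
      apply Rle_trans with (E R1); trivial.
      apply Rmult_le_reg_r with (E0 R1); [lra | ]. unfold Rdiv. rewrite Rmult_assoc, Rinv_l by lra. nra.
Qed.

(** The Tricomi function is specified for each [lam] separately, so its continuity at [lam = 0] has
    to be proved. In [outer_compare] one takes first [R] large, to bring the exponential near 1,
    then [lam] small, for the two powers. *)
Lemma outer_close (m : nat) (f f1 : R -> R) (r eps : R) :
  (3 <= m)%nat -> outer m 0 f f1 -> 0 < r -> 0 < eps ->
  exists l0, 0 < l0 /\ forall lam phi phi1, 0 <= lam <= l0 -> outer m lam phi phi1 ->
    Rabs (phi r / f r - 1) <= eps.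
Proof.
  intros Hm Hf Hr He.
  assert (HA : Rbar_locally p_infty (fun R1 => Rabs (exp ((INR m + 2) ^ 2 / R1 ^ 2) - exp 0) < eps / 2)).
  { apply (flim_eps _ (fun R1 => exp ((INR m + 2) ^ 2 / R1 ^ 2))); [ | lra].
    apply (flim_cont _ exp); [apply continuity_pt_filterlim, derivable_continuous_pt, derivable_pt_exp | ].
    apply flim_val with ((INR m + 2) ^ 2 * 0 ^ 2); [ | ring].
    apply (flim_ext _ (fun x => (INR m + 2) ^ 2 * (/ x) ^ 2)); [ | flims].
    apply (infty_intro _ 0). intros x Hx. field. lra. }
  destruct (infty_elim _ (r + 1) HA) as [R1 [HR1 HA']].
  specialize (HA' R1 (Rle_refl _)). rewrite exp_0 in HA'. apply Rabs_def2 in HA'.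
  set (Ex := exp ((INR m + 2) ^ 2 / R1 ^ 2)) in *.
  assert (Hc : forall x, 0 < x -> filterlim (fun l => Rpower x (l / 2)) (at_right 0) (locally 1)).
  { intros x Hx. apply flim_val with (Rpower x (0 / 2)).
    - apply (cont_right (fun l => Rpower x (l / 2))). apply (ex_derive_continuous (fun l => Rpower x (l / 2))).
      unfold Rpower. auto_derive. trivial.
    - unfold Rdiv. rewrite Rmult_0_l. now apply Rpower_O. }
  assert (HcR := Hc R1). assert (Hcr := Hc r Hr). assert (HR0 : 0 < R1) by lra. specialize (HcR HR0).
  assert (HExp : 0 < Ex) by apply exp_pos.
  apply flim_eps with (eps := eps / 2 / Ex) in HcR; [ | typeclasses eauto | apply Rdiv_lt_0_compat; lra].
  apply flim_eps with (eps := eps) in Hcr; [ | typeclasses eauto | trivial].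
  destruct (at_right_0_elim _ (filter_and _ _ HcR Hcr)) as [a [Ha Hal]].
  exists (Rmin (a / 2) 4). split; [apply Rmin_glb_lt; lra | ].
  intros lam phi phi1 Hlam Ho.
  assert (Hla := Rmin_l (a / 2) 4). assert (Hl4 := Rmin_r (a / 2) 4).
  assert (Hb : 0 <= lam <= 4) by lra.
  destruct (outer_compare m lam phi phi1 f f1 Hm Hb Ho Hf) as [_ HT].
  assert (HrR : r <= R1) by lra.
  destruct (HT r R1 Hr HrR) as [T1 T2]. fold Ex in T2.
  destruct (Req_dec lam 0) as [-> | Hnz].
  - replace (0 / 2) with 0 in * by field. rewrite Rpower_O in T1, T2 by lra. apply Rabs_le. lra.
  - destruct (Hal lam) as [B1 B2]; [lra | ]. apply Rabs_def2 in B1. apply Rabs_def2 in B2.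
    apply Rabs_le. split; [lra | ].
    assert (Rpower R1 (lam / 2) * Ex <= (1 + eps / 2 / Ex) * Ex) by (apply Rmult_le_compat_r; lra).
    replace ((1 + eps / 2 / Ex) * Ex) with (Ex + eps / 2) in H by (field; lra). lra.
Qed.

(** * Comparison with the bubble *)

(* The weight [L s^2/(1+s^2)^2] on [w^2] lets the damping [- m w] in [s w' = g - m w]
   absorb the coupling term, so that [g^2 + weight * w^2] obeys a scalar Gronwall inequality
   with the integrable rate [s/(1+s^2)^2]. *)
Lemma radial_gronwall (m : nat) (L c1 eps S : R) (w g f : R -> R) :
  (3 <= m)%nat -> 0 < L -> 0 <= c1 -> 0 < eps ->
  (forall s, 0 < s <= S -> is_derive w s ((g s - INR m * w s) / s) /\
     is_derive g s (s * f s) /\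
     Rabs (f s) <= L / (1 + s ^ 2) ^ 2 * Rabs (w s) + c1 * eps) ->
  filterlim w (at_right 0) (locally 0) -> filterlim g (at_right 0) (locally 0) ->
  forall s, 0 < s <= S -> Rabs (w s) <= exp (L / 4) * eps * (1 + c1 * s ^ 2).
Proof.
  intros Hm HL Hc1 He Hd Hw0 Hg0.
  assert (HM : 3 <= INR m) by (apply (le_INR 3) in Hm; simpl in Hm; lra).
  (* The term [eps ^ 2] keeps [V] positive, so that [sqrt V] is differentiable. *)
  set (V := fun s => g s ^ 2 + L * s ^ 2 / (1 + s ^ 2) ^ 2 * w s ^ 2 + eps ^ 2).
  set (V1 := fun s => 2 * g s * (s * f s) + L * (2 * s / (1 + s ^ 2) ^ 2 - 4 * s ^ 3 / (1 + s ^ 2) ^ 3) * w s ^ 2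
     + L * s ^ 2 / (1 + s ^ 2) ^ 2 * (2 * w s * ((g s - INR m * w s) / s))).
  assert (H1s : forall s, 0 < 1 + s ^ 2) by (intros s; generalize (pow2_ge_0 s); lra).
  assert (HV : forall s, 0 < s <= S -> is_derive V s (V1 s)).
  { intros s Hs. destruct (Hd s Hs) as [D0 [D1 _]]. unfold V, V1.
    auto_derive; [dsolve; specialize (H1s s); nra | ]. drw D0; drw D1. field.
    specialize (H1s s). lra. }
  assert (Hwgt : forall s, 0 <= L * s ^ 2 / (1 + s ^ 2) ^ 2 * w s ^ 2).
  { intros s. apply Rmult_le_pos; [ | apply pow2_ge_0].
    apply Rdiv_le_0_compat; [ | apply pow_lt, H1s]. apply Rmult_le_pos; [lra | apply pow2_ge_0]. }
  assert (HVp : forall s, 0 < V s).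
  { intros s. unfold V. specialize (Hwgt s). generalize (pow2_ge_0 (g s)). nra. }
  assert (HVg : forall s, Rabs (g s) <= sqrt (V s)).
  { intros s. rewrite <- sqrt_Rsqr_abs. apply sqrt_le_1_alt. unfold V, Rsqr. specialize (Hwgt s). nra. }
  assert (HV1 : forall s, 0 < s <= S -> V1 s <= L * s / (1 + s ^ 2) ^ 2 * V s + 2 * c1 * eps * s * Rabs (g s)).
  { intros s Hs. destruct (Hd s Hs) as [_ [_ Hf]]. specialize (H1s s).
    set (k := / (1 + s ^ 2) ^ 2). assert (Hk : 0 < k) by (apply Rinv_0_lt_compat, pow_lt; lra).
    assert (E1 : 2 * g s * (s * f s) <= 2 * s * (Rabs (g s) * (L * k * Rabs (w s) + c1 * eps))).
    { replace (2 * g s * (s * f s)) with (2 * s * (g s * f s)) by ring.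
      apply Rmult_le_compat_l; [lra | ].
      apply Rle_trans with (1 := Rle_abs _). rewrite Rabs_mult.
      apply Rmult_le_compat_l; [apply Rabs_pos | exact Hf]. }
    assert (E2 : L * (2 * s / (1 + s ^ 2) ^ 2 - 4 * s ^ 3 / (1 + s ^ 2) ^ 3) * w s ^ 2 <= L * (2 * s * k) * w s ^ 2).
    { apply Rmult_le_compat_r; [apply pow2_ge_0 | ]. apply Rmult_le_compat_l; [lra | ].
      assert (0 <= 4 * s ^ 3 / (1 + s ^ 2) ^ 3).
      { apply Rdiv_le_0_compat; [ | apply pow_lt; lra]. assert (0 < s ^ 3) by (apply pow_lt; lra). lra. }
      fold k in H. unfold Rdiv at 1. fold k. lra. }
    assert (E3 : L * s ^ 2 / (1 + s ^ 2) ^ 2 * (2 * w s * ((g s - INR m * w s) / s))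
      <= L * k * s * (2 * (Rabs (g s) * Rabs (w s)) - 2 * INR m * w s ^ 2)).
    { replace (L * s ^ 2 / (1 + s ^ 2) ^ 2 * (2 * w s * ((g s - INR m * w s) / s)))
        with (L * k * s * (2 * (g s * w s) - 2 * INR m * w s ^ 2)) by (unfold k; field; lra).
      apply Rmult_le_compat_l; [apply Rmult_le_pos; nra | ].
      assert (g s * w s <= Rabs (g s) * Rabs (w s)) by (rewrite <- Rabs_mult; apply Rle_abs). lra. }
    assert (E4 : w s ^ 2 = Rabs (w s) ^ 2) by (symmetry; apply pow2_abs).
    assert (E5 : g s ^ 2 = Rabs (g s) ^ 2) by (symmetry; apply pow2_abs).
    assert (E6 : L * k * s * g s ^ 2 <= L * k * s * V s).
    { apply Rmult_le_compat_l; [apply Rmult_le_pos; nra | ]. unfold V. specialize (Hwgt s).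
      generalize (pow2_ge_0 eps). lra. }
    replace (L * s / (1 + s ^ 2) ^ 2 * V s) with (L * k * s * V s) by (unfold k; field; lra).
    rewrite E4 in E2, E3. rewrite E5 in E6. unfold V1. rewrite E4.
    set (a := Rabs (g s)) in *. set (x := Rabs (w s)) in *.
    assert (E7 : 0 <= L * k * s) by (apply Rmult_le_pos; nra).
    (* The absorption: with [m >= 3] the claim reduces to [(a - 2 x)^2 >= 0]. *)
    assert (E8 : L * k * s * (4 * (a * x) + 2 * x ^ 2 - 2 * INR m * x ^ 2) <= L * k * s * a ^ 2).
    { apply Rmult_le_compat_l; trivial. assert (0 <= x ^ 2) by apply pow2_ge_0.
      assert (3 * x ^ 2 <= INR m * x ^ 2) by (apply Rmult_le_compat_r; lra).
      assert (0 <= (a - 2 * x) ^ 2) by apply pow2_ge_0. nra. }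
    lra. }
  (* The exponent is minus the integral of [(L/2) t/(1+t^2)^2] from 0 to [s]; this integral is at
     most [L/4] whatever [S] is. *)
  assert (HR : forall s, 0 < s <= S -> sqrt (V s) * exp (- (L / 4 * (1 - / (1 + s ^ 2)))) - c1 * eps * s ^ 2 / 2 <= eps).
  { intros s Hs. apply (derive_decr_lim0
      (fun s => sqrt (V s) * exp (- (L / 4 * (1 - / (1 + s ^ 2)))) - c1 * eps * s ^ 2 / 2)
      (fun s => exp (- (L / 4 * (1 - / (1 + s ^ 2)))) / (2 * sqrt (V s)) * (V1 s - L * s / (1 + s ^ 2) ^ 2 * V s) - c1 * eps * s)); [lra | | | ].
    - intros x Hx. assert (Hx' : 0 < x <= S) by lra. assert (DV := HV x Hx').
      destruct (is_derive_opaque _ _ _ DV) as [Q [EQ DQ]].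
      apply (is_derive_ext (fun s => sqrt (Q s) * exp (- (L / 4 * (1 - / (1 + s ^ 2)))) - c1 * eps * s ^ 2 / 2)).
      { intros t. now rewrite EQ. }
      specialize (H1s x) as H1x. specialize (HVp x).
      auto_derive; [dsolve; rewrite ?EQ; lra | ]. drw DQ. rewrite EQ.
      assert (HsV : sqrt (V x) * sqrt (V x) = V x) by (apply sqrt_sqrt; lra).
      assert (0 < sqrt (V x)) by now apply sqrt_lt_R0.
      replace (x * (x * 1)) with (x ^ 2) by ring. set (ex := exp (- (L / 4 * (1 + - / (1 + x ^ 2))))).
      replace (exp (- (L / 4 * (1 - / (1 + x ^ 2))))) with ex by reflexivity.
      set (q := sqrt (V x)) in *. rewrite <- HsV. field. lra.
    - intros x Hx. assert (Hx' : 0 < x <= S) by lra. specialize (HV1 x Hx'). specialize (HVp x).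
      assert (Hq : 0 < sqrt (V x)) by now apply sqrt_lt_R0.
      specialize (HVg x). set (q := sqrt (V x)) in *.
      set (ex := exp (- (L / 4 * (1 - / (1 + x ^ 2))))).
      assert (Hex : 0 < ex) by apply exp_pos.
      assert (Hex1 : ex <= 1).
      { apply Rle_trans with (exp 0); [ | rewrite exp_0; lra]. apply exp_le_compat. specialize (H1s x).
        assert (/ (1 + x ^ 2) <= 1).
        { rewrite <- Rinv_1. apply Rinv_le_contravar; generalize (pow2_ge_0 x); lra. }
        nra. }
      assert (Hce : 0 <= 2 * c1 * eps * x) by (repeat apply Rmult_le_pos; lra).
      assert (V1 x - L * x / (1 + x ^ 2) ^ 2 * V x <= 2 * c1 * eps * x * q) by nra.
      assert (ex / (2 * q) * (V1 x - L * x / (1 + x ^ 2) ^ 2 * V x) <= ex / (2 * q) * (2 * c1 * eps * x * q)).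
      { apply Rmult_le_compat_l; trivial. apply Rdiv_le_0_compat; lra. }
      replace (ex / (2 * q) * (2 * c1 * eps * x * q)) with (ex * (c1 * eps * x)) in H0 by (field; lra).
      assert (ex * (c1 * eps * x) <= c1 * eps * x) by nra. lra.
    - apply flim_val with (sqrt (0 ^ 2 + L * 0 ^ 2 * / (1 + 0 ^ 2) ^ 2 * 0 ^ 2 + eps ^ 2) * exp (- (L / 4 * (1 - / (1 + 0 ^ 2)))) - c1 * eps * 0 ^ 2 * / 2).
      + assert (Hi : filterlim (fun s => / (1 + s ^ 2)) (at_right 0) (locally (/ (1 + 0 ^ 2)))).
        { apply flim_inv; [typeclasses eauto | lra | flims]. }
        apply flim_minus; [typeclasses eauto | | flims].
        apply flim_mult; [typeclasses eauto | | ].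
        * apply (flim_cont _ sqrt); [apply continuous_sqrt | ]. unfold V, Rdiv.
          assert (Hi2 : filterlim (fun s => / (1 + s ^ 2) ^ 2) (at_right 0) (locally (/ (1 + 0 ^ 2) ^ 2))).
          { apply flim_inv; [typeclasses eauto | nra | flims]. }
          flims.
        * apply (flim_cont _ exp); [apply continuity_pt_filterlim, derivable_continuous_pt, derivable_pt_exp | ].
          flims.
      + replace (0 ^ 2 + L * 0 ^ 2 * / (1 + 0 ^ 2) ^ 2 * 0 ^ 2 + eps ^ 2) with (eps ^ 2) by ring.
        rewrite sqrt_pow2 by lra.
        replace (- (L / 4 * (1 - / (1 + 0 ^ 2)))) with 0 by field. rewrite exp_0. ring. }
  set (A := exp (L / 4) * eps).
  assert (HA : 0 < A) by (apply Rmult_lt_0_compat; [apply exp_pos | trivial]).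
  assert (Hg : forall s, 0 < s <= S -> Rabs (g s) <= A * (1 + c1 * s ^ 2 / 2)).
  { intros s Hs. apply Rle_trans with (1 := HVg s). specialize (HR s Hs).
    assert (Hex : exp (- (L / 4 * (1 - / (1 + s ^ 2)))) * exp (L / 4 * (1 - / (1 + s ^ 2))) = 1).
    { rewrite <- exp_plus, Rplus_opp_l. apply exp_0. }
    assert (Hle : exp (L / 4 * (1 - / (1 + s ^ 2))) <= exp (L / 4)).
    { apply exp_le_compat. assert (0 < / (1 + s ^ 2)) by apply Rinv_0_lt_compat, H1s. nra. }
    set (ex := exp (- (L / 4 * (1 - / (1 + s ^ 2))))) in *. set (ey := exp (L / 4 * (1 - / (1 + s ^ 2)))) in *.
    assert (0 < ey) by apply exp_pos.
    replace (sqrt (V s)) with (sqrt (V s) * ex * ey) by (rewrite Rmult_assoc, Hex; ring).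
    assert (0 <= c1 * eps * s ^ 2 / 2) by (apply Rdiv_le_0_compat; [apply Rmult_le_pos; [nra | apply pow2_ge_0] | lra]).
    apply Rle_trans with ((eps + c1 * eps * s ^ 2 / 2) * ey); [apply Rmult_le_compat_r; lra | ].
    unfold A. replace (exp (L / 4) * eps * (1 + c1 * s ^ 2 / 2)) with ((eps + c1 * eps * s ^ 2 / 2) * exp (L / 4)) by (field).
    apply Rmult_le_compat_l; lra. }
  intros s Hs.
  assert (HP : forall x, 0 < x -> 0 < x ^ m) by (intros; apply pow_lt; lra).
  (* [w] is recovered from [g] through [(s^m w)' = s^(m-1) g], for each sign in turn. *)
  assert (Hsg : forall sg, (sg = 1 \/ sg = -1) -> sg * w s <= A * (1 + c1 * s ^ 2)).
  { intros sg Hsg0. apply Rmult_le_reg_l with (s ^ m); [apply HP; lra | ].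
    assert (s ^ m * (sg * w s) - s ^ m * (A * (1 / INR m + c1 * s ^ 2 / (2 * (INR m + 2)))) <= 0).
    { apply (derive_decr_lim0 (fun s => s ^ m * (sg * w s) - s ^ m * (A * (1 / INR m + c1 * s ^ 2 / (2 * (INR m + 2)))))
       (fun s => s ^ m / s * (sg * g s - A * (1 + c1 * s ^ 2 / 2)))); [lra | | | ].
      - intros x Hx. assert (Hx' : 0 < x <= S) by lra. destruct (Hd x Hx') as [D0 _].
        auto_derive; [dsolve; lra | ]. drw D0. rewrite pow_pred by lra. field. lra.
      - intros x Hx. assert (Hx' : 0 < x <= S) by lra. assert (Hx0 : 0 < x) by lra. specialize (Hg x Hx'). specialize (HP x Hx0).
        assert (sg * g x <= Rabs (g x)).
        { destruct Hsg0 as [-> | ->]; [rewrite Rmult_1_l; apply Rle_abs | ].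
          replace (-1 * g x) with (- g x) by ring. rewrite <- Rabs_Ropp. apply Rle_abs. }
        assert (0 < x ^ m / x) by (apply Rdiv_lt_0_compat; lra). nra.
      - apply flim_val with (0 ^ m * (sg * 0) - 0 ^ m * (A * (1 / INR m + c1 * 0 ^ 2 * / (2 * (INR m + 2))))).
        + unfold Rdiv. flims.
        + replace (0 ^ m) with 0; [ring | ]. symmetry. apply pow_ne_zero. lia. }
    apply Rle_trans with (s ^ m * (A * (1 / INR m + c1 * s ^ 2 / (2 * (INR m + 2))))); [lra | ].
    apply Rmult_le_compat_l; [left; apply HP; lra | ]. apply Rmult_le_compat_l; [lra | ].
    apply Rplus_le_compat.
    - unfold Rdiv. rewrite Rmult_1_l. rewrite <- Rinv_1. apply Rinv_le_contravar; lra.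
    - assert (0 <= c1 * s ^ 2) by (apply Rmult_le_pos; [lra | apply pow2_ge_0]).
      apply Rle_trans with (c1 * s ^ 2 * / 1); [ | rewrite Rinv_1; lra]. apply Rmult_le_compat_l; trivial.
      apply Rinv_le_contravar; lra. }
  fold A. apply Rabs_le. split.
  - specialize (Hsg (-1) (or_intror eq_refl)). lra.
  - specialize (Hsg 1 (or_introl eq_refl)). lra.
Qed.

(** * The algebraic soliton and the rescaled ground state *)

Definition alc (m : nat) : R := / (INR m * (INR m + 2)).

(** [alc m] is [alpha_p] at [p = 2/m], so this is the soliton [U_1]. *)
Definition bubble (m : nat) (s : R) : R := Rpower (1 + alc m * s ^ 2) (- (INR m / 2)).

Definition bubble1 (m : nat) (s : R) : R :=
  - INR m * alc m * s / (1 + alc m * s ^ 2) * bubble m s.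

Lemma INR_ge3 (m : nat) : (3 <= m)%nat -> 3 <= INR m.
Proof. intros Hm. apply (le_INR 3) in Hm. simpl in Hm. lra. Qed.

Lemma alc_pos (m : nat) : (3 <= m)%nat -> 0 < alc m.
Proof. intros Hm. apply INR_ge3 in Hm. apply Rinv_0_lt_compat. nra. Qed.

Lemma bubble_den (m : nat) (s : R) : (3 <= m)%nat -> 1 <= 1 + alc m * s ^ 2.
Proof. intros Hm. assert (H := alc_pos m Hm). generalize (pow2_ge_0 s). nra. Qed.

Lemma bubble_pos (m : nat) (s : R) : 0 < bubble m s.
Proof. apply Rpower_pos. Qed.

Lemma bubble_pow (m : nat) (s : R) :
  (3 <= m)%nat -> Rpower (bubble m s) (4 / INR m) = / (1 + alc m * s ^ 2) ^ 2.
Proof.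
  intros Hm. assert (HM := INR_ge3 m Hm). assert (H1 := bubble_den m s Hm).
  unfold bubble. rewrite Rpower_mult.
  replace (- (INR m / 2) * (4 / INR m)) with (- INR 2) by (simpl; field; lra).
  rewrite Rpower_Ropp, Rpower_pow by lra. trivial.
Qed.

Lemma bubble_le1 (m : nat) (s : R) : (3 <= m)%nat -> bubble m s <= 1.
Proof.
  intros Hm. assert (HM := INR_ge3 m Hm). assert (H1 := bubble_den m s Hm).
  unfold bubble. rewrite Rpower_Ropp. rewrite <- Rinv_1 at 2. apply Rinv_le_contravar; [lra | ].
  apply Rle_trans with (Rpower (1 + alc m * s ^ 2) 0); [rewrite Rpower_O; lra | apply Rle_Rpower; lra].
Qed.

Lemma bubble_derive (m : nat) (s : R) :
  (3 <= m)%nat -> is_derive (bubble m) s (bubble1 m s).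
Proof.
  intros Hm. assert (H1 := bubble_den m s Hm).
  unfold bubble1, bubble. eapply is_derive_val.
  - apply (is_derive_Rpower (fun s => 1 + alc m * s ^ 2) s (2 * alc m * s)); [lra | ].
    auto_derive; trivial. ring.
  - field. lra.
Qed.

Lemma bubble_radsol (m : nat) :
  (3 <= m)%nat -> radsol m (fun s => - Rpower (bubble m s) (4 / INR m)) (bubble m) (bubble1 m).
Proof.
  intros Hm r Hr. assert (HM := INR_ge3 m Hm). assert (H1 := bubble_den m r Hm).
  assert (D0 := bubble_derive m r Hm). split; trivial.
  destruct (is_derive_opaque _ _ _ D0) as [q [Eq Dq]].
  unfold bubble1.
  apply (is_derive_ext (fun s => - INR m * alc m * s / (1 + alc m * s ^ 2) * q s)).
  { intros t. now rewrite Eq. }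
  auto_derive; [dsolve; simpl in H1; lra | ]. drw Dq. rewrite bubble_pow by trivial.
  rewrite !Eq. unfold bubble1.
  (* The Laplacian of the bubble produces the factor [m (m+2) alc], and [alc] is the value that
     makes it 1. *)
  assert (Ha : INR m * (INR m + 2) * alc m = 1) by (unfold alc; field; lra).
  set (a := alc m) in *. set (M := INR m) in *.
  replace (/ (1 + a * r ^ 2) ^ 2) with (M * (M + 2) * a / (1 + a * r ^ 2) ^ 2) by (rewrite Ha; field; simpl in *; lra).
  field. simpl in *; lra.
Qed.

Lemma bubble_lim0 (m : nat) :
  (3 <= m)%nat -> filterlim (bubble m) (at_right 0) (locally 1) /\
    filterlim (bubble1 m) (at_right 0) (locally 0).
Proof.
  intros Hm.
  assert (H0 : filterlim (bubble m) (at_right 0) (locally 1)).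
  { apply flim_val with (bubble m 0).
    - apply cont_right, (is_derive_cont _ _ _ (bubble_derive m 0 Hm)).
    - unfold bubble, Rpower. replace (1 + alc m * 0 ^ 2) with 1 by ring.
      rewrite ln_1, Rmult_0_r. apply exp_0. }
  split; trivial. unfold bubble1.
  apply flim_val with (- INR m * alc m * 0 * / (1 + alc m * 0 ^ 2) * 1); [ | ring].
  assert (filterlim (fun s => / (1 + alc m * s ^ 2)) (at_right 0) (locally (/ (1 + alc m * 0 ^ 2)))).
  { apply flim_inv; [typeclasses eauto | generalize (bubble_den m 0 Hm); lra | flims]. }
  unfold Rdiv. flims.
Qed.

(** The coefficient of [s^(-m)] in the tail of the bubble, with which the exterior solution has to
    match. *)
Definition bubble_lim (m : nat) : R := Rpower (alc m) (- (INR m / 2)).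

Lemma bubble_tail_eq (m : nat) (s : R) :
  (3 <= m)%nat -> 0 < s -> s ^ m * bubble m s = Rpower (alc m + / s ^ 2) (- (INR m / 2)).
Proof.
  intros Hm Hs. assert (Ha := alc_pos m Hm).
  assert (Hi : 0 < / s ^ 2) by (apply Rinv_0_lt_compat; nra).
  unfold bubble. replace (1 + alc m * s ^ 2) with (s ^ 2 * (alc m + / s ^ 2)) by (field; lra).
  rewrite <- Rpower_mult_distr by nra. rewrite <- Rmult_assoc.
  replace (s ^ m * Rpower (s ^ 2) (- (INR m / 2))) with 1; [ring | ].
  rewrite <- (Rpower_pow 2) by trivial. rewrite Rpower_mult, <- (Rpower_pow m) by trivial.
  rewrite <- Rpower_plus. symmetry. replace (INR m + INR 2 * - (INR m / 2)) with 0 by (simpl; field).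
  now apply Rpower_O.
Qed.

Lemma bubble_tail_le (m : nat) (s : R) :
  (3 <= m)%nat -> 0 < s -> s ^ m * bubble m s <= bubble_lim m.
Proof.
  intros Hm Hs. assert (Ha := alc_pos m Hm). assert (HM := INR_ge3 m Hm).
  assert (Hi : 0 < / s ^ 2) by (apply Rinv_0_lt_compat; nra).
  rewrite bubble_tail_eq by trivial. unfold bubble_lim. rewrite !Rpower_Ropp.
  apply Rinv_le_contravar; [apply Rpower_pos | ]. apply Rle_Rpower_l; lra.
Qed.

Lemma bubble_tail_lim (m : nat) :
  (3 <= m)%nat ->
  filterlim (fun s => s ^ m * bubble m s) (Rbar_locally p_infty) (locally (bubble_lim m)).
Proof.
  intros Hm. assert (Ha := alc_pos m Hm).
  apply (flim_ext _ (fun s => Rpower (alc m + (/ s) ^ 2) (- (INR m / 2)))).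
  - apply (infty_intro _ 0). intros s Hs. rewrite bubble_tail_eq by trivial.
    f_equal. field. lra.
  - apply (flim_cont _ (fun x => Rpower x (- (INR m / 2)))).
    + apply (ex_derive_continuous (fun x => Rpower x (- (INR m / 2)))).
      eexists. apply (is_derive_Rpower (fun x => x) (alc m) 1); trivial. auto_derive; trivial.
    + apply flim_val with (alc m + 0 ^ 2); [flims | ring].
Qed.

Lemma power_diff_le (sg K x y : R) :
  0 < sg -> 0 < x -> 0 < y -> Rpower x sg <= K -> Rpower y sg <= K ->
  Rabs (Rpower x sg * x - Rpower y sg * y) <= (sg + 1) * K * Rabs (x - y).
Proof.
  intros Hsg.
  assert (Hw : forall x y, 0 < x -> x <= y -> Rpower y sg <= K ->
    0 <= Rpower y sg * y - Rpower x sg * x <= (sg + 1) * K * (y - x)).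
  { clear x y. intros x y Hx Hxy HK. split.
    - assert (Rpower x sg <= Rpower y sg) by (apply Rle_Rpower_l; lra).
      assert (Hp := Rpower_pos x sg). nra.
    - replace ((sg + 1) * K * (y - x)) with ((sg + 1) * K * y - (sg + 1) * K * x) by ring.
      apply (derive_le (fun t => Rpower t sg * t) (fun t => (sg + 1) * Rpower t sg) (fun t => (sg + 1) * K * t) (fun _ => (sg + 1) * K)); trivial.
      + intros t Ht. unfold Rpower. auto_derive; [lra | field; lra].
      + intros t Ht. auto_derive; trivial. ring.
      + intros t Ht. apply Rmult_le_compat_l; [lra | ]. apply Rle_trans with (2 := HK).
        apply Rle_Rpower_l; lra. }
  intros Hx Hy HKx HKy. destruct (Rle_lt_dec x y) as [H | H].
  - destruct (Hw x y Hx H HKy) as [H1 H2]. rewrite !Rabs_left1; lra.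
  - assert (H' : y <= x) by lra. destruct (Hw y x Hy H' HKx) as [H1 H2]. rewrite !Rabs_pos_eq; lra.
Qed.

(** It is also applied to [u1], with [b * beta] in place of [b], the factor that differentiation
    produces. *)
Definition resc (b beta : R) (u : R -> R) (s : R) : R := u (s / beta) / b.

Lemma resc_derive (b beta : R) (u : R -> R) (s l : R) :
  0 < b -> 0 < beta -> is_derive u (s / beta) l -> is_derive (resc b beta u) s (l / (b * beta)).
Proof.
  intros Hb Hbeta H. unfold resc.
  eapply is_derive_val.
  - apply (is_derive_scal_l (fun s => u (s / beta)) s (/ beta * l) (/ b)).
    apply (is_derive_comp u (fun s => s / beta)); [exact H | ].
    auto_derive; trivial. field. lra.
  - cbv [scal]; simpl. cbv [mult]; simpl. field. lra.
Qed.

(** As [b^(4/m) = beta^2], the power term keeps the coefficient 1, while the trap and the eigenvalue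
    acquire the small factors [beta^(-4)] and [beta^(-2)]. *)
Lemma resc_radsol (m : nat) (lam b : R) (u u1 : R -> R) :
  (3 <= m)%nat -> 0 < b -> gstate m lam b u u1 ->
  let beta := Rpower b (2 / INR m) in
  radsol m (fun s => s ^ 2 / beta ^ 4 - lam / beta ^ 2 - Rpower (resc b beta u s) (4 / INR m))
    (resc b beta u) (resc (b * beta) beta u1).
Proof.
  intros Hm Hb [Hs [Hu _]] beta r Hr. assert (HM := INR_ge3 m Hm).
  assert (Hbe : 0 < beta) by apply Rpower_pos.
  assert (Hrb : 0 < r / beta) by (apply Rdiv_lt_0_compat; lra).
  destruct (Hs (r / beta) Hrb) as [D0 D1]. destruct (Hu (r / beta) Hrb) as [[A1 _] _].
  split.
  - eapply is_derive_val; [apply resc_derive; [lra | trivial | exact D0] | reflexivity].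
  - eapply is_derive_val; [apply resc_derive; [now apply Rmult_lt_0_compat | trivial | exact D1] | ].
    assert (HK : Rpower (u (r / beta)) (4 / INR m) = beta ^ 2 * Rpower (resc b beta u r) (4 / INR m)).
    { replace (u (r / beta)) with (b * resc b beta u r) at 1 by (unfold resc; field; lra).
      rewrite <- Rpower_mult_distr; [ | trivial | unfold resc; now apply Rdiv_lt_0_compat].
      f_equal. unfold beta. rewrite <- (Rpower_pow 2) by apply Rpower_pos. rewrite Rpower_mult. f_equal.
      simpl. field. lra. }
    rewrite HK. unfold resc. field. repeat split; lra.
Qed.

Lemma resc_lim0 (b beta l : R) (u : R -> R) :
  0 < b -> 0 < beta -> filterlim u (at_right 0) (locally l) ->
  filterlim (resc b beta u) (at_right 0) (locally (l / b)).
Proof.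
  intros Hb Hbe Hu. unfold resc. apply flim_mult; [typeclasses eauto | | apply flim_const; typeclasses eauto].
  apply flim_eps; [typeclasses eauto | ]. intros eps He.
  apply flim_eps with (eps := eps) in Hu; [ | typeclasses eauto | trivial].
  destruct (at_right_0_elim _ Hu) as [a [Ha H]].
  apply (at_right_0_intro _ (a * beta)); [now apply Rmult_lt_0_compat | ].
  intros x Hx. apply H. split; [apply Rdiv_lt_0_compat; lra | ].
  apply Rmult_lt_reg_r with beta; trivial. unfold Rdiv. rewrite Rmult_assoc, Rinv_l, Rmult_1_r; lra.
Qed.

(** The radial operator factors as [w'' + (m+1)/s w' = (1/s) (s w' + m w)'], and [s w' + m w] is the
    second unknown of [radial_gronwall]. The forcing, made of the trap and eigenvalue terms, is at
    most [(m + 3)/beta^2] for [s <= beta] because [0 < lam < m + 2]; hence [eps = beta^(-2)] and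
    [c1 = m + 3]. *)
Lemma inner_compare (m : nat) (lam b K S : R) (u u1 : R -> R) :
  (3 <= m)%nat -> 0 < b -> gstate m lam b u u1 -> 0 < K ->
  let beta := Rpower b (2 / INR m) in
  S ^ 2 <= beta ^ 2 ->
  (forall s, 0 < s <= S -> Rpower (resc b beta u s) (4 / INR m) <= K / (1 + s ^ 2) ^ 2 /\
     Rpower (bubble m s) (4 / INR m) <= K / (1 + s ^ 2) ^ 2) ->
  forall s, 0 < s <= S -> Rabs (resc b beta u s - bubble m s) <=
    exp ((4 / INR m + 1) * K / 4) / beta ^ 2 * (1 + (INR m + 3) * s ^ 2).
Proof.
  intros Hm Hb H HK beta HS HKs. assert (HM := INR_ge3 m Hm).
  assert (Hbe : 0 < beta) by apply Rpower_pos.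
  assert (Hbe2 : 0 < beta ^ 2) by (apply pow_lt; trivial).
  assert (Hl1 := gs_lam_pos m lam b u u1 Hm Hb H). assert (Hl2 := gs_lam_lt m lam b u u1 H).
  assert (Hv := resc_radsol m lam b u u1 Hm Hb H). fold beta in Hv. cbv zeta in Hv.
  destruct H as [_ [Hu [H0 [H1 _]]]].
  set (v := resc b beta u) in *. set (v1 := resc (b * beta) beta u1) in *.
  assert (Hvp : forall s, 0 < s -> 0 < v s <= 1).
  { intros s Hs. assert (Hsb : 0 < s / beta) by (apply Rdiv_lt_0_compat; lra).
    destruct (Hu _ Hsb) as [[A1 A2] _]. unfold v, resc. split; [now apply Rdiv_lt_0_compat | ].
    apply Rmult_le_reg_r with b; trivial. unfold Rdiv. rewrite Rmult_assoc, Rinv_l; lra. }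
  set (sg := 4 / INR m) in *.
  assert (Hsg : 0 < sg) by (apply Rdiv_lt_0_compat; lra).
  assert (Hq := bubble_radsol m Hm).
  set (f := fun s => - (Rpower (v s) sg * v s - Rpower (bubble m s) sg * bubble m s)
     + (s ^ 2 / beta ^ 4 - lam / beta ^ 2) * v s).
  intros s Hs.
  apply (radial_gronwall m ((sg + 1) * K) (INR m + 3) (/ beta ^ 2) S (fun s => v s - bubble m s)
    (fun s => s * (v1 s - bubble1 m s) + INR m * (v s - bubble m s)) f); trivial.
  - apply Rmult_lt_0_compat; lra.
  - lra.
  - now apply Rinv_0_lt_compat.
  - intros t Ht. assert (Ht0 : 0 < t) by lra.
    destruct (Hv t Ht0) as [D0 D1]. destruct (Hq t Ht0) as [G0 G1].
    destruct (HKs t Ht) as [K1 K2]. destruct (Hvp t Ht0) as [A1 A2].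
    split; [ | split].
    + eapply is_derive_val; [apply (is_derive_minus v (bubble m) t _ _ D0 G0) | ].
      cbv [minus plus opp]; simpl. field. lra.
    + set (q := bubble m) in *. set (q1 := bubble1 m) in *. clearbody q q1 v v1.
      auto_derive; [dsolve | ]. drw D0; drw D1; drw G0; drw G1. fold sg. unfold f. field. split; lra.
    + unfold f. apply Rle_trans with (1 := Rabs_triang _ _). apply Rplus_le_compat.
      * rewrite Rabs_Ropp.
        apply Rle_trans with ((sg + 1) * (K / (1 + t ^ 2) ^ 2) * Rabs (v t - bubble m t)).
        -- apply power_diff_le; trivial. apply bubble_pos.
        -- right. unfold Rdiv. ring.
      * rewrite Rabs_mult, (Rabs_pos_eq (v t)) by lra.
        assert (HA : Rabs (t ^ 2 / beta ^ 4 - lam / beta ^ 2) <= (INR m + 3) * / beta ^ 2).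
        { replace (t ^ 2 / beta ^ 4) with (t ^ 2 / beta ^ 2 * / beta ^ 2) by (field; lra).
          assert (t ^ 2 / beta ^ 2 <= 1).
          { apply Rmult_le_reg_r with (beta ^ 2); trivial. unfold Rdiv.
            rewrite Rmult_assoc, Rinv_l by lra. nra. }
          assert (0 <= t ^ 2 / beta ^ 2) by (apply Rdiv_le_0_compat; nra).
          assert (Hi : 0 < / beta ^ 2) by now apply Rinv_0_lt_compat.
          replace (t ^ 2 / beta ^ 2 * / beta ^ 2 - lam / beta ^ 2) with ((t ^ 2 / beta ^ 2 - lam) * / beta ^ 2) by (unfold Rdiv; ring).
          rewrite Rabs_mult, (Rabs_pos_eq (/ beta ^ 2)) by lra.
          apply Rmult_le_compat_r; [lra | ]. apply Rabs_le. lra. }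
        assert (Hp := Rabs_pos (t ^ 2 / beta ^ 4 - lam / beta ^ 2)). nra.
  - apply flim_val with (b / b - 1); [ | field; lra].
    apply flim_minus; [typeclasses eauto | now apply resc_lim0 | now apply bubble_lim0].
  - apply flim_val with (0 * (0 / (b * beta) - 0) + INR m * (b / b - 1)); [ | field; lra].
    assert (filterlim v (at_right 0) (locally (b / b))) by now apply resc_lim0.
    assert (filterlim v1 (at_right 0) (locally (0 / (b * beta)))).
    { apply resc_lim0; trivial. now apply Rmult_lt_0_compat. }
    destruct (bubble_lim0 m Hm) as [B0 B1].
    flims.
Qed.

(** * Matching the two regions *)

Lemma first_zero (f : R -> R) (a b : R) :
  a <= b -> (forall x, a <= x <= b -> continuity_pt f x) -> f a < 0 -> 0 <= f b ->
  exists t, a < t <= b /\ f t = 0 /\ forall x, a <= x < t -> f x < 0.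
Proof.
  intros Hab Hc Ha Hb.
  set (E := fun x => a <= x <= b /\ forall y, a <= y <= x -> f y < 0).
  destruct (completeness E) as [t [Hub Hlub]].
  - exists b. intros x [Hx _]. lra.
  - exists a. split; [lra | ]. intros y Hy. replace y with a by lra. trivial.
  - assert (Hat : a <= t). { apply Hub. split; [lra | ]. intros y Hy. replace y with a by lra. trivial. }
    assert (Htb : t <= b). { apply Hlub. intros x [Hx _]. lra. }
    assert (Hlt : forall x, a <= x < t -> f x < 0).
    { intros x Hx. apply Rnot_le_lt. intros Hfx. assert (t <= x); [ | lra].
      apply Hlub. intros y [Hy Hy']. apply Rnot_lt_le. intros Hxy.
      assert (f x < 0) by (apply Hy'; lra). lra. }
    assert (Hct := Hc t (conj Hat Htb)).
    assert (Hloc : forall e, 0 < e -> exists d, 0 < d /\ forall x, Rabs (x - t) < d -> Rabs (f x - f t) < e).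
    { intros e He. destruct (Hct e He) as [d [Hd Hd']]. exists d. split; trivial.
      intros x Hx. destruct (Req_dec x t) as [-> | Hn].
      - rewrite Rminus_diag, Rabs_R0; trivial.
      - apply Hd'. split; [split; [exact I | auto] | exact Hx]. }
    assert (Hft : f t = 0).
    { apply Rle_antisym.
      - apply Rnot_lt_le. intros Hp. destruct (Hloc (f t) Hp) as [d [Hd Hd']].
        destruct (Req_dec a t) as [-> | Hn]; [lra | ].
        set (x := Rmax a (t - d / 2)).
        assert (Hx1 : a <= x) by apply Rmax_l. assert (Hx2 : t - d / 2 <= x) by apply Rmax_r.
        assert (Hx3 : x < t) by (apply Rmax_lub_lt; lra).
        assert (f x < 0) by (apply Hlt; lra).
        specialize (Hd' x). assert (Hxt : Rabs (x - t) < d) by (rewrite Rabs_left; lra).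
        specialize (Hd' Hxt). apply Rabs_def2 in Hd'. lra.
      - apply Rnot_lt_le. intros Hn. assert (He : 0 < - f t) by lra. destruct (Hloc _ He) as [d [Hd Hd']].
        assert (Htb' : t < b). { destruct (Rle_lt_or_eq_dec t b Htb) as [H | H]; [trivial | subst; lra]. }
        set (x := Rmin b (t + d / 2)).
        assert (Hx1 : x <= b) by apply Rmin_l. assert (Hx2 : x <= t + d / 2) by apply Rmin_r.
        assert (Hx3 : t < x) by (apply Rmin_glb_lt; lra).
        assert (x <= t); [ | lra]. apply Hub. split; [lra | ].
        intros y Hy. destruct (Rlt_le_dec y t) as [H | H]; [apply Hlt; lra | ].
        specialize (Hd' y). assert (Hyt : Rabs (y - t) < d) by (rewrite Rabs_pos_eq; lra).
        specialize (Hd' Hyt). apply Rabs_def2 in Hd'. lra. }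
    exists t. split; [ | split; trivial]. split; trivial.
    destruct (Rle_lt_or_eq_dec a t Hat) as [H | H]; [trivial | subst; lra].
Qed.

(* [poho >= 0] reads [Y (m - Y) <= theta] for [Y = - r u'/u]; when [theta] is small this keeps [Y]
   on the branch near [m], that is, [u] decaying like [r^(-m)]. *)
Lemma match_upper (m : nat) (lam b k0 rs r1 : R) (u u1 : R -> R) :
  (3 <= m)%nat -> 0 < b -> gstate m lam b u u1 ->
  0 < rs -> (INR m + 2) * r1 ^ 2 <= 1 / 2 -> k0 <= 1 / 2 ->
  INR m * u rs + 2 * (rs * u1 rs) < 0 ->
  rs ^ 2 * Rpower (u rs) (4 / INR m) <= k0 ->
  forall r, rs <= r <= r1 ->
    r ^ m * u r <= rs ^ m * u rs * exp (k0 + (INR m + 2) * r ^ 2).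
Proof.
  intros Hm Hb H Hrs Hr1 Hk0 Hneg Hks. assert (HM := INR_ge3 m Hm).
  assert (Hl1 := gs_lam_pos m lam b u u1 Hm Hb H). assert (Hl2 := gs_lam_lt m lam b u u1 H).
  assert (HH := fun r => poho_nonneg m lam b u u1 r Hm Hb H).
  destruct H as [Hs [Hu _]].
  assert (HP : forall x, 0 < x -> 0 < x ^ m) by (intros; apply pow_lt; lra).
  set (sg := 4 / INR m) in *. assert (Hsg : 0 < sg) by (apply Rdiv_lt_0_compat; lra).
  (* This is [(r^(m/2) u)^(4/m)], so it decreases where [Dn <= 0]. *)
  set (ka := fun r => r ^ 2 * Rpower (u r) sg).
  set (th := fun r => ka r + lam * r ^ 2).
  assert (Hkap : forall r, 0 < r -> 0 < ka r).
  { intros r Hr. apply Rmult_lt_0_compat; [nra | apply Rpower_pos]. }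
  assert (HY : forall r, 0 < r -> - (r * u1 r) * (INR m * u r + r * u1 r) <= th r * u r ^ 2).
  { intros r Hr. specialize (HH r Hr). unfold poho in HH. fold sg in HH. specialize (HP r Hr).
    assert (Hk := Rpower_pos (u r) sg). assert (Hu2 := pow2_ge_0 (u r)).
    assert (E1 : r ^ m * 0 <= r ^ m * ((r * u1 r) ^ 2 + INR m * u r * (r * u1 r)
       + (r ^ 2 * Rpower (u r) sg * (2 / (sg + 2)) + (lam - r ^ 2) * r ^ 2) * u r ^ 2)).
    { rewrite Rmult_0_r. apply Rle_trans with (1 := Rmult_le_pos 2 _ (Rlt_le _ _ Rlt_0_2) HH).
      right. field. lra. }
    apply Rmult_le_reg_l in E1; trivial.
    assert (E2 : r ^ 2 * Rpower (u r) sg * (2 / (sg + 2)) <= ka r).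
    { unfold ka. rewrite <- (Rmult_1_r (r ^ 2 * Rpower (u r) sg)) at 2.
      apply Rmult_le_compat_l; [apply Rmult_le_pos; nra | ].
      apply Rmult_le_reg_r with (sg + 2); [lra | ]. unfold Rdiv. rewrite Rmult_assoc, Rinv_l; lra. }
    assert (E3 : (r ^ 2 * Rpower (u r) sg * (2 / (sg + 2)) + (lam - r ^ 2) * r ^ 2) * u r ^ 2 <= th r * u r ^ 2).
    { apply Rmult_le_compat_r; trivial. unfold th. assert (0 <= r ^ 2 * r ^ 2) by nra. lra. }
    lra. }
  set (Dn := fun r => INR m * u r + 2 * (r * u1 r)).
  assert (Hkd : forall r, 0 < r -> is_derive ka r (ka r * (2 / INR m) * Dn r / (r * u r))).
  { intros r Hr. destruct (Hs r Hr) as [D0 _]. destruct (Hu r Hr) as [[A1 _] _].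
    assert (HK := is_derive_Rpower u r (u1 r) sg A1 D0).
    destruct (is_derive_opaque _ _ _ HK) as [Kf [EK DK]].
    apply (is_derive_ext (fun r => r ^ 2 * Kf r)); [intros t; unfold ka; now rewrite EK | ].
    auto_derive; [dsolve | ]. drw DK. rewrite EK. unfold ka, Dn, sg. field. lra. }
  assert (Hmono : forall x y, rs <= x -> x <= y -> (forall t, x <= t <= y -> Dn t <= 0) -> ka y <= ka x).
  { intros x y Hx Hxy HD. eapply (derive_decr ka); trivial.
    - intros t Ht. apply Hkd. lra.
    - intros t Ht. assert (Ht0 : 0 < t) by lra. specialize (HD t Ht). destruct (Hu t Ht0) as [[A1 _] _].
      specialize (Hkap t Ht0).
      replace (ka t * (2 / INR m) * Dn t / (t * u t)) with (ka t * (2 / INR m) / (t * u t) * Dn t) by (field; lra).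
      assert (0 <= ka t * (2 / INR m) / (t * u t)); [ | nra].
      apply Rdiv_le_0_compat; [ | nra]. apply Rmult_le_pos; [lra | apply Rdiv_le_0_compat; lra]. }
  assert (Hth : forall r, rs <= r <= r1 -> ka r <= k0 -> th r <= 1).
  { intros r Hr Hk. unfold th. assert (lam * r ^ 2 <= (INR m + 2) * r1 ^ 2); [ | lra].
    apply Rmult_le_compat; nra. }
  (* At a first zero of [Dn] one has [Y = m/2], and [HY] would read [m^2/4 <= th <= 1], impossible
     for [m >= 3]. Up to that point [ka] has decreased, which is why [th <= 1] still holds there. *)
  assert (HDn : forall r, rs <= r <= r1 -> Dn r < 0).
  { intros r2 Hr2. apply Rnot_le_lt. intros Hc.
    destruct (first_zero Dn rs r2) as [t [Ht [Ht0 Htn]]]; trivial; [lra | | ].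
    - intros x Hx. assert (Hx0 : 0 < x) by lra. destruct (Hs x Hx0) as [D0 D1].
      apply continuity_pt_filterlim.
      apply (ex_derive_continuous Dn). unfold Dn. auto_derive; dsolve.
    - assert (Hka : ka t <= k0).
      { apply Rle_trans with (ka rs); [ | exact Hks]. apply Hmono; [lra | lra | ].
        intros x Hx. destruct (Req_dec x t) as [-> | Hn]; [lra | left; apply Htn; lra]. }
      assert (Ht1 : th t <= 1) by (apply Hth; trivial; lra).
      assert (Htp : 0 < t) by lra. specialize (HY t Htp). destruct (Hu t Htp) as [[A1 _] _].
      unfold Dn in Ht0. replace (t * u1 t) with (- (INR m / 2 * u t)) in HY by lra.
      assert (th t * u t ^ 2 <= 1 * u t ^ 2) by (apply Rmult_le_compat_r; nra).
      assert (INR m ^ 2 / 4 * u t ^ 2 <= 1 * u t ^ 2) by lra.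
      assert (9 / 4 * u t ^ 2 <= INR m ^ 2 / 4 * u t ^ 2) by (apply Rmult_le_compat_r; nra).
      nra. }
  assert (Hka : forall r, rs <= r <= r1 -> ka r <= k0).
  { intros r Hr. apply Rle_trans with (ka rs); [ | exact Hks]. apply Hmono; [lra | lra | ].
    intros x Hx. left. apply HDn. lra. }
  assert (Hg : forall r, rs <= r <= r1 -> INR m * u r + r * u1 r <= 2 / INR m * th r * u r /\ Dn r <= - (INR m / 2) * u r).
  { intros r Hr. assert (Hr0 : 0 < r) by lra. specialize (HDn r Hr). unfold Dn in *.
    specialize (HY r Hr0). destruct (Hu r Hr0) as [[A1 _] _]. specialize (Hka r Hr).
    assert (Ht1 := Hth r Hr Hka). assert (Htp : 0 < th r) by (unfold th; specialize (Hkap r Hr0); nra).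
    (* Dividing by [x >= (m/2) u] selects the branch of [Y] near [m]. *)
    assert (G1 : INR m * u r + r * u1 r <= 2 / INR m * th r * u r).
    { set (x := - (r * u1 r)) in *. replace (r * u1 r) with (- x) in * by (unfold x; ring).
      apply Rmult_le_reg_l with x; [nra | ]. apply Rle_trans with (th r * u r ^ 2); [lra | ].
      replace (th r * u r ^ 2) with (INR m / 2 * u r * (2 / INR m * th r * u r)) by (field; lra).
      apply Rmult_le_compat_r; [ | lra].
      apply Rmult_le_pos; [apply Rmult_le_pos; [apply Rdiv_le_0_compat | ] | ]; lra. }
    split; trivial.
    assert (2 / INR m * th r * u r <= 2 / 3 * 1 * u r).
    { apply Rmult_le_compat_r; [lra | ]. apply Rmult_le_compat; try lra.
      - apply Rdiv_le_0_compat; lra.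
      - apply Rmult_le_compat_l; [lra | ]. apply Rinv_le_contravar; lra. }
    nra. }
  intros r Hr. assert (Hr0 : 0 < r) by lra.
  (* By [G1] the logarithmic slope of [r^m u] is at most [th/r], where [th = ka + lam r^2]. The
     slope of [ka], at most [- ka/r], compensates the first part, and the term [(m + 2) r^2] the
     second. *)
  assert (HL : r ^ m * u r * exp (ka r - (INR m + 2) * r ^ 2) <= rs ^ m * u rs * exp (ka rs - (INR m + 2) * rs ^ 2)).
  { apply (derive_decr (fun r => r ^ m * u r * exp (ka r - (INR m + 2) * r ^ 2))
      (fun r => exp (ka r - (INR m + 2) * r ^ 2) * (r ^ m / r) * (INR m * u r + r * u1 r + r * u r * (ka r * (2 / INR m) * Dn r / (r * u r) - 2 * (INR m + 2) * r)))); [lra | | ].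
    - intros x Hx. assert (Hx0 : 0 < x) by lra. destruct (Hs x Hx0) as [D0 _]. assert (DK := Hkd x Hx0).
      destruct (is_derive_opaque _ _ _ DK) as [Kf [EK DK']].
      apply (is_derive_ext (fun r => r ^ m * u r * exp (Kf r - (INR m + 2) * r ^ 2))); [intros t; now rewrite EK | ].
      auto_derive; [dsolve | ]. drw D0; drw DK'. rewrite EK, pow_pred by lra.
      replace (x * (x * 1)) with (x ^ 2) by ring.
      change (ka x + - ((INR m + 2) * x ^ 2)) with (ka x - (INR m + 2) * x ^ 2).
      destruct (Hu x Hx0) as [[A1 _] _]. field. lra.
    - intros x Hx. assert (Hx0 : 0 < x) by lra. assert (Hx1 : rs <= x <= r1) by lra.
      destruct (Hg x Hx1) as [G1 G2]. destruct (Hu x Hx0) as [[A1 _] _]. specialize (Hkap x Hx0). specialize (HP x Hx0).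
      assert (Hex := exp_pos (ka x - (INR m + 2) * x ^ 2)).
      replace (x * u x * (ka x * (2 / INR m) * Dn x / (x * u x) - 2 * (INR m + 2) * x))
        with (ka x * (2 / INR m) * Dn x - 2 * (INR m + 2) * x ^ 2 * u x) by (field; lra).
      assert (G3 : ka x * (2 / INR m) * Dn x <= ka x * (2 / INR m) * (- (INR m / 2) * u x)).
      { apply Rmult_le_compat_l; trivial. apply Rmult_le_pos; [lra | apply Rdiv_le_0_compat; lra]. }
      replace (ka x * (2 / INR m) * (- (INR m / 2) * u x)) with (- (ka x * u x)) in G3 by (field; lra).
      assert (G4 : 2 / INR m * th x * u x <= 1 * th x * u x).
      { apply Rmult_le_compat_r; [lra | ]. apply Rmult_le_compat_r; [unfold th; nra | ].
        apply Rmult_le_reg_r with (INR m); [lra | ]. unfold Rdiv. rewrite Rmult_assoc, Rinv_l; lra. }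
      assert (G5 : th x * u x <= ka x * u x + (INR m + 2) * x ^ 2 * u x).
      { unfold th. assert (lam * x ^ 2 * u x <= (INR m + 2) * x ^ 2 * u x) by (apply Rmult_le_compat_r; nra). lra. }
      assert (0 <= (INR m + 2) * x ^ 2 * u x) by (apply Rmult_le_pos; nra).
      assert (0 < exp (ka x - (INR m + 2) * x ^ 2) * (x ^ m / x)).
      { apply Rmult_lt_0_compat; trivial. apply Rdiv_lt_0_compat; lra. }
      assert (INR m * u x + x * u1 x + (ka x * (2 / INR m) * Dn x - 2 * (INR m + 2) * x ^ 2 * u x) <= 0) by lra.
      nra. }
  assert (Hex : exp (ka r - (INR m + 2) * r ^ 2) * exp ((INR m + 2) * r ^ 2 - ka r) = 1).
  { rewrite <- exp_plus. replace (ka r - (INR m + 2) * r ^ 2 + ((INR m + 2) * r ^ 2 - ka r)) with 0 by ring. apply exp_0. }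
  replace (r ^ m * u r) with (r ^ m * u r * exp (ka r - (INR m + 2) * r ^ 2) * exp ((INR m + 2) * r ^ 2 - ka r))
    by (rewrite Rmult_assoc, Hex; ring).
  destruct (Hu rs Hrs) as [[A1 _] _]. assert (HPs := HP rs Hrs).
  apply Rle_trans with (rs ^ m * u rs * exp (ka rs - (INR m + 2) * rs ^ 2) * exp ((INR m + 2) * r ^ 2 - ka r)).
  - apply Rmult_le_compat_r; [left; apply exp_pos | trivial].
  - rewrite Rmult_assoc, <- exp_plus. apply Rmult_le_compat_l; [nra | ].
    apply exp_le_compat. specialize (Hkap r Hr0). unfold ka at 1. fold sg.
    assert (0 <= (INR m + 2) * rs ^ 2) by nra. lra.
Qed.

Lemma large_power (y X : R) : 0 < y -> exists B, 1 <= B /\ forall b, B <= b -> X <= Rpower b y.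
Proof.
  intros Hy. set (X1 := Rmax X 1).
  assert (HX1 : 1 <= X1) by apply Rmax_r. assert (HX : X <= X1) by apply Rmax_l.
  exists (Rpower X1 (/ y)). split.
  - apply Rle_trans with (Rpower X1 0); [rewrite Rpower_O; lra | ].
    apply Rle_Rpower; [trivial | left; now apply Rinv_0_lt_compat].
  - intros b Hb. apply Rle_trans with (1 := HX).
    replace X1 with (Rpower (Rpower X1 (/ y)) y).
    + apply Rle_Rpower_l; [lra | ]. split; [apply Rpower_pos | trivial].
    + rewrite Rpower_mult, Rinv_l by lra. apply Rpower_1. lra.
Qed.

Lemma Rpower_le1 (x y : R) : 0 < x <= 1 -> 0 <= y -> Rpower x y <= 1.
Proof.
  intros Hx Hy. rewrite <- (Rpower_1 1) by lra.
  apply Rle_trans with (Rpower 1 y); [now apply Rle_Rpower_l | ].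
  unfold Rpower. rewrite ln_1, !Rmult_0_r. lra.
Qed.

Lemma resc_range (m : nat) (lam b beta : R) (u u1 : R -> R) (s : R) :
  0 < b -> 0 < beta -> gstate m lam b u u1 -> 0 < s -> 0 < resc b beta u s <= 1.
Proof.
  intros Hb Hbe [_ [Hu _]] Hs. assert (Hsb : 0 < s / beta) by (apply Rdiv_lt_0_compat; lra).
  destruct (Hu _ Hsb) as [[A1 A2] _]. unfold resc. split; [now apply Rdiv_lt_0_compat | ].
  apply Rmult_le_reg_r with b; trivial. unfold Rdiv. rewrite Rmult_assoc, Rinv_l; lra.
Qed.

(** The first run of Gronwall: [K = (1 + S^2)^2] is admissible merely because both functions are at
    most 1. The threshold [B] depends on [S] through [exp] of a multiple of [K], so the window must
    stay fixed. *)
Lemma inner_fixed (m : nat) (S tau : R) :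
  (3 <= m)%nat -> 0 < S -> 0 < tau ->
  exists B, 1 <= B /\ forall b lam u u1, B <= b -> gstate m lam b u u1 ->
    forall s, 0 < s <= S -> Rabs (resc b (Rpower b (2 / INR m)) u s - bubble m s) <= tau.
Proof.
  intros Hm HS Ht. assert (HM := INR_ge3 m Hm).
  set (K := (1 + S ^ 2) ^ 2).
  assert (HK : 0 < K) by (apply pow_lt; nra).
  set (D := exp ((4 / INR m + 1) * K / 4) * (1 + (INR m + 3) * S ^ 2)).
  assert (HD : 0 < D) by (apply Rmult_lt_0_compat; [apply exp_pos | nra]).
  assert (Hy : 0 < 2 / INR m) by (apply Rdiv_lt_0_compat; lra).
  destruct (large_power (2 / INR m) (S + D / tau + 1) Hy) as [B [HB HBb]].
  exists B. split; trivial. intros b lam u u1 Hb H s Hs.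
  assert (Hb0 : 0 < b) by lra. specialize (HBb b Hb).
  set (beta := Rpower b (2 / INR m)) in *.
  assert (HDt : 0 < D / tau) by now apply Rdiv_lt_0_compat.
  assert (Hc : Rabs (resc b beta u s - bubble m s) <=
    exp ((4 / INR m + 1) * K / 4) / beta ^ 2 * (1 + (INR m + 3) * s ^ 2)).
  { apply (inner_compare m lam b K S u u1); trivial.
    - fold beta. nra.
    - intros t Htt. fold beta.
      assert (H1 : 1 <= K / (1 + t ^ 2) ^ 2).
      { apply Rmult_le_reg_r with ((1 + t ^ 2) ^ 2); [apply pow_lt; nra | ].
        unfold Rdiv. rewrite Rmult_assoc, Rinv_l, Rmult_1_l, Rmult_1_r by (apply pow_nonzero; nra).
        apply pow_incr. split; nra. }
      assert (0 <= 4 / INR m) by (apply Rdiv_le_0_compat; lra).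
      split; apply Rle_trans with (2 := H1); apply Rpower_le1; trivial.
      + apply (resc_range m lam b beta u u1); trivial; [apply Rpower_pos | lra].
      + split; [apply bubble_pos | now apply bubble_le1]. }
  apply Rle_trans with (1 := Hc).
  assert (Hbp : 0 < beta ^ 2) by (apply pow_lt; apply Rpower_pos).
  apply Rle_trans with (D / beta ^ 2).
  - unfold D, Rdiv. rewrite (Rmult_assoc _ (/ beta ^ 2)), (Rmult_comm (/ beta ^ 2)), <- Rmult_assoc.
    apply Rmult_le_compat_r; [left; now apply Rinv_0_lt_compat | ].
    apply Rmult_le_compat_l; [left; apply exp_pos | ]. assert (s ^ 2 <= S ^ 2) by (apply pow_incr; lra). nra.
  - apply Rmult_le_reg_r with (beta ^ 2); trivial. unfold Rdiv. rewrite Rmult_assoc, Rinv_l, Rmult_1_r by lra.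
    assert (D = D / tau * tau) by (field; lra).
    assert (D / tau <= beta ^ 2) by nra. nra.
Qed.

Lemma Rpower_beta (m : nat) (b : R) : (3 <= m)%nat -> 0 < b -> Rpower b (2 / INR m) ^ m = b ^ 2.
Proof.
  intros Hm Hb. assert (HM := INR_ge3 m Hm).
  rewrite <- (Rpower_pow m), Rpower_mult by apply Rpower_pos.
  replace (2 / INR m * INR m) with (INR 2) by (simpl; field; lra). now apply Rpower_pow.
Qed.

Lemma resc_potential (m : nat) (b : R) (u : R -> R) (s : R) :
  (3 <= m)%nat -> 0 < b -> let beta := Rpower b (2 / INR m) in 0 < u (s / beta) ->
  (s / beta) ^ 2 * Rpower (u (s / beta)) (4 / INR m) = s ^ 2 * Rpower (resc b beta u s) (4 / INR m).
Proof.
  intros Hm Hb beta Hu. assert (HM := INR_ge3 m Hm).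
  assert (Hbe : 0 < beta) by apply Rpower_pos.
  replace (u (s / beta)) with (b * resc b beta u s) at 1 by (unfold resc; field; lra).
  rewrite <- Rpower_mult_distr; [ | trivial | unfold resc; now apply Rdiv_lt_0_compat].
  replace (Rpower b (4 / INR m)) with (beta ^ 2); [field; lra | ].
  unfold beta. rewrite <- (Rpower_pow 2) by apply Rpower_pos. rewrite Rpower_mult. f_equal.
  simpl. field. lra.
Qed.

(** Since [beta^m = b^2], the quantity [b r^m u] becomes [s^m v] without any factor; uniform bounds
    are stated for it. *)
Lemma resc_mass (m : nat) (b : R) (u : R -> R) (s : R) :
  (3 <= m)%nat -> 0 < b -> let beta := Rpower b (2 / INR m) in
  b * ((s / beta) ^ m * u (s / beta)) = s ^ m * resc b beta u s.
Proof.
  intros Hm Hb beta.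
  unfold Rdiv at 1. rewrite Rpow_mult_distr, pow_inv. unfold beta at 1. rewrite Rpower_beta by trivial.
  unfold resc. field. lra.
Qed.

Lemma bubble_decr (m : nat) (s t : R) :
  (3 <= m)%nat -> 0 <= s -> s <= t -> bubble m t <= bubble m s.
Proof.
  intros Hm Hs Hst. assert (HM := INR_ge3 m Hm). assert (Ha := alc_pos m Hm).
  unfold bubble. rewrite !Rpower_Ropp. apply Rinv_le_contravar; [apply Rpower_pos | ].
  apply Rle_Rpower_l; [lra | ]. assert (s ^ 2 <= t ^ 2) by (apply pow_incr; lra). nra.
Qed.

(** Inside [S1] this is the comparison on a fixed window. To go on with [match_upper] one needs a
    radius with [Y > m/2]. The bubble has this property far out, but only values of [u] are known to
    be close to those of the bubble, not derivatives; hence a drop of [r^m u^2] between [S0] and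
    [S1] is used. *)
Lemma match_region (m : nat) (eta : R) :
  (3 <= m)%nat -> 0 < eta <= 1 / 2 ->
  exists S1 B, 1 <= S1 /\ 1 <= B /\ forall b lam u u1, B <= b -> gstate m lam b u u1 ->
    let beta := Rpower b (2 / INR m) in
    S1 / beta <= / (INR m + 2) /\
    (forall s, 0 < s <= S1 -> Rabs (resc b beta u s - bubble m s) <= eta * bubble m s) /\
    (forall r, S1 / beta <= r <= / (INR m + 2) ->
       b * (r ^ m * u r) <= (1 + eta) * bubble_lim m * exp (eta + (INR m + 2) * r ^ 2)).
Proof.
  intros Hm Heta. assert (HM := INR_ge3 m Hm). assert (Ha := alc_pos m Hm).
  set (A0 := bubble_lim m). assert (HA0 : 0 < A0) by apply Rpower_pos.
  set (a := alc m) in *.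
  assert (Hae : 0 < a ^ 2 * eta) by (apply Rmult_lt_0_compat; [apply pow_lt | ]; lra).
  (* Beyond [S0] the potential [s^2 v^(4/m)], with [v] at most twice the bubble, is at most
     [4/(a^2 s^2) <= eta]. *)
  set (S0 := 1 + 4 / (a ^ 2 * eta)).
  assert (HS0 : 1 < S0) by (unfold S0; assert (0 < 4 / (a ^ 2 * eta)) by (apply Rdiv_lt_0_compat; lra); lra).
  set (z0 := S0 ^ m * bubble m S0 ^ 2).
  assert (Hz0 : 0 < z0).
  { apply Rmult_lt_0_compat; [apply pow_lt; lra | ]. assert (H := bubble_pos m S0). nra. }
  (* At [S1] the value of [s^m bubble^2] is below 1/16 of that at [S0]; replacing the bubble by [v]
     costs a factor 4 at each end. *)
  set (S1 := S0 + 16 * A0 ^ 2 / z0).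
  assert (HA02 : 0 < A0 ^ 2) by (apply pow_lt; trivial).
  assert (HS01 : S0 < S1) by (unfold S1; assert (0 < 16 * A0 ^ 2 / z0) by (apply Rdiv_lt_0_compat; lra); lra).
  assert (Hz1 : S1 ^ m * bubble m S1 ^ 2 < z0 / 16 * 1).
  { assert (H1 : S1 ^ m * bubble m S1 <= A0) by (apply bubble_tail_le; [trivial | lra]).
    assert (HB1 := bubble_pos m S1). assert (HP1 : S1 <= S1 ^ m).
    { replace S1 with (S1 ^ 1) at 1 by ring. apply Rle_pow; [lra | lia]. }
    assert (H2 : S1 * (S1 ^ m * bubble m S1 ^ 2) <= A0 ^ 2).
    { apply Rle_trans with (S1 ^ m * (S1 ^ m * bubble m S1 ^ 2)).
      - apply Rmult_le_compat_r; trivial. apply Rmult_le_pos; [lra | nra].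
      - replace (S1 ^ m * (S1 ^ m * bubble m S1 ^ 2)) with ((S1 ^ m * bubble m S1) ^ 2) by ring.
        apply pow_incr. split; trivial. apply Rmult_le_pos; lra. }
    assert (H3 : A0 ^ 2 < S1 * (z0 / 16)).
    { unfold S1. replace ((S0 + 16 * A0 ^ 2 / z0) * (z0 / 16)) with (S0 * (z0 / 16) + A0 ^ 2) by (field; lra). nra. }
    rewrite Rmult_1_r. apply Rmult_lt_reg_l with S1; lra. }
  set (tau := eta * bubble m S1).
  assert (Htau : 0 < tau) by (apply Rmult_lt_0_compat; [lra | apply bubble_pos]).
  assert (HS1 : 0 < S1) by lra.
  destruct (inner_fixed m S1 tau Hm HS1 Htau) as [B1 [HB1 Hin]].
  assert (Hy : 0 < 2 / INR m) by (apply Rdiv_lt_0_compat; lra).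
  destruct (large_power (2 / INR m) (S1 * (INR m + 2)) Hy) as [B2 [HB2 Hbig]].
  exists S1, (B1 + B2). split; [lra | split; [lra | ]].
  intros b lam u u1 Hb H beta. assert (Hb0 : 0 < b) by lra.
  assert (Hb1 : B1 <= b) by lra. assert (Hb2 : B2 <= b) by lra.
  specialize (Hin b lam u u1 Hb1 H). fold beta in Hin. specialize (Hbig b Hb2). fold beta in Hbig.
  assert (Hbe : 0 < beta) by apply Rpower_pos.
  assert (Hsb : S1 / beta <= / (INR m + 2)).
  { apply Rmult_le_reg_r with (beta * (INR m + 2)); [nra | ]. field_simplify; lra. }
  assert (Hclose : forall s, 0 < s <= S1 -> Rabs (resc b beta u s - bubble m s) <= eta * bubble m s).
  { intros s Hs. apply Rle_trans with (1 := Hin s Hs). apply Rmult_le_compat_l; [lra | ].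
    apply bubble_decr; trivial; lra. }
  split; [trivial | split; [trivial | ]].
  set (v := resc b beta u) in *.
  assert (Hv : forall s, 0 < s <= S1 -> (1 - eta) * bubble m s <= v s <= (1 + eta) * bubble m s).
  { intros s Hs. specialize (Hclose s Hs). apply Rabs_le_between in Hclose. lra. }
  destruct (match H with conj Hs0 (conj Hu _) => conj Hs0 Hu end) as [Hs Hu].
  (* the mean value theorem gives a point where [r^m u^2] decreases *)
  set (ze := fun r => r ^ m * u r ^ 2).
  set (ze1 := fun r => r ^ m / r * u r * (INR m * u r + 2 * (r * u1 r))).
  set (r0 := S0 / beta). set (rr := S1 / beta).
  assert (Hr0 : 0 < r0) by (apply Rdiv_lt_0_compat; lra).
  assert (Hr01 : r0 < rr) by (apply Rmult_lt_compat_r; [now apply Rinv_0_lt_compat | trivial]).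
  assert (Hzed : forall x, r0 <= x <= rr -> is_derive ze x (ze1 x)).
  { intros x Hx. assert (Hx0 : 0 < x) by lra. destruct (Hs x Hx0) as [D0 _]. unfold ze, ze1.
    auto_derive; [dsolve | ]. drw D0. rewrite pow_pred by lra. field. lra. }
  assert (Hzev : forall s, ze (s / beta) = s ^ m * v s ^ 2).
  { intros s. unfold ze, v, resc. unfold Rdiv at 1. rewrite Rpow_mult_distr, pow_inv. unfold beta at 1.
    rewrite Rpower_beta by trivial. field. lra. }
  destruct (MVT_gen ze r0 rr ze1) as [rs [Hrs Hrs']].
  { rewrite Rmin_left, Rmax_right by lra. intros x Hx. apply Hzed. lra. }
  { rewrite Rmin_left, Rmax_right by lra. intros x Hx.
    apply continuity_pt_filterlim, (is_derive_cont ze x (ze1 x)), Hzed, Hx. }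
  rewrite Rmin_left, Rmax_right in Hrs by lra.
  assert (Hrs0 : 0 < rs) by lra.
  assert (Hdrop : ze rr < ze r0).
  { unfold rr, r0. rewrite !Hzev.
    assert (P0 : 0 < S0 ^ m) by (apply pow_lt; lra). assert (P1 : 0 < S1 ^ m) by (apply pow_lt; lra).
    assert (Q0 := bubble_pos m S0).
    destruct (Hv S0) as [V0 _]; [lra | ]. destruct (Hv S1) as [V1 V2]; [lra | ].
    assert (E1 : bubble m S0 ^ 2 / 4 <= v S0 ^ 2).
    { replace (bubble m S0 ^ 2 / 4) with ((bubble m S0 / 2) ^ 2) by field. apply pow_incr. nra. }
    assert (E2 : v S1 ^ 2 <= 4 * bubble m S1 ^ 2).
    { replace (4 * bubble m S1 ^ 2) with ((2 * bubble m S1) ^ 2) by ring. apply pow_incr. nra. }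
    assert (E3 : z0 / 4 <= S0 ^ m * v S0 ^ 2) by (unfold z0; nra).
    assert (E4 : S1 ^ m * v S1 ^ 2 <= 4 * (S1 ^ m * bubble m S1 ^ 2)) by nra.
    lra. }
  destruct (Hu rs Hrs0) as [[A1 _] _].
  assert (Hneg : INR m * u rs + 2 * (rs * u1 rs) < 0).
  { apply Rnot_le_lt. intros Hc. assert (0 <= ze1 rs); [ | nra].
    apply Rmult_le_pos; trivial. apply Rmult_le_pos; [ | lra].
    apply Rdiv_le_0_compat; [left; apply pow_lt; lra | lra]. }
  set (ss := rs * beta).
  assert (Hss : S0 <= ss <= S1).
  { unfold ss, r0, rr in *. split.
    - apply Rmult_le_reg_r with (/ beta); [now apply Rinv_0_lt_compat | ]. rewrite Rmult_assoc, Rinv_r; unfold Rdiv in Hrs; lra.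
    - apply Rmult_le_reg_r with (/ beta); [now apply Rinv_0_lt_compat | ]. rewrite Rmult_assoc, Rinv_r; unfold Rdiv in Hrs; lra. }
  assert (Ers : rs = ss / beta) by (unfold ss; field; lra).
  destruct (Hv ss) as [V1 V2]; [lra | ]. assert (Qs := bubble_pos m ss).
  assert (Hpot : rs ^ 2 * Rpower (u rs) (4 / INR m) <= eta).
  { rewrite Ers. unfold beta. rewrite resc_potential; trivial; [ | fold beta; rewrite <- Ers; lra]. fold beta. fold v.
    assert (V0 : 0 < v ss) by nra.
    apply Rle_trans with (ss ^ 2 * (4 * Rpower (bubble m ss) (4 / INR m))).
    - apply Rmult_le_compat_l; [nra | ].
      apply Rle_trans with (Rpower (2 * bubble m ss) (4 / INR m)); [apply Rle_Rpower_l; nra | ].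
      rewrite <- Rpower_mult_distr by lra. apply Rmult_le_compat_r; [left; apply Rpower_pos | ].
      apply Rle_trans with (Rpower 2 (INR 2)); [ | rewrite Rpower_pow by lra; lra].
      apply Rle_Rpower; [lra | ]. simpl. apply Rmult_le_reg_r with (INR m); [lra | ].
      unfold Rdiv. rewrite Rmult_assoc, Rinv_l; lra.
    - rewrite bubble_pow by trivial. fold a.
      assert (E1 : a * ss ^ 2 <= 1 + a * ss ^ 2) by lra.
      assert (E2 : 0 < a * ss ^ 2) by (apply Rmult_lt_0_compat; nra).
      apply Rle_trans with (ss ^ 2 * (4 * / (a * ss ^ 2) ^ 2)).
      + apply Rmult_le_compat_l; [nra | ]. apply Rmult_le_compat_l; [lra | ].
        apply Rinv_le_contravar; [apply pow_lt; trivial | apply pow_incr; lra].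
      + replace (ss ^ 2 * (4 * / (a * ss ^ 2) ^ 2)) with (4 / (a ^ 2 * eta) * eta / ss ^ 2) by (field; repeat split; lra).
        assert (0 < 4 / (a ^ 2 * eta)) by (apply Rdiv_lt_0_compat; lra).
        assert (4 / (a ^ 2 * eta) <= ss ^ 2) by (unfold S0 in Hss; nra).
        apply Rmult_le_reg_r with (ss ^ 2); [nra | ]. unfold Rdiv at 1. rewrite Rmult_assoc, Rinv_l by nra. nra. }
  intros r Hr. fold rr in Hr.
  assert (Hup : r ^ m * u r <= rs ^ m * u rs * exp (eta + (INR m + 2) * r ^ 2)).
  { apply (match_upper m lam b eta rs (/ (INR m + 2)) u u1); trivial; try lra.
    assert (0 < / (INR m + 2) <= / 2).
    { split; [apply Rinv_0_lt_compat; lra | apply Rinv_le_contravar; lra]. }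
    replace ((INR m + 2) * (/ (INR m + 2)) ^ 2) with (/ (INR m + 2)) by (field; lra). lra. }
  apply Rle_trans with (b * (rs ^ m * u rs * exp (eta + (INR m + 2) * r ^ 2))).
  - apply Rmult_le_compat_l; lra.
  - rewrite <- Rmult_assoc. apply Rmult_le_compat_r; [left; apply exp_pos | ].
    rewrite Ers. unfold beta. rewrite resc_mass by trivial. fold beta. fold v.
    apply Rle_trans with (ss ^ m * ((1 + eta) * bubble m ss)).
    + apply Rmult_le_compat_l; [apply pow_le; lra | trivial].
    + assert (ss ^ m * bubble m ss <= A0) by (apply bubble_tail_le; [trivial | lra]). nra.
Qed.

(** Outside [S1 / beta] this is [match_region]; inside, [s^m v <= S1^m] because [v <= 1]. *)
Lemma mass_bound_near (m : nat) :
  (3 <= m)%nat ->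
  exists C B, 1 <= C /\ 1 <= B /\ forall b lam u u1, B <= b -> gstate m lam b u u1 ->
    forall r, 0 < r <= / (INR m + 2) -> b * (r ^ m * u r) <= C.
Proof.
  intros Hm. assert (HM := INR_ge3 m Hm).
  assert (Heta : 0 < 1 / 2 <= 1 / 2) by lra.
  destruct (match_region m (1 / 2) Hm Heta) as [S1 [B [HS1 [HB H]]]].
  set (A0 := bubble_lim m) in *. assert (HA0 : 0 < A0) by apply Rpower_pos.
  assert (HSm : 1 <= S1 ^ m) by now apply pow_R1_Rle.
  exists (S1 ^ m + (1 + 1 / 2) * A0 * exp 1), B.
  assert (He : 0 < (1 + 1 / 2) * A0 * exp 1) by (apply Rmult_lt_0_compat; [lra | apply exp_pos]).
  split; [lra | split; [lra | ]].
  intros b lam u u1 Hb Hg r Hr. assert (Hb0 : 0 < b) by lra.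
  destruct (H b lam u u1 Hb Hg) as [H1 [_ H2]].
  set (beta := Rpower b (2 / INR m)) in *. assert (Hbe : 0 < beta) by apply Rpower_pos.
  destruct (Rle_lt_dec (S1 / beta) r) as [Hc | Hc].
  - apply Rle_trans with ((1 + 1 / 2) * A0 * exp 1); [ | lra].
    eapply Rle_trans; [apply H2; lra | ]. apply Rmult_le_compat_l; [lra | ]. apply exp_le_compat.
    assert (r ^ 2 <= (/ (INR m + 2)) ^ 2) by (apply pow_incr; lra).
    assert ((INR m + 2) * r ^ 2 <= (INR m + 2) * (/ (INR m + 2)) ^ 2) by (apply Rmult_le_compat_l; lra).
    replace ((INR m + 2) * (/ (INR m + 2)) ^ 2) with (/ (INR m + 2)) in H3 by (field; lra).
    assert (/ (INR m + 2) <= / 2) by (apply Rinv_le_contravar; lra). lra.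
  - apply Rle_trans with (S1 ^ m); [ | lra].
    replace r with (r * beta / beta) by (field; lra). unfold beta at 2 4. rewrite resc_mass by trivial. fold beta.
    assert (Hrb : 0 < r * beta) by nra.
    destruct (resc_range m lam b beta u u1 (r * beta) Hb0 Hbe Hg Hrb) as [V1 V2].
    assert (Hrs : r * beta <= S1).
    { left. apply Rmult_lt_reg_r with (/ beta); [now apply Rinv_0_lt_compat | ].
      rewrite Rmult_assoc, Rinv_r, Rmult_1_r by lra. exact Hc. }
    rewrite <- (Rmult_1_r (S1 ^ m)). apply Rmult_le_compat; try lra.
    + apply pow_le; lra.
    + apply pow_incr; lra.
Qed.

(** The bound [s^m x <= C], raised to the power [4/m], is a decay like [s^(-4)], the weight that
    [radial_gronwall] requires; near 0 the bound [x <= 1] is used. *)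
Lemma decay_potential (m : nat) (C s x : R) :
  (3 <= m)%nat -> 1 <= C -> 0 < s -> 0 < x <= 1 -> s ^ m * x <= C ->
  Rpower x (4 / INR m) <= 4 * C ^ 2 / (1 + s ^ 2) ^ 2.
Proof.
  intros Hm HC Hs Hx Hsx. assert (HM := INR_ge3 m Hm).
  assert (Hsg : 0 < 4 / INR m) by (apply Rdiv_lt_0_compat; lra).
  assert (H1s : 0 < (1 + s ^ 2) ^ 2) by (apply pow_lt; nra).
  apply Rmult_le_reg_r with ((1 + s ^ 2) ^ 2); trivial.
  unfold Rdiv at 2. rewrite Rmult_assoc, Rinv_l, Rmult_1_r by lra.
  destruct (Rle_lt_dec s 1) as [H1 | H1].
  - assert (Hp1 := Rpower_le1 x (4 / INR m) Hx (Rlt_le _ _ Hsg)).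
    assert ((1 + s ^ 2) ^ 2 <= 4).
    { replace 4 with (2 ^ 2) by ring. apply pow_incr. nra. }
    assert (1 <= C ^ 2) by nra. nra.
  - assert (Hsm : 0 < s ^ m) by (apply pow_lt; lra).
    assert (E1 : s ^ 4 * Rpower x (4 / INR m) <= C ^ 2).
    { replace (s ^ 4) with (Rpower (s ^ m) (4 / INR m)).
      - rewrite Rpower_mult_distr by lra.
        apply Rle_trans with (Rpower C (4 / INR m)); [apply Rle_Rpower_l; [lra | nra] | ].
        rewrite <- (Rpower_pow 2) by lra. apply Rle_Rpower; trivial. simpl.
        apply Rmult_le_reg_r with (INR m); [lra | ]. unfold Rdiv. rewrite Rmult_assoc, Rinv_l; lra.
      - rewrite <- (Rpower_pow m) by lra. rewrite Rpower_mult.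
        replace (INR m * (4 / INR m)) with (INR 4) by (simpl; field; lra). apply Rpower_pow. lra. }
    assert ((1 + s ^ 2) ^ 2 <= 4 * s ^ 4).
    { replace (4 * s ^ 4) with ((2 * s ^ 2) ^ 2) by ring. apply pow_incr. nra. }
    nra.
Qed.

(** The second, uniform run of Gronwall: with the mass bound, [K] does not depend on the window,
    which can extend up to [beta/(m+2)]. *)
Lemma inner_estimate (m : nat) :
  (3 <= m)%nat ->
  exists C B, 0 < C /\ 1 <= B /\ forall b lam u u1, B <= b -> gstate m lam b u u1 ->
    let beta := Rpower b (2 / INR m) in
    forall s, 0 < s <= beta / (INR m + 2) ->
      Rabs (resc b beta u s - bubble m s) <= C / beta ^ 2 * (1 + s ^ 2).
Proof.
  intros Hm. assert (HM := INR_ge3 m Hm).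
  destruct (mass_bound_near m Hm) as [C [B [HC [HB H]]]].
  set (A0 := bubble_lim m). assert (HA0 : 0 < A0) by apply Rpower_pos.
  set (C1 := C + A0). set (K := 4 * C1 ^ 2).
  assert (HK : 0 < K) by (unfold K, C1; nra).
  set (E := exp ((4 / INR m + 1) * K / 4)). assert (HE : 0 < E) by apply exp_pos.
  exists (E * (INR m + 3)), B. split; [nra | split; trivial].
  intros b lam u u1 Hb Hg beta s Hs. assert (Hb0 : 0 < b) by lra.
  assert (Hbe : 0 < beta) by apply Rpower_pos.
  assert (Hc : Rabs (resc b beta u s - bubble m s) <= E / beta ^ 2 * (1 + (INR m + 3) * s ^ 2)).
  { apply (inner_compare m lam b K (beta / (INR m + 2)) u u1); trivial.
    - fold beta. apply pow_incr. split; [apply Rdiv_le_0_compat; lra | ].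
      apply Rmult_le_reg_r with (INR m + 2); [lra | ]. unfold Rdiv. rewrite Rmult_assoc, Rinv_l by lra. nra.
    - fold beta. intros t Ht. split; apply decay_potential; trivial; try (unfold C1; lra).
      + apply (resc_range m lam b beta u u1); trivial; lra.
      + unfold beta. rewrite <- resc_mass by trivial. fold beta. apply Rle_trans with C; [ | unfold C1; lra].
        apply (H b lam u u1); trivial. split; [apply Rdiv_lt_0_compat; lra | ].
        apply Rmult_le_reg_r with beta; trivial. unfold Rdiv. rewrite Rmult_assoc, Rinv_l by lra.
        unfold Rdiv in Ht. lra.
      + split; [apply bubble_pos | now apply bubble_le1].
      + apply Rle_trans with A0; [apply bubble_tail_le; trivial; lra | unfold C1; lra]. }
  apply Rle_trans with (1 := Hc).
  replace (E * (INR m + 3) / beta ^ 2 * (1 + s ^ 2)) with (E / beta ^ 2 * ((INR m + 3) * (1 + s ^ 2))) by (unfold Rdiv; ring).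
  apply Rmult_le_compat_l; [left; apply Rdiv_lt_0_compat; [lra | apply pow_lt; trivial] | nra].
Qed.

Lemma beta_ge1 (m : nat) (b : R) : (3 <= m)%nat -> 1 <= b -> 1 <= Rpower b (2 / INR m).
Proof.
  intros Hm Hb. assert (HM := INR_ge3 m Hm).
  apply Rle_trans with (Rpower b 0); [rewrite Rpower_O; lra | ].
  apply Rle_Rpower; [trivial | apply Rdiv_le_0_compat; lra].
Qed.

(** Up to [1/beta], closeness to the bubble lets [poho] gain an amount of order [lam beta^(-2)]. All
    losses are at most of order [beta^(-3)], as is the value of [poho] at some radius of order 1,
    because [b^(-2) = beta^(-m) <= beta^(-3)]. Comparing gives [lam beta^(-2) <= C beta^(-3)]. *)
Lemma lam_bound (m : nat) :
  (3 <= m)%nat ->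
  exists C B, 0 < C /\ 1 <= B /\ forall b lam u u1, B <= b -> gstate m lam b u u1 ->
    lam <= C / Rpower b (2 / INR m).
Proof.
  intros Hm. assert (HM := INR_ge3 m Hm).
  destruct (mass_bound_near m Hm) as [C [B1 [HC [HB1 Hmass]]]].
  set (q := bubble m 1). assert (Hq : 0 < q) by apply bubble_pos.
  assert (Hq2 : 0 < q / 2) by lra.
  destruct (inner_fixed m 1 (q / 2) Hm Rlt_0_1 Hq2) as [B2 [HB2 Hin]].
  set (r1 := / (INR m + 2)).
  assert (Hr1 : 0 < r1 <= / 2).
  { split; [apply Rinv_0_lt_compat | apply Rinv_le_contravar]; lra. }
  set (C2 := C / (r1 / 2) ^ m).
  assert (HP2 : 0 < (r1 / 2) ^ m) by (apply pow_lt; lra).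
  assert (HC2 : 0 < C2) by (apply Rdiv_lt_0_compat; lra).
  assert (Hy : 0 < 2 / INR m) by (apply Rdiv_lt_0_compat; lra).
  destruct (large_power (2 / INR m) (2 * (INR m + 2)) Hy) as [B3 [HB3 Hbig]].
  set (C3 := (2 / r1) ^ 2 * C2 ^ 2 + (INR m + 3) * C2 ^ 2).
  assert (HC3 : 0 < C3).
  { unfold C3. assert (0 < C2 ^ 2) by (apply pow_lt; trivial). generalize (pow2_ge_0 (2 / r1)). nra. }
  set (Cf := (INR m + 2) * 4 / q ^ 2 * (C3 + 2 * C ^ 2)).
  assert (HCf : 0 < Cf).
  { unfold Cf. apply Rmult_lt_0_compat; [apply Rdiv_lt_0_compat | ]; nra. }
  exists Cf, (B1 + B2 + B3 + C2). split; [trivial | split; [lra | ]].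
  intros b lam u u1 Hb Hg. assert (Hb0 : 0 < b) by lra.
  assert (Hb1 : B1 <= b) by lra. assert (Hb2 : B2 <= b) by lra. assert (Hb3 : B3 <= b) by lra.
  specialize (Hmass b lam u u1 Hb1 Hg). specialize (Hin b lam u u1 Hb2 Hg). specialize (Hbig b Hb3).
  assert (Hbeta1 := beta_ge1 m b Hm ltac:(lra)). assert (Hbm := Rpower_beta m b Hm Hb0).
  assert (Hl1 := gs_lam_pos m lam b u u1 Hm Hb0 Hg). assert (Hl2 := gs_lam_lt m lam b u u1 Hg).
  assert (HmassS := fun s => resc_mass m b u s Hm Hb0). cbv zeta in HmassS.
  set (beta := Rpower b (2 / INR m)) in *. fold r1 in Hmass.
  assert (Hpd := fun r => poho_derive m lam b u u1 r Hm Hg).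
  assert (Hp0 := poho_lim0 m lam b u u1 Hb0 Hg).
  assert (Hrange := fun s => resc_range m lam b beta u u1 s Hb0 ltac:(lra) Hg).
  destruct Hg as [Hs [Hu _]].
  set (H := poho m lam u u1) in *.
  (* Bounds [r^3 r^m u^2]: one factor [u] is estimated by [s^3 v <= C], where [m >= 3] enters, the
     other by the mass bound. *)
  set (e0 := C ^ 2 / beta ^ 3).
  assert (Hb3p : 0 < beta ^ 3) by (apply pow_lt; lra).
  assert (He0 : 0 < e0) by (apply Rdiv_lt_0_compat; [apply pow_lt | ]; lra).
  assert (Hr3 : forall r, 0 < r <= r1 -> r ^ 3 * r ^ m * u r ^ 2 <= e0).
  { intros r Hr. assert (Hr0 : 0 < r) by lra. destruct (Hu r Hr0) as [[A1 A2] _].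
    set (s := r * beta). assert (Hs0 : 0 < s) by (unfold s; nra).
    assert (Er : r = s / beta) by (unfold s; field; lra).
    destruct (Hrange s Hs0) as [V1 V2].
    assert (Hsm : s ^ m * resc b beta u s <= C).
    { rewrite <- HmassS, <- Er. now apply Hmass. }
    assert (Hs3 : s ^ 3 * resc b beta u s <= C).
    { destruct (Rle_lt_dec s 1) as [H1 | H1].
      - apply Rle_trans with (1 * 1); [ | lra]. apply Rmult_le_compat; try lra; [apply pow_le; lra | ].
        rewrite <- (pow1 3). apply pow_incr. lra.
      - apply Rle_trans with (2 := Hsm). apply Rmult_le_compat_r; [lra | ]. apply Rle_pow; [lra | trivial]. }
    assert (E1 : r ^ 3 * u r <= b * C / beta ^ 3).
    { replace (r ^ 3 * u r) with (b / beta ^ 3 * (s ^ 3 * resc b beta u s)).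
      - replace (b * C / beta ^ 3) with (b / beta ^ 3 * C) by (field; lra).
        apply Rmult_le_compat_l; [apply Rdiv_le_0_compat; lra | trivial].
      - unfold resc. rewrite <- Er. unfold s. field. lra. }
    assert (E2 : r ^ m * u r <= C / b).
    { apply Rmult_le_reg_l with b; trivial. replace (b * (C / b)) with C by (field; lra). now apply Hmass. }
    replace (r ^ 3 * r ^ m * u r ^ 2) with (r ^ 3 * u r * (r ^ m * u r)) by ring.
    apply Rle_trans with (b * C / beta ^ 3 * (C / b)).
    - apply Rmult_le_compat; trivial; apply Rmult_le_pos; try lra; apply pow_le; lra.
    - right. unfold e0. field. lra. }
  set (ra := / beta).
  assert (Hra : 0 < ra) by (apply Rinv_0_lt_compat; lra).
  assert (Hra1 : ra <= r1 / 2).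
  { unfold ra, r1. replace (/ (INR m + 2) / 2) with (/ (2 * (INR m + 2))) by (field; lra). apply Rinv_le_contravar; lra. }
  (* No bound on [u1] is available yet; the mean value theorem provides one at some point of a fixed
     interval. *)
  destruct (MVT_gen u (r1 / 2) r1 u1) as [rho [Hrho Hrho']].
  { rewrite Rmin_left, Rmax_right by lra. intros x Hx. apply Hs. lra. }
  { rewrite Rmin_left, Rmax_right by lra. intros x Hx.
    apply continuity_pt_filterlim, (is_derive_cont u x (u1 x)), Hs. lra. }
  rewrite Rmin_left, Rmax_right in Hrho by lra.
  assert (Hrho0 : 0 < rho) by lra.
  assert (Hu2 : forall x, r1 / 2 <= x <= r1 -> u x <= C2 / b).
  { intros x Hx. assert (Hx0 : 0 < x <= r1) by lra. specialize (Hmass x Hx0).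
    destruct (Hu x) as [[A1 _] _]; [lra | ].
    assert ((r1 / 2) ^ m <= x ^ m) by (apply pow_incr; lra).
    apply Rmult_le_reg_l with (b * (r1 / 2) ^ m); [nra | ].
    replace (b * (r1 / 2) ^ m * (C2 / b)) with C by (unfold C2; field; lra).
    apply Rle_trans with (2 := Hmass). rewrite Rmult_assoc. apply Rmult_le_compat_l; [lra | ]. apply Rmult_le_compat_r; lra. }
  assert (HHrho : H rho <= C3 / b ^ 2).
  { destruct (Hu rho Hrho0) as [[A1 _] A3]. destruct (Hu (r1 / 2)) as [[B4 _] _]; [lra | ]. destruct (Hu r1) as [[B5 _] _]; [lra | ].
    assert (U1 := Hu2 rho Hrho). assert (U2 : u (r1 / 2) <= C2 / b) by (apply Hu2; lra).
    assert (D1 : - u1 rho <= 2 / r1 * (C2 / b)).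
    { apply Rmult_le_reg_l with (r1 / 2); [lra | ]. replace (r1 / 2 * (2 / r1 * (C2 / b))) with (C2 / b) by (field; lra). nra. }
    assert (D2 : u1 rho ^ 2 <= (2 / r1) ^ 2 * C2 ^ 2 / b ^ 2).
    { replace ((2 / r1) ^ 2 * C2 ^ 2 / b ^ 2) with ((2 / r1 * (C2 / b)) ^ 2) by (field; lra).
      replace (u1 rho ^ 2) with ((- u1 rho) ^ 2) by ring. apply pow_incr. lra. }
    assert (D3 : u rho ^ 2 <= C2 ^ 2 / b ^ 2).
    { replace (C2 ^ 2 / b ^ 2) with ((C2 / b) ^ 2) by (field; lra). apply pow_incr. lra. }
    assert (HC2b : C2 / b <= 1).
    { apply Rmult_le_reg_r with b; trivial. unfold Rdiv. rewrite Rmult_assoc, Rinv_l; lra. }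
    assert (D4 : Rpower (u rho) (4 / INR m) <= 1) by (apply Rpower_le1; lra).
    assert (D4' := Rpower_pos (u rho) (4 / INR m)).
    assert (HPr : 0 < rho ^ m <= 1).
    { split; [apply pow_lt; lra | ]. rewrite <- (pow1 m). apply pow_incr. lra. }
    assert (Hrho2 : 0 < rho ^ 2 <= 1) by nra.
    assert (D5 : Rpower (u rho) (4 / INR m) * u rho ^ 2 / (4 / INR m + 2) <= u rho ^ 2).
    { assert (0 <= u rho ^ 2) by apply pow2_ge_0.
      apply Rmult_le_reg_r with (4 / INR m + 2); [lra | ]. unfold Rdiv at 1. rewrite Rmult_assoc, Rinv_l by lra.
      rewrite Rmult_1_r. nra. }
    assert (D6 : u1 rho ^ 2 / 2 + Rpower (u rho) (4 / INR m) * u rho ^ 2 / (4 / INR m + 2)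
       + (lam - rho ^ 2) * u rho ^ 2 / 2 <= C3 / b ^ 2).
    { assert (0 <= u rho ^ 2) by apply pow2_ge_0. assert (0 <= u1 rho ^ 2) by apply pow2_ge_0.
      replace (C3 / b ^ 2) with ((2 / r1) ^ 2 * C2 ^ 2 / b ^ 2 + (INR m + 3) * (C2 ^ 2 / b ^ 2)) by (unfold C3; field; lra).
      assert ((lam - rho ^ 2) * u rho ^ 2 <= (INR m + 2) * u rho ^ 2) by (apply Rmult_le_compat_r; lra).
      assert ((INR m + 3) * u rho ^ 2 <= (INR m + 3) * (C2 ^ 2 / b ^ 2)) by (apply Rmult_le_compat_l; lra).
      assert (0 <= INR m * u rho ^ 2) by (apply Rmult_le_pos; lra).
      lra. }
    unfold H, poho.
    assert (D7 : INR m / 2 * (rho * rho ^ m * u rho * u1 rho) <= 0).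
    { assert (0 <= rho * rho ^ m * u rho) by (apply Rmult_le_pos; nra).
      assert (rho * rho ^ m * u rho * u1 rho <= 0) by nra. nra. }
    assert (D8 : 0 <= C3 / b ^ 2) by (apply Rdiv_le_0_compat; nra).
    assert (D9 : 0 < rho ^ 2 * rho ^ m <= 1) by nra.
    set (X := u1 rho ^ 2 / 2 + Rpower (u rho) (4 / INR m) * u rho ^ 2 / (4 / INR m + 2)
       + (lam - rho ^ 2) * u rho ^ 2 / 2) in *.
    assert (rho ^ 2 * rho ^ m * X <= rho ^ 2 * rho ^ m * (C3 / b ^ 2)) by (apply Rmult_le_compat_l; lra).
    assert (rho ^ 2 * rho ^ m * (C3 / b ^ 2) <= C3 / b ^ 2) by nra. lra. }
  assert (Hdn : forall x, 0 < x <= r1 -> - (2 * e0) <= x * x ^ m * (lam - 2 * x ^ 2) * u x ^ 2).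
  { intros x Hx. specialize (Hr3 x Hx). assert (0 < x ^ m) by (apply pow_lt; lra).
    assert (0 <= x * x ^ m * u x ^ 2) by (apply Rmult_le_pos; [nra | apply pow2_ge_0]). nra. }
  assert (Hinner : forall x, 0 < x <= ra -> b * (q / 2) <= u x).
  { intros x Hx. set (s := x * beta). assert (Hs1 : 0 < s <= 1).
    { unfold s. split; [nra | ]. apply Rmult_le_reg_r with (/ beta); [apply Rinv_0_lt_compat; lra | ].
      rewrite Rmult_assoc, Rinv_r by lra. unfold ra in Hx. lra. }
    specialize (Hin s Hs1). apply Rabs_le_between in Hin.
    assert (q <= bubble m s) by (apply bubble_decr; trivial; lra).
    replace (u x) with (b * resc b beta u s).
    - apply Rmult_le_compat_l; lra.
    - unfold resc, s. replace (x * beta / beta) with x by (field; lra). field. lra. }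
  set (G := fun x => lam * b ^ 2 * (q / 2) ^ 2 * (x ^ 2 * x ^ m) / (INR m + 2) - 2 * e0 * x).
  set (G1 := fun x => lam * b ^ 2 * (q / 2) ^ 2 * (x * x ^ m) - 2 * e0).
  assert (HGd : forall x, 0 < x -> is_derive G x (G1 x)).
  { intros x Hx. unfold G, G1. auto_derive; trivial. rewrite pow_pred by lra. field. lra. }
  assert (HHra : G ra <= H ra).
  { assert (0 <= H ra - G ra); [ | lra].
    eapply (derive_incr_lim0 (fun x => H x - G x)); [exact Hra | | | ].
    - intros x Hx. apply (is_derive_minus H G); [apply Hpd; lra | apply HGd; lra].
    - intros x Hx. cbv [minus plus opp]; simpl. unfold G1.
      assert (Hx1 : 0 < x <= r1) by lra. specialize (Hr3 x Hx1). specialize (Hinner x Hx).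
      assert (0 < x ^ m) by (apply pow_lt; lra).
      assert (b ^ 2 * (q / 2) ^ 2 <= u x ^ 2).
      { replace (b ^ 2 * (q / 2) ^ 2) with ((b * (q / 2)) ^ 2) by ring. apply pow_incr. nra. }
      assert (lam * (x * x ^ m) * (b ^ 2 * (q / 2) ^ 2) <= lam * (x * x ^ m) * u x ^ 2).
      { apply Rmult_le_compat_l; [apply Rmult_le_pos; nra | trivial]. }
      simpl in *. lra.
    - apply flim_val with (0 - (lam * b ^ 2 * (q / 2) ^ 2 * (0 ^ 2 * 0 ^ m) * / (INR m + 2) - 2 * e0 * 0)); [ | ring].
      unfold G. unfold Rdiv. flims. }
  assert (HHr : H ra - H rho <= 2 * e0 * r1).
  { assert (H ra - - (2 * e0) * ra <= H rho - - (2 * e0) * rho); [ | nra].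
    eapply (derive_incr (fun x => H x - - (2 * e0) * x)); [lra | | ].
    - intros x Hx. apply (is_derive_minus H (fun x => - (2 * e0) * x)); [apply Hpd; lra | ].
      eapply is_derive_val; [auto_derive; trivial | ]. reflexivity.
    - intros x Hx. cbv [minus plus opp]; simpl. assert (Hx1 : 0 < x <= r1) by lra. specialize (Hdn x Hx1). simpl in Hdn. lra. }
  assert (HG : G ra = lam * q ^ 2 / (4 * (INR m + 2) * beta ^ 2) - 2 * e0 * ra).
  { unfold G. f_equal. unfold ra at 2. rewrite pow_inv, Hbm. unfold ra. field. repeat split; lra. }
  rewrite HG in HHra.
  assert (Hb23 : C3 / b ^ 2 <= C3 / beta ^ 3).
  { apply Rmult_le_compat_l; [lra | ]. apply Rinv_le_contravar; trivial. rewrite <- Hbm. now apply Rle_pow. }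
  assert (Hfin : lam * q ^ 2 / (4 * (INR m + 2) * beta ^ 2) <= (C3 + 2 * C ^ 2) / beta ^ 3).
  { replace ((C3 + 2 * C ^ 2) / beta ^ 3) with (C3 / beta ^ 3 + 2 * e0) by (unfold e0; field; lra). nra. }
  apply Rmult_le_reg_l with (q ^ 2 / (4 * (INR m + 2) * beta ^ 2)).
  { apply Rdiv_lt_0_compat; nra. }
  replace (q ^ 2 / (4 * (INR m + 2) * beta ^ 2) * (Cf / beta)) with ((C3 + 2 * C ^ 2) / beta ^ 3)
    by (unfold Cf; field; repeat split; lra).
  unfold Rdiv in *. lra.
Qed.

(** Beyond [1/(m+2)] the power [u^(2p)] is at most 1, and [lam <= 1] by [lam_bound]. So
    [u exp(r^2/2)] decreases by [gs_gauss_decr], and the bound at [1/(m+2)] propagates. *)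
Lemma mass_bound (m : nat) :
  (3 <= m)%nat ->
  exists C B, 1 <= C /\ 1 <= B /\ forall b lam u u1, B <= b -> gstate m lam b u u1 ->
    lam <= 2 /\ forall r, 0 < r -> b * (r ^ m * u r) <= C.
Proof.
  intros Hm. assert (HM := INR_ge3 m Hm).
  destruct (mass_bound_near m Hm) as [C [B1 [HC [HB1 Hmass]]]].
  destruct (lam_bound m Hm) as [Cl [B2 [HCl [HB2 Hlam]]]].
  set (r1 := / (INR m + 2)).
  assert (Hr1 : 0 < r1 <= / 2).
  { split; [apply Rinv_0_lt_compat | apply Rinv_le_contravar]; lra. }
  assert (HP : 0 < r1 ^ m) by (apply pow_lt; lra).
  destruct (gauss_pow_bound m) as [Cg [HCg Hgauss]].
  set (C2 := C / r1 ^ m). assert (HC2 : 0 < C2) by (apply Rdiv_lt_0_compat; lra).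
  assert (Hy : 0 < 2 / INR m) by (apply Rdiv_lt_0_compat; lra).
  destruct (large_power (2 / INR m) Cl Hy) as [B3 [HB3 Hbig]].
  assert (HCe : 0 < Cg * (C2 * exp 1)) by (apply Rmult_lt_0_compat; [lra | apply Rmult_lt_0_compat; [lra | apply exp_pos]]).
  exists (C + Cg * (C2 * exp 1)), (B1 + B2 + B3 + C2). split; [lra | split; [lra | ]].
  intros b lam u u1 Hb Hg. assert (Hb0 : 0 < b) by lra.
  assert (Hb1 : B1 <= b) by lra. assert (Hb2 : B2 <= b) by lra. assert (Hb3 : B3 <= b) by lra.
  specialize (Hmass b lam u u1 Hb1 Hg). specialize (Hlam b lam u u1 Hb2 Hg). specialize (Hbig b Hb3).
  fold r1 in Hmass.
  assert (Hl : lam <= 1).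
  { apply Rle_trans with (1 := Hlam). apply Rmult_le_reg_r with (Rpower b (2 / INR m)); [apply Rpower_pos | ].
    unfold Rdiv at 1. rewrite Rmult_assoc, Rinv_l by (apply Rgt_not_eq, Rpower_pos). lra. }
  split; [lra | ]. intros r Hr.
  destruct (Rle_lt_dec r r1) as [Hc | Hc]; [specialize (Hmass r (conj Hr Hc)); lra | ].
  assert (Hu := proj1 (proj2 Hg)).
  assert (Hur1 : u r1 <= C2 / b).
  { assert (H := Hmass r1 ltac:(lra)). apply Rmult_le_reg_l with (b * r1 ^ m); [nra | ].
    replace (b * r1 ^ m * (C2 / b)) with C by (unfold C2; field; lra). lra. }
  assert (HC2b : C2 / b <= 1).
  { apply Rmult_le_reg_r with b; trivial. unfold Rdiv. rewrite Rmult_assoc, Rinv_l; lra. }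
  assert (Hgd : u r * exp (r ^ 2 / 2) <= u r1 * exp (r1 ^ 2 / 2)).
  { apply (gs_gauss_decr m lam b u u1); trivial; try lra.
    intros x Hx. apply Rle_trans with 1; [ | lra]. assert (Hx0 : 0 < x) by lra.
    destruct (Hu x Hx0) as [[A1 _] _].
    assert (u x <= u r1).
    { eapply (derive_decr u u1); trivial.
      - intros y Hy0. apply (proj1 Hg). lra.
      - intros y Hy0. left. apply Hu. lra. }
    apply Rpower_le1; [lra | apply Rdiv_le_0_compat; lra]. }
  assert (Hu2 : u r * exp (r ^ 2 / 2) <= C2 / b * exp 1).
  { apply Rle_trans with (1 := Hgd). destruct (Hu r1) as [[A1 _] _]; [lra | ].
    apply Rmult_le_compat; try lra; [left; apply exp_pos | ]. apply exp_le_compat. nra. }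
  specialize (Hgauss r (Rlt_le _ _ Hr)).
  assert (Hgg : exp (r ^ 2 / 2) * exp (- (r ^ 2) / 2) = 1).
  { rewrite <- exp_plus. replace (r ^ 2 / 2 + - r ^ 2 / 2) with 0 by field. apply exp_0. }
  apply Rle_trans with (Cg * (C2 * exp 1)); [ | lra].
  replace (b * (r ^ m * u r)) with ((r ^ m * exp (- (r ^ 2) / 2)) * (b * (u r * exp (r ^ 2 / 2))))
    by (replace (r ^ m * exp (- r ^ 2 / 2) * (b * (u r * exp (r ^ 2 / 2)))) with
         (b * (r ^ m * u r) * (exp (r ^ 2 / 2) * exp (- (r ^ 2) / 2))) by ring; rewrite Hgg; ring).
  destruct (Hu r Hr) as [[A1 _] _].
  apply Rmult_le_compat; trivial.
  - apply Rmult_le_pos; [apply pow_le; lra | left; apply exp_pos].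
  - apply Rmult_le_pos; [lra | ]. apply Rmult_le_pos; [lra | left; apply exp_pos].
  - replace (C2 * exp 1) with (b * (C2 / b * exp 1)) by (field; lra). apply Rmult_le_compat_l; lra.
Qed.

(** This provides the constant [kap] of [gs_ratio_quant], of order [beta^(-2)]. *)
Lemma potential_bound (m : nat) (b C r x : R) :
  (3 <= m)%nat -> 0 < b -> 1 <= C -> 0 < r -> 0 < x -> b * (r ^ m * x) <= C ->
  r ^ 4 * Rpower x (4 / INR m) <= C ^ 2 / Rpower b (2 / INR m) ^ 2.
Proof.
  intros Hm Hb HC Hr Hx H. assert (HM := INR_ge3 m Hm).
  assert (Hrm : 0 < r ^ m) by (apply pow_lt; lra).
  assert (Hsg : 0 < 4 / INR m) by (apply Rdiv_lt_0_compat; lra).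
  apply Rmult_le_reg_l with (Rpower b (2 / INR m) ^ 2); [apply pow_lt, Rpower_pos | ].
  assert (Hne := Rpower_pos b (2 / INR m)).
  replace (Rpower b (2 / INR m) ^ 2 * (C ^ 2 / Rpower b (2 / INR m) ^ 2)) with (C ^ 2) by (field; lra).
  replace (Rpower b (2 / INR m) ^ 2) with (Rpower b (4 / INR m)).
  - replace (r ^ 4) with (Rpower (r ^ m) (4 / INR m)).
    + rewrite Rpower_mult_distr, Rpower_mult_distr by nra.
      apply Rle_trans with (Rpower C (4 / INR m)); [apply Rle_Rpower_l; [lra | split; [repeat apply Rmult_lt_0_compat | ]; trivial] | ].
      rewrite <- (Rpower_pow 2) by lra. apply Rle_Rpower; trivial. simpl.
      apply Rmult_le_reg_r with (INR m); [lra | ]. unfold Rdiv. rewrite Rmult_assoc, Rinv_l; lra.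
    + rewrite <- (Rpower_pow m) by lra. rewrite Rpower_mult.
      replace (INR m * (4 / INR m)) with (INR 4) by (simpl; field; lra). apply Rpower_pow. lra.
  - rewrite <- (Rpower_pow 2) by apply Rpower_pos. rewrite Rpower_mult. f_equal. simpl. field. lra.
Qed.

Definition outer_family (m : nat) (Phi : R -> R -> R) : Prop :=
  forall lam, 0 <= lam < INR m + 2 -> exists phi1, outer m lam (Phi lam) phi1.

(* [J = - r u' - (m + A r^2) u] satisfies [r J' >= A r^2 J], so its sign at 1 propagates to 0. *)
Lemma slope_bound (m : nat) (Phi : R -> R -> R) :
  (3 <= m)%nat -> outer_family m Phi ->
  exists A B, 1 <= A /\ 1 <= B /\ forall b lam u u1, B <= b -> gstate m lam b u u1 ->
    forall r, 0 < r <= 1 -> - (r * u1 r) <= (INR m + A * r ^ 2) * u r.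
Proof.
  intros Hm HPhi. assert (HM := INR_ge3 m Hm).
  destruct (mass_bound m Hm) as [C [B [HC [HB Hmass]]]].
  set (A := 1 + (INR m + 2) / 2 + 2 * (INR m + 2) ^ 2).
  assert (HA : 1 <= A) by (unfold A; nra).
  exists A, B. split; [trivial | split; trivial].
  intros b lam u u1 Hb Hg. assert (Hb0 : 0 < b) by lra.
  destruct (Hmass b lam u u1 Hb Hg) as [Hl2 _].
  assert (Hl1 := gs_lam_pos m lam b u u1 Hm Hb0 Hg).
  destruct (HPhi lam) as [phi1 Ho]; [lra | ]. set (phi := Phi lam) in *.
  assert (Hu := proj1 (proj2 Hg)). assert (Hs := proj1 Hg).
  assert (Hp := fun r => outer_pos _ _ _ _ r Ho).
  (* At [r = 1] the nonnegative Wronskian with [phi] reads [- u1/u <= - phi1/phi], and [outer]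
     bounds the right side uniformly in [lam]. *)
  assert (H1 : - u1 1 <= A * u 1).
  { assert (Hl : 0 <= lam < INR m + 2) by lra.
    destruct (wronsk_outer m lam _ u u1 phi phi1 Ho Hl Hs (gs_potential_le m lam b u u1 Hg) (proj2 (proj2 (proj2 (proj2 Hg))))) as [HW _].
    specialize (HW 1 Rlt_0_1). unfold wronsk in HW. rewrite pow1 in HW.
    destruct Ho as [_ [_ [_ [_ Ho]]]]. destruct (Ho ltac:(lra) 1 Rlt_0_1) as [_ Ho1].
    specialize (Hp 1 Rlt_0_1). destruct (Hu 1 Rlt_0_1) as [[A1 _] _].
    apply Rmult_le_reg_r with (phi 1); trivial.
    apply Rle_trans with (u 1 * - phi1 1); [lra | ].
    rewrite (Rmult_comm A), Rmult_assoc. apply Rmult_le_compat_l; [lra | ].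
    assert (E1 : 1 ^ 2 + (INR m + 2 - lam) / 2 + 2 * (INR m + 2) ^ 2 / 1 ^ 2 <= A).
    { unfold A. replace (2 * (INR m + 2) ^ 2 / 1 ^ 2) with (2 * (INR m + 2) ^ 2) by field. lra. }
    nra. }
  intros r Hr.
  set (J := fun r => - (r * u1 r) - (INR m + A * r ^ 2) * u r).
  set (N := fun r => A * (INR m - 2) + A ^ 2 * r ^ 2 - r ^ 2 + lam + Rpower (u r) (4 / INR m)).
  assert (HJ : J r * exp (- (A * r ^ 2 / 2)) <= J 1 * exp (- (A * 1 ^ 2 / 2))).
  { apply (derive_incr (fun r => J r * exp (- (A * r ^ 2 / 2))) (fun r => exp (- (A * r ^ 2 / 2)) * (r * N r * u r))); [lra | | ].
    - intros x Hx. assert (Hx0 : 0 < x) by lra. destruct (Hs x Hx0) as [D0 D1].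
      unfold J, N. auto_derive; [dsolve | ]. drw D0; drw D1.
      replace (x * (x * 1)) with (x ^ 2) by ring.
      replace (A * x ^ 2 * / 2) with (A * x ^ 2 / 2) by reflexivity. field. lra.
    - intros x Hx. assert (Hx0 : 0 < x) by lra. destruct (Hu x Hx0) as [[A1 _] _].
      assert (Hk := Rpower_pos (u x) (4 / INR m)).
      apply Rmult_le_pos; [left; apply exp_pos | ]. apply Rmult_le_pos; [ | lra].
      apply Rmult_le_pos; [lra | ]. unfold N.
      assert (0 <= A ^ 2 * x ^ 2 - x ^ 2) by (assert (1 <= A ^ 2) by nra; assert (0 <= x ^ 2) by nra; nra).
      nra. }
  assert (HJ1 : J 1 <= 0).
  { unfold J. destruct (Hu 1 Rlt_0_1) as [[A1 _] _]. nra. }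
  assert (He := exp_pos (- (A * r ^ 2 / 2))). assert (He1 := exp_pos (- (A * 1 ^ 2 / 2))).
  assert (J r <= 0) by nra. unfold J in H. lra.
Qed.

(** The upper bound is that of [match_region]. For the lower one, [slope_bound] says that
    [r^m u exp(A r^2/2)] increases, so what is known at a fixed large [S2], where the bubble is
    already close to its tail, is kept further out; [del] makes the exponentials harmless. *)
Lemma uniform_ratio (m : nat) (Phi : R -> R -> R) (eta : R) :
  (3 <= m)%nat -> outer_family m Phi -> 0 < eta <= 1 / 2 ->
  exists del B, 0 < del <= / (INR m + 2) /\ 1 <= B /\
    forall b lam u u1, B <= b -> gstate m lam b u u1 ->
    let beta := Rpower b (2 / INR m) in
    forall s, 0 < s <= del * beta ->
      (1 - eta) * bubble m s <= resc b beta u s <= (1 + eta) * bubble m s.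
Proof.
  intros Hm HPhi Heta. assert (HM := INR_ge3 m Hm).
  (* The bounds below multiply several factors such as [1 - e], [1 + e] and [exp (2 * e)], and
     [eta / 8] absorbs them. *)
  set (e := eta / 8). assert (He : 0 < e <= 1 / 16) by (unfold e; lra).
  assert (He2 : 0 < e <= 1 / 2) by lra.
  destruct (match_region m e Hm He2) as [S1 [B1 [HS1 [HB1 Hup]]]].
  destruct (slope_bound m Phi Hm HPhi) as [A [B2 [HA [HB2 Hslope]]]].
  set (A0 := bubble_lim m) in *. assert (HA0 : 0 < A0) by apply Rpower_pos.
  assert (HQ := bubble_tail_lim m Hm).
  apply flim_eps with (eps := e * A0) in HQ; [ | typeclasses eauto | nra].
  destruct (infty_elim _ S1 HQ) as [S2 [HS2 HQ2]]. clear HQ. fold A0 in HQ2.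
  assert (HS20 : 0 < S2) by lra.
  assert (HQS2 := bubble_pos m S2).
  destruct (inner_fixed m S2 (e * bubble m S2) Hm HS20 ltac:(nra)) as [B3 [HB3 Hin]].
  set (del := e / (A * (INR m + 2))).
  assert (HAm : 0 < A * (INR m + 2)) by nra.
  assert (Hdel : 0 < del) by (apply Rdiv_lt_0_compat; lra).
  assert (Hdel1 : A * (INR m + 2) * del = e) by (unfold del; field; lra).
  assert (Hdel2 : del <= / (INR m + 2)).
  { apply Rmult_le_reg_r with (INR m + 2); [lra | ]. rewrite Rinv_l by lra. nra. }
  assert (Hdel3 : del <= 1).
  { apply Rle_trans with (1 := Hdel2). rewrite <- Rinv_1. apply Rinv_le_contravar; lra. }
  exists del, (B1 + B2 + B3). split; [lra | split; [lra | ]].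
  intros b lam u u1 Hb Hg beta s Hs. assert (Hb0 : 0 < b) by lra.
  assert (Hb1 : B1 <= b) by lra. assert (Hb2 : B2 <= b) by lra. assert (Hb3 : B3 <= b) by lra.
  destruct (Hup b lam u u1 Hb1 Hg) as [_ [_ HU]]. specialize (Hslope b lam u u1 Hb2 Hg).
  specialize (Hin b lam u u1 Hb3 Hg).
  assert (HmassS := fun s => resc_mass m b u s Hm Hb0). cbv zeta in HmassS.
  fold beta in HU, Hin, HmassS. assert (Hbe : 0 < beta) by apply Rpower_pos.
  set (v := resc b beta u) in *.
  destruct (Rle_lt_dec s S2) as [Hc | Hc].
  - assert (H1 := Hin s ltac:(lra)). apply Rabs_le_between in H1.
    assert (bubble m S2 <= bubble m s) by (apply bubble_decr; trivial; lra). unfold e in *. nra.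
  - assert (Hsm : 0 < s ^ m) by (apply pow_lt; lra).
    assert (HQl : (1 - e) * A0 <= s ^ m * bubble m s).
    { assert (H1 := HQ2 s ltac:(lra)). apply Rabs_def2 in H1. lra. }
    assert (HQu := bubble_tail_le m s Hm ltac:(lra)). fold A0 in HQu.
    assert (Hrd : s / beta <= del).
    { apply Rmult_le_reg_r with beta; trivial. unfold Rdiv. rewrite Rmult_assoc, Rinv_l; lra. }
    assert (Hr0 : 0 < s / beta) by (apply Rdiv_lt_0_compat; lra).
    assert (Hr2 : (s / beta) ^ 2 <= del ^ 2) by (apply pow_incr; lra).
    split.
    + assert (HV2 : (1 - e) * bubble m S2 <= v S2).
      { assert (H1 := Hin S2 ltac:(lra)). apply Rabs_le_between in H1. lra. }
      assert (Hinc : (S2 / beta) ^ m * u (S2 / beta) * exp (A * (S2 / beta) ^ 2 / 2) <= (s / beta) ^ m * u (s / beta) * exp (A * (s / beta) ^ 2 / 2)).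
      { apply (derive_incr (fun r => r ^ m * u r * exp (A * r ^ 2 / 2)) (fun r => exp (A * r ^ 2 / 2) * (r ^ m / r) * ((INR m + A * r ^ 2) * u r + r * u1 r))).
        - apply Rmult_le_compat_r; [left; now apply Rinv_0_lt_compat | lra].
        - intros x Hx. assert (Hx0 : 0 < x). { assert (0 < S2 / beta) by (apply Rdiv_lt_0_compat; lra). lra. }
          destruct (proj1 Hg x Hx0) as [D0 _].
          auto_derive; [dsolve | ]. drw D0. rewrite pow_pred by lra.
          replace (x * (x * 1)) with (x ^ 2) by ring.
          replace (A * x ^ 2 * / 2) with (A * x ^ 2 / 2) by reflexivity. field. lra.
        - intros x Hx. assert (Hx0 : 0 < x). { assert (0 < S2 / beta) by (apply Rdiv_lt_0_compat; lra). lra. }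
          assert (Hx1 : x <= 1) by lra. specialize (Hslope x (conj Hx0 Hx1)).
          apply Rmult_le_pos; [apply Rmult_le_pos; [left; apply exp_pos | ] | lra].
          apply Rdiv_le_0_compat; [apply pow_le; lra | lra]. }
      assert (E1 : S2 ^ m * v S2 <= s ^ m * v s * exp e).
      { rewrite <- !HmassS.
        assert (HP2 : 0 < (S2 / beta) ^ m) by (apply pow_lt, Rdiv_lt_0_compat; lra).
        assert (HP3 : 0 < (s / beta) ^ m) by (apply pow_lt; trivial).
        destruct (proj1 (proj2 Hg) (S2 / beta)) as [[A1 _] _]; [apply Rdiv_lt_0_compat; lra | ].
        destruct (proj1 (proj2 Hg) (s / beta) Hr0) as [[A2 _] _].
        rewrite Rmult_assoc. apply Rmult_le_compat_l; [lra | ].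
        apply Rle_trans with ((S2 / beta) ^ m * u (S2 / beta) * exp (A * (S2 / beta) ^ 2 / 2)).
        - rewrite <- (Rmult_1_r ((S2 / beta) ^ m * u (S2 / beta))) at 1. apply Rmult_le_compat_l; [nra | ].
          rewrite <- exp_0. apply exp_le_compat. apply Rdiv_le_0_compat; [ | lra]. apply Rmult_le_pos; [lra | apply pow2_ge_0].
        - apply Rle_trans with (1 := Hinc). apply Rmult_le_compat_l; [nra | ]. apply exp_le_compat. nra. }
      assert (E2 : (1 - e) * A0 <= S2 ^ m * bubble m S2).
      { assert (H1 := HQ2 S2 ltac:(lra)). apply Rabs_def2 in H1. lra. }
      assert (HS2m : 0 < S2 ^ m) by (apply pow_lt; trivial).
      assert (E3 : (1 - e) ^ 2 * A0 <= s ^ m * v s * exp e).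
      { apply Rle_trans with (2 := E1). apply Rle_trans with (S2 ^ m * ((1 - e) * bubble m S2)); [nra | ].
        apply Rmult_le_compat_l; lra. }
      assert (E4 : (1 - e) * exp e <= 1).
      { assert (H1 := exp_ineq1_le (- e)). assert (H2 : exp (- e) * exp e = 1) by (rewrite <- exp_plus, Rplus_opp_l; apply exp_0).
        assert (H3 := exp_pos e). nra. }
      apply Rmult_le_reg_l with (s ^ m); trivial.
      assert (V0 : 0 <= s ^ m * v s).
      { apply Rmult_le_pos; [lra | ]. left. apply (resc_range m lam b beta u u1 s); trivial; lra. }
      assert (E5 : (1 - e) ^ 3 * A0 <= s ^ m * v s).
      { replace ((1 - e) ^ 3 * A0) with ((1 - e) * ((1 - e) ^ 2 * A0)) by ring.
        apply Rle_trans with ((1 - e) * (s ^ m * v s * exp e)); [apply Rmult_le_compat_l; lra | nra]. }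
      assert (E6 : (1 - eta) * A0 <= (1 - e) ^ 3 * A0).
      { apply Rmult_le_compat_r; [lra | ]. unfold e in *. nra. }
      apply Rle_trans with ((1 - eta) * (s ^ m * bubble m s)); [right; ring | ].
      apply Rle_trans with ((1 - eta) * A0); [apply Rmult_le_compat_l | ]; lra.
    + assert (HU1 := HU (s / beta)). rewrite HmassS in HU1.
      assert (E1 : s ^ m * v s <= (1 + e) * A0 * exp (2 * e)).
      { eapply Rle_trans; [apply HU1; split | ].
        - apply Rmult_le_compat_r; [left; now apply Rinv_0_lt_compat | lra].
        - lra.
        - apply Rmult_le_compat_l; [nra | ]. apply exp_le_compat. nra. }
      assert (E2 : (1 - 2 * e) * exp (2 * e) <= 1).
      { assert (H1 := exp_ineq1_le (- (2 * e))). assert (H2 : exp (- (2 * e)) * exp (2 * e) = 1) by (rewrite <- exp_plus, Rplus_opp_l; apply exp_0).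
        assert (H3 := exp_pos (2 * e)). nra. }
      apply Rmult_le_reg_l with (s ^ m); trivial.
      apply Rle_trans with (1 := E1).
      apply Rle_trans with ((1 + eta) * ((1 - e) * A0)); [ | nra].
      replace ((1 + eta) * ((1 - e) * A0)) with ((1 + eta) * (1 - e) * A0) by ring.
      replace ((1 + e) * A0 * exp (2 * e)) with ((1 + e) * exp (2 * e) * A0) by ring.
      apply Rmult_le_compat_r; [lra | ].
      apply Rmult_le_reg_l with (1 - 2 * e); [lra | ].
      apply Rle_trans with ((1 + e) * 1).
      * replace ((1 - 2 * e) * ((1 + e) * exp (2 * e))) with ((1 + e) * ((1 - 2 * e) * exp (2 * e))) by ring.
        apply Rmult_le_compat_l; lra.
      * unfold e in *. nra.
Qed.

(** As [exp(r^2/2) r^k phi] tends to 1 in [outer], the limit of [u / phi] is the [c(b)] of the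
    theorem. *)
Definition coupling (m : nat) (lam b : R) (u u1 phi phi1 : R -> R) (c : R) : Prop :=
  gstate m lam b u u1 /\ outer m lam phi phi1 /\ 0 < c /\
  filterlim (fun r => u r / phi r) (Rbar_locally p_infty) (locally c) /\
  (forall r, 0 < r -> u r <= c * phi r).

(** The estimates are [gs_ratio_quant] with [kap] of order [beta^(-2)]. For [b c] from below, take
    [r = del]: there [b r^m u] is comparable with the tail of the bubble, while [u <= c phi] with
    [phi] bounded. From above, take [r = 1]: the relative error is at most 1/4, so [c phi <= 2 u],
    and [phi 1 >= exp(-1/2)]. *)
Lemma c_facts (m : nat) (Phi : R -> R -> R) :
  (3 <= m)%nat -> outer_family m Phi ->
  exists C B, 1 <= C /\ 1 <= B /\ forall b lam u u1 phi phi1 c, B <= b ->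
    coupling m lam b u u1 phi phi1 c ->
    lam <= 2 /\ / C <= b * c <= C /\
    forall r, 0 < r ->
      0 <= c * phi r - u r <= C / Rpower b (2 / INR m) ^ 2 * (c * phi r) / r ^ 2 /\
      0 <= r * u1 r * phi r - u r * (r * phi1 r) <= C / Rpower b (2 / INR m) ^ 2 * (c * phi r ^ 2) / r ^ 2 /\
      b * (r ^ m * u r) <= C.
Proof.
  intros Hm HPhi. assert (HM := INR_ge3 m Hm).
  destruct (mass_bound m Hm) as [C [B1 [HC [HB1 Hmass]]]].
  assert (Hh : 0 < 1 / 2 <= 1 / 2) by lra.
  destruct (uniform_ratio m Phi (1 / 2) Hm HPhi Hh) as [del [B2 [Hdel [HB2 Hun]]]].
  assert (Hdel1 : del <= 1).
  { apply Rle_trans with (1 := proj2 Hdel). rewrite <- Rinv_1. apply Rinv_le_contravar; lra. }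
  assert (Hy : 0 < 2 / INR m) by (apply Rdiv_lt_0_compat; lra).
  set (A0 := bubble_lim m). assert (HA0 : 0 < A0) by apply Rpower_pos.
  assert (HQ := bubble_tail_lim m Hm).
  apply flim_eps with (eps := A0 / 2) in HQ; [ | typeclasses eauto | lra].
  destruct (infty_elim _ 1 HQ) as [S2 [HS2 HQ2]]. clear HQ. fold A0 in HQ2.
  destruct (large_power (2 / INR m) (C + S2 / del) Hy) as [B3 [HB3 Hbig]].
  set (G := exp ((INR m + 2) ^ 2 / del ^ 2)). assert (HG : 0 < G) by apply exp_pos.
  (* As [del <= 1], this bounds [del^(-(m+2-lam)/2)] uniformly in [lam >= 0]. *)
  set (kk := Rpower del (- ((INR m + 2) / 2))).
  assert (Hkk : 0 < kk) by apply Rpower_pos.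
  set (C1 := C ^ 2 + 2 * C * exp (1 / 2) + 4 * G * kk / A0).
  assert (Ha1 : 0 < 2 * C * exp (1 / 2)) by (apply Rmult_lt_0_compat; [lra | apply exp_pos]).
  assert (Ha2 : 0 < 4 * G * kk / A0) by (apply Rdiv_lt_0_compat; [repeat apply Rmult_lt_0_compat; lra | trivial]).
  assert (HC1 : 1 <= C1) by (unfold C1; nra).
  assert (HCC1 : C <= C1 /\ C ^ 2 <= C1) by (unfold C1; nra).
  exists C1, (B1 + B2 + B3). split; [trivial | split; [lra | ]].
  intros b lam u u1 phi phi1 c Hb [Hg [Ho [Hc [Hlim Hle]]]].
  assert (Hb0 : 0 < b) by lra.
  assert (Hb1 : B1 <= b) by lra. assert (Hb2 : B2 <= b) by lra. assert (Hb3 : B3 <= b) by lra.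
  destruct (Hmass b lam u u1 Hb1 Hg) as [Hl2 Hmb]. specialize (Hun b lam u u1 Hb2 Hg). cbv zeta in Hun.
  specialize (Hbig b Hb3).
  assert (HmassS := fun s => resc_mass m b u s Hm Hb0). cbv zeta in HmassS.
  set (beta := Rpower b (2 / INR m)) in *. assert (Hbe : 0 < beta) by apply Rpower_pos.
  assert (Hl1 := gs_lam_pos m lam b u u1 Hm Hb0 Hg).
  assert (Hu := proj1 (proj2 Hg)).
  assert (Hp := fun r => outer_pos _ _ _ _ r Ho).
  assert (HSd : 0 < S2 / del) by (apply Rdiv_lt_0_compat; lra).
  set (kap := C ^ 2 / beta ^ 2).
  assert (Hkap0 : 0 <= kap).
  { apply Rdiv_le_0_compat; [nra | apply pow_lt; trivial]. }
  assert (Hkap1 : kap <= 1).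
  { unfold kap. apply Rmult_le_reg_r with (beta ^ 2); [apply pow_lt; trivial | ].
    unfold Rdiv. rewrite Rmult_assoc, Rinv_l by (apply pow_nonzero; lra). nra. }
  assert (Hq := gs_ratio_quant m lam b kap c u u1 phi phi1 Hm Hb0 Hg Ho Hl2 Hkap0
    (fun r Hr => potential_bound m b C r (u r) Hm Hb0 HC Hr (proj1 (proj1 (Hu r Hr))) (Hmb r Hr)) Hc Hlim Hle).
  assert (HkC : kap <= C1 / beta ^ 2).
  { apply Rmult_le_compat_r; [left; apply Rinv_0_lt_compat, pow_lt; trivial | lra]. }
  split; [trivial | split; [split | ]].
  - assert (Hdb : S2 <= del * beta).
    { apply Rle_trans with (del * (S2 / del)); [right; field; lra | apply Rmult_le_compat_l; lra]. }
    destruct (Hun (del * beta)) as [H1 _]; [split; [nra | lra] | ].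
    assert (H2 := HQ2 (del * beta) Hdb). apply Rabs_def2 in H2.
    assert (Hpm : 0 < (del * beta) ^ m) by (apply pow_lt; nra).
    assert (H3 : A0 / 4 <= b * (del ^ m * u del)).
    { replace del with (del * beta / beta) by (field; lra). rewrite HmassS.
      apply Rle_trans with ((del * beta) ^ m * ((1 - 1 / 2) * bubble m (del * beta))); [lra | ].
      apply Rmult_le_compat_l; lra. }
    assert (H4 : u del <= c * phi del) by (apply Hle; lra).
    assert (H5 : phi del <= G * kk).
    { destruct Ho as [_ [_ [_ [_ Ho]]]]. destruct (Ho ltac:(lra) del ltac:(lra)) as [Ho1 _]. fold G in Ho1.
      assert (P1 : 1 <= exp (del ^ 2 / 2)).
      { rewrite <- exp_0. apply exp_le_compat. apply Rdiv_le_0_compat; [apply pow2_ge_0 | lra]. }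
      assert (P2 : / kk <= Rpower del ((INR m + 2 - lam) / 2)).
      { unfold kk. rewrite <- Rpower_Ropp, Ropp_involutive.
        replace (Rpower del ((INR m + 2) / 2)) with (Rpower del ((INR m + 2 - lam) / 2) * Rpower del (lam / 2))
          by (rewrite <- Rpower_plus; f_equal; field).
        assert (Rpower del (lam / 2) <= 1) by (apply Rpower_le1; lra).
        assert (P3 := Rpower_pos del ((INR m + 2 - lam) / 2)). nra. }
      assert (P4 : 0 < / kk) by now apply Rinv_0_lt_compat.
      specialize (Hp del ltac:(lra)).
      apply Rmult_le_reg_l with (/ kk); trivial.
      replace (/ kk * (G * kk)) with G by (field; lra).
      apply Rle_trans with (2 := Ho1). apply Rmult_le_compat_r; [lra | ]. nra. }
    assert (Hd1 : 0 < del ^ m <= 1).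
    { split; [apply pow_lt; lra | ]. rewrite <- (pow1 m). apply pow_incr. lra. }
    assert (H6 : A0 / 4 <= b * c * (G * kk)).
    { apply Rle_trans with (1 := H3). rewrite (Rmult_assoc b c). apply Rmult_le_compat_l; [lra | ].
      destruct (Hu del ltac:(lra)) as [[A1 _] _]. specialize (Hp del ltac:(lra)). nra. }
    apply Rle_trans with (/ (4 * G * kk / A0)).
    + apply Rinv_le_contravar; trivial. unfold C1. nra.
    + replace (/ (4 * G * kk / A0)) with (A0 / 4 / (G * kk)) by (field; repeat split; lra).
      apply Rmult_le_reg_r with (G * kk); [nra | ]. unfold Rdiv at 1. rewrite Rmult_assoc, Rinv_l; [lra | ].
      apply Rgt_not_eq. nra.
  - destruct (Hq 1 Rlt_0_1) as [_ H1]. specialize (Hmb 1 Rlt_0_1). rewrite pow1 in Hmb.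
    specialize (Hp 1 Rlt_0_1).
    assert (H2 : exp (- (1 / 2)) <= phi 1).
    { destruct Ho as [_ [_ [Ho _]]]. specialize (Ho 1 Rlt_0_1).
      replace (Rpower 1 ((INR m + 2 - lam) / 2)) with 1 in Ho by (unfold Rpower; rewrite ln_1, Rmult_0_r, exp_0; trivial).
      replace (1 ^ 2 / 2) with (1 / 2) in Ho by field.
      apply Rmult_le_reg_l with (exp (1 / 2)); [apply exp_pos | ].
      rewrite <- exp_plus. replace (1 / 2 + - (1 / 2)) with 0 by ring. rewrite exp_0. lra. }
    assert (H3 : c * phi 1 <= 2 * u 1).
    { replace (kap * c / 4 * phi 1 / 1 ^ 2) with (kap * (c * phi 1) / 4) in H1 by field.
      assert (0 < c * phi 1) by now apply Rmult_lt_0_compat. nra. }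
    assert (H4 : c * exp (- (1 / 2)) <= 2 * u 1) by nra.
    apply Rle_trans with (2 * C * exp (1 / 2)); [ | unfold C1; nra].
    apply Rmult_le_reg_r with (exp (- (1 / 2))); [apply exp_pos | ].
    rewrite (Rmult_assoc (2 * C)), <- exp_plus. replace (1 / 2 + - (1 / 2)) with 0 by ring. rewrite exp_0. nra.
  - intros r Hr. destruct (Hq r Hr) as [[H1 H2] H3]. specialize (Hp r Hr). specialize (Hle r Hr).
    assert (Hi : 0 < / r ^ 2) by (apply Rinv_0_lt_compat; nra).
    assert (Hcp : 0 < c * phi r) by now apply Rmult_lt_0_compat.
    assert (Hcp2 : 0 < c * phi r ^ 2) by (apply Rmult_lt_0_compat; nra).
    split; [split; [lra | ] | split; [split; [trivial | ] | ]].
    + apply Rle_trans with (1 := H3). unfold Rdiv. rewrite !Rmult_assoc. unfold Rdiv in HkC.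
      assert (X1 : 0 < c * (phi r * / r ^ 2)) by (rewrite <- Rmult_assoc; now apply Rmult_lt_0_compat).
      assert (kap * (c * (phi r * / r ^ 2)) <= C1 * / beta ^ 2 * (c * (phi r * / r ^ 2))) by (apply Rmult_le_compat_r; lra).
      assert (0 <= kap * (c * (phi r * / r ^ 2))) by (apply Rmult_le_pos; lra). lra.
    + apply Rle_trans with (1 := H2). unfold Rdiv. rewrite !Rmult_assoc. unfold Rdiv in HkC.
      assert (X1 : 0 < c * (phi r ^ 2 * / r ^ 2)) by (rewrite <- Rmult_assoc; now apply Rmult_lt_0_compat).
      assert (kap * (c * (phi r ^ 2 * / r ^ 2)) <= C1 * / beta ^ 2 * (c * (phi r ^ 2 * / r ^ 2))) by (apply Rmult_le_compat_r; lra).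
      assert (0 <= kap * (c * (phi r ^ 2 * / r ^ 2))) by (apply Rmult_le_pos; lra). lra.
    + specialize (Hmb r Hr). lra.
Qed.

(** At a fixed small [r] both descriptions hold as [b] grows: [b r^m u] is near [bubble_lim m] by
    [uniform_ratio], and [u] is near [c Phi 0 r] by [c_facts] and [outer_close]. The order of the
    quantifiers matters: [del] depends on [eta] only, [B] also on [r]. *)
Lemma c_asymptotic (m : nat) (Phi : R -> R -> R) (eta : R) :
  (3 <= m)%nat -> outer_family m Phi -> 0 < eta <= 1 / 2 ->
  exists del, 0 < del /\ forall r, 0 < r <= del ->
    exists B, 1 <= B /\ forall b lam u u1 phi1 c, B <= b ->
      coupling m lam b u u1 (Phi lam) phi1 c ->
      Rabs (b * c * (r ^ m * Phi 0 r) - bubble_lim m) <= eta * bubble_lim m.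
Proof.
  intros Hm HPhi Heta. assert (HM := INR_ge3 m Hm).
  set (A0 := bubble_lim m). assert (HA0 : 0 < A0) by apply Rpower_pos.
  set (e := eta / 8). assert (He : 0 < e <= 1 / 16) by (unfold e; lra).
  assert (He2 : 0 < e <= 1 / 2) by lra.
  destruct (uniform_ratio m Phi e Hm HPhi He2) as [del [B1 [Hdel [HB1 Hun]]]].
  destruct (c_facts m Phi Hm HPhi) as [C [B2 [HC [HB2 Hcf]]]].
  destruct (lam_bound m Hm) as [Cl [B3 [HCl [HB3 Hlam]]]].
  exists del. split; [lra | ]. intros r Hr.
  destruct (HPhi 0 ltac:(lra)) as [f1 Hf].
  destruct (outer_close m (Phi 0) f1 r e Hm Hf ltac:(lra) ltac:(lra)) as [l0 [Hl0 Hclose]].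
  assert (HQ := bubble_tail_lim m Hm).
  apply flim_eps with (eps := e * A0) in HQ; [ | typeclasses eauto | nra].
  destruct (infty_elim _ 1 HQ) as [S2 [HS2 HQ2]]. clear HQ. fold A0 in HQ2.
  assert (Hy : 0 < 2 / INR m) by (apply Rdiv_lt_0_compat; lra).
  assert (Hr2 : 0 < r ^ 2) by nra.
  destruct (large_power (2 / INR m) (1 + S2 / r + Cl / l0 + C / r ^ 2 / e) Hy) as [B4 [HB4 Hbig]].
  exists (B1 + B2 + B3 + B4). split; [lra | ].
  intros b lam u u1 phi1 c Hb Hco. assert (Hb0 : 0 < b) by lra.
  assert (Hb1 : B1 <= b) by lra. assert (Hb2 : B2 <= b) by lra. assert (Hb3 : B3 <= b) by lra. assert (Hb4 : B4 <= b) by lra.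
  destruct (Hcf b lam u u1 (Phi lam) phi1 c Hb2 Hco) as [Hl2 [_ Hcq]].
  destruct (Hcq r ltac:(lra)) as [Hq1 _]. clear Hcq.
  destruct Hco as [Hg [Ho [Hc _]]].
  specialize (Hun b lam u u1 Hb1 Hg). cbv zeta in Hun. specialize (Hlam b lam u u1 Hb3 Hg). specialize (Hbig b Hb4).
  assert (HmassS := fun s => resc_mass m b u s Hm Hb0). cbv zeta in HmassS.
  set (beta := Rpower b (2 / INR m)) in *. assert (Hbe : 0 < beta) by apply Rpower_pos.
  assert (Hl1 := gs_lam_pos m lam b u u1 Hm Hb0 Hg).
  assert (X1 : 0 < S2 / r) by (apply Rdiv_lt_0_compat; lra).
  assert (X2 : 0 < Cl / l0) by (apply Rdiv_lt_0_compat; lra).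
  assert (X3 : 0 < C / r ^ 2 / e) by (repeat apply Rdiv_lt_0_compat; lra).
  assert (Hll0 : lam <= l0).
  { apply Rle_trans with (1 := Hlam). apply Rmult_le_reg_r with beta; trivial.
    unfold Rdiv. rewrite Rmult_assoc, Rinv_l, Rmult_1_r by lra.
    apply Rle_trans with (l0 * (Cl / l0)); [right; field; lra | apply Rmult_le_compat_l; lra]. }
  assert (Hcl := Hclose lam (Phi lam) phi1 ltac:(lra) Ho).
  assert (Hp := outer_pos _ _ _ _ r Ho ltac:(lra)).
  assert (Hf0 := outer_pos _ _ _ _ r Hf ltac:(lra)).
  assert (Hsm : 0 < r ^ m) by (apply pow_lt; lra).
  assert (Hm1 : (1 - e) ^ 2 * A0 <= b * (r ^ m * u r) <= (1 + e) * A0).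
  { replace r with (r * beta / beta) by (field; lra). rewrite HmassS.
    assert (Hrb : S2 <= r * beta).
    { apply Rle_trans with (r * (S2 / r)); [right; field; lra | apply Rmult_le_compat_l; lra]. }
    destruct (Hun (r * beta)) as [U1 U2]; [split; [nra | apply Rmult_le_compat_r; lra] | ].
    assert (H2 := HQ2 (r * beta) Hrb). apply Rabs_def2 in H2.
    assert (H3 := bubble_tail_le m (r * beta) Hm ltac:(nra)). fold A0 in H3.
    assert (Hpm : 0 < (r * beta) ^ m) by (apply pow_lt; nra).
    split.
    - apply Rle_trans with ((r * beta) ^ m * ((1 - e) * bubble m (r * beta))); [nra | apply Rmult_le_compat_l; lra].
    - apply Rle_trans with ((r * beta) ^ m * ((1 + e) * bubble m (r * beta))); [apply Rmult_le_compat_l; lra | nra]. }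
  assert (Hcq : (1 - e) * (c * Phi lam r) <= u r <= c * Phi lam r).
  { split; [ | lra].
    assert (Hke : C / beta ^ 2 * (c * Phi lam r) / r ^ 2 <= e * (c * Phi lam r)); [ | lra].
    replace (C / beta ^ 2 * (c * Phi lam r) / r ^ 2) with (C / r ^ 2 / e / beta ^ 2 * e * (c * Phi lam r)) by (field; repeat split; lra).
    apply Rmult_le_compat_r; [left; now apply Rmult_lt_0_compat | ].
    apply Rle_trans with (1 * e); [ | lra]. apply Rmult_le_compat_r; [lra | ].
    apply Rmult_le_reg_r with (beta ^ 2); [apply pow_lt; lra | ]. unfold Rdiv at 1.
    rewrite Rmult_assoc, Rinv_l by (apply pow_nonzero; lra). nra. }
  assert (Hph : (1 - e) * Phi 0 r <= Phi lam r <= (1 + e) * Phi 0 r).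
  { apply Rabs_le_between in Hcl.
    replace (Phi lam r) with (Phi lam r / Phi 0 r * Phi 0 r) by (field; lra). split; apply Rmult_le_compat_r; lra. }
  set (X := b * c * (r ^ m * Phi 0 r)).
  assert (Hbr : 0 < b * r ^ m) by now apply Rmult_lt_0_compat.
  assert (E1 : b * (r ^ m * u r) <= (1 + e) * X).
  { apply Rle_trans with (b * r ^ m * (c * ((1 + e) * Phi 0 r))); [ | right; unfold X; ring].
    rewrite <- Rmult_assoc. apply Rmult_le_compat_l; [lra | ]. apply Rle_trans with (1 := proj2 Hcq).
    apply Rmult_le_compat_l; lra. }
  assert (E2 : (1 - e) ^ 2 * X <= b * (r ^ m * u r)).
  { apply Rle_trans with (b * r ^ m * ((1 - e) * (c * ((1 - e) * Phi 0 r)))); [right; unfold X; ring | ].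
    rewrite <- (Rmult_assoc b). apply Rmult_le_compat_l; [lra | ]. apply Rle_trans with (2 := proj1 Hcq).
    apply Rmult_le_compat_l; [lra | ]. apply Rmult_le_compat_l; lra. }
  apply Rabs_le. split.
  - assert (E3 : (1 - e) ^ 2 * A0 <= (1 + e) * X) by lra.
    assert ((1 - eta) * (1 + e) <= (1 - e) ^ 2) by (unfold e in *; nra).
    assert ((1 - eta) * A0 * (1 + e) <= X * (1 + e)) by nra.
    apply Rmult_le_reg_r in H0; lra.
  - assert (E3 : (1 - e) ^ 2 * X <= (1 + e) * A0) by lra.
    assert ((1 + e) <= (1 + eta) * (1 - e) ^ 2) by (unfold e in *; nra).
    assert (X * (1 - e) ^ 2 <= (1 + eta) * A0 * (1 - e) ^ 2) by nra.
    apply Rmult_le_reg_r in H0; nra.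
Qed.

(** * Asymptotics of [c] and the three estimates *)

Definition ground_family (m : nat) (Phi : R -> R -> R) (lam : R -> R) (u u1 : R -> R -> R)
  (c : R -> R) : Prop :=
  forall b, 0 < b -> exists phi1, coupling m (lam b) b (u b) (u1 b) (Phi (lam b)) phi1 (c b).

(** A function of [b] times a function of [r] is near [A0]. Fixing [r] makes [b * c b] a Cauchy
    function; inserting its limit [Ap] gives the limit of [r^m Phi 0 r] at 0, which would otherwise
    require the connection formula of the Tricomi function. *)
Lemma c_limit (m : nat) (Phi : R -> R -> R) (lam : R -> R) (u u1 : R -> R -> R) (c : R -> R) :
  (3 <= m)%nat -> outer_family m Phi -> ground_family m Phi lam u u1 c ->
  exists Ap, 0 < Ap /\
    filterlim (fun b => b * c b) (Rbar_locally p_infty) (locally Ap) /\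
    filterlim (fun r => r ^ m * Phi 0 r) (at_right 0) (locally (bubble_lim m / Ap)).
Proof.
  intros Hm HPhi Hfam.
  set (A0 := bubble_lim m). assert (HA0 : 0 < A0) by apply Rpower_pos.
  destruct (c_facts m Phi Hm HPhi) as [C [B [HC [HB Hcf]]]].
  assert (Hg : forall b, B <= b -> / C <= b * c b <= C).
  { intros b Hb. destruct (Hfam b ltac:(lra)) as [phi1 Hco].
    now destruct (Hcf b _ _ _ _ _ _ Hb Hco) as [_ [H _]]. }
  assert (HCi : 0 < / C) by (apply Rinv_0_lt_compat; lra).
  destruct (HPhi 0) as [f1 Hf]; [split; [lra | generalize (INR_ge3 m Hm); lra] | ].
  set (h := fun r => r ^ m * Phi 0 r).
  assert (Hh : forall r, 0 < r -> 0 < h r).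
  { intros r Hr. apply Rmult_lt_0_compat; [now apply pow_lt | now apply (outer_pos m 0 _ f1)]. }
  assert (Has : forall eta, 0 < eta <= 1 / 2 -> exists del, 0 < del /\ forall r, 0 < r <= del ->
    exists B', forall b, B' <= b -> Rabs (b * c b * h r - A0) <= eta * A0).
  { intros eta Heta. destruct (c_asymptotic m Phi eta Hm HPhi Heta) as [del [Hdel H]].
    exists del. split; trivial. intros r Hr. destruct (H r Hr) as [B' [HB' H']].
    exists B'. intros b Hb. destruct (Hfam b ltac:(lra)) as [phi1 Hco].
    now apply (H' b (lam b) (u b) (u1 b) phi1 (c b)). }
  (* The lower bound on [h r] does not depend on [eta]; it allows the division by [h] in the Cauchy
     criterion. *)
  assert (Hhl : forall eta, 0 < eta <= 1 / 2 -> exists del, 0 < del /\ forall r, 0 < r <= del ->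
    A0 / (2 * C) <= h r /\ exists B', forall b, B' <= b -> Rabs (b * c b * h r - A0) <= eta * A0).
  { intros eta Heta. destruct (Has eta Heta) as [del [Hdel H]]. exists del. split; trivial.
    intros r Hr. destruct (H r Hr) as [B' HB']. split; [ | now exists B'].
    assert (HM1 := Rmax_l B B'). assert (HM2 := Rmax_r B B'). set (b := Rmax B B') in *.
    specialize (HB' b HM2). apply Rabs_le_between in HB'. specialize (Hg b HM1).
    specialize (Hh r (proj1 Hr)).
    apply Rmult_le_reg_l with (2 * C); [lra | ]. replace (2 * C * (A0 / (2 * C))) with A0 by (field; lra).
    assert (b * c b * h r <= C * h r) by (apply Rmult_le_compat_r; lra). nra. }
  assert (Hcau : exists Ap, filterlim (fun b => b * c b) (Rbar_locally p_infty) (locally Ap)).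
  { apply (proj1 (filterlim_locally_cauchy (F := Rbar_locally p_infty) (fun b => b * c b))).
    intros [eps Heps].
    set (eta := Rmin (1 / 2) (eps / (8 * C))).
    assert (He8 : 0 < eps / (8 * C)) by (apply Rdiv_lt_0_compat; lra).
    assert (Heta : 0 < eta <= 1 / 2) by (split; [apply Rmin_glb_lt; lra | apply Rmin_l]).
    assert (Heta2 : eta <= eps / (8 * C)) by apply Rmin_r.
    destruct (Hhl eta Heta) as [del [Hdel H]]. destruct (H del ltac:(lra)) as [H1 [B' HB']].
    exists (fun b => B' <= b). split; [exists B'; intros; lra | ].
    intros x y Hx Hy. change (Rabs (y * c y - x * c x) < eps).
    assert (Hx' := HB' x Hx). assert (Hy' := HB' y Hy).
    assert (H2 : Rabs ((y * c y - x * c x) * h del) <= 2 * eta * A0).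
    { replace ((y * c y - x * c x) * h del) with ((y * c y * h del - A0) + - (x * c x * h del - A0)) by ring.
      apply Rle_trans with (1 := Rabs_triang _ _). rewrite Rabs_Ropp. lra. }
    specialize (Hh del Hdel). rewrite Rabs_mult, (Rabs_pos_eq (h del)) in H2 by lra.
    apply Rmult_lt_reg_r with (h del); trivial. apply Rle_lt_trans with (1 := H2).
    apply Rle_lt_trans with (2 * (eps / (8 * C)) * A0); [apply Rmult_le_compat_r; lra | ].
    apply Rlt_le_trans with (eps * (A0 / (2 * C))); [ | apply Rmult_le_compat_l; lra].
    replace (2 * (eps / (8 * C)) * A0) with (eps * (A0 / (2 * C)) / 2) by (field; lra).
    assert (0 < eps * (A0 / (2 * C))); [ | lra].
    apply Rmult_lt_0_compat; trivial. apply Rdiv_lt_0_compat; lra. }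
  destruct Hcau as [Ap HAp].
  assert (HAp0 : / C <= Ap).
  { apply (flim_le (Rbar_locally p_infty) (fun _ => / C) (fun b => b * c b)); trivial.
    - apply (infty_intro _ B). intros b Hb. apply Hg. lra.
    - apply flim_const. typeclasses eauto. }
  exists Ap. split; [lra | split; [trivial | ]].
  apply flim_eps; [typeclasses eauto | ]. intros eps Heps.
  set (eta := Rmin (1 / 2) (eps * Ap / (2 * A0))).
  assert (He8 : 0 < eps * Ap / (2 * A0)) by (apply Rdiv_lt_0_compat; [apply Rmult_lt_0_compat | ]; lra).
  assert (Heta : 0 < eta <= 1 / 2) by (split; [apply Rmin_glb_lt; lra | apply Rmin_l]).
  assert (Heta2 : eta <= eps * Ap / (2 * A0)) by apply Rmin_r.
  destruct (Has eta Heta) as [del [Hdel H]].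
  apply (at_right_0_intro _ del Hdel). intros r Hr. change (Rabs (h r - A0 / Ap) < eps).
  destruct (H r ltac:(lra)) as [B' HB'].
  assert (H1 : Rabs (Ap * h r - A0) <= eta * A0).
  { apply (flim_le (Rbar_locally p_infty) (fun b => Rabs (b * c b * h r - A0)) (fun _ => eta * A0)).
    - apply (infty_intro _ B'). intros b Hb. apply HB'. lra.
    - apply (flim_cont _ Rabs); [apply continuous_Rabs | ]. flims.
    - apply flim_const. typeclasses eauto. }
  apply Rmult_lt_reg_l with Ap; [lra | ].
  replace (Ap * Rabs (h r - A0 / Ap)) with (Rabs (Ap * h r - A0)).
  - apply Rle_lt_trans with (1 := H1). apply Rle_lt_trans with (eps * Ap / (2 * A0) * A0); [apply Rmult_le_compat_r; lra | ].
    replace (eps * Ap / (2 * A0) * A0) with (Ap * eps / 2) by (field; lra).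
    assert (0 < Ap * eps) by (apply Rmult_lt_0_compat; lra). lra.
  - rewrite <- (Rabs_pos_eq Ap) at 2 by lra. rewrite <- Rabs_mult. f_equal. field. lra.
Qed.

(** In the variable [s] the region ends at [b^(p a)], which lies within [beta/(m+2)] for large [b],
    and there [(1 + s^2)/beta^2 <= 2 b^(-2p(1-a))]. *)
Lemma estimate_inner (m : nat) (a : R) :
  (3 <= m)%nat -> 0 < a < 1 ->
  exists C B, 0 < C /\ 1 <= B /\ forall b lam u u1, B <= b -> gstate m lam b u u1 ->
    forall r, 0 < r <= Rpower b (- (2 / INR m * (1 - a))) ->
      / b * Rabs (u r - b * bubble m (r * Rpower b (2 / INR m)))
        <= C * Rpower b (- (2 * (2 / INR m) * (1 - a))).
Proof.
  intros Hm Ha. assert (HM := INR_ge3 m Hm).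
  destruct (inner_estimate m Hm) as [C [B1 [HC [HB1 H]]]].
  assert (Hy : 0 < 2 / INR m * (1 - a)) by (apply Rmult_lt_0_compat; [apply Rdiv_lt_0_compat | ]; lra).
  destruct (large_power (2 / INR m * (1 - a)) (INR m + 2) Hy) as [B2 [HB2 Hbig]].
  exists (2 * C), (B1 + B2). split; [lra | split; [lra | ]].
  intros b lam u u1 Hb Hg r Hr. assert (Hb0 : 0 < b) by lra.
  assert (Hb1 : B1 <= b) by lra. assert (Hb2 : B2 <= b) by lra. assert (Hb3 : 1 <= b) by lra.
  specialize (H b lam u u1 Hb1 Hg). cbv zeta in H. specialize (Hbig b Hb2).
  set (p := 2 / INR m) in *.
  set (beta := Rpower b p) in *. assert (Hbe : 0 < beta) by apply Rpower_pos.
  set (s := r * beta).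
  assert (Hs : 0 < s <= Rpower b (p * a)).
  { unfold s. split; [apply Rmult_lt_0_compat; lra | ].
    apply Rle_trans with (Rpower b (- (p * (1 - a))) * beta); [apply Rmult_le_compat_r; lra | ].
    unfold beta. rewrite <- Rpower_plus. right. f_equal. ring. }
  set (ba := Rpower b (p * a)) in *.
  assert (Hba1 : 1 <= ba).
  { apply Rle_trans with (Rpower b 0); [rewrite Rpower_O; lra | ]. apply Rle_Rpower; [trivial | nra]. }
  assert (Hbb : beta = Rpower b (p * (1 - a)) * ba).
  { unfold beta, ba. rewrite <- Rpower_plus. f_equal. ring. }
  assert (Hs2 : s <= beta / (INR m + 2)).
  { apply Rle_trans with (1 := proj2 Hs). apply Rmult_le_reg_r with (INR m + 2); [lra | ].
    unfold Rdiv. rewrite Rmult_assoc, Rinv_l, Rmult_1_r by lra. rewrite Hbb, Rmult_comm.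
    apply Rmult_le_compat_r; lra. }
  specialize (H s (conj (proj1 Hs) Hs2)).
  replace (/ b * Rabs (u r - b * bubble m s)) with (Rabs (resc b beta u s - bubble m s)).
  - apply Rle_trans with (1 := H).
    replace (Rpower b (- (2 * p * (1 - a)))) with (ba ^ 2 / beta ^ 2).
    + replace (2 * C * (ba ^ 2 / beta ^ 2)) with (C / beta ^ 2 * (2 * ba ^ 2)) by (unfold Rdiv; ring).
      apply Rmult_le_compat_l; [left; apply Rdiv_lt_0_compat; [lra | apply pow_lt; trivial] | ].
      assert (s ^ 2 <= ba ^ 2) by (apply pow_incr; lra). nra.
    + unfold ba, beta. rewrite <- !(Rpower_pow 2) by apply Rpower_pos. rewrite !Rpower_mult.
      unfold Rdiv. rewrite <- Rpower_Ropp, <- Rpower_plus. f_equal. simpl. ring.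
  - unfold resc, s. replace (r * beta / beta) with r by (field; lra).
    rewrite <- (Rabs_pos_eq (/ b)) at 1 by (left; now apply Rinv_0_lt_compat).
    rewrite <- Rabs_mult. f_equal. field. lra.
Qed.

(** Since [b c] is bounded below, [c^(2p+1)] is at least a multiple of [b^(-(2p+1)) = 1/(beta^2 b)].
    This converts errors in [b] into the form of the theorem. *)
Lemma c_power (m : nat) (b c C : R) :
  (3 <= m)%nat -> 0 < b -> 1 <= C -> / C <= b * c ->
  / (Rpower b (2 / INR m) ^ 2 * b) <= Rpower C (4 / INR m + 1) * Rpower c (4 / INR m + 1).
Proof.
  intros Hm Hb HC Hc. assert (HM := INR_ge3 m Hm).
  assert (HCi : 0 < / C) by (apply Rinv_0_lt_compat; lra).
  assert (Hc0 : 0 < c) by nra.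
  assert (Hsg : 0 < 4 / INR m) by (apply Rdiv_lt_0_compat; lra).
  rewrite Rpower_mult_distr by lra.
  replace (Rpower b (2 / INR m) ^ 2 * b) with (Rpower b (4 / INR m + 1)).
  - rewrite <- Rpower_Ropp. replace (Rpower b (- (4 / INR m + 1))) with (Rpower (/ b) (4 / INR m + 1)).
    + apply Rle_Rpower_l; [lra | ]. split; [now apply Rinv_0_lt_compat | ].
      apply Rmult_le_reg_l with (b * / C); [nra | ].
      replace (b * / C * / b) with (/ C) by (field; lra).
      replace (b * / C * (C * c)) with (b * c) by (field; lra). trivial.
    + unfold Rpower. f_equal. rewrite ln_Rinv by trivial. ring.
  - rewrite Rpower_plus, Rpower_1 by trivial. f_equal.
    rewrite <- (Rpower_pow 2) by apply Rpower_pos. rewrite Rpower_mult. f_equal. simpl. field. lra.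
Qed.

(** The error is at most [C beta^(-2) c phi/r^2]. For [r >= b^(-p(1-a))] its relative size is at
    most 1/2, so [c phi <= 2 u], and the mass bound on [u] controls [r^m c phi] down to small
    radii. *)
Lemma estimate_middle (m : nat) (Phi : R -> R -> R) (a : R) :
  (3 <= m)%nat -> outer_family m Phi -> 0 < a < 1 ->
  exists C B, 0 < C /\ 1 <= B /\ forall b lam u u1 phi phi1 c, B <= b ->
    coupling m lam b u u1 phi phi1 c ->
    forall r, Rpower b (- (2 / INR m * (1 - a))) <= r ->
      r ^ m * Rabs (u r - c * phi r)
        <= C * Rpower c (4 / INR m + 1) * Rpower b (2 * (2 / INR m) * (1 - a)).
Proof.
  intros Hm HPhi Ha. assert (HM := INR_ge3 m Hm).
  destruct (c_facts m Phi Hm HPhi) as [C [B1 [HC [HB1 Hcf]]]].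
  set (p := 2 / INR m) in *. assert (Hp : 0 < p) by (apply Rdiv_lt_0_compat; lra).
  assert (Hpa : 0 < p * a) by (apply Rmult_lt_0_compat; lra).
  destruct (large_power (p * a) (2 * C) Hpa) as [B2 [HB2 Hbig]].
  exists (C * (2 * C) * Rpower C (4 / INR m + 1)), (B1 + B2).
  split; [apply Rmult_lt_0_compat; [nra | apply Rpower_pos] | split; [lra | ]].
  intros b lam u u1 phi phi1 c Hb Hco r Hr. assert (Hb0 : 0 < b) by lra.
  assert (Hb1 : B1 <= b) by lra. assert (Hb2 : B2 <= b) by lra.
  destruct (Hcf b lam u u1 phi phi1 c Hb1 Hco) as [_ [[Hc1 _] Hq]].
  specialize (Hbig b Hb2). destruct Hco as [Hg [Ho [Hc _]]].
  assert (Hpw := c_power m b c C Hm Hb0 HC Hc1). fold p in Hq, Hpw.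
  assert (Hr0 : 0 < r) by (generalize (Rpower_pos b (- (p * (1 - a)))); lra).
  destruct (Hq r Hr0) as [[Q1 Q2] [_ Q3]].
  set (beta := Rpower b p) in *. assert (Hbe : 0 < beta) by apply Rpower_pos.
  set (b1 := Rpower b (p * (1 - a))). assert (Hb1p : 0 < b1) by apply Rpower_pos.
  assert (Hrb : / b1 <= r) by (unfold b1; rewrite <- Rpower_Ropp; trivial).
  assert (Hri : / r ^ 2 <= b1 ^ 2).
  { rewrite <- (Rinv_inv b1), pow_inv. apply Rinv_le_contravar; [apply pow_lt; now apply Rinv_0_lt_compat | ].
    apply pow_incr. split; [left; now apply Rinv_0_lt_compat | trivial]. }
  assert (Hb12 : Rpower b (2 * p * (1 - a)) = b1 ^ 2).
  { unfold b1. rewrite <- (Rpower_pow 2) by apply Rpower_pos. rewrite Rpower_mult. f_equal. simpl. ring. }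
  rewrite Hb12.
  set (ba := Rpower b (p * a)) in *.
  assert (Hbb : beta = b1 * ba).
  { unfold beta, ba, b1. rewrite <- Rpower_plus. f_equal. ring. }
  assert (Hphi := outer_pos _ _ _ _ r Ho Hr0).
  assert (Hcp : 0 < c * phi r) by now apply Rmult_lt_0_compat.
  assert (Hb2p : 0 < beta ^ 2) by (apply pow_lt; trivial).
  assert (Hhalf : C / beta ^ 2 * / r ^ 2 <= 1 / 2).
  { apply Rle_trans with (C / beta ^ 2 * b1 ^ 2).
    - apply Rmult_le_compat_l; [apply Rdiv_le_0_compat; lra | trivial].
    - replace (C / beta ^ 2 * b1 ^ 2) with (C / ba ^ 2) by (rewrite Hbb; field; lra).
      apply Rmult_le_reg_r with (ba ^ 2); [apply pow_lt; lra | ]. unfold Rdiv at 1.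
      rewrite Rmult_assoc, Rinv_l by (apply pow_nonzero; lra). nra. }
  assert (H1 : c * phi r <= 2 * u r).
  { replace (C / beta ^ 2 * (c * phi r) / r ^ 2) with (C / beta ^ 2 * / r ^ 2 * (c * phi r)) in Q2 by (unfold Rdiv; ring).
    assert (C / beta ^ 2 * / r ^ 2 * (c * phi r) <= 1 / 2 * (c * phi r)) by (apply Rmult_le_compat_r; lra). lra. }
  assert (Hrm : 0 < r ^ m) by (apply pow_lt; trivial).
  rewrite Rabs_minus_sym, Rabs_pos_eq by trivial.
  apply Rle_trans with (r ^ m * (C / beta ^ 2 * (2 * u r) * b1 ^ 2)).
  - apply Rmult_le_compat_l; [lra | ]. apply Rle_trans with (1 := Q2).
    assert (Hri0 : 0 < / r ^ 2) by (apply Rinv_0_lt_compat, pow_lt; trivial).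
    assert (HCb : 0 < C / beta ^ 2) by (apply Rdiv_lt_0_compat; lra).
    unfold Rdiv at 1. apply Rmult_le_compat; try lra.
    + apply Rmult_le_pos; lra.
    + apply Rmult_le_compat_l; lra.
  - replace (r ^ m * (C / beta ^ 2 * (2 * u r) * b1 ^ 2)) with (C * 2 * (b * (r ^ m * u r)) * / (beta ^ 2 * b) * b1 ^ 2) by (field; lra).
    apply Rmult_le_compat_r; [apply pow_le; lra | ].
    replace (C * (2 * C) * Rpower C (4 / INR m + 1) * Rpower c (4 / INR m + 1))
      with (C * 2 * C * (Rpower C (4 / INR m + 1) * Rpower c (4 / INR m + 1))) by ring.
    assert (0 < u r) by lra.
    apply Rmult_le_compat; trivial.
    + repeat apply Rmult_le_pos; lra.
    + left; apply Rinv_0_lt_compat; nra.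
    + apply Rmult_le_compat_l; lra.
Qed.

(** For [r >= 1] the normalized function of [outer] is at most [exp((m+2)^2)], so the weighted error
    is at most a multiple of [c/beta^2], and [c_power] applies. *)
Lemma estimate_outer (m : nat) (Phi : R -> R -> R) :
  (3 <= m)%nat -> outer_family m Phi ->
  exists C B, 0 < C /\ 1 <= B /\ forall b lam u u1 phi phi1 c, B <= b ->
    coupling m lam b u u1 phi phi1 c ->
    forall r, 1 <= r ->
      exp (r ^ 2 / 2) * Rpower r ((INR m + 2 - lam) / 2) * Rabs (u r - c * phi r)
        <= C * Rpower c (4 / INR m + 1).
Proof.
  intros Hm HPhi. assert (HM := INR_ge3 m Hm).
  destruct (c_facts m Phi Hm HPhi) as [C [B1 [HC [HB1 Hcf]]]].
  set (G := exp ((INR m + 2) ^ 2)). assert (HG : 0 < G) by apply exp_pos.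
  exists (C * C * G * Rpower C (4 / INR m + 1)), B1.
  split; [apply Rmult_lt_0_compat; [ | apply Rpower_pos]; apply Rmult_lt_0_compat; nra | split; [lra | ]].
  intros b lam u u1 phi phi1 c Hb Hco r Hr. assert (Hb0 : 0 < b) by lra.
  destruct (Hcf b lam u u1 phi phi1 c Hb Hco) as [Hl2 [[Hc1 Hc2] Hq]].
  destruct Hco as [Hg [Ho [Hc _]]].
  assert (Hpw := c_power m b c C Hm Hb0 HC Hc1).
  destruct (Hq r ltac:(lra)) as [[Q1 Q2] _].
  set (beta := Rpower b (2 / INR m)) in *. assert (Hbe : 0 < beta) by apply Rpower_pos.
  assert (Hphi := outer_pos _ _ _ _ r Ho ltac:(lra)).
  destruct Ho as [_ [_ [_ [_ Ho]]]]. destruct (Ho ltac:(lra) r ltac:(lra)) as [HE _].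
  set (k := exp (r ^ 2 / 2) * Rpower r ((INR m + 2 - lam) / 2)) in *.
  assert (Hk : 0 < k) by (apply Rmult_lt_0_compat; [apply exp_pos | apply Rpower_pos]).
  assert (HE2 : k * phi r <= G).
  { apply Rle_trans with (1 := HE). apply exp_le_compat.
    assert (0 < (INR m + 2) ^ 2) by (apply pow_lt; lra). assert (1 <= r ^ 2) by nra.
    apply Rmult_le_reg_r with (r ^ 2); [lra | ]. unfold Rdiv. rewrite Rmult_assoc, Rinv_l by lra; nra. }
  rewrite Rabs_minus_sym, Rabs_pos_eq by trivial.
  apply Rle_trans with (k * (C / beta ^ 2 * (c * phi r))).
  - apply Rmult_le_compat_l; [lra | ]. apply Rle_trans with (1 := Q2).
    assert (0 <= C / beta ^ 2 * (c * phi r)).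
    { apply Rmult_le_pos; [apply Rdiv_le_0_compat; [lra | apply pow_lt; trivial] | nra]. }
    assert (1 <= r ^ 2) by nra.
    apply Rmult_le_reg_r with (r ^ 2); [lra | ]. unfold Rdiv at 1. rewrite Rmult_assoc, Rinv_l by lra; nra.
  - replace (k * (C / beta ^ 2 * (c * phi r))) with (C * (b * c) * (k * phi r) * / (beta ^ 2 * b)) by (field; lra).
    replace (C * C * G * Rpower C (4 / INR m + 1) * Rpower c (4 / INR m + 1))
      with (C * C * G * (Rpower C (4 / INR m + 1) * Rpower c (4 / INR m + 1))) by ring.
    assert (0 < b * c) by nra.
    apply Rmult_le_compat; trivial.
    + apply Rmult_le_pos; [apply Rmult_le_pos; lra | left; now apply Rmult_lt_0_compat].
    + left; apply Rinv_0_lt_compat, Rmult_lt_0_compat; [apply pow_lt | ]; trivial.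
    + apply Rmult_le_compat; try lra; try (apply Rmult_le_pos; lra). apply Rmult_le_compat_l; lra.
Qed.

(** * The eigenvalue when [d >= 6] *)

(** The integrals from 0 are encoded as antiderivatives with limit 0, so that each dimension can
    supply the closed forms it has. *)
Definition bubble_moments (m : nat) (P0 P2 : R -> R) : Prop :=
  (forall s, 0 < s -> is_derive P0 s (s * s ^ m * bubble m s ^ 2) /\
     is_derive P2 s (s ^ 3 * s ^ m * bubble m s ^ 2)) /\
  filterlim P0 (at_right 0) (locally 0) /\ filterlim P2 (at_right 0) (locally 0).

Lemma moments_pos (m : nat) (P0 P2 : R -> R) :
  bubble_moments m P0 P2 ->
  (forall s, 0 < s -> 0 < P0 s /\ 0 <= P2 s) /\ (forall s t, 0 < s -> s <= t -> P0 s <= P0 t).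
Proof.
  intros [Hd [H0 H2]].
  assert (Hp : forall s, 0 < s -> 0 < s * s ^ m * bubble m s ^ 2).
  { intros s Hs. assert (B := bubble_pos m s). assert (0 < s ^ m) by (apply pow_lt; trivial).
    apply Rmult_lt_0_compat; nra. }
  split.
  - intros s Hs. split.
    + apply Rle_lt_trans with (P0 (s / 2)).
      * apply (derive_incr_lim0 P0 (fun s => s * s ^ m * bubble m s ^ 2)); trivial; [lra | | ].
        -- intros x Hx. apply Hd. lra.
        -- intros x Hx. left. apply Hp. lra.
      * apply (derive_incr_strict P0 (fun s => s * s ^ m * bubble m s ^ 2)); [lra | | ].
        -- intros x Hx. apply Hd. lra.
        -- intros x Hx. apply Hp. lra.
    + apply (derive_incr_lim0 P2 (fun s => s ^ 3 * s ^ m * bubble m s ^ 2)); trivial.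
      * intros x Hx. apply Hd. lra.
      * intros x Hx. replace (x ^ 3 * x ^ m * bubble m x ^ 2) with (x ^ 2 * (x * x ^ m * bubble m x ^ 2)) by ring.
        apply Rmult_le_pos; [nra | left; apply Hp; lra].
  - intros s t Hs Hst. apply (derive_incr P0 (fun s => s * s ^ m * bubble m s ^ 2)); trivial.
    + intros x Hx. apply Hd. lra.
    + intros x Hx. left. apply Hp. lra.
Qed.

(** After multiplication by [beta^4] the only unknown coefficient in front of the two moments is
    [lam beta^2]. *)
Lemma poho_scaled (m : nat) (lam b : R) (u u1 : R -> R) (s : R) :
  (3 <= m)%nat -> 0 < b -> gstate m lam b u u1 -> 0 < s ->
  let beta := Rpower b (2 / INR m) in
  is_derive (fun s => beta ^ 4 * poho m lam u u1 (s / beta)) s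
    (lam * beta ^ 2 * (s * s ^ m * resc b beta u s ^ 2) - 2 * (s ^ 3 * s ^ m * resc b beta u s ^ 2)).
Proof.
  intros Hm Hb Hg Hs beta. assert (Hbe : 0 < beta) by apply Rpower_pos.
  assert (Hsb : 0 < s / beta) by (apply Rdiv_lt_0_compat; lra).
  assert (D := poho_derive m lam b u u1 (s / beta) Hm Hg Hsb).
  set (l := s / beta * (s / beta) ^ m * (lam - 2 * (s / beta) ^ 2) * u (s / beta) ^ 2) in D.
  eapply is_derive_val.
  - apply (is_derive_scal (fun s => poho m lam u u1 (s / beta)) s (beta ^ 4) (/ beta * l)).
    apply (is_derive_comp (poho m lam u u1) (fun s => s / beta)); [exact D | ].
    auto_derive; trivial. field. lra.
  - cbv [scal]; simpl. cbv [mult]; simpl. unfold l, resc.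
    replace ((s / beta) ^ m) with (s ^ m / b ^ 2).
    + field. lra.
    + unfold Rdiv at 2. rewrite Rpow_mult_distr, pow_inv. unfold beta at 1. now rewrite Rpower_beta.
Qed.

(** Integrated up to [S], the identity says that [h] is [L = lam beta^2] times one moment of [v^2]
    minus twice the other, each within the factors [(1 - eta)^2] and [(1 + eta)^2] of that of the
    bubble. Since [h >= 0] by the sign of [poho], the terms of [h + 2 P2] are nonnegative and the
    errors combine into a single relative one. *)
Lemma lam_sandwich (m : nat) (Phi : R -> R -> R) (P0 P2 : R -> R) (eta : R) :
  (3 <= m)%nat -> outer_family m Phi -> bubble_moments m P0 P2 -> 0 < eta <= 1 / 4 ->
  exists del0 B, 0 < del0 <= 1 /\ 1 <= B /\ forall del b lam u u1,
    0 < del <= del0 -> B <= b -> gstate m lam b u u1 ->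
    let beta := Rpower b (2 / INR m) in
    let F := (beta ^ 4 * poho m lam u u1 del + 2 * P2 (del * beta)) / P0 (del * beta) in
    (1 - 4 * eta) * F <= lam * beta ^ 2 <= (1 + 16 * eta) * F.
Proof.
  intros Hm HPhi HP Heta. assert (HM := INR_ge3 m Hm).
  assert (Heta2 : 0 < eta <= 1 / 2) by lra.
  destruct (uniform_ratio m Phi eta Hm HPhi Heta2) as [del0 [B [Hdel [HB Hun]]]].
  exists del0, B. split; [split; [lra | ] | split; trivial].
  { apply Rle_trans with (1 := proj2 Hdel). rewrite <- Rinv_1. apply Rinv_le_contravar; lra. }
  intros del b lam u u1 Hd Hb Hg beta F. assert (Hb0 : 0 < b) by lra.
  specialize (Hun b lam u u1 Hb Hg). fold beta in Hun. cbv zeta in Hun.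
  assert (Hbe : 0 < beta) by apply Rpower_pos.
  assert (Hl := gs_lam_pos m lam b u u1 Hm Hb0 Hg).
  destruct (moments_pos m P0 P2 HP) as [HPp _].
  destruct HP as [HPd [HP0 HP2]].
  set (S := del * beta). assert (HS : 0 < S) by (apply Rmult_lt_0_compat; lra).
  destruct (HPp S HS) as [HP0S HP2S].
  set (h := fun s => beta ^ 4 * poho m lam u u1 (s / beta)).
  assert (Hhd := fun s Hs => poho_scaled m lam b u u1 s Hm Hb0 Hg Hs). cbv zeta in Hhd. fold beta in Hhd.
  assert (Hh0 : filterlim h (at_right 0) (locally 0)).
  { assert (Hp0 := poho_lim0 m lam b u u1 Hb0 Hg).
    apply (resc_lim0 (/ beta ^ 4) beta 0) in Hp0; [ | apply Rinv_0_lt_compat, pow_lt; trivial | trivial].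
    apply flim_val with (0 / / beta ^ 4); [ | unfold Rdiv; ring].
    apply (flim_ext _ (resc (/ beta ^ 4) beta (poho m lam u u1))); trivial.
    apply filter_forall. intros x. unfold resc, h, Rdiv. rewrite Rinv_inv. ring. }
  assert (HhS : h S = beta ^ 4 * poho m lam u u1 del).
  { unfold h, S. f_equal. f_equal. field. lra. }
  assert (Hhp : 0 <= h S).
  { rewrite HhS. apply Rmult_le_pos; [left; apply pow_lt; trivial | apply (poho_nonneg m lam b); trivial; lra]. }
  assert (Hv : forall s, 0 < s <= S -> (1 - eta) ^ 2 * bubble m s ^ 2 <= resc b beta u s ^ 2 <= (1 + eta) ^ 2 * bubble m s ^ 2).
  { intros s Hs. destruct (Hun s) as [U1 U2].
    - split; [lra | ]. apply Rle_trans with (1 := proj2 Hs). apply Rmult_le_compat_r; lra.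
    -  rewrite <- !Rpow_mult_distr. split; apply pow_incr; split; trivial; nra. }
  set (L := lam * beta ^ 2) in *.
  assert (HL : 0 < L) by (apply Rmult_lt_0_compat; [trivial | apply pow_lt; trivial]).
  assert (Hsp : forall s, 0 < s -> 0 < s * s ^ m /\ 0 < s ^ 3 * s ^ m).
  { intros s Hs. split; apply Rmult_lt_0_compat; trivial; apply pow_lt; trivial. }
  assert (E1 : h S <= L * (1 + eta) ^ 2 * P0 S - 2 * (1 - eta) ^ 2 * P2 S).
  { assert (h S - (L * (1 + eta) ^ 2 * P0 S - 2 * (1 - eta) ^ 2 * P2 S) <= 0); [ | lra].
    eapply (derive_decr_lim0 (fun s => h s - (L * (1 + eta) ^ 2 * P0 s - 2 * (1 - eta) ^ 2 * P2 s))
      (fun s => L * (s * s ^ m * resc b beta u s ^ 2) - 2 * (s ^ 3 * s ^ m * resc b beta u s ^ 2)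
        - (L * (1 + eta) ^ 2 * (s * s ^ m * bubble m s ^ 2) - 2 * (1 - eta) ^ 2 * (s ^ 3 * s ^ m * bubble m s ^ 2)))); [trivial | | | ].
    - intros x Hx. destruct (HPd x ltac:(lra)) as [D0 D2].
      apply (is_derive_minus h); [apply Hhd; lra | ].
      auto_derive; [dsolve | ]. drw D0; drw D2. ring.
    - intros x Hx. destruct (Hv x Hx) as [V1 V2]. destruct (Hsp x ltac:(lra)) as [X1 X2].
      assert (L * (x * x ^ m) * resc b beta u x ^ 2 <= L * (x * x ^ m) * ((1 + eta) ^ 2 * bubble m x ^ 2)).
      { apply Rmult_le_compat_l; [apply Rmult_le_pos; lra | trivial]. }
      assert (x ^ 3 * x ^ m * ((1 - eta) ^ 2 * bubble m x ^ 2) <= x ^ 3 * x ^ m * resc b beta u x ^ 2) by (apply Rmult_le_compat_l; lra).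
      lra.
    - apply flim_val with (0 - (L * (1 + eta) ^ 2 * 0 - 2 * (1 - eta) ^ 2 * 0)); [flims | ring]. }
  assert (E2 : L * (1 - eta) ^ 2 * P0 S - 2 * (1 + eta) ^ 2 * P2 S <= h S).
  { assert (L * (1 - eta) ^ 2 * P0 S - 2 * (1 + eta) ^ 2 * P2 S - h S <= 0); [ | lra].
    eapply (derive_decr_lim0 (fun s => L * (1 - eta) ^ 2 * P0 s - 2 * (1 + eta) ^ 2 * P2 s - h s)
      (fun s => (L * (1 - eta) ^ 2 * (s * s ^ m * bubble m s ^ 2) - 2 * (1 + eta) ^ 2 * (s ^ 3 * s ^ m * bubble m s ^ 2)) -
         (L * (s * s ^ m * resc b beta u s ^ 2) - 2 * (s ^ 3 * s ^ m * resc b beta u s ^ 2)))); [trivial | | | ].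
    - intros x Hx. destruct (HPd x ltac:(lra)) as [D0 D2].
      apply (is_derive_minus (fun s => L * (1 - eta) ^ 2 * P0 s - 2 * (1 + eta) ^ 2 * P2 s) h); [ | apply Hhd; lra].
      auto_derive; [dsolve | ]. drw D0; drw D2. ring.
    - intros x Hx. destruct (Hv x Hx) as [V1 V2]. destruct (Hsp x ltac:(lra)) as [X1 X2].
      assert (L * (x * x ^ m) * ((1 - eta) ^ 2 * bubble m x ^ 2) <= L * (x * x ^ m) * resc b beta u x ^ 2).
      { apply Rmult_le_compat_l; [apply Rmult_le_pos; lra | trivial]. }
      assert (x ^ 3 * x ^ m * resc b beta u x ^ 2 <= x ^ 3 * x ^ m * ((1 + eta) ^ 2 * bubble m x ^ 2)) by (apply Rmult_le_compat_l; lra).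
      lra.
    - apply flim_val with (L * (1 - eta) ^ 2 * 0 - 2 * (1 + eta) ^ 2 * 0 - 0); [flims | ring]. }
  unfold F. fold S. rewrite <- HhS.
  set (N := h S + 2 * P2 S). assert (HN : 0 <= N) by (unfold N; lra).
  assert (HF : N / P0 S * P0 S = N) by (field; lra).
  split.
  - apply Rmult_le_reg_r with (P0 S * (1 + eta) ^ 2); [apply Rmult_lt_0_compat; nra | ].
    apply Rle_trans with ((1 - 4 * eta) * (1 + eta) ^ 2 * N); [right; rewrite <- HF at 2; ring | ].
    (* The constant 4, and 16 in the other half, bound the quotients of [(1 - eta)^2] and
       [(1 + eta)^2] for [eta <= 1/4]. *)
    assert ((1 - 4 * eta) * (1 + eta) ^ 2 <= (1 - eta) ^ 2) by nra.
    assert ((1 - 4 * eta) * (1 + eta) ^ 2 * N <= (1 - eta) ^ 2 * N) by (apply Rmult_le_compat_r; trivial).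
    assert ((1 - eta) ^ 2 * N <= h S + 2 * (1 - eta) ^ 2 * P2 S) by (unfold N; assert ((1 - eta) ^ 2 <= 1) by nra; nra).
    lra.
  - apply Rmult_le_reg_r with (P0 S * (1 - eta) ^ 2); [apply Rmult_lt_0_compat; nra | ].
    apply Rle_trans with ((1 + 16 * eta) * (1 - eta) ^ 2 * N); [ | right; rewrite <- HF at 1; ring].
    assert ((1 + eta) ^ 2 <= (1 + 16 * eta) * (1 - eta) ^ 2) by nra.
    assert ((1 + eta) ^ 2 * N <= (1 + 16 * eta) * (1 - eta) ^ 2 * N) by (apply Rmult_le_compat_r; trivial).
    assert (h S + 2 * (1 + eta) ^ 2 * P2 S <= (1 + eta) ^ 2 * N) by (unfold N; assert (1 <= (1 + eta) ^ 2) by nra; nra).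
    lra.
Qed.

(** The step shared by the three cases; [n] is the expected size of [lam beta^2], namely [1], [ln b]
    or [beta]. The radius [del] is fixed before [b] grows, hence a threshold [B] for each small
    [del] in the hypothesis. *)
Lemma lam_limit_close (m : nat) (Phi : R -> R -> R) (P0 P2 : R -> R) (lam : R -> R) (u u1 : R -> R -> R)
  (n : R -> R) (T : R) :
  (3 <= m)%nat -> outer_family m Phi -> bubble_moments m P0 P2 -> 0 < T ->
  (forall b, 0 < b -> gstate m (lam b) b (u b) (u1 b)) ->
  (forall tau, 0 < tau -> exists del1, 0 < del1 /\ forall del, 0 < del <= del1 ->
    exists B, 1 <= B /\ forall b, B <= b ->
      0 < n b /\
      let beta := Rpower b (2 / INR m) in
      Rabs ((beta ^ 4 * poho m (lam b) (u b) (u1 b) del + 2 * P2 (del * beta)) / P0 (del * beta) / n b - T) <= tau) ->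
  filterlim (fun b => lam b * Rpower b (2 / INR m) ^ 2 / n b) (Rbar_locally p_infty) (locally T).
Proof.
  intros Hm HPhi HP HT Hg HF. apply flim_eps; [typeclasses eauto | ]. intros eps Heps.
  set (tau := Rmin T (eps / 4)).
  assert (Htau : 0 < tau) by (apply Rmin_glb_lt; lra).
  assert (Ht1 : tau <= T) by apply Rmin_l. assert (Ht2 : tau <= eps / 4) by apply Rmin_r.
  set (eta := Rmin (1 / 4) (eps / (128 * T))).
  assert (He0 : 0 < eps / (128 * T)) by (apply Rdiv_lt_0_compat; lra).
  assert (Heta : 0 < eta <= 1 / 4) by (split; [apply Rmin_glb_lt; lra | apply Rmin_l]).
  assert (Heta2 : eta * T <= eps / 128).
  { apply Rle_trans with (eps / (128 * T) * T); [apply Rmult_le_compat_r; [lra | apply Rmin_r] | right; field; lra]. }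
  destruct (lam_sandwich m Phi P0 P2 eta Hm HPhi HP Heta) as [del0 [B0 [Hdel0 [HB0 Hs]]]].
  destruct (HF tau Htau) as [del1 [Hdel1 HF1]].
  set (del := Rmin del0 del1).
  assert (Hd : 0 < del) by (apply Rmin_glb_lt; lra).
  assert (Hd0 : del <= del0) by apply Rmin_l. assert (Hd1 : del <= del1) by apply Rmin_r.
  destruct (HF1 del (conj Hd Hd1)) as [B1 [HB1 HF2]].
  apply (infty_intro _ (B0 + B1)). intros b Hb. assert (Hb0 : 0 < b) by lra.
  destruct (Hs del b (lam b) (u b) (u1 b) (conj Hd Hd0) ltac:(lra) (Hg b Hb0)) as [S1 S2].
  destruct (HF2 b ltac:(lra)) as [Hn H2]. cbv zeta in H2.
  set (F := (Rpower b (2 / INR m) ^ 4 * poho m (lam b) (u b) (u1 b) del + 2 * P2 (del * Rpower b (2 / INR m))) /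
           P0 (del * Rpower b (2 / INR m))) in *.
  set (L := lam b * Rpower b (2 / INR m) ^ 2) in *.
  apply Rabs_le_between in H2.
  assert (Hi : 0 < / n b) by now apply Rinv_0_lt_compat.
  assert (E1 : (1 - 4 * eta) * (F / n b) <= L / n b).
  { unfold Rdiv. rewrite <- Rmult_assoc. apply Rmult_le_compat_r; lra. }
  assert (E2 : L / n b <= (1 + 16 * eta) * (F / n b)).
  { unfold Rdiv. rewrite <- Rmult_assoc. apply Rmult_le_compat_r; lra. }
  set (f := F / n b) in *. apply Rabs_def1.
  - assert (16 * eta * f <= 16 * eta * (2 * T)) by (apply Rmult_le_compat_l; lra). lra.
  - assert (4 * eta * f <= 4 * eta * (2 * T)) by (apply Rmult_le_compat_l; lra). lra.
Qed.

(** Multiplied by [beta^4], this bound has the order [beta^(4-m)]: negligible for [m >= 5], bounded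
    for [m = 4], and of leading order for [m = 3]. *)
Lemma poho_upper (m : nat) (Phi : R -> R -> R) (del : R) :
  (3 <= m)%nat -> outer_family m Phi -> 0 < del <= 1 ->
  exists C B, 0 < C /\ 1 <= B /\ forall b lam u u1, B <= b -> gstate m lam b u u1 ->
    0 <= poho m lam u u1 del <= C / b ^ 2.
Proof.
  intros Hm HPhi Hd. assert (HM := INR_ge3 m Hm).
  destruct (slope_bound m Phi Hm HPhi) as [A [B1 [HA [HB1 Hsl]]]].
  destruct (mass_bound m Hm) as [C [B2 [HC [HB2 Hmass]]]].
  assert (Hdm : 0 < del ^ m <= 1).
  { split; [apply pow_lt; lra | ]. rewrite <- (pow1 m). apply pow_incr. lra. }
  set (C1 := C / del ^ m). assert (HC1 : 0 < C1) by (apply Rdiv_lt_0_compat; lra).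
  exists (((INR m + A) ^ 2 + 2) * C1 ^ 2), (B1 + B2 + C1).
  split; [generalize (pow2_ge_0 (INR m + A)); nra | split; [lra | ]].
  intros b lam u u1 Hb Hg. assert (Hb0 : 0 < b) by lra.
  split; [apply (poho_nonneg m lam b); trivial; lra | ].
  specialize (Hsl b lam u u1 ltac:(lra) Hg del Hd). destruct (Hmass b lam u u1 ltac:(lra) Hg) as [Hl2 Hmb].
  specialize (Hmb del (proj1 Hd)).
  destruct (proj1 (proj2 Hg) del (proj1 Hd)) as [[A1 A2] A3].
  assert (Hu : u del <= C1 / b).
  { apply Rmult_le_reg_l with (b * del ^ m); [nra | ].
    replace (b * del ^ m * (C1 / b)) with C by (unfold C1; field; lra). lra. }
  assert (HC1b : C1 / b <= 1).
  { apply Rmult_le_reg_r with b; trivial. unfold Rdiv. rewrite Rmult_assoc, Rinv_l; lra. }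
  assert (Hu2 : u del ^ 2 <= C1 ^ 2 / b ^ 2).
  { replace (C1 ^ 2 / b ^ 2) with ((C1 / b) ^ 2) by (field; lra). apply pow_incr. lra. }
  assert (Hsg : 0 < 4 / INR m) by (apply Rdiv_lt_0_compat; lra).
  assert (HK : Rpower (u del) (4 / INR m) <= 1) by (apply Rpower_le1; lra).
  assert (Hx2 : 0 <= u del ^ 2) by apply pow2_ge_0.
  assert (D5 : Rpower (u del) (4 / INR m) * u del ^ 2 / (4 / INR m + 2) <= u del ^ 2 / 2).
  { apply Rmult_le_reg_r with (4 / INR m + 2); [lra | ]. unfold Rdiv at 1. rewrite Rmult_assoc, Rinv_l by lra.
    rewrite Rmult_1_r. nra. }
  assert (D6 : del ^ 2 * u1 del ^ 2 <= (INR m + A) ^ 2 * u del ^ 2).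
  { replace (del ^ 2 * u1 del ^ 2) with ((- (del * u1 del)) ^ 2) by ring.
    replace ((INR m + A) ^ 2 * u del ^ 2) with (((INR m + A) * u del) ^ 2) by ring.
    apply pow_incr. split; [nra | ]. apply Rle_trans with (1 := Hsl). apply Rmult_le_compat_r; [lra | ].
    assert (del ^ 2 <= 1) by nra. nra. }
  assert (Hd2 : 0 < del ^ 2 <= 1) by nra.
  unfold poho.
  assert (D7 : INR m / 2 * (del * del ^ m * u del * u1 del) <= 0).
  { assert (0 <= del * del ^ m * u del) by (apply Rmult_le_pos; nra). assert (del * del ^ m * u del * u1 del <= 0) by nra. nra. }
  set (X := u1 del ^ 2 / 2 + Rpower (u del) (4 / INR m) * u del ^ 2 / (4 / INR m + 2) + (lam - del ^ 2) * u del ^ 2 / 2) in *.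
  assert (D8 : del ^ 2 * X <= ((INR m + A) ^ 2 + 2) * u del ^ 2).
  { unfold X.
    assert (del ^ 2 * (Rpower (u del) (4 / INR m) * u del ^ 2 / (4 / INR m + 2)) <= 1 * (u del ^ 2 / 2)).
    { apply Rle_trans with (del ^ 2 * (u del ^ 2 / 2)); [apply Rmult_le_compat_l; lra | apply Rmult_le_compat_r; lra]. }
    assert (del ^ 2 * ((lam - del ^ 2) * u del ^ 2 / 2) <= 1 * (u del ^ 2)).
    { replace (del ^ 2 * ((lam - del ^ 2) * u del ^ 2 / 2)) with (del ^ 2 * (lam - del ^ 2) / 2 * u del ^ 2) by field.
      apply Rmult_le_compat_r; trivial. nra. }
    assert (0 <= (INR m + A) ^ 2 * u del ^ 2) by (apply Rmult_le_pos; [apply pow2_ge_0 | trivial]). lra. }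
  assert (D10 : del ^ 2 * del ^ m * X <= ((INR m + A) ^ 2 + 2) * u del ^ 2).
  { replace (del ^ 2 * del ^ m * X) with (del ^ m * (del ^ 2 * X)) by ring.
    apply Rle_trans with (del ^ m * (((INR m + A) ^ 2 + 2) * u del ^ 2)); [apply Rmult_le_compat_l; lra | nra]. }
  apply Rle_trans with (((INR m + A) ^ 2 + 2) * u del ^ 2); [lra | ].
  replace (((INR m + A) ^ 2 + 2) * C1 ^ 2 / b ^ 2) with (((INR m + A) ^ 2 + 2) * (C1 ^ 2 / b ^ 2)) by (unfold Rdiv; ring).
  apply Rmult_le_compat_l; [generalize (pow2_ge_0 (INR m + A)); lra | trivial].
Qed.

Lemma primitive_exists (f : R -> R) :
  (forall x, continuous f x) ->
  exists P, (forall s, is_derive P s (f s)) /\ filterlim P (at_right 0) (locally 0).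
Proof.
  intros Hf. set (P := fun s => RInt f 0 s).
  assert (HP : forall s, is_derive P s (f s)).
  { intros s. apply is_derive_RInt with 0; trivial.
    apply filter_forall. intros x. apply RInt_correct, ex_RInt_continuous. intros z _. apply Hf. }
  exists P. split; trivial.
  apply flim_val with (P 0); [apply cont_right, (is_derive_cont _ _ _ (HP 0)) | ].
  exact (RInt_point 0 f).
Qed.

Lemma bubble_moment_exists (m n : nat) :
  (3 <= m)%nat ->
  exists P, (forall s, is_derive P s (s ^ n * s ^ m * bubble m s ^ 2)) /\
    filterlim P (at_right 0) (locally 0).
Proof.
  intros Hm. apply primitive_exists. intros x.
  apply (ex_derive_continuous (fun s => s ^ n * s ^ m * bubble m s ^ 2)).
  assert (D := bubble_derive m x Hm). destruct (is_derive_opaque _ _ _ D) as [q [Eq Dq]].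
  apply (ex_derive_ext (fun s => s ^ n * s ^ m * q s ^ 2)); [intros t; now rewrite Eq | ].
  auto_derive. dsolve.
Qed.

(** Up to this boundary term, [(m + 2) P0 = alc (m - 4) P2]. For [m > 4] this yields the limit of
    [P2 / P0]; for [m = 4] the second coefficient vanishes and [P0] is obtained in closed form. *)
Lemma bubble_boundary_derive (m : nat) (s : R) :
  (3 <= m)%nat -> 0 < s ->
  is_derive (fun s => s ^ 2 * s ^ m * (1 + alc m * s ^ 2) * bubble m s ^ 2) s
    (s * s ^ m * bubble m s ^ 2 * (INR m + 2 - alc m * (INR m - 4) * s ^ 2)).
Proof.
  intros Hm Hs. assert (H1 := bubble_den m s Hm).
  assert (D := bubble_derive m s Hm). destruct (is_derive_opaque _ _ _ D) as [q [Eq Dq]].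
  apply (is_derive_ext (fun s => s ^ 2 * s ^ m * (1 + alc m * s ^ 2) * q s ^ 2)); [intros t; now rewrite Eq | ].
  auto_derive; [dsolve | ]. drw Dq. rewrite !Eq, pow_pred by lra. unfold bubble1. field. lra.
Qed.

Lemma bubble_boundary_lim0 (m : nat) :
  (3 <= m)%nat ->
  filterlim (fun s => s ^ 2 * s ^ m * (1 + alc m * s ^ 2) * bubble m s ^ 2) (at_right 0) (locally 0).
Proof.
  intros Hm. destruct (bubble_lim0 m Hm) as [H0 _].
  apply flim_val with (0 ^ 2 * 0 ^ m * (1 + alc m * 0 ^ 2) * 1 ^ 2); [flims | ring].
Qed.

Lemma lam_high (m : nat) (Phi : R -> R -> R) (lam : R -> R) (u u1 : R -> R -> R) :
  (5 <= m)%nat -> outer_family m Phi ->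
  (forall b, 0 < b -> gstate m (lam b) b (u b) (u1 b)) ->
  filterlim (fun b => lam b * Rpower b (2 / INR m) ^ 2) (Rbar_locally p_infty)
    (locally (2 * (INR m + 2) / (alc m * (INR m - 4)))).
Proof.
  intros Hm5 HPhi Hg. assert (Hm : (3 <= m)%nat) by lia.
  assert (HM5 : 5 <= INR m) by (apply (le_INR 5) in Hm5; simpl in Hm5; lra).
  assert (Ha := alc_pos m Hm). set (a := alc m) in *.
  destruct (bubble_moment_exists m 1 Hm) as [P0 [HP0 HP00]].
  set (Rb := fun s => s ^ 2 * s ^ m * (1 + a * s ^ 2) * bubble m s ^ 2).
  (* The primitive dictated by the boundary identity; once [Rb] is negligible, the limit of
     [2 P2 / P0] can be read off. *)
  set (P2 := fun s => ((INR m + 2) * P0 s - Rb s) / (a * (INR m - 4))).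
  assert (Ham : 0 < a * (INR m - 4)) by (apply Rmult_lt_0_compat; lra).
  assert (Hmom : bubble_moments m P0 P2).
  { split; [ | split; trivial].
    - intros s Hs. split.
      + eapply is_derive_val; [apply HP0 | ring].
      + assert (D0 := HP0 s). assert (D1 := bubble_boundary_derive m s Hm Hs). fold a in D1. fold Rb in D1.
        destruct (is_derive_opaque _ _ _ D1) as [q [Eq Dq]].
        apply (is_derive_ext (fun s => ((INR m + 2) * P0 s - q s) / (a * (INR m - 4)))); [intros t; unfold P2; now rewrite Eq | ].
        auto_derive; [dsolve | ]. drw D0; drw Dq. field. lra.
    - unfold P2. assert (H := bubble_boundary_lim0 m Hm). fold a in H. fold Rb in H.
      apply flim_val with (((INR m + 2) * 0 - 0) * / (a * (INR m - 4))); [unfold Rdiv; flims | ring]. }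
  set (T := 2 * (INR m + 2) / (a * (INR m - 4))).
  assert (HT : 0 < T) by (apply Rdiv_lt_0_compat; lra).
  apply (flim_ext _ (fun b => lam b * Rpower b (2 / INR m) ^ 2 / 1)).
  { apply filter_forall. intros b. field. }
  apply (lam_limit_close m Phi P0 P2 lam u u1 (fun _ => 1) T); trivial.
  intros tau Htau. exists 1. split; [lra | ]. intros del Hd.
  destruct (poho_upper m Phi del Hm HPhi Hd) as [C [B1 [HC [HB1 Hpu]]]].
  destruct (moments_pos m P0 P2 Hmom) as [HPp HPm].
  set (A0 := bubble_lim m). assert (HA0 : 0 < A0) by apply Rpower_pos.
  set (p1 := P0 1). assert (Hp1 : 0 < p1) by (apply HPp; lra).
  (* Comes from [Rb S <= A0^2 (1 + a)/S] at [S = del beta], where [S^5 <= S^m] uses [m >= 5]. *)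
  set (C2 := 2 * (A0 ^ 2 * (1 + a)) / (a * (INR m - 4)) / del).
  assert (HC2 : 0 < C2).
  { unfold C2. apply Rdiv_lt_0_compat; [ | lra]. apply Rdiv_lt_0_compat; trivial.
    assert (0 < A0 ^ 2) by (apply pow_lt; trivial). nra. }
  assert (Hy : 0 < 2 / INR m) by (apply Rdiv_lt_0_compat; lra).
  assert (Hq1 : 0 < (C + C2) / (p1 * tau)) by (apply Rdiv_lt_0_compat; [lra | now apply Rmult_lt_0_compat]).
  assert (Hq2 : 0 < / del) by (apply Rinv_0_lt_compat; lra).
  destruct (large_power (2 / INR m) (1 + / del + (C + C2) / (p1 * tau)) Hy) as [B2 [HB2 Hbig]].
  exists (B1 + B2). split; [lra | ]. intros b Hb. split; [lra | ]. intros beta.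
  assert (Hb0 : 0 < b) by lra. specialize (Hbig b ltac:(lra)). fold beta in Hbig.
  assert (Hbm := Rpower_beta m b Hm Hb0). fold beta in Hbm.
  destruct (Hpu b (lam b) (u b) (u1 b) ltac:(lra) (Hg b Hb0)) as [Hh1 Hh2].
  set (h := poho m (lam b) (u b) (u1 b) del) in *.
  assert (Hbe : 1 <= beta) by lra.
  set (S := del * beta).
  assert (HS : 1 <= S).
  { unfold S. apply Rle_trans with (del * / del); [right; field; lra | apply Rmult_le_compat_l; lra]. }
  assert (HPS : p1 <= P0 S) by (apply HPm; lra).
  assert (E1 : beta ^ 4 * h <= C / beta).
  { apply Rle_trans with (beta ^ 4 * (C / b ^ 2)); [apply Rmult_le_compat_l; [apply pow_le; lra | trivial] | ].
    assert (beta ^ 5 <= b ^ 2) by (rewrite <- Hbm; apply Rle_pow; trivial).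
    assert (0 < beta ^ 5) by (apply pow_lt; lra).
    apply Rle_trans with (beta ^ 4 * (C / beta ^ 5)).
    - apply Rmult_le_compat_l; [apply pow_le; lra | ]. apply Rmult_le_compat_l; [lra | ]. now apply Rinv_le_contravar.
    - right. field. lra. }
  assert (E1' : 0 <= beta ^ 4 * h) by (apply Rmult_le_pos; [apply pow_le; lra | trivial]).
  assert (E2 : 0 <= Rb S <= A0 ^ 2 * (1 + a) / S).
  { assert (Q1 := bubble_pos m S). assert (Q2 := bubble_tail_le m S Hm ltac:(lra)). fold A0 in Q2.
    assert (Sm : 0 < S ^ m) by (apply pow_lt; lra). unfold Rb. split.
    - apply Rmult_le_pos; [ | nra]. apply Rmult_le_pos; nra.
    - assert (Q3 : (S ^ m * bubble m S) ^ 2 <= A0 ^ 2) by (apply pow_incr; split; [apply Rmult_le_pos; lra | trivial]).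
      apply Rmult_le_reg_r with (S ^ m * S); [nra | ].
      replace (A0 ^ 2 * (1 + a) / S * (S ^ m * S)) with (A0 ^ 2 * ((1 + a) * S ^ m)) by (field; lra).
      replace (S ^ 2 * S ^ m * (1 + a * S ^ 2) * bubble m S ^ 2 * (S ^ m * S))
        with ((S ^ m * bubble m S) ^ 2 * (S ^ 3 * (1 + a * S ^ 2))) by ring.
      assert (S5 : S ^ 5 <= S ^ m) by (apply Rle_pow; trivial).
      assert (0 < S ^ 3) by (apply pow_lt; lra).
      apply Rmult_le_compat; trivial; [apply pow2_ge_0 | apply Rmult_le_pos; nra | ].
      apply Rle_trans with ((1 + a) * S ^ 5); [ | apply Rmult_le_compat_l; lra].
      replace ((1 + a) * S ^ 5) with (S ^ 3 * (S ^ 2 + a * S ^ 2)) by ring. apply Rmult_le_compat_l; nra. }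
  replace ((beta ^ 4 * h + 2 * P2 S) / P0 S / 1 - T) with ((beta ^ 4 * h - 2 * Rb S / (a * (INR m - 4))) / P0 S)
    by (unfold T, P2; field; repeat split; lra).
  assert (E3 : 2 * Rb S / (a * (INR m - 4)) <= C2 / beta).
  { replace (C2 / beta) with (2 * (A0 ^ 2 * (1 + a) / S) / (a * (INR m - 4))) by (unfold C2, S; field; repeat split; lra).
    apply Rmult_le_compat_r; [left; now apply Rinv_0_lt_compat | lra]. }
  assert (E3' : 0 <= 2 * Rb S / (a * (INR m - 4))) by (apply Rdiv_le_0_compat; lra).
  assert (E4 : C / beta + C2 / beta <= p1 * tau).
  { replace (C / beta + C2 / beta) with ((C + C2) / (p1 * tau) * (p1 * tau) / beta) by (field; repeat split; lra).
    apply Rmult_le_reg_r with beta; [lra | ]. unfold Rdiv at 1. rewrite Rmult_assoc, Rinv_l, Rmult_1_r by lra.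
    rewrite (Rmult_comm (p1 * tau)). apply Rmult_le_compat_r; [nra | lra]. }
  unfold Rdiv at 1. rewrite Rabs_mult, (Rabs_pos_eq (/ P0 S)) by (left; apply Rinv_0_lt_compat; lra).
  apply Rmult_le_reg_r with (P0 S); [lra | ]. rewrite Rmult_assoc, Rinv_l, Rmult_1_r by lra.
  apply Rle_trans with (p1 * tau); [ | nra].
  assert (0 <= C / beta) by (apply Rdiv_le_0_compat; lra). assert (0 <= C2 / beta) by (apply Rdiv_le_0_compat; lra).
  apply Rabs_le. lra.
Qed.

(** * The logarithmic case [m = 4] *)

Lemma inv_ln_lim : filterlim (fun b => / ln b) (Rbar_locally p_infty) (locally 0).
Proof.
  apply flim_eps; [typeclasses eauto | ]. intros eps He. apply (infty_intro _ (exp (/ eps))). intros b Hb.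
  assert (Hl : / eps < ln b) by (rewrite <- (ln_exp (/ eps)); apply ln_increasing; [apply exp_pos | trivial]).
  assert (0 < / eps) by now apply Rinv_0_lt_compat.
  rewrite Rminus_0_r, Rabs_pos_eq by (left; apply Rinv_0_lt_compat; lra).
  rewrite <- (Rinv_inv eps). apply Rinv_lt_contravar; [nra | trivial].
Qed.

Lemma flim_at_infty_comp (f g : R -> R) (l : R) :
  filterlim f (Rbar_locally p_infty) (locally l) ->
  (forall X, exists B, forall b, B <= b -> X <= g b) ->
  filterlim (fun b => f (g b)) (Rbar_locally p_infty) (locally l).
Proof.
  intros Hf Hg. apply flim_eps; [typeclasses eauto | ]. intros eps He.
  apply flim_eps with (eps := eps) in Hf; [ | typeclasses eauto | trivial].
  destruct (infty_elim _ 0 Hf) as [M [HM HM']]. destruct (Hg M) as [B HB].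
  apply (infty_intro _ B). intros b Hb. apply HM', HB. lra.
Qed.

Lemma bubble4 (s : R) : bubble 4 s = / (1 + alc 4 * s ^ 2) ^ 2.
Proof.
  assert (H1 := bubble_den 4 s ltac:(lia)).
  unfold bubble. replace (INR 4 / 2) with (INR 2) by (simpl; field).
  rewrite Rpower_Ropp, Rpower_pow by lra. reflexivity.
Qed.

(** [P0] tends to [1/(6 a^3)] and [P2] grows like [ln (1 + a s^2)/(2 a^4)]. At [s = del beta] this
    logarithm is equivalent to [ln b], whatever [del] is, because [beta^2 = b]. The limit is
    [6/a = 144]. *)
Lemma lam_six (Phi : R -> R -> R) (lam : R -> R) (u u1 : R -> R -> R) :
  outer_family 4 Phi ->
  (forall b, 0 < b -> gstate 4 (lam b) b (u b) (u1 b)) ->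
  filterlim (fun b => lam b * Rpower b (2 / INR 4) ^ 2 / ln b) (Rbar_locally p_infty) (locally 144).
Proof.
  intros HPhi Hg. assert (Hm : (3 <= 4)%nat) by lia.
  assert (Ha := alc_pos 4 Hm). assert (Ha24 : alc 4 = / 24) by (unfold alc; simpl; field).
  set (a := alc 4) in *.
  set (P0 := fun s => s ^ 2 * s ^ 4 * (1 + a * s ^ 2) * bubble 4 s ^ 2 / 6).
  (* With [y = 1 + a s^2] the integral becomes that of [(y - 1)^3/(2 a^4 y^4)] in [y], and [11/6] is
     the value of the rational part at [y = 1]. *)
  set (P2 := fun s => / (2 * a ^ 4) * (ln (1 + a * s ^ 2) + 3 / (1 + a * s ^ 2) - 3 / (2 * (1 + a * s ^ 2) ^ 2)
     + 1 / (3 * (1 + a * s ^ 2) ^ 3) - 11 / 6)).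
  assert (HIc : forall s, 1 <= 1 + a * s ^ 2) by (intros s; apply (bubble_den 4 s Hm)).
  assert (Hmom : bubble_moments 4 P0 P2).
  { split; [ | split].
    - intros s Hs. assert (H1 := HIc s). split.
      + assert (D1 := bubble_boundary_derive 4 s Hm Hs). fold a in D1.
        destruct (is_derive_opaque _ _ _ D1) as [q [Eq Dq]].
        apply (is_derive_ext (fun s => q s / 6)); [intros t; unfold P0; now rewrite Eq | ].
        auto_derive; [dsolve | ]. drw Dq. simpl INR. field.
      + unfold P2. rewrite bubble4. fold a. auto_derive.
        * simpl in H1. repeat split; try lra; apply Rgt_not_eq; repeat apply Rmult_lt_0_compat; lra.
        * field. simpl in *. repeat split; lra.
    - assert (H := bubble_boundary_lim0 4 Hm). fold a in H. unfold P0, Rdiv.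
      apply flim_val with (0 * / 6); [ | ring]. apply flim_mult; [typeclasses eauto | exact H | apply flim_const; typeclasses eauto].
    - apply flim_val with (P2 0).
      + apply cont_right. apply (ex_derive_continuous P2). unfold P2. auto_derive. assert (H1 := HIc 0). simpl in H1.
        repeat split; try lra; apply Rgt_not_eq; repeat apply Rmult_lt_0_compat; lra.
      + unfold P2. replace (1 + a * 0 ^ 2) with 1 by ring. rewrite ln_1. field. lra. }
  assert (Hlarge : forall del, 0 < del -> forall X, exists B, forall b, B <= b -> X <= del * Rpower b (2 / INR 4)).
  { intros del Hd X. destruct (large_power (2 / INR 4) (X / del)) as [B [_ HB]]; [simpl; lra | ].
    exists B. intros b Hb. specialize (HB b Hb).
    apply Rle_trans with (del * (X / del)); [right; field; lra | apply Rmult_le_compat_l; lra]. }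
  assert (Hb2 : forall b, 0 < b -> Rpower b (2 / INR 4) ^ 2 = b).
  { intros b Hb. rewrite <- (Rpower_pow 2), Rpower_mult by apply Rpower_pos.
    replace (2 / INR 4 * INR 2) with 1 by (simpl; field). now apply Rpower_1. }
  assert (HI0 : filterlim (fun s => / (1 + a * s ^ 2)) (Rbar_locally p_infty) (locally 0)).
  { apply (flim_abs_le _ _ (fun s => / a * (/ s) ^ 2)).
    - apply (infty_intro _ 0). intros s Hs. specialize (HIc s).
      rewrite Rminus_0_r, Rabs_pos_eq by (left; apply Rinv_0_lt_compat; lra).
      rewrite pow_inv, <- Rinv_mult. apply Rinv_le_contravar; nra.
    - apply flim_val with (/ a * 0 ^ 2); [flims | ring]. }
  assert (HP0 : filterlim P0 (Rbar_locally p_infty) (locally (/ (6 * a ^ 3)))).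
  { apply (flim_ext _ (fun s => / (6 * a ^ 3) * (1 - / (1 + a * s ^ 2)) ^ 3)).
    - apply filter_forall. intros s. specialize (HIc s). unfold P0. rewrite bubble4. fold a. field. simpl in *. lra.
    - apply flim_val with (/ (6 * a ^ 3) * (1 - 0) ^ 3); [flims | ring]. }
  apply (lam_limit_close 4 Phi P0 P2 lam u u1 ln 144); trivial; [lra | ].
  intros tau Htau. exists 1. split; [lra | ]. intros del Hd.
  destruct (poho_upper 4 Phi del Hm HPhi Hd) as [C [B1 [HC [HB1 Hpu]]]].
  set (S := fun b => del * Rpower b (2 / INR 4)).
  assert (HP0S : filterlim (fun b => P0 (S b)) (Rbar_locally p_infty) (locally (/ (6 * a ^ 3)))).
  { apply flim_at_infty_comp; trivial. apply Hlarge. lra. }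
  assert (HIS : filterlim (fun b => / (1 + a * S b ^ 2)) (Rbar_locally p_infty) (locally 0)).
  { apply (flim_at_infty_comp (fun s => / (1 + a * s ^ 2))); trivial. apply Hlarge. lra. }
  assert (Hln : filterlim (fun b => ln (1 + a * S b ^ 2) * / ln b) (Rbar_locally p_infty) (locally 1)).
  (* The argument is [b] times [1/b + a del^2], and the second factor has a finite positive limit,
     so its logarithm is negligible. *)
  { apply (flim_ext _ (fun b => 1 + ln (/ b + a * del ^ 2) * / ln b)).
    - apply (infty_intro _ 1). intros b Hb.
      assert (Hl : 0 < ln b) by (rewrite <- ln_1; apply ln_increasing; lra).
      unfold S. rewrite Rpow_mult_distr, Hb2 by lra.
      assert (0 < / b) by (apply Rinv_0_lt_compat; lra).
      assert (0 < a * del ^ 2) by (apply Rmult_lt_0_compat; [lra | nra]).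
      replace (1 + a * (del ^ 2 * b)) with (b * (/ b + a * del ^ 2)) by (field; lra).
      rewrite ln_mult by lra. field. lra.
    - apply flim_val with (1 + ln (0 + a * del ^ 2) * 0); [ | ring].
      apply flim_plus; [typeclasses eauto | apply flim_const; typeclasses eauto | ].
      apply flim_mult; [typeclasses eauto | | apply inv_ln_lim].
      apply (flim_cont _ ln).
      + apply continuity_pt_filterlim, derivable_continuous_pt. exists (/ (0 + a * del ^ 2)). apply derivable_pt_lim_ln.
        rewrite Rplus_0_l. apply Rmult_lt_0_compat; [lra | nra].
      + flims. }
  assert (Hil := inv_ln_lim).
  assert (HP2S : filterlim (fun b => P2 (S b) * / ln b) (Rbar_locally p_infty) (locally (/ (2 * a ^ 4)))).
  { apply (flim_ext _ (fun b => / (2 * a ^ 4) * (ln (1 + a * S b ^ 2) * / ln b + (3 * / (1 + a * S b ^ 2) - 3 / 2 * (/ (1 + a * S b ^ 2)) ^ 2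
       + 1 / 3 * (/ (1 + a * S b ^ 2)) ^ 3 - 11 / 6) * / ln b))).
    - apply (infty_intro _ 1). intros b Hb. assert (Hl : 0 < ln b) by (rewrite <- ln_1; apply ln_increasing; lra).
      specialize (HIc (S b)). unfold P2. set (y := 1 + a * S b ^ 2) in *. field. repeat split; lra.
    - apply flim_val with (/ (2 * a ^ 4) * (1 + (3 * 0 - 3 / 2 * 0 ^ 2 + 1 / 3 * 0 ^ 3 - 11 / 6) * 0)); [flims | ring]. }
  assert (Hh : filterlim (fun b => Rpower b (2 / INR 4) ^ 4 * poho 4 (lam b) (u b) (u1 b) del * / ln b) (Rbar_locally p_infty) (locally 0)).
  { apply (flim_scal0 _ _ _ C); [ | exact Hil].
    apply (infty_intro _ B1). intros b Hb. destruct (Hpu b (lam b) (u b) (u1 b) ltac:(lra) (Hg b ltac:(lra))) as [Hh1 Hh2].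
    replace (Rpower b (2 / INR 4) ^ 4) with (b ^ 2) by (rewrite <- (Hb2 b) at 1 by lra; ring).
    assert (Hbb : 0 < b ^ 2) by (apply pow_lt; lra).
    rewrite Rabs_pos_eq by (apply Rmult_le_pos; lra).
    apply Rle_trans with (b ^ 2 * (C / b ^ 2)); [apply Rmult_le_compat_l; lra | right; field; lra]. }
  assert (HF : filterlim (fun b => (Rpower b (2 / INR 4) ^ 4 * poho 4 (lam b) (u b) (u1 b) del + 2 * P2 (S b)) / P0 (S b) / ln b)
     (Rbar_locally p_infty) (locally 144)).
  { apply (flim_ext _ (fun b => (Rpower b (2 / INR 4) ^ 4 * poho 4 (lam b) (u b) (u1 b) del * / ln b + 2 * (P2 (S b) * / ln b)) * / P0 (S b))).
    - apply filter_forall. intros b. unfold Rdiv. ring.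
    - apply flim_val with ((0 + 2 * / (2 * a ^ 4)) * / / (6 * a ^ 3)).
      + apply flim_mult; [typeclasses eauto | flims | ].
        apply flim_inv; [typeclasses eauto | apply Rinv_neq_0_compat; assert (0 < a ^ 3) by (apply pow_lt; trivial); lra | trivial].
      + rewrite Ha24. field. }
  apply flim_eps with (eps := tau) in HF; [ | typeclasses eauto | trivial].
  destruct (infty_elim _ 2 HF) as [B [HB HB']].
  exists B. split; [lra | ]. intros b Hb. split.
  - rewrite <- ln_1. apply ln_increasing; lra.
  - intros beta. left. apply (HB' b Hb).
Qed.

(** * Gamma function values *)

(** The sequence inside [Gamma]. As [Gamma] is the real part of a [Lim_seq], each of its values used
    below rests on a proof that this sequence converges. *)
Definition gauss (x : R) (n : nat) : R := INR (fact n) * Rpower (INR n) x / poch x n.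

Lemma Gamma_unique (x l : R) : is_lim_seq (gauss x) l -> Gamma x = l.
Proof. intros H. unfold Gamma. change (real (Lim_seq (gauss x)) = l). now rewrite (is_lim_seq_unique _ _ H). Qed.

(** [poch x n] has the [n + 1] factors from [x] to [x + n], so the shift brings in
    [x + INR (S n)]. *)
Lemma poch_shift (x : R) (n : nat) : x * poch (x + 1) n = poch x n * (x + INR (S n)).
Proof.
  induction n as [ | n IH].
  - simpl. ring.
  - change (poch (x + 1) (S n)) with (poch (x + 1) n * (x + 1 + INR (S n))).
    change (poch x (S n)) with (poch x n * (x + INR (S n))).
    rewrite <- Rmult_assoc, IH. rewrite (S_INR (S n)). ring.
Qed.

Lemma poch_pos (x : R) (n : nat) : 0 < x -> 0 < poch x n.
Proof.
  intros Hx. induction n as [ | n IH]; simpl poch; trivial.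
  apply Rmult_lt_0_compat; trivial. generalize (pos_INR (S n)). simpl INR. lra.
Qed.

Lemma shift_factor_lim (x : R) : is_lim_seq (fun n => (x + INR (S n)) / INR n) 1.
Proof.
  apply (is_lim_seq_ext_loc (fun n => 1 + (x + 1) * / INR n)).
  - exists 1%nat. intros n Hn. rewrite S_INR. apply (lt_INR 0) in Hn. simpl in Hn. field. lra.
  - replace (Finite 1) with (Finite (1 + (x + 1) * 0)) by (f_equal; ring).
    apply (is_lim_seq_plus' _ _ 1 ((x + 1) * 0)); [apply is_lim_seq_const | ].
    apply (is_lim_seq_mult' _ _ (x + 1) 0); [apply is_lim_seq_const | ].
    apply (is_lim_seq_inv INR p_infty); [apply is_lim_seq_INR | discriminate].
Qed.

Lemma gauss_shift (x : R) (n : nat) :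
  (1 <= n)%nat -> x <> 0 -> poch (x + 1) n <> 0 -> x + INR (S n) <> 0 ->
  gauss x n = gauss (x + 1) n / x * ((x + INR (S n)) / INR n).
Proof.
  intros Hn Hx Hp Hs. apply (le_INR 1) in Hn. simpl in Hn.
  assert (E := poch_shift x n).
  assert (Hpx : poch x n <> 0).
  { intros H. rewrite H, Rmult_0_l in E. apply Rmult_integral in E. tauto. }
  unfold gauss. rewrite Rpower_plus, Rpower_1 by lra.
  apply Rmult_eq_reg_r with (poch x n); trivial. apply Rmult_eq_reg_r with (x * poch (x + 1) n); [ | now apply Rmult_integral_contrapositive].
  replace (INR (fact n) * Rpower (INR n) x / poch x n * poch x n * (x * poch (x + 1) n))
    with (INR (fact n) * Rpower (INR n) x * (x * poch (x + 1) n)) by (field; trivial).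
  rewrite E at 1. field. repeat split; trivial; lra.
Qed.

(** The functional equation read downwards, which reaches the negative arguments of [Cconst]. *)
Lemma gauss_down (x l : R) :
  (forall n : nat, x + INR n <> 0) -> is_lim_seq (gauss (x + 1)) l -> is_lim_seq (gauss x) (l / x).
Proof.
  intros Hx Hl. assert (Hx0 : x <> 0) by (specialize (Hx O); simpl in Hx; lra).
  assert (Hp : forall n, poch (x + 1) n <> 0).
  { induction n as [ | n IH]; simpl poch.
    - specialize (Hx 1%nat). simpl in Hx. trivial.
    - apply Rmult_integral_contrapositive. split; trivial. specialize (Hx (S (S n))). rewrite (S_INR (S n)) in Hx. simpl INR in *. lra. }
  apply (is_lim_seq_ext_loc (fun n => gauss (x + 1) n / x * ((x + INR (S n)) / INR n))).
  - exists 1%nat. intros n Hn. symmetry. now apply gauss_shift.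
  - replace (Finite (l / x)) with (Finite (l / x * 1)) by (f_equal; ring).
    apply is_lim_seq_mult'; [ | apply shift_factor_lim].
    apply is_lim_seq_mult'; [trivial | apply is_lim_seq_const].
Qed.

Lemma gauss_up (x l : R) :
  0 < x -> is_lim_seq (gauss x) l -> is_lim_seq (gauss (x + 1)) (x * l).
Proof.
  intros Hx Hl.
  apply (is_lim_seq_ext_loc (fun n => x * gauss x n * / ((x + INR (S n)) / INR n))).
  - exists 1%nat. intros n Hn. rewrite gauss_shift; trivial.
    + apply (le_INR 1) in Hn. simpl in Hn. assert (Hs := pos_INR (S n)). field. repeat split; lra.
    + lra.
    + apply Rgt_not_eq, poch_pos. lra.
    + assert (Hs := pos_INR (S n)). lra.
  - replace (Finite (x * l)) with (Finite (x * l * / 1)) by (f_equal; field).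
    apply is_lim_seq_mult'.
    + apply is_lim_seq_mult'; [apply is_lim_seq_const | trivial].
    + apply (is_lim_seq_inv _ 1); [apply shift_factor_lim | ]. intros H; injection H; lra.
Qed.

Lemma ln_le_sub1 (t : R) : 0 < t -> ln t <= t - 1.
Proof. intros Ht. generalize (exp_ineq1_le (ln t)). rewrite exp_ln by trivial. lra. Qed.

(** Concavity of [ln]: the inequality [ln t <= t - 1] at [t / y] and at [1 / y], with the weights
    [x] and [1 - x]. *)
Lemma bernoulli_power (t x : R) : 0 < t -> 0 < x <= 1 -> Rpower t x <= 1 + x * (t - 1).
Proof.
  intros Ht Hx.
  assert (Hy : 0 < 1 + x * (t - 1)) by nra.
  set (y := 1 + x * (t - 1)) in *.
  assert (H1 := ln_le_sub1 (t / y) ltac:(apply Rdiv_lt_0_compat; lra)).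
  assert (H2 := ln_le_sub1 (1 / y) ltac:(apply Rdiv_lt_0_compat; lra)).
  unfold Rdiv in H1, H2. rewrite ln_mult, ln_Rinv in H1 by (try apply Rinv_0_lt_compat; lra).
  rewrite Rmult_1_l, ln_Rinv in H2 by lra.
  assert (H3 : x * ln t <= ln y).
  { assert (x * (ln t - ln y) + (1 - x) * (- ln y) <= x * (t * / y - 1) + (1 - x) * (/ y - 1)) by nra.
    replace (x * (t * / y - 1) + (1 - x) * (/ y - 1)) with 0 in H by (unfold y; field; unfold y in Hy; lra).
    lra. }
  unfold Rpower. rewrite <- (exp_ln y) by trivial. destruct H3 as [H3 | ->]; [left; now apply exp_increasing | lra].
Qed.

Lemma gauss_pos (x : R) (n : nat) : 0 < x -> 0 < gauss x n.
Proof.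
  intros Hx. apply Rdiv_lt_0_compat; [ | now apply poch_pos].
  apply Rmult_lt_0_compat; [apply INR_fact_lt_0 | apply exp_pos].
Qed.

Lemma gauss_step (x : R) (n : nat) :
  0 < x -> (1 <= n)%nat ->
  gauss x (S n) = gauss x n * (Rpower (INR (S n) / INR n) x / (1 + x / INR (S n))).
Proof.
  intros Hx Hn. apply (le_INR 1) in Hn. simpl in Hn.
  assert (Hs : 0 < INR (S n)) by (rewrite S_INR; lra).
  unfold gauss. change (poch x (S n)) with (poch x n * (x + INR (S n))).
  replace (fact (S n)) with (S n * fact n)%nat by reflexivity. rewrite mult_INR.
  replace (Rpower (INR (S n)) x) with (Rpower (INR n) x * Rpower (INR (S n) / INR n) x).
  - assert (Hp := poch_pos x n Hx). field. repeat split; lra.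
  - rewrite Rpower_mult_distr; [ | lra | apply Rdiv_lt_0_compat; lra]. f_equal. field. lra.
Qed.

(** For [0 < x <= 1] the sequence increases, while the variant [G], with [(n+1)^x] in place of
    [n^x], lies above it and decreases. *)
Lemma gauss_lim (x : R) : 0 < x <= 1 -> exists l, 0 < l /\ is_lim_seq (gauss x) l.
Proof.
  intros Hx.
  assert (Hi : forall n, (1 <= n)%nat -> gauss x n <= gauss x (S n)).
  { intros n Hn. rewrite gauss_step by (trivial; lra).
    assert (Hg := gauss_pos x n ltac:(lra)).
    apply (le_INR 1) in Hn. simpl in Hn. assert (Hs : INR (S n) = INR n + 1) by apply S_INR.
    rewrite <- (Rmult_1_r (gauss x n)) at 1. apply Rmult_le_compat_l; [lra | ].
    assert (Hd : 0 < 1 + x / INR (S n)) by (assert (0 < x / INR (S n)) by (apply Rdiv_lt_0_compat; lra); lra).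
    apply Rmult_le_reg_r with (1 + x / INR (S n)); trivial.
    set (y := 1 + x / INR (S n)) in *.
    replace (Rpower (INR (S n) / INR n) x / y * y) with (Rpower (INR (S n) / INR n) x) by (field; lra).
    rewrite Rmult_1_l. unfold y in *. clear y.
    assert (H1 := ln_le_sub1 (INR n / INR (S n)) ltac:(apply Rdiv_lt_0_compat; lra)).
    replace (INR n / INR (S n)) with (/ (INR (S n) / INR n)) in H1 by (field; lra).
    rewrite ln_Rinv in H1 by (apply Rdiv_lt_0_compat; lra).
    replace (/ (INR (S n) / INR n) - 1) with (- / INR (S n)) in H1 by (rewrite Hs; field; lra).
    assert (H2 := ln_le_sub1 _ Hd). unfold Rpower.
    rewrite <- (exp_ln (1 + x / INR (S n))) by trivial.
    assert (H3 : ln (1 + x / INR (S n)) <= x * ln (INR (S n) / INR n)) by (unfold Rdiv in *; nra).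
    destruct H3 as [H3 | ->]; [left; now apply exp_increasing | lra]. }
  set (G := fun n => gauss x n * Rpower (INR (S n) / INR n) x).
  assert (HG : forall n, (1 <= n)%nat -> G (S n) <= G n).
  { intros n Hn. unfold G. rewrite gauss_step by (trivial; lra).
    assert (Hg := gauss_pos x n ltac:(lra)).
    apply (le_INR 1) in Hn. simpl in Hn. assert (Hs : INR (S n) = INR n + 1) by apply S_INR.
    assert (Hss : INR (S (S n)) = INR n + 2) by (rewrite S_INR, Hs; ring).
    rewrite Rmult_assoc. apply Rmult_le_compat_l; [lra | ].
    rewrite <- (Rmult_1_r (Rpower (INR (S n) / INR n) x)) at 2. unfold Rdiv at 1. rewrite Rmult_assoc.
    apply Rmult_le_compat_l; [left; apply exp_pos | ].
    assert (Hd : 0 < 1 + x / INR (S n)) by (assert (0 < x / INR (S n)) by (apply Rdiv_lt_0_compat; lra); lra).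
    apply Rmult_le_reg_l with (1 + x / INR (S n)); trivial.
    rewrite <- Rmult_assoc, Rinv_r, Rmult_1_l, Rmult_1_r by lra.
    apply Rle_trans with (1 + x * (INR (S (S n)) / INR (S n) - 1)).
    - apply bernoulli_power; trivial. apply Rdiv_lt_0_compat; lra.
    - right. rewrite Hss, Hs. field. lra. }
  assert (HGb : forall n, G (S n) <= G 1%nat).
  { induction n as [ | n IH]; [lra | ]. apply Rle_trans with (2 := IH). apply HG. lia. }
  assert (Hb : forall n, gauss x (S n) <= G 1%nat).
  { intros n. apply Rle_trans with (2 := HGb n). unfold G.
    assert (Hg := gauss_pos x (S n) ltac:(lra)).
    assert (1 <= Rpower (INR (S (S n)) / INR (S n)) x); [ | nra].
    assert (0 < INR (S n)) by (apply lt_0_INR; lia).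
    assert (Hr : 1 <= INR (S (S n)) / INR (S n)).
    { apply Rmult_le_reg_r with (INR (S n)); trivial. unfold Rdiv. rewrite Rmult_assoc, Rinv_l by lra.
      rewrite (S_INR (S n)). lra. }
    apply Rle_trans with (Rpower (INR (S (S n)) / INR (S n)) 0); [rewrite Rpower_O; lra | ].
    apply Rle_Rpower; lra. }
  destruct (ex_finite_lim_seq_incr (fun n => gauss x (S n)) (G 1%nat)) as [l Hl].
  - intros n. apply Hi. lia.
  - exact Hb.
  - exists l. split.
    + apply Rlt_le_trans with (gauss x 1); [apply gauss_pos; lra | ].
      apply (is_lim_seq_incr_compare (fun n => gauss x (S n)) l Hl) with (n := O).
      intros n. apply Hi. lia.
    + now apply is_lim_seq_incr_1.
Qed.

Lemma gauss_one : is_lim_seq (gauss 1) 1.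
Proof.
  assert (Hp : forall n, poch 1 n = INR (fact (S n))).
  { induction n as [ | n IH]; [simpl; ring | ].
    change (poch 1 (S n)) with (poch 1 n * (1 + INR (S n))). rewrite IH.
    replace (fact (S (S n))) with (S (S n) * fact (S n))%nat by reflexivity. rewrite mult_INR, (S_INR (S n)). ring. }
  apply (is_lim_seq_ext_loc (fun n => / ((0 + INR (S n)) / INR n))).
  - exists 1%nat. intros n Hn. apply (le_INR 1) in Hn. simpl in Hn.
    unfold gauss. rewrite Hp, Rpower_1 by lra. replace (fact (S n)) with (S n * fact n)%nat by reflexivity. rewrite mult_INR.
    assert (Hf := INR_fact_lt_0 n). assert (0 < INR (S n)) by (apply lt_0_INR; lia). field. repeat split; lra.
  - replace (Finite 1) with (Finite (/ 1)) by (f_equal; field).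
    apply (is_lim_seq_inv _ 1); [apply shift_factor_lim | ]. intros H; injection H; lra.
Qed.

(** * Wallis integrals and the value of Gamma at 1/2 *)

Fixpoint sin_prim (k : nat) (x : R) : R :=
  match k with
  | O => x
  | S O => - cos x
  | S (S j) => - (sin x ^ S j * cos x) / INR (S (S j)) + INR (S j) / INR (S (S j)) * sin_prim j x
  end.

Lemma sin_prim_derive (k : nat) : forall x, is_derive (sin_prim k) x (sin x ^ k).
Proof.
  assert (H : forall x, is_derive (sin_prim k) x (sin x ^ k) /\ is_derive (sin_prim (S k)) x (sin x ^ S k)); [ | intros x; apply H].
  induction k as [ | k IH]; intros x.
  - split; simpl; auto_derive; trivial; ring.
  - split; [apply IH | ]. destruct (IH x) as [D _].
    destruct (is_derive_opaque _ _ _ D) as [q [Eq Dq]].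
    apply (is_derive_ext (fun x => - (sin x ^ S k * cos x) / INR (S (S k)) + INR (S k) / INR (S (S k)) * q x)).
    { intros t. rewrite Eq. reflexivity. }
    assert (Hk : INR (S (S k)) = INR (S k) + 1) by apply S_INR.
    assert (Hk0 := pos_INR (S k)).
    generalize dependent (INR (S (S k))). intros c Hc.
    eapply is_derive_val.
    + apply (is_derive_plus (fun x => - (sin x ^ S k * cos x) / c) (fun x => INR (S k) / c * q x)).
      * apply (is_derive_scal_l (fun x => - (sin x ^ S k * cos x)) x (- (INR (S k) * sin x ^ k * cos x * cos x - sin x ^ S k * sin x)) (/ c)).
        apply (is_derive_opp (fun x => sin x ^ S k * cos x)).
        eapply is_derive_val.
        -- apply (is_derive_mult (fun x => sin x ^ S k) cos).
           ++ apply (is_derive_pow sin (S k) x (cos x)). apply is_derive_sin.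
           ++ apply is_derive_cos.
           ++ intros a b. apply Rmult_comm.
        -- cbv [plus mult]; simpl Init.Nat.pred; simpl. ring.
      * apply (is_derive_scal q x (INR (S k) / c) (sin x ^ k)). exact Dq.
    + cbv [plus scal]; simpl. cbv [mult]; simpl.
      assert (Hcs : cos x * cos x = 1 - sin x * sin x) by (generalize (sin2_cos2 x); unfold Rsqr; lra).
      change (match k with O => 1 | S _ => INR k + 1 end) with (INR (S k)) in *.
      replace (INR (S k) * sin x ^ k * cos x * cos x) with (INR (S k) * sin x ^ k * (cos x * cos x)) by ring.
      rewrite Hcs, Hc. field. lra.
Qed.

(** The integral of [sin^k] over [[0, pi/2]], with the primitive that the reduction formula
    gives. *)
Definition wallis (k : nat) : R := sin_prim k (PI / 2) - sin_prim k 0.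

Lemma wallis_step (k : nat) : wallis (S (S k)) = INR (S k) / INR (S (S k)) * wallis k.
Proof.
  unfold wallis. change (sin_prim (S (S k))) with (fun x => - (sin x ^ S k * cos x) / INR (S (S k)) + INR (S k) / INR (S (S k)) * sin_prim k x).
  cbv beta. rewrite cos_PI2, sin_0, pow_ne_zero by discriminate.
  unfold Rdiv. ring.
Qed.

Lemma wallis_decr (k : nat) : wallis (S k) <= wallis k.
Proof.
  assert (HPI := PI_RGT_0).
  unfold wallis. apply (derive_le (sin_prim (S k)) (fun x => sin x ^ S k) (sin_prim k) (fun x => sin x ^ k)); [lra | | | ].
  - intros x _. apply sin_prim_derive.
  - intros x _. apply sin_prim_derive.
  - intros x Hx. assert (Hs : 0 <= sin x <= 1).
    { split; [apply sin_ge_0; lra | apply SIN_bound]. }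
    simpl. assert (0 <= sin x ^ k) by (apply pow_le; lra). nra.
Qed.

(** The reduction factors of the two integrals telescope, and the initial product is [pi/2]. *)
Lemma wallis_prod (n : nat) : wallis (2 * n) * wallis (S (2 * n)) = PI / (2 * INR (S (2 * n))).
Proof.
  induction n as [ | n IH].
  - simpl. unfold wallis. simpl. rewrite cos_PI2, cos_0. field.
  - replace (2 * S n)%nat with (S (S (2 * n))) by lia. rewrite !wallis_step.
    replace (INR (S (2 * n)) / INR (S (S (2 * n))) * wallis (2 * n) * (INR (S (S (2 * n))) / INR (S (S (S (2 * n)))) * wallis (S (2 * n))))
      with (INR (S (2 * n)) / INR (S (S (S (2 * n)))) * (wallis (2 * n) * wallis (S (2 * n)))).
    + rewrite IH. assert (0 < INR (S (2 * n))) by (apply lt_0_INR; lia). assert (0 < INR (S (S (S (2 * n))))) by (apply lt_0_INR; lia).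
      field. lra.
    + assert (0 < INR (S (S (2 * n)))) by (apply lt_0_INR; lia). assert (0 < INR (S (S (S (2 * n))))) by (apply lt_0_INR; lia). field. lra.
Qed.

Lemma gauss_half (n : nat) : (1 <= n)%nat -> gauss (1 / 2) n = 2 * sqrt (INR n) * wallis (S (2 * n)).
Proof.
  intros Hn. unfold gauss.
  assert (Hp : INR (fact n) / poch (1 / 2) n = 2 * wallis (S (2 * n))).
  { clear Hn. induction n as [ | n IH].
    - unfold wallis. simpl. rewrite cos_PI2, cos_0. field.
    - replace (2 * S n)%nat with (S (S (2 * n))) by lia. rewrite wallis_step.
      replace (2 * (INR (S (S (2 * n))) / INR (S (S (S (2 * n)))) * wallis (S (2 * n))))
        with (INR (S (S (2 * n))) / INR (S (S (S (2 * n)))) * (2 * wallis (S (2 * n)))) by ring.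
      rewrite <- IH. change (poch (1 / 2) (S n)) with (poch (1 / 2) n * (1 / 2 + INR (S n))).
      replace (fact (S n)) with (S n * fact n)%nat by reflexivity. rewrite mult_INR.
      assert (H1 := poch_pos (1 / 2) n ltac:(lra)).
      replace (INR (S (S (2 * n)))) with (2 * INR (S n)) by (rewrite !S_INR, mult_INR; simpl; ring).
      replace (INR (S (S (S (2 * n))))) with (2 * INR (S n) + 1) by (rewrite !S_INR, mult_INR; simpl; ring).
      assert (0 < INR (S n)) by (apply lt_0_INR; lia). field. lra. }
  apply (le_INR 1) in Hn. simpl in Hn.
  replace (Rpower (INR n) (1 / 2)) with (sqrt (INR n)) by (rewrite <- Rpower_sqrt by lra; f_equal; field).
  replace (INR (fact n) * sqrt (INR n) / poch (1 / 2) n) with (INR (fact n) / poch (1 / 2) n * sqrt (INR n)) by (unfold Rdiv; ring).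
  rewrite Hp. ring.
Qed.

Lemma wallis_pos (k : nat) : 0 < wallis k.
Proof.
  assert (H : 0 < wallis k /\ 0 < wallis (S k)); [ | apply H].
  induction k as [ | k [H1 H2]].
  - unfold wallis. simpl. rewrite cos_PI2, cos_0. assert (HPI := PI_RGT_0). lra.
  - split; trivial. rewrite wallis_step. apply Rmult_lt_0_compat; trivial.
    apply Rdiv_lt_0_compat; apply lt_0_INR; lia.
Qed.

(** [gauss (1/2) n] is [2 sqrt n] times a Wallis integral. Since these integrals decrease, its
    square lies between two expressions given by [wallis_prod], both tending to [pi]. *)
Lemma gauss_half_lim (l : R) : is_lim_seq (gauss (1 / 2)) l -> l * l = PI.
Proof.
  intros Hl.
  assert (H2 : is_lim_seq (fun n => gauss (1 / 2) n * gauss (1 / 2) n) (l * l)) by now apply is_lim_seq_mult'.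
  assert (H3 : is_lim_seq (fun n => gauss (1 / 2) n * gauss (1 / 2) n) PI).
  { assert (HPI := PI_RGT_0).
    assert (Hb : forall n, (1 <= n)%nat -> PI * / ((1 + INR (S n)) / INR n) <= gauss (1 / 2) n * gauss (1 / 2) n <= PI).
    { intros n Hn. rewrite gauss_half by trivial.
      assert (Hw := wallis_pos (S (2 * n))). assert (Hp := wallis_prod n).
      assert (Hd1 := wallis_decr (2 * n)). assert (Hd2 := wallis_decr (S (2 * n))).
      rewrite wallis_step in Hd2.
      apply (le_INR 1) in Hn. simpl in Hn.
      assert (Hs : sqrt (INR n) * sqrt (INR n) = INR n) by (apply sqrt_sqrt; lra).
      assert (E1 : INR (S (2 * n)) = 2 * INR n + 1) by (rewrite S_INR, mult_INR; simpl; ring).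
      assert (E2 : INR (S (S (2 * n))) = 2 * INR n + 2) by (rewrite S_INR, E1; ring).
      rewrite E1, E2 in Hd2. rewrite E1 in Hp. rewrite S_INR.
      set (w := wallis (S (2 * n))) in *. set (w0 := wallis (2 * n)) in *.
      replace (2 * sqrt (INR n) * w * (2 * sqrt (INR n) * w)) with (4 * (sqrt (INR n) * sqrt (INR n)) * (w * w)) by ring.
      rewrite Hs.
      assert (U : w * w <= PI / (2 * (2 * INR n + 1))) by (rewrite <- Hp; apply Rmult_le_compat_r; lra).
      assert (L : PI / (2 * (2 * INR n + 2)) <= w * w).
      { replace (PI / (2 * (2 * INR n + 2))) with ((2 * INR n + 1) / (2 * INR n + 2) * w0 * w).
        - apply Rmult_le_compat_r; lra.
        - rewrite Rmult_assoc, Hp. field. lra. }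
      split.
      - apply Rle_trans with (4 * INR n * (PI / (2 * (2 * INR n + 2)))); [ | apply Rmult_le_compat_l; lra].
        replace (4 * INR n * (PI / (2 * (2 * INR n + 2)))) with (PI * (INR n / (INR n + 1))) by (field; lra).
        apply Rmult_le_compat_l; [lra | ].
        replace (/ ((1 + (INR n + 1)) / INR n)) with (INR n / (INR n + 2)) by (field; lra).
        apply Rmult_le_compat_l; [lra | ]. apply Rinv_le_contravar; lra.
      - apply Rle_trans with (4 * INR n * (PI / (2 * (2 * INR n + 1)))); [apply Rmult_le_compat_l; lra | ].
        replace (4 * INR n * (PI / (2 * (2 * INR n + 1)))) with (PI * (INR n / (INR n + / 2))) by (field; lra).
        rewrite <- (Rmult_1_r PI) at 2. apply Rmult_le_compat_l; [lra | ].
        apply Rmult_le_reg_r with (INR n + / 2); [lra | ]. unfold Rdiv. rewrite Rmult_assoc, Rinv_l; lra. }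
    apply (is_lim_seq_le_le_loc (fun n => PI * / ((1 + INR (S n)) / INR n)) _ (fun _ => PI)).
    - exists 1%nat. exact Hb.
    - replace (Finite PI) with (Finite (PI * / 1)) by (f_equal; field).
      apply is_lim_seq_mult'; [apply is_lim_seq_const | ].
      apply (is_lim_seq_inv _ 1); [apply shift_factor_lim | ]. intros H; injection H; lra.
    - apply is_lim_seq_const. }
  apply is_lim_seq_unique in H2. apply is_lim_seq_unique in H3. rewrite H2 in H3. now injection H3.
Qed.

(** These are the values in [Cconst] at [p = 2/3], brought by the functional equation to the
    arguments 1/4, 3/4, 1/2 and 1. The constant [rho] is [Gamma(1/4)/Gamma(3/4)]; it is
    characterized by quotients of [poch] because those appear in the Mellin recurrence. *)
Lemma Gamma_constant :
  exists rho, 0 < rho /\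
    is_lim_seq (fun n => poch (3 / 4) n / poch (1 / 4) n / sqrt (INR n)) rho /\
    Gamma (5 / 4) * Gamma (- (3 / 2)) * Gamma 3 /
      (Gamma (- (1 / 4)) * Gamma (3 / 2) * Gamma (1 / 2) * Gamma (5 / 2)) = - (4 / 9) * rho / PI.
Proof.
  destruct (gauss_lim (1 / 4) ltac:(lra)) as [g1 [Hg1 L1]].
  destruct (gauss_lim (3 / 4) ltac:(lra)) as [g3 [Hg3 L3]].
  destruct (gauss_lim (1 / 2) ltac:(lra)) as [gh [Hgh Lh]].
  assert (HPI := gauss_half_lim gh Lh).
  exists (g1 / g3). split; [now apply Rdiv_lt_0_compat | split].
  - apply (is_lim_seq_ext_loc (fun n => gauss (1 / 4) n / gauss (3 / 4) n)).
    + exists 1%nat. intros n Hn. apply (le_INR 1) in Hn. simpl in Hn. unfold gauss.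
      assert (H1 := poch_pos (1 / 4) n ltac:(lra)). assert (H3 := poch_pos (3 / 4) n ltac:(lra)).
      assert (Hf := INR_fact_lt_0 n).
      assert (Hr : Rpower (INR n) (3 / 4) = Rpower (INR n) (1 / 4) * sqrt (INR n)).
      { rewrite <- Rpower_sqrt, <- Rpower_plus by lra. f_equal. field. }
      rewrite Hr. assert (Hs : 0 < sqrt (INR n)) by (apply sqrt_lt_R0; lra).
      assert (Hq := exp_pos (1 / 4 * ln (INR n))). fold (Rpower (INR n) (1 / 4)) in Hq.
      field. repeat split; lra.
    + apply is_lim_seq_div'; trivial. lra.
  - assert (G54 : Gamma (5 / 4) = 1 / 4 * g1).
    { apply Gamma_unique. replace (5 / 4) with (1 / 4 + 1) by field. apply gauss_up; trivial; lra. }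
    assert (Gm14 : Gamma (- (1 / 4)) = g3 / (- (1 / 4))).
    { apply Gamma_unique. apply gauss_down; [ | now replace (- (1 / 4) + 1) with (3 / 4) by field].
      intros [ | n]; [simpl; lra | ]. rewrite S_INR. generalize (pos_INR n). lra. }
    assert (G32 : is_lim_seq (gauss (3 / 2)) (1 / 2 * gh)).
    { replace (3 / 2) with (1 / 2 + 1) by field. apply gauss_up; trivial; lra. }
    assert (G52 : Gamma (5 / 2) = 3 / 2 * (1 / 2 * gh)).
    { apply Gamma_unique. replace (5 / 2) with (3 / 2 + 1) by field. apply gauss_up; trivial; lra. }
    assert (Gm12 : is_lim_seq (gauss (- (1 / 2))) (gh / (- (1 / 2)))).
    { apply gauss_down; [ | now replace (- (1 / 2) + 1) with (1 / 2) by field].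
      intros [ | n]; [simpl; lra | ]. rewrite S_INR. generalize (pos_INR n). lra. }
    assert (Gm32 : Gamma (- (3 / 2)) = gh / (- (1 / 2)) / (- (3 / 2))).
    { apply Gamma_unique. apply gauss_down; [ | now replace (- (3 / 2) + 1) with (- (1 / 2)) by field].
      intros [ | [ | n]]; [simpl; lra | simpl; lra | ]. rewrite !S_INR. generalize (pos_INR n). lra. }
    assert (G3 : Gamma 3 = 2 * (1 * 1)).
    { apply Gamma_unique. replace 3 with (1 + 1 + 1) by ring. replace 2 with (1 + 1) by ring.
      apply gauss_up; [lra | ]. apply gauss_up; [lra | apply gauss_one]. }
    rewrite G54, Gm14, (Gamma_unique _ _ G32), G52, Gm32, G3, (Gamma_unique _ _ Lh), <- HPI.
    field. lra.
Qed.

(** * The eigenvalue when [d = 5] *)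

Lemma flim_at_right_inv (f : R -> R) (l : R) :
  filterlim (fun t => f (/ t)) (Rbar_locally p_infty) (locally l) ->
  filterlim f (at_right 0) (locally l).
Proof.
  intros H. apply flim_eps; [typeclasses eauto | ]. intros eps He.
  apply flim_eps with (eps := eps) in H; [ | typeclasses eauto | trivial].
  destruct (infty_elim _ 1 H) as [M [HM HM']].
  apply (at_right_0_intro _ (/ M)); [apply Rinv_0_lt_compat; lra | ].
  intros x Hx. rewrite <- (Rinv_inv x). apply HM'.
  rewrite <- (Rinv_inv M). apply Rinv_le_contravar; lra.
Qed.

(* [Jmom f f1 s J n] is an antiderivative of [r^(s+4n-1) f] vanishing at infinity when [J] is one of
   [r^(s-1) f]; it encodes the Mellin recurrence [M(s+4) = s (s-3) M(s)] for [f'' + 4 f'/r = r^2 f]. *)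
Fixpoint Jmom (f f1 : R -> R) (s : nat) (J : R -> R) (n : nat) (r : R) : R :=
  match n with
  | O => J r
  | S k => r * r ^ (s + 4 * k) * f1 r - (INR (s + 4 * k) - 3) * (r ^ (s + 4 * k) * f r)
     + INR (s + 4 * k) * (INR (s + 4 * k) - 3) * Jmom f f1 s J k r
  end.

(** Each step is the identity [(r^(N+1) f' - (N-3) r^N f)' = r^(N+3) f - N (N-3) r^(N-1) f]. *)
Lemma Jmom_derive (f f1 J : R -> R) (s n : nat) :
  radsol 3 (fun r => r ^ 2 - 0) f f1 ->
  (forall r, 0 < r -> is_derive J r (r ^ s / r * f r)) ->
  forall r, 0 < r -> is_derive (Jmom f f1 s J n) r (r ^ (s + 4 * n) / r * f r).
Proof.
  intros Hs HJ. induction n as [ | k IH]; intros r Hr.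
  - simpl Jmom. replace (s + 4 * 0)%nat with s by lia. now apply HJ.
  - destruct (Hs r Hr) as [D0 D1]. assert (Dk := IH r Hr).
    destruct (is_derive_opaque _ _ _ Dk) as [q [Eq Dq]].
    replace (s + 4 * S k)%nat with ((s + 4 * k) + 4)%nat by lia. rewrite pow_add.
    apply (is_derive_ext (fun r => r * r ^ (s + 4 * k) * f1 r - (INR (s + 4 * k) - 3) * (r ^ (s + 4 * k) * f r)
      + INR (s + 4 * k) * (INR (s + 4 * k) - 3) * q r)).
    { intros t. rewrite Eq. reflexivity. }
    set (N := (s + 4 * k)%nat) in *. clearbody N.
    auto_derive; [dsolve | ]. drw D0; drw D1; drw Dq. rewrite pow_pred by lra.
    change (INR 3) with (1 + 1 + 1). field. lra.
Qed.

(** For [r >= 1] the bounds of [outer] give [exp(r^2/2) f <= exp 25], where [25 = (3 + 2)^2], and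
    [- r f1 <= 60 r^2 f]. *)
Lemma radial_rapid_decay (f f1 : R -> R) (n : nat) :
  outer 3 0 f f1 ->
  filterlim (fun r => r ^ n * f r) (Rbar_locally p_infty) (locally 0) /\
  filterlim (fun r => r * r ^ n * f1 r) (Rbar_locally p_infty) (locally 0).
Proof.
  intros Ho. assert (Hp := fun r => outer_pos _ _ _ _ r Ho).
  assert (Hn := fun r Hr => outer_neg _ _ _ _ r Ho ltac:(simpl; lra) Hr).
  destruct Ho as [_ [_ [_ [_ Ho]]]]. specialize (Ho ltac:(lra)). simpl INR in Ho.
  assert (Hdec : forall k : nat, filterlim (fun r => r ^ k * f r) (Rbar_locally p_infty) (locally 0)).
  { intros k. destruct (gauss_pow_bound (S k)) as [C [HC HCb]].
    apply (flim_abs_le _ _ (fun r => C * exp 25 * / r)).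
    - apply (infty_intro _ 1). intros r Hr. destruct (Ho r ltac:(lra)) as [H1 _].
      specialize (HCb r ltac:(lra)). specialize (Hp r ltac:(lra)).
      assert (Hrk : 0 < r ^ k) by (apply pow_lt; lra).
      rewrite Rminus_0_r, Rabs_pos_eq by (apply Rmult_le_pos; lra).
      assert (E1 : exp (r ^ 2 / 2) * f r <= exp 25).
      { apply Rle_trans with (exp (r ^ 2 / 2) * Rpower r ((1 + 1 + 1 + 2 - 0) / 2) * f r).
        - apply Rmult_le_compat_r; [lra | ]. rewrite <- (Rmult_1_r (exp (r ^ 2 / 2))) at 1.
          apply Rmult_le_compat_l; [left; apply exp_pos | ].
          apply Rle_trans with (Rpower r 0); [rewrite Rpower_O; lra | apply Rle_Rpower; lra].
        - apply Rle_trans with (1 := H1). apply exp_le_compat.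
          apply Rmult_le_reg_r with (r ^ 2); [nra | ]. unfold Rdiv. rewrite Rmult_assoc, Rinv_l by nra. nra. }
      assert (Hgg : exp (r ^ 2 / 2) * exp (- (r ^ 2) / 2) = 1).
      { rewrite <- exp_plus. replace (r ^ 2 / 2 + - r ^ 2 / 2) with 0 by field. apply exp_0. }
      apply Rmult_le_reg_r with r; [lra | ]. rewrite (Rmult_assoc (C * exp 25)), Rinv_l, Rmult_1_r by lra.
      replace (r ^ k * f r * r) with (r ^ S k * exp (- (r ^ 2) / 2) * (exp (r ^ 2 / 2) * f r))
        by (replace (r ^ S k * exp (- r ^ 2 / 2) * (exp (r ^ 2 / 2) * f r)) with (r * r ^ k * f r * (exp (r ^ 2 / 2) * exp (- (r ^ 2) / 2)))
              by (simpl; ring); rewrite Hgg; ring).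
      apply Rmult_le_compat; trivial.
      + apply Rmult_le_pos; [apply pow_le; lra | left; apply exp_pos].
      + apply Rmult_le_pos; [left; apply exp_pos | lra].
    - apply flim_val with (C * exp 25 * 0); [flims | ring]. }
  split; [apply Hdec | ].
  apply (flim_abs_le _ _ (fun r => 60 * (r ^ (n + 2) * f r))).
  - apply (infty_intro _ 1). intros r Hr. destruct (Ho r ltac:(lra)) as [_ H2].
    specialize (Hp r ltac:(lra)). specialize (Hn r ltac:(lra)).
    assert (Hrn : 0 < r ^ n) by (apply pow_lt; lra).
    replace (r * r ^ n * f1 r) with (- (r ^ n * (- (r * f1 r)))) by ring.
    rewrite Rminus_0_r, Rabs_Ropp, Rabs_pos_eq by (apply Rmult_le_pos; nra).
    rewrite pow_add. replace (60 * (r ^ n * r ^ 2 * f r)) with (r ^ n * (60 * r ^ 2 * f r)) by ring.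
    apply Rmult_le_compat_l; [lra | ].
    apply Rle_trans with ((r ^ 2 + (1 + 1 + 1 + 2 - 0) / 2 + 2 * (1 + 1 + 1 + 2) ^ 2 / r ^ 2) * f r); [lra | ].
    apply Rmult_le_compat_r; [lra | ].
    assert (1 <= r ^ 2) by nra.
    assert (2 * (1 + 1 + 1 + 2) ^ 2 / r ^ 2 <= 50).
    { apply Rmult_le_reg_r with (r ^ 2); [lra | ]. unfold Rdiv. rewrite Rmult_assoc, Rinv_l; lra. }
    lra.
  - apply flim_val with (60 * 0); [ | ring]. apply flim_mult; [typeclasses eauto | apply flim_const; typeclasses eauto | apply Hdec].
Qed.

Lemma Jmom_lim_infty (f f1 J : R -> R) (s n : nat) :
  outer 3 0 f f1 -> filterlim J (Rbar_locally p_infty) (locally 0) ->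
  filterlim (Jmom f f1 s J n) (Rbar_locally p_infty) (locally 0).
Proof.
  intros Ho HJ. induction n as [ | k IH]; [exact HJ | ].
  destruct (radial_rapid_decay f f1 (s + 4 * k) Ho) as [H1 H2].
  simpl Jmom. set (N := (s + 4 * k)%nat) in *.
  change (filterlim (fun r => r * r ^ N * f1 r - (INR N - 3) * (r ^ N * f r) + INR N * (INR N - 3) * Jmom f f1 s J k r) (Rbar_locally p_infty) (locally 0)).
  apply flim_val with (0 - (INR N - 3) * 0 + INR N * (INR N - 3) * 0); [ | ring].
  apply flim_plus; [typeclasses eauto | | apply flim_mult; [typeclasses eauto | apply flim_const; typeclasses eauto | exact IH]].
  apply flim_minus; [typeclasses eauto | exact H2 | ].
  apply flim_mult; [typeclasses eauto | apply flim_const; typeclasses eauto | exact H1].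
Qed.

(** If [M] is the integral of [r^(s-1) f] over the half-line, this is that of [r^(s+4n-1) f]. *)
Fixpoint mom (s : nat) (M : R) (n : nat) : R :=
  match n with
  | O => M
  | S k => INR (s + 4 * k) * (INR (s + 4 * k) - 3) * mom s M k
  end.

(** The boundary terms carry [r^N f] and [r^(N+1) f1] with [N >= 4], against singularities of order
    [r^(-3)] and [r^(-4)]; so they vanish at 0 and only the integral is left. *)
Lemma Jmom_lim0 (f f1 J : R -> R) (s n : nat) (M l0 l1 : R) :
  (4 <= s)%nat ->
  filterlim (fun r => r ^ 3 * f r) (at_right 0) (locally l0) ->
  filterlim (fun r => r ^ 4 * f1 r) (at_right 0) (locally l1) ->
  filterlim J (at_right 0) (locally (- M)) ->
  filterlim (Jmom f f1 s J n) (at_right 0) (locally (- mom s M n)).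
Proof.
  intros Hs H0 H1 HJ. induction n as [ | k IH]; [exact HJ | ].
  simpl mom. simpl Jmom. assert (Hk : exists j, (s + 4 * k = j + 4)%nat) by (exists (s + 4 * k - 4)%nat; lia).
  destruct Hk as [j Hj]. fold (Init.Nat.mul 4 k) in *.
  change (filterlim (fun r => r * r ^ (s + 4 * k) * f1 r - (INR (s + 4 * k) - 3) * (r ^ (s + 4 * k) * f r) + INR (s + 4 * k) * (INR (s + 4 * k) - 3) * Jmom f f1 s J k r) (at_right 0) (locally (- (INR (s + 4 * k) * (INR (s + 4 * k) - 3) * mom s M k)))).
  set (N := (s + 4 * k)%nat) in *.
  assert (E1 : filterlim (fun r => r * r ^ N * f1 r) (at_right 0) (locally 0)).
  { apply (flim_ext _ (fun r => r * r ^ j * (r ^ 4 * f1 r))).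
    - apply filter_forall. intros r. rewrite Hj, pow_add. ring.
    - apply flim_val with (0 * 0 ^ j * l1); [flims | ring]. }
  assert (E2 : filterlim (fun r => r ^ N * f r) (at_right 0) (locally 0)).
  { apply (flim_ext _ (fun r => r * r ^ j * (r ^ 3 * f r))).
    - apply filter_forall. intros r. rewrite Hj, pow_add. ring.
    - apply flim_val with (0 * 0 ^ j * l0); [flims | ring]. }
  apply flim_val with (0 - (INR N - 3) * 0 + INR N * (INR N - 3) * (- mom s M k)); [ | ring].
  apply flim_plus; [typeclasses eauto | | apply flim_mult; [typeclasses eauto | apply flim_const; typeclasses eauto | exact IH]].
  apply flim_minus; [typeclasses eauto | exact E1 | ].
  apply flim_mult; [typeclasses eauto | apply flim_const; typeclasses eauto | exact E2].
Qed.

(** Log-convexity of the moments in the form of weighted arithmetic-geometric means: pointwise,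
    [r^3 <= mu^3/4 + 3 r^4/(4 mu)] and [r^4 <= 3 mu r^3/4 + r^7/(4 mu^3)]. The parameter [mu] stays
    free, to be optimized later. *)
Lemma mom_interpolation (f f1 A B : R -> R) (l0 l1 MA MB : R) (n : nat) :
  outer 3 0 f f1 ->
  filterlim (fun r => r ^ 3 * f r) (at_right 0) (locally l0) ->
  filterlim (fun r => r ^ 4 * f1 r) (at_right 0) (locally l1) ->
  (forall r, 0 < r -> is_derive A r (r ^ 4 / r * f r)) ->
  (forall r, 0 < r -> is_derive B r (r ^ 7 / r * f r)) ->
  filterlim A (Rbar_locally p_infty) (locally 0) -> filterlim B (Rbar_locally p_infty) (locally 0) ->
  filterlim A (at_right 0) (locally (- MA)) -> filterlim B (at_right 0) (locally (- MB)) ->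
  forall mu, 0 < mu ->
    mom 7 MB n <= mu ^ 3 / 4 * mom 4 MA n + 3 / (4 * mu) * mom 4 MA (S n) /\
    mom 4 MA (S n) <= 3 * mu / 4 * mom 7 MB n + / (4 * mu ^ 3) * mom 7 MB (S n).
Proof.
  intros Ho H0 H1 HA HB HAi HBi HA0 HB0 mu Hmu.
  assert (Hp := fun r => outer_pos _ _ _ _ r Ho). assert (Hs := proj1 Ho).
  assert (DA := fun k => Jmom_derive f f1 A 4 k Hs HA). assert (DB := fun k => Jmom_derive f f1 B 7 k Hs HB).
  assert (IA := fun k => Jmom_lim_infty f f1 A 4 k Ho HAi). assert (IB := fun k => Jmom_lim_infty f f1 B 7 k Ho HBi).
  assert (ZA := fun k => Jmom_lim0 f f1 A 4 k MA l0 l1 (le_n 4) H0 H1 HA0).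
  assert (ZB := fun k => Jmom_lim0 f f1 B 7 k MB l0 l1 ltac:(lia) H0 H1 HB0).
  set (a := Jmom f f1 4 A) in *. set (b := Jmom f f1 7 B) in *. clearbody a b.
  (* A nonnegative function has a nonnegative integral, phrased for an antiderivative that vanishes
     at infinity. *)
  assert (key : forall (h h1 : R -> R) (l : R), (forall r, 0 < r -> is_derive h r (h1 r)) ->
    (forall r, 0 < r -> h1 r <= 0) -> filterlim h (Rbar_locally p_infty) (locally 0) ->
    filterlim h (at_right 0) (locally l) -> 0 <= l).
  { intros h h1 l Hd Hneg Hi Hz.
    apply (flim_le (at_right 0) (fun _ => 0) h); [ | apply flim_const; typeclasses eauto | trivial].
    apply (at_right_0_intro _ 1); [lra | ]. intros x Hx.
    apply (derive_decr_lim_infty h h1); trivial; intros; [apply Hd | apply Hneg]; lra. }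
  assert (Hpn : forall r, 0 < r -> 0 < r ^ (4 + 4 * n) / r * f r).
  { intros r Hr. apply Rmult_lt_0_compat; [apply Rdiv_lt_0_compat; [apply pow_lt | ]; trivial | auto]. }
  split.
  - assert (0 <= mu ^ 3 / 4 * mom 4 MA n + 3 / (4 * mu) * mom 4 MA (S n) - mom 7 MB n); [ | lra].
    apply (key (fun r => b n r - (mu ^ 3 / 4 * a n r + 3 / (4 * mu) * a (S n) r))
      (fun r => r ^ (7 + 4 * n) / r * f r - (mu ^ 3 / 4 * (r ^ (4 + 4 * n) / r * f r) + 3 / (4 * mu) * (r ^ (4 + 4 * S n) / r * f r)))).
    + intros r Hr. assert (X := DA n r Hr). assert (Y := DA (S n) r Hr). assert (Z := DB n r Hr).
      set (a0 := a n) in *. set (a1 := a (S n)) in *. set (b0 := b n) in *. clearbody a0 a1 b0.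
      auto_derive; [dsolve | ]. drw X; drw Y; drw Z. rewrite ?Rmult_1_l. reflexivity.
    + intros r Hr. replace (7 + 4 * n)%nat with (4 + 4 * n + 3)%nat by lia. replace (4 + 4 * S n)%nat with (4 + 4 * n + 4)%nat by lia.
      specialize (Hpn r Hr). set (e := (4 + 4 * n)%nat) in *.
      rewrite !pow_add. set (w := r ^ e / r * f r) in *.
      replace (r ^ e * r ^ 3 / r * f r) with (r ^ 3 * w) by (unfold w, Rdiv; ring).
      replace (r ^ e * r ^ 4 / r * f r) with (r ^ 4 * w) by (unfold w, Rdiv; ring).
      replace (r ^ 3 * w - (mu ^ 3 / 4 * w + 3 / (4 * mu) * (r ^ 4 * w)))
        with (- (w / (4 * mu) * ((r - mu) ^ 2 * (3 * r ^ 2 + 2 * r * mu + mu ^ 2)))) by (field; lra).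
      assert (0 <= w / (4 * mu) * ((r - mu) ^ 2 * (3 * r ^ 2 + 2 * r * mu + mu ^ 2))); [ | lra].
      apply Rmult_le_pos; [apply Rdiv_le_0_compat; lra | ]. apply Rmult_le_pos; [apply pow2_ge_0 | assert (0 < r * mu) by nra; nra].
    + apply flim_val with (0 - (mu ^ 3 / 4 * 0 + 3 / (4 * mu) * 0)); [ | ring].
      assert (X := IA n). assert (Y := IA (S n)). assert (Z := IB n). flims.
    + apply flim_val with (- mom 7 MB n - (mu ^ 3 / 4 * - mom 4 MA n + 3 / (4 * mu) * - mom 4 MA (S n))); [ | ring].
      assert (X := ZA n). assert (Y := ZA (S n)). assert (Z := ZB n).
      apply flim_minus; [typeclasses eauto | exact Z | ].
      apply flim_plus; [typeclasses eauto | | ]; (apply flim_mult; [typeclasses eauto | apply flim_const; typeclasses eauto | assumption]).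
  - assert (0 <= 3 * mu / 4 * mom 7 MB n + / (4 * mu ^ 3) * mom 7 MB (S n) - mom 4 MA (S n)); [ | lra].
    apply (key (fun r => a (S n) r - (3 * mu / 4 * b n r + / (4 * mu ^ 3) * b (S n) r))
      (fun r => r ^ (4 + 4 * S n) / r * f r - (3 * mu / 4 * (r ^ (7 + 4 * n) / r * f r) + / (4 * mu ^ 3) * (r ^ (7 + 4 * S n) / r * f r)))).
    + intros r Hr. assert (X := DA (S n) r Hr). assert (Y := DB (S n) r Hr). assert (Z := DB n r Hr).
      set (a0 := a (S n)) in *. set (a1 := b (S n)) in *. set (b0 := b n) in *. clearbody a0 a1 b0.
      auto_derive; [dsolve | ]. drw X; drw Y; drw Z. rewrite ?Rmult_1_l. reflexivity.
    + intros r Hr. replace (7 + 4 * n)%nat with (4 + 4 * n + 3)%nat by lia. replace (4 + 4 * S n)%nat with (4 + 4 * n + 4)%nat by lia.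
      replace (7 + 4 * S n)%nat with (4 + 4 * n + 7)%nat by lia.
      specialize (Hpn r Hr). set (e := (4 + 4 * n)%nat) in *.
      rewrite !pow_add. set (w := r ^ e / r * f r) in *.
      replace (r ^ e * r ^ 3 / r * f r) with (r ^ 3 * w) by (unfold w, Rdiv; ring).
      replace (r ^ e * r ^ 4 / r * f r) with (r ^ 4 * w) by (unfold w, Rdiv; ring).
      replace (r ^ e * r ^ 7 / r * f r) with (r ^ 7 * w) by (unfold w, Rdiv; ring).
      replace (r ^ 4 * w - (3 * mu / 4 * (r ^ 3 * w) + / (4 * mu ^ 3) * (r ^ 7 * w)))
        with (- (w * r ^ 3 / (4 * mu ^ 3) * ((r - mu) ^ 2 * (r ^ 2 + 2 * r * mu + 3 * mu ^ 2)))) by (field; lra).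
      assert (0 <= w * r ^ 3 / (4 * mu ^ 3) * ((r - mu) ^ 2 * (r ^ 2 + 2 * r * mu + 3 * mu ^ 2))); [ | lra].
      assert (0 < r ^ 3) by (apply pow_lt; trivial). assert (0 < mu ^ 3) by (apply pow_lt; trivial).
      apply Rmult_le_pos; [apply Rdiv_le_0_compat; nra | ]. apply Rmult_le_pos; [apply pow2_ge_0 | assert (0 < r * mu) by nra; nra].
    + apply flim_val with (0 - (3 * mu / 4 * 0 + / (4 * mu ^ 3) * 0)); [ | ring].
      assert (X := IA (S n)). assert (Y := IB (S n)). assert (Z := IB n). flims.
    + apply flim_val with (- mom 4 MA (S n) - (3 * mu / 4 * - mom 7 MB n + / (4 * mu ^ 3) * - mom 7 MB (S n))); [ | ring].
      assert (X := ZA (S n)). assert (Y := ZB (S n)). assert (Z := ZB n).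
      apply flim_minus; [typeclasses eauto | exact X | ].
      apply flim_plus; [typeclasses eauto | | ]; (apply flim_mult; [typeclasses eauto | apply flim_const; typeclasses eauto | assumption]).
Qed.

Lemma mom_pos (s : nat) (M : R) (n : nat) : (4 <= s)%nat -> 0 < M -> 0 < mom s M n.
Proof.
  intros Hs HM. induction n as [ | n IH]; trivial. simpl mom.
  assert (H : INR 4 <= INR (s + 4 * n)) by (apply le_INR; lia). simpl (INR 4) in H.
  apply Rmult_lt_0_compat; trivial. apply Rmult_lt_0_compat; simpl in *; lra.
Qed.

(** The factors [(7 + 4k)(4 + 4k)] and [(4 + 4k)(1 + 4k)] of the two recurrences have the quotient
    [(7 + 4k)/(1 + 4k)], from which the two [poch] arise. *)
Lemma mom_ratio (MA MB : R) (n : nat) :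
  0 < MA -> mom 7 MB n * MA * 3 = mom 4 MA n * MB * (4 * INR n + 1) * (poch (3 / 4) n / poch (1 / 4) n).
Proof.
  intros HA. induction n as [ | n IH].
  - simpl. field.
  - assert (H1 := poch_pos (1 / 4) n ltac:(lra)).
    change (poch (3 / 4) (S n)) with (poch (3 / 4) n * (3 / 4 + INR (S n))).
    change (poch (1 / 4) (S n)) with (poch (1 / 4) n * (1 / 4 + INR (S n))).
    change (mom 7 MB (S n)) with (INR (7 + 4 * n) * (INR (7 + 4 * n) - 3) * mom 7 MB n).
    change (mom 4 MA (S n)) with (INR (4 + 4 * n) * (INR (4 + 4 * n) - 3) * mom 4 MA n).
    rewrite (S_INR n), !plus_INR, !mult_INR. change (INR 7) with (1 + 1 + 1 + 1 + 1 + 1 + 1). change (INR 4) with (1 + 1 + 1 + 1).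
    assert (Hn := pos_INR n). set (x := INR n) in *.
    set (b := mom 7 MB n) in *.
    replace ((1 + 1 + 1 + 1 + 1 + 1 + 1 + (1 + 1 + 1 + 1) * x) * (1 + 1 + 1 + 1 + 1 + 1 + 1 + (1 + 1 + 1 + 1) * x - 3) * b * MA * 3)
      with ((7 + 4 * x) * (4 + 4 * x) * (b * MA * 3)) by ring.
    rewrite IH. field. lra.
Qed.

(** The quotient [q] of the [n]-th moments is known in two ways: by [mom_ratio] it is equivalent to
    [(MB/MA) (4/3) rho n^(3/2)], and by interpolation it lies between [X/Y^(1/4)] and [X^(3/4)],
    with [X] and [Y] equivalent to [16 n^2], so it is equivalent to [8 n^(3/2)]. As in the
    Bohr-Mollerup theorem, the recurrence and log-convexity determine the constant. *)
Lemma mellin_ratio (f f1 A B : R -> R) (l0 l1 MA MB rho : R) :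
  outer 3 0 f f1 -> 0 < MA -> 0 < MB -> 0 < rho ->
  filterlim (fun r => r ^ 3 * f r) (at_right 0) (locally l0) ->
  filterlim (fun r => r ^ 4 * f1 r) (at_right 0) (locally l1) ->
  (forall r, 0 < r -> is_derive A r (r ^ 4 / r * f r)) ->
  (forall r, 0 < r -> is_derive B r (r ^ 7 / r * f r)) ->
  filterlim A (Rbar_locally p_infty) (locally 0) -> filterlim B (Rbar_locally p_infty) (locally 0) ->
  filterlim A (at_right 0) (locally (- MA)) -> filterlim B (at_right 0) (locally (- MB)) ->
  is_lim_seq (fun n => poch (3 / 4) n / poch (1 / 4) n / sqrt (INR n)) rho ->
  rho * MB = 6 * MA.
Proof.
  intros Ho HMA HMB Hrho H0 H1 HA HB HAi HBi HA0 HB0 Hlim.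
  assert (Hint := mom_interpolation f f1 A B l0 l1 MA MB).
  set (y := fun n => poch (3 / 4) n / poch (1 / 4) n / sqrt (INR n)) in *.
  (* Fourth powers avoid fractional exponents; the limit of [z] is [16^3 = 8^4]. *)
  set (z := fun n => (MB / MA * ((4 * INR n + 1) / (3 * INR n)) * y n) ^ 4).
  set (X := fun n => (4 + 4 * INR n) * (1 + 4 * INR n)).
  set (Y := fun n => (7 + 4 * INR n) * (4 + 4 * INR n)).
  assert (Hz : forall n, (1 <= n)%nat -> X n ^ 4 / Y n / INR n ^ 6 <= z n <= X n ^ 3 / INR n ^ 6).
  { intros n Hn. apply (le_INR 1) in Hn. simpl in Hn.
    assert (Hx : 0 < X n) by (unfold X; nra). assert (Hy : 0 < Y n) by (unfold Y; nra).
    assert (Ha := mom_pos 4 MA n ltac:(lia) HMA). assert (Hb := mom_pos 7 MB n ltac:(lia) HMB).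
    assert (Hr := mom_ratio MA MB n HMA).
    assert (Ea : mom 4 MA (S n) = X n * mom 4 MA n).
    { change (mom 4 MA (S n)) with (INR (4 + 4 * n) * (INR (4 + 4 * n) - 3) * mom 4 MA n).
      rewrite !plus_INR, !mult_INR. change (INR 4) with (1 + 1 + 1 + 1). unfold X. ring. }
    assert (Eb : mom 7 MB (S n) = Y n * mom 7 MB n).
    { change (mom 7 MB (S n)) with (INR (7 + 4 * n) * (INR (7 + 4 * n) - 3) * mom 7 MB n).
      rewrite !plus_INR, !mult_INR. change (INR 4) with (1 + 1 + 1 + 1). change (INR 7) with (1 + 1 + 1 + 1 + 1 + 1 + 1). unfold Y. ring. }
    set (q := mom 7 MB n / mom 4 MA n).
    assert (Hq : 0 < q) by now apply Rdiv_lt_0_compat.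
    assert (Hqb : mom 7 MB n = q * mom 4 MA n) by (unfold q; field; lra).
    assert (Hs : sqrt (INR n) * sqrt (INR n) = INR n) by (apply sqrt_sqrt; lra).
    assert (Hsp : 0 < sqrt (INR n)) by (apply sqrt_lt_R0; lra).
    assert (Hzq : z n = q ^ 4 / INR n ^ 6).
    { unfold z, y.
      assert (Hpq : poch (3 / 4) n / poch (1 / 4) n = q * MA * 3 / (MB * (4 * INR n + 1))).
      { apply Rmult_eq_reg_l with (mom 4 MA n * MB * (4 * INR n + 1)).
        - rewrite <- Hr, Hqb. field. lra.
        - apply Rgt_not_eq. repeat apply Rmult_lt_0_compat; lra. }
      rewrite Hpq.
      replace (MB / MA * ((4 * INR n + 1) / (3 * INR n)) * (q * MA * 3 / (MB * (4 * INR n + 1)) / sqrt (INR n)))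
        with (q / (INR n * sqrt (INR n))) by (field; repeat split; lra).
      replace ((q / (INR n * sqrt (INR n))) ^ 4) with (q ^ 4 / (INR n ^ 4 * ((sqrt (INR n) * sqrt (INR n)) * (sqrt (INR n) * sqrt (INR n))))) by (field; lra).
      rewrite Hs. f_equal. ring. }
    rewrite Hzq.
    (* The optimal parameters: they turn the two inequalities into [q <= X^(3/4)] and
       [X <= Y^(1/4) q]. *)
    set (mu := Rpower (X n) (/ 4)). set (nu := Rpower (Y n) (/ 4)).
    assert (Hmu : 0 < mu) by apply Rpower_pos. assert (Hnu : 0 < nu) by apply Rpower_pos.
    assert (Hroot : forall t, 0 < t -> Rpower t (/ 4) ^ 4 = t).
    { intros t Ht. rewrite <- (Rpower_pow 4), Rpower_mult by apply Rpower_pos.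
      replace (/ 4 * INR 4) with 1 by (simpl; field). now apply Rpower_1. }
    assert (Emu : mu ^ 4 = X n) by now apply Hroot. assert (Enu : nu ^ 4 = Y n) by now apply Hroot.
    destruct (Hint n Ho H0 H1 HA HB HAi HBi HA0 HB0 mu Hmu) as [I1 _].
    destruct (Hint n Ho H0 H1 HA HB HAi HBi HA0 HB0 nu Hnu) as [_ I2].
    rewrite Ea in I1, I2. rewrite Eb in I2. rewrite Hqb in I1, I2. rewrite <- Emu in I1. rewrite <- Enu in I2.
    assert (Q1 : q <= mu ^ 3).
    { apply Rmult_le_reg_r with (mom 4 MA n); trivial. apply Rle_trans with (1 := I1). right. field. lra. }
    assert (Q2 : X n <= nu * q).
    { apply Rmult_le_reg_r with (mom 4 MA n); trivial. apply Rle_trans with (1 := I2). right. field. lra. }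
    assert (Hn6 : 0 < INR n ^ 6) by (apply pow_lt; lra).
    split; (apply Rmult_le_compat_r; [left; now apply Rinv_0_lt_compat | ]).
    - apply Rmult_le_reg_r with (Y n); trivial. unfold Rdiv. rewrite Rmult_assoc, Rinv_l, Rmult_1_r by lra.
      rewrite <- Enu at 1. rewrite <- Rpow_mult_distr, (Rmult_comm q). apply pow_incr. lra.
    - replace (X n ^ 3) with ((mu ^ 3) ^ 4) by (rewrite <- Emu; ring). apply pow_incr. lra. }
  assert (Hinv : is_lim_seq (fun n => / INR n) 0).
  { apply (is_lim_seq_inv INR p_infty); [apply is_lim_seq_INR | discriminate]. }
  assert (Hlin : forall a c, is_lim_seq (fun n => a * / INR n + c) c).
  { intros a c. replace (Finite c) with (Finite (a * 0 + c)) by (f_equal; ring).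
    apply is_lim_seq_plus'; [ | apply is_lim_seq_const]. apply is_lim_seq_mult'; [apply is_lim_seq_const | trivial]. }
  assert (Hpow : forall (w : nat -> R) (l : R) (k : nat), is_lim_seq w l -> is_lim_seq (fun n => w n ^ k) (l ^ k)).
  { intros w l k Hw. induction k as [ | k IH]; [apply is_lim_seq_const | ].
    exact (is_lim_seq_mult' w (fun n => w n ^ k) l (l ^ k) Hw IH). }
  assert (Lz : is_lim_seq z ((MB / MA * (4 / 3) * rho) ^ 4)).
  { apply (Hpow (fun n => MB / MA * ((4 * INR n + 1) / (3 * INR n)) * y n)). apply is_lim_seq_mult'; trivial.
    apply is_lim_seq_mult'; [apply is_lim_seq_const | ].
    apply (is_lim_seq_ext_loc (fun n => 1 / 3 * / INR n + 4 / 3)); [ | apply Hlin].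
    exists 1%nat. intros n Hn. apply (le_INR 1) in Hn. simpl in Hn. field. lra. }
  assert (Lz2 : is_lim_seq z 4096).
  { apply (is_lim_seq_le_le_loc (fun n => X n ^ 4 / Y n / INR n ^ 6) z (fun n => X n ^ 3 / INR n ^ 6)).
    - exists 1%nat. exact Hz.
    - apply (is_lim_seq_ext_loc (fun n => ((4 * / INR n + 4) * (1 * / INR n + 4)) ^ 4 * / ((7 * / INR n + 4) * (4 * / INR n + 4)))).
      + exists 1%nat. intros n Hn. apply (le_INR 1) in Hn. simpl in Hn. unfold X, Y. field. repeat split; lra.
      + replace (Finite 4096) with (Finite ((4 * 4) ^ 4 * / (4 * 4))) by (f_equal; field).
        apply is_lim_seq_mult'.
        * apply (Hpow (fun n => (4 * / INR n + 4) * (1 * / INR n + 4))). apply is_lim_seq_mult'; apply Hlin.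
        * apply (is_lim_seq_inv (fun n => (7 * / INR n + 4) * (4 * / INR n + 4)) (4 * 4)); [apply is_lim_seq_mult'; apply Hlin | ].
          intros H; injection H; lra.
    - apply (is_lim_seq_ext_loc (fun n => ((4 * / INR n + 4) * (1 * / INR n + 4)) ^ 3)).
      + exists 1%nat. intros n Hn. apply (le_INR 1) in Hn. simpl in Hn. unfold X. field. lra.
      + replace (Finite 4096) with (Finite ((4 * 4) ^ 3)) by (f_equal; ring).
        apply (Hpow (fun n => (4 * / INR n + 4) * (1 * / INR n + 4))). apply is_lim_seq_mult'; apply Hlin. }
  apply is_lim_seq_unique in Lz. apply is_lim_seq_unique in Lz2. rewrite Lz in Lz2.
  assert (E : (MB / MA * (4 / 3) * rho) ^ 4 = 4096) by now injection Lz2.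
  set (w := MB / MA * (4 / 3) * rho) in *.
  assert (Hw : 0 < w) by (unfold w; apply Rmult_lt_0_compat; [apply Rmult_lt_0_compat; [now apply Rdiv_lt_0_compat | lra] | trivial]).
  assert (Hw8 : w = 8).
  { assert (H2 : (w ^ 2 - 64) * (w ^ 2 + 64) = 0) by (replace ((w ^ 2 - 64) * (w ^ 2 + 64)) with (w ^ 4 - 4096) by ring; lra).
    apply Rmult_integral in H2. destruct H2 as [H2 | H2]; [ | nra].
    assert (H3 : (w - 8) * (w + 8) = 0) by lra. apply Rmult_integral in H3. destruct H3; lra. }
  unfold w in Hw8. apply Rmult_eq_reg_l with (4 / 3 / MA); [ | apply Rgt_not_eq, Rdiv_lt_0_compat; lra].
  replace (4 / 3 / MA * (rho * MB)) with (MB / MA * (4 / 3) * rho) by (field; lra). rewrite Hw8. field. lra.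
Qed.

(** [A = r f' + 3 f] and [B = r^4 f'] have the derivatives [r^3 f] and [r^6 f], and the function is
    [A B/2] up to a term that vanishes at 0. There [B] tends to [- 3 L], and [A], in which the
    singularities of order [r^(-3)] cancel, tends to [- M], with [M] the integral of [r^3 f]. Then
    [mellin_ratio] gives [M = rho L/2]. *)
Lemma poho0_limit (f f1 : R -> R) (L rho : R) :
  outer 3 0 f f1 -> 0 < L -> 0 < rho ->
  filterlim (fun r => r ^ 3 * f r) (at_right 0) (locally L) ->
  is_lim_seq (fun n => poch (3 / 4) n / poch (1 / 4) n / sqrt (INR n)) rho ->
  filterlim (fun r => r ^ 2 * r ^ 3 * (f1 r ^ 2 / 2 - r ^ 2 * f r ^ 2 / 2) + 3 / 2 * (r * r ^ 3 * f r * f1 r))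
    (at_right 0) (locally (3 / 4 * L ^ 2 * rho)).
Proof.
  intros Ho HL Hrho Hf Hlim.
  assert (Hp := fun r => outer_pos _ _ _ _ r Ho).
  assert (Hs := proj1 Ho).
  set (A := fun r => r * f1 r + 3 * f r).
  assert (HA : forall r, 0 < r -> is_derive A r (r ^ 4 / r * f r)).
  { intros r Hr. destruct (Hs r Hr) as [D0 D1]. unfold A. auto_derive; [dsolve | ]. drw D0; drw D1. simpl (INR 3). field. lra. }
  assert (HAi : filterlim A (Rbar_locally p_infty) (locally 0)).
  { destruct (radial_rapid_decay f f1 0 Ho) as [R1 R2].
    apply (flim_ext _ (fun r => r * r ^ 0 * f1 r + 3 * (r ^ 0 * f r))); [apply filter_forall; intros r; unfold A; simpl; ring | ].
    apply flim_val with (0 + 3 * 0); [ | ring]. apply flim_plus; [typeclasses eauto | exact R2 | ].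
    apply flim_mult; [typeclasses eauto | apply flim_const; typeclasses eauto | exact R1]. }
  (* Convergence at 0 of the integral of [r^3 f], in the variable [t = 1/r]: near 0 the integrand is
     below [2 L]. *)
  assert (HAex : exists M, 0 < M /\ filterlim A (at_right 0) (locally (- M))).
  { assert (Hf' := Hf). apply flim_eps with (eps := L) in Hf'; [ | typeclasses eauto | trivial].
    destruct (at_right_0_elim _ Hf') as [r0 [Hr0 Hb]].
    set (a := 1 + 2 / r0). assert (Ha : 1 < a) by (unfold a; assert (0 < 2 / r0) by (apply Rdiv_lt_0_compat; lra); lra).
    assert (Hia : forall t, a <= t -> 0 < / t < r0).
    { intros t Ht. split; [apply Rinv_0_lt_compat; lra | ].
      apply Rmult_lt_reg_r with t; [lra | ]. rewrite Rinv_l by lra.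
      assert (r0 * (2 / r0) = 2) by (field; lra). unfold a in Ht. nra. }
    destruct (incr_bounded_lim (fun t => - A (/ t)) (fun t => (/ t) ^ 4 / / t * f (/ t) / t ^ 2) a (- A (/ a) + 2 * L)) as [M [HM HMb]].
    - intros t Ht. assert (Hi := proj1 (Hia t Ht)). assert (D := HA (/ t) Hi).
      eapply is_derive_val.
      + apply (is_derive_opp (fun t => A (/ t))). apply (is_derive_comp A (fun t => / t)); [exact D | ].
        auto_derive; [lra | reflexivity].
      + cbv [opp scal]; simpl. cbv [mult]; simpl. field. lra.
    - intros t Ht. assert (Hi := proj1 (Hia t Ht)). specialize (Hp _ Hi).
      apply Rdiv_le_0_compat; [ | apply pow_lt; lra]. apply Rmult_le_pos; [ | lra].
      apply Rdiv_le_0_compat; [apply pow_le; lra | trivial].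
    - intros t Ht. destruct (Hia t Ht) as [Hi1 Hi2]. destruct (Hia a (Rle_refl a)) as [Hj1 Hj2].
      assert (Hta : / t <= / a) by (apply Rinv_le_contravar; lra).
      assert (A (/ a) - A (/ t) <= 2 * L * / a - 2 * L * / t).
      { apply (derive_le A (fun r => r ^ 4 / r * f r) (fun r => 2 * L * r) (fun _ => 2 * L)); trivial.
        - intros x Hx. apply HA. lra.
        - intros x Hx. auto_derive; trivial. ring.
        - intros x Hx. assert (Hx' : 0 < x < r0) by lra. specialize (Hb x Hx'). apply Rabs_def2 in Hb.
          replace (x ^ 4 / x * f x) with (x ^ 3 * f x) by (field; lra). lra. }
      assert (/ a <= 1) by (rewrite <- Rinv_1; apply Rinv_le_contravar; lra). nra.
    - assert (HA0 : filterlim A (at_right 0) (locally (- M))).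
      { apply flim_at_right_inv. apply (flim_ext _ (fun t => - - A (/ t))); [apply filter_forall; intros t; ring | ].
        apply flim_opp; [typeclasses eauto | exact HM]. }
      exists M. split; trivial.
      assert (Hpd : forall x, 0 < x -> 0 < x ^ 4 / x * f x).
      { intros x Hx. apply Rmult_lt_0_compat; [apply Rdiv_lt_0_compat; [apply pow_lt | ]; trivial | auto]. }
      assert (- M <= A 1).
      { apply (derive_incr_lim0 A (fun r => r ^ 4 / r * f r)); trivial; [lra | intros x Hx; apply HA; lra | intros x Hx; left; apply Hpd; lra]. }
      assert (A 1 < A 2).
      { apply (derive_incr_strict A (fun r => r ^ 4 / r * f r)); [lra | intros x Hx; apply HA; lra | intros x Hx; apply Hpd; lra]. }
      assert (A 2 <= 0).
      { apply (derive_incr_lim_infty A (fun r => r ^ 4 / r * f r)); trivial; intros x Hx; [apply HA | left; apply Hpd]; lra. }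
      lra. }
  destruct HAex as [M [HM HA0]].
  set (B := fun r => r ^ 4 * f1 r).
  assert (HB0 : filterlim B (at_right 0) (locally (- (3 * L)))).
  { apply (flim_ext _ (fun r => r ^ 3 * A r - 3 * (r ^ 3 * f r))); [apply filter_forall; intros r; unfold A, B; ring | ].
    apply flim_val with (0 ^ 3 * - M - 3 * L); [ | ring].
    apply flim_minus; [typeclasses eauto | | ].
    - apply flim_mult; [typeclasses eauto | flims | exact HA0].
    - apply flim_mult; [typeclasses eauto | apply flim_const; typeclasses eauto | exact Hf]. }
  assert (HB : forall r, 0 < r -> is_derive B r (r ^ 7 / r * f r)).
  { intros r Hr. destruct (Hs r Hr) as [D0 D1]. unfold B. auto_derive; [dsolve | ]. drw D1. simpl (INR 3). field. lra. }
  assert (HBi : filterlim B (Rbar_locally p_infty) (locally 0)).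
  { destruct (radial_rapid_decay f f1 3 Ho) as [_ R2].
    apply (flim_ext _ (fun r => r * r ^ 3 * f1 r)); [apply filter_forall; intros r; unfold B; ring | exact R2]. }
  assert (Hr := mellin_ratio f f1 A B L (- (3 * L)) M (3 * L) rho Ho HM ltac:(lra) Hrho Hf HB0 HA HB HAi HBi HA0 HB0 Hlim).
  apply (flim_ext _ (fun r => / 2 * (B r * A r) - / 2 * (r * (r ^ 3 * f r) ^ 2))).
  - apply filter_forall. intros r. unfold A, B. field.
  - apply flim_val with (/ 2 * (- (3 * L) * - M) - / 2 * (0 * L ^ 2)).
    + apply flim_minus; [typeclasses eauto | | ].
      * apply flim_mult; [typeclasses eauto | apply flim_const; typeclasses eauto | ]. apply flim_mult; [typeclasses eauto | exact HB0 | exact HA0].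
      * apply flim_mult; [typeclasses eauto | apply flim_const; typeclasses eauto | ]. apply flim_mult; [typeclasses eauto | apply flim_id0 | ].
        apply flim_pow; [typeclasses eauto | exact Hf].
    + assert (HMe : M = rho * L / 2) by lra. rewrite HMe. field.
Qed.

(** * Limits at a fixed radius, and the case [m = 3] *)

Lemma inv_beta_lim (m : nat) :
  (3 <= m)%nat -> filterlim (fun b => / Rpower b (2 / INR m)) (Rbar_locally p_infty) (locally 0).
Proof.
  intros Hm. assert (HM := INR_ge3 m Hm).
  apply (flim_at_infty_comp Rinv); [apply flim_inv_infty | ].
  intros X. destruct (large_power (2 / INR m) X) as [B [_ HB]]; [apply Rdiv_lt_0_compat; lra | ].
  now exists B.
Qed.

Lemma lam_to_zero (m : nat) (lam : R -> R) (u u1 : R -> R -> R) :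
  (3 <= m)%nat -> (forall b, 0 < b -> gstate m (lam b) b (u b) (u1 b)) ->
  filterlim lam (Rbar_locally p_infty) (locally 0).
Proof.
  intros Hm Hg. destruct (lam_bound m Hm) as [C [B [HC [HB H]]]].
  apply (flim_abs_le _ _ (fun b => C * / Rpower b (2 / INR m))).
  - apply (infty_intro _ B). intros b Hb. assert (Hb0 : 0 < b) by lra.
    rewrite Rminus_0_r, Rabs_pos_eq by (left; apply (gs_lam_pos m _ b (u b) (u1 b)); auto).
    apply (H b (lam b) (u b) (u1 b)); [lra | auto].
  - apply flim_val with (C * 0); [ | ring].
    apply flim_mult; [typeclasses eauto | apply flim_const; typeclasses eauto | now apply inv_beta_lim].
Qed.

(** Quantitative Wronskians take the place of compactness: [c_facts] compares [r u'/u] with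
    [r phi1/phi], and [outer_compare] compares the latter with the case [lam = 0]; the errors are of
    order [beta^(-2)] and [lam]. *)
Lemma family_limits (m : nat) (Phi : R -> R -> R) (lam : R -> R) (u u1 : R -> R -> R) (c : R -> R)
  (f1 : R -> R) (Ap r : R) :
  (3 <= m)%nat -> outer_family m Phi -> ground_family m Phi lam u u1 c ->
  outer m 0 (Phi 0) f1 -> 0 < r ->
  filterlim (fun b => b * c b) (Rbar_locally p_infty) (locally Ap) ->
  filterlim (fun b => b * u b r) (Rbar_locally p_infty) (locally (Ap * Phi 0 r)) /\
  filterlim (fun b => b * u1 b r) (Rbar_locally p_infty) (locally (Ap * f1 r)).
Proof.
  intros Hm HPhi Hfam Hf Hr HAp.
  assert (Hg : forall b, 0 < b -> gstate m (lam b) b (u b) (u1 b)).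
  { intros b Hb. destruct (Hfam b Hb) as [phi1 [H _]]. trivial. }
  assert (Hl0 := lam_to_zero m lam u u1 Hm Hg).
  assert (Hib := inv_beta_lim m Hm).
  destruct (c_facts m Phi Hm HPhi) as [C [B [HC [HB Hcf]]]].
  assert (Hfp := outer_pos _ _ _ _ r Hf Hr).
  assert (Hphi : filterlim (fun b => Phi (lam b) r) (Rbar_locally p_infty) (locally (Phi 0 r))).
  { assert (Hq : filterlim (fun b => Phi (lam b) r / Phi 0 r) (Rbar_locally p_infty) (locally 1)).
    { apply flim_eps; [typeclasses eauto | ]. intros eps Heps.
      destruct (outer_close m (Phi 0) f1 r (eps / 2) Hm Hf Hr ltac:(lra)) as [l0 [Hl00 Hcl]].
      apply flim_eps with (eps := l0) in Hl0; [ | typeclasses eauto | trivial].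
      destruct (infty_elim _ 1 Hl0) as [B1 [HB1 H1]].
      apply (infty_intro _ B1). intros b Hb. assert (Hb0 : 0 < b) by lra.
      specialize (H1 b ltac:(lra)). apply Rabs_def2 in H1.
      destruct (Hfam b Hb0) as [phi1 [Hgb [Ho _]]].
      assert (Hlp := gs_lam_pos m _ b _ _ Hm Hb0 Hgb).
      assert (Rabs (Phi (lam b) r / Phi 0 r - 1) <= eps / 2) by (apply (Hcl (lam b) (Phi (lam b)) phi1); trivial; lra). lra. }
    apply (flim_ext _ (fun b => Phi (lam b) r / Phi 0 r * Phi 0 r)).
    - apply filter_forall. intros b. field. lra.
    - apply flim_val with (1 * Phi 0 r); [ | ring]. apply flim_mult; [typeclasses eauto | exact Hq | apply flim_const; typeclasses eauto]. }
  assert (HX : filterlim (fun b => b * c b * Phi (lam b) r) (Rbar_locally p_infty) (locally (Ap * Phi 0 r))).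
  { apply flim_mult; [typeclasses eauto | exact HAp | exact Hphi]. }
  assert (Herr : filterlim (fun b => C / r ^ 2 * ((b * c b * Phi (lam b) r) * (/ Rpower b (2 / INR m)) ^ 2)) (Rbar_locally p_infty) (locally 0)).
  { apply flim_val with (C / r ^ 2 * (Ap * Phi 0 r * 0 ^ 2)); [ | ring].
    apply flim_mult; [typeclasses eauto | apply flim_const; typeclasses eauto | ].
    apply flim_mult; [typeclasses eauto | exact HX | ]. apply flim_pow; [typeclasses eauto | exact Hib]. }
  assert (HU : filterlim (fun b => b * u b r) (Rbar_locally p_infty) (locally (Ap * Phi 0 r))).
  { assert (Hd : filterlim (fun b => b * c b * Phi (lam b) r - b * u b r) (Rbar_locally p_infty) (locally 0)).
    { apply (flim_abs_le _ _ (fun b => C / r ^ 2 * ((b * c b * Phi (lam b) r) * (/ Rpower b (2 / INR m)) ^ 2))); [ | exact Herr].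
      apply (infty_intro _ B). intros b Hb. assert (Hb0 : 0 < b) by lra. destruct (Hfam b Hb0) as [phi1 Hco].
      destruct (Hcf b _ _ _ _ _ _ ltac:(lra) Hco) as [_ [_ Hq]]. destruct (Hq r Hr) as [[Q1 Q2] _].
      assert (Hbe := Rpower_pos b (2 / INR m)). set (beta := Rpower b (2 / INR m)) in *.
      replace (b * c b * Phi (lam b) r - b * u b r - 0) with (b * (c b * Phi (lam b) r - u b r)) by ring.
      rewrite Rabs_pos_eq by (apply Rmult_le_pos; lra).
      apply Rle_trans with (b * (C / beta ^ 2 * (c b * Phi (lam b) r) / r ^ 2)); [apply Rmult_le_compat_l; lra | ].
      right. field. lra. }
    apply (flim_ext _ (fun b => b * c b * Phi (lam b) r - (b * c b * Phi (lam b) r - b * u b r))).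
    - apply filter_forall. intros b. ring.
    - apply flim_val with (Ap * Phi 0 r - 0); [ | ring]. apply flim_minus; [typeclasses eauto | exact HX | exact Hd]. }
  split; trivial.
  assert (Hd : filterlim (fun b => b * (r * u1 b r) - b * u b r * (r * f1 r / Phi 0 r)) (Rbar_locally p_infty) (locally 0)).
  { apply (flim_abs_le _ _ (fun b => C / r ^ 2 * ((b * c b * Phi (lam b) r) * (/ Rpower b (2 / INR m)) ^ 2) + b * u b r * (lam b * / 2))).
    - apply flim_eps with (eps := 4) in Hl0; [ | typeclasses eauto | lra].
      destruct (infty_elim _ B Hl0) as [B1 [HB1 H1]].
      apply (infty_intro _ B1). intros b Hb. assert (Hb0 : 0 < b) by lra. destruct (Hfam b Hb0) as [phi1 Hco].
      specialize (H1 b ltac:(lra)). apply Rabs_def2 in H1.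
      destruct (Hcf b _ _ _ _ _ _ ltac:(lra) Hco) as [_ [_ Hq]]. destruct (Hq r Hr) as [_ [[Q1 Q2] _]].
      destruct Hco as [Hgb [Ho [Hc _]]].
      assert (Hlp := gs_lam_pos m _ b _ _ Hm Hb0 Hgb).
      destruct (outer_compare m (lam b) (Phi (lam b)) phi1 (Phi 0) f1 Hm ltac:(lra) Ho Hf) as [Hcmp _].
      destruct (Hcmp r Hr) as [S1 S2].
      assert (Hpp := outer_pos _ _ _ _ r Ho Hr). destruct (proj1 (proj2 Hgb) r Hr) as [[A1 _] _].
      assert (Hbe := Rpower_pos b (2 / INR m)). set (beta := Rpower b (2 / INR m)) in *.
      set (ph := Phi (lam b) r) in *. set (f := Phi 0 r) in *. set (x := r * phi1 r) in *. set (w := r * u1 b r) in *. set (v := u b r) in *.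
      assert (E1 : 0 <= w - v * x / ph <= C / beta ^ 2 * (c b * ph) / r ^ 2).
      { split; apply Rmult_le_reg_r with ph; trivial.
        - replace ((w - v * x / ph) * ph) with (w * ph - v * x) by (field; lra). lra.
        - replace ((w - v * x / ph) * ph) with (w * ph - v * x) by (field; lra). apply Rle_trans with (1 := Q2). right. field. lra. }
      assert (E2 : 0 <= v * x / ph - v * (r * f1 r / f) <= v * (lam b * / 2)).
      { replace (v * x / ph - v * (r * f1 r / f)) with (v * ((x * f - ph * (r * f1 r)) / (ph * f))) by (field; lra).
        assert (Hpf : 0 < ph * f) by now apply Rmult_lt_0_compat.
        split.
        - apply Rmult_le_pos; [lra | ]. apply Rdiv_le_0_compat; lra.
        - apply Rmult_le_compat_l; [lra | ]. apply Rmult_le_reg_r with (ph * f); trivial.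
          unfold Rdiv at 1. rewrite Rmult_assoc, Rinv_l by lra. unfold Rdiv in S2. lra. }
      replace (b * w - b * v * (r * f1 r / f) - 0) with (b * ((w - v * x / ph) + (v * x / ph - v * (r * f1 r / f)))) by ring.
      rewrite Rabs_pos_eq by (apply Rmult_le_pos; lra).
      apply Rle_trans with (b * (C / beta ^ 2 * (c b * ph) / r ^ 2 + v * (lam b * / 2))); [apply Rmult_le_compat_l; lra | ].
      right. field. lra.
    - apply flim_val with (0 + Ap * Phi 0 r * (0 * / 2)); [ | ring].
      apply flim_plus; [typeclasses eauto | exact Herr | ]. apply flim_mult; [typeclasses eauto | exact HU | ].
      apply flim_mult; [typeclasses eauto | exact Hl0 | apply flim_const; typeclasses eauto]. }
  apply (flim_ext _ (fun b => (b * (r * u1 b r) - b * u b r * (r * f1 r / Phi 0 r) + b * u b r * (r * f1 r / Phi 0 r)) * / r)).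
  - apply filter_forall. intros b. field. lra.
  - apply flim_val with ((0 + Ap * Phi 0 r * (r * f1 r / Phi 0 r)) * / r); [ | field; lra].
    apply flim_mult; [typeclasses eauto | | apply flim_const; typeclasses eauto].
    apply flim_plus; [typeclasses eauto | exact Hd | ]. apply flim_mult; [typeclasses eauto | exact HU | apply flim_const; typeclasses eauto].
Qed.

Lemma bubble3_sqr (s : R) : bubble 3 s ^ 2 = / (1 + alc 3 * s ^ 2) ^ 3.
Proof.
  assert (H1 := bubble_den 3 s ltac:(lia)).
  unfold bubble. rewrite <- (Rpower_pow 2), Rpower_mult by apply Rpower_pos.
  replace (- (INR 3 / 2) * INR 2) with (- INR 3) by (simpl; field).
  rewrite Rpower_Ropp, Rpower_pow by lra. reflexivity.
Qed.

Lemma atan_lim : filterlim atan (Rbar_locally p_infty) (locally (PI / 2)).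
Proof.
  apply (flim_ext _ (fun x => PI / 2 - atan (/ x))).
  - apply (infty_intro _ 0). intros x Hx. rewrite atan_inv by trivial. ring.
  - apply flim_val with (PI / 2 - atan 0); [ | rewrite atan_0; ring].
    apply flim_minus; [typeclasses eauto | apply flim_const; typeclasses eauto | ].
    apply (flim_cont _ atan); [ | apply flim_inv_infty].
    apply continuity_pt_filterlim, derivable_continuous_pt, derivable_pt_atan.
Qed.

(** As [beta^3 = b^2], the scaled boundary value divided by [beta] is [b^2 poho]. It tends to
    [Ap^2 H0 del], which is near [(3/4) A0^2 rho] for small [del]. The moment [2 P2] contributes at
    most [2 A0^2 del beta], and [P0] tends to [3 pi/(16 q^5)]. With [A0 = q^(-3)] the quotient is
    [4 rho/(pi q)]. *)
Lemma lam_five (Phi : R -> R -> R) (lam : R -> R) (u u1 : R -> R -> R) (c : R -> R) (rho : R) :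
  outer_family 3 Phi -> ground_family 3 Phi lam u u1 c -> 0 < rho ->
  is_lim_seq (fun n => poch (3 / 4) n / poch (1 / 4) n / sqrt (INR n)) rho ->
  filterlim (fun b => lam b * Rpower b (2 / INR 3) ^ 2 / Rpower b (2 / INR 3))
    (Rbar_locally p_infty) (locally (4 * sqrt 15 * rho / PI)).
Proof.
  intros HPhi Hfam Hrho Hrl. assert (Hm : (3 <= 3)%nat) by lia.
  assert (HPI := PI_RGT_0).
  assert (Hg : forall b, 0 < b -> gstate 3 (lam b) b (u b) (u1 b)).
  { intros b Hb. destruct (Hfam b Hb) as [phi1 [H _]]. trivial. }
  assert (Ha := alc_pos 3 Hm). assert (Ha15 : alc 3 = / 15) by (unfold alc; simpl; field).
  set (a := alc 3) in *. set (q := sqrt a).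
  assert (Hq : 0 < q) by now apply sqrt_lt_R0.
  assert (Hqa : q ^ 2 = a) by (unfold q; simpl; rewrite Rmult_1_r; apply sqrt_sqrt; lra).
  assert (Hq15 : / q = sqrt 15) by (unfold q; rewrite Ha15, sqrt_inv, Rinv_inv; trivial).
  set (A0 := bubble_lim 3). assert (HA0 : 0 < A0) by apply Rpower_pos.
  assert (HA0q : A0 = / q ^ 3).
  { unfold A0, bubble_lim. fold a. rewrite Rpower_Ropp. f_equal. unfold q. rewrite <- Rpower_sqrt by trivial.
    rewrite <- (Rpower_pow 3), Rpower_mult by apply Rpower_pos. f_equal. simpl. field. }
  (* The primitive of [s^4/(1 + a s^2)^3] that vanishes at 0. *)
  set (P0 := fun s => (3 / 8 * atan (q * s) - (5 * (q * s) ^ 3 + 3 * (q * s)) / (8 * (1 + (q * s) ^ 2) ^ 2)) / q ^ 5).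
  destruct (bubble_moment_exists 3 3 Hm) as [P2 [HP2 HP20]].
  assert (HP0d : forall s, is_derive P0 s (s * s ^ 3 * bubble 3 s ^ 2)).
  { intros s. rewrite bubble3_sqr. fold a. rewrite <- Hqa. unfold P0.
    assert (X : 0 < 1 + (q * s) ^ 2) by (generalize (pow2_ge_0 (q * s)); lra).
    auto_derive.
    - repeat split; try lra. apply Rgt_not_eq. simpl in X. repeat apply Rmult_lt_0_compat; lra.
    - field. simpl in *. repeat split; try lra; apply Rgt_not_eq; generalize (pow2_ge_0 (q * s)); simpl; nra. }
  assert (Hmom : bubble_moments 3 P0 P2).
  { split; [ | split; trivial].
    - intros s Hs. split; [apply HP0d | apply HP2].
    - apply flim_val with (P0 0); [apply cont_right, (is_derive_cont _ _ _ (HP0d 0)) | ].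
      unfold P0. rewrite Rmult_0_r, atan_0. field. lra. }
  set (pinf := 3 * PI / (16 * q ^ 5)).
  assert (Hq5 : 0 < q ^ 5) by (apply pow_lt; trivial).
  assert (Hpinf : 0 < pinf) by (apply Rdiv_lt_0_compat; lra).
  assert (HP0i : filterlim P0 (Rbar_locally p_infty) (locally pinf)).
  { assert (HqX : forall X, exists B, forall b, B <= b -> X <= q * b).
    { intros X. exists (X / q). intros b Hb. apply Rle_trans with (q * (X / q)); [right; field; lra | apply Rmult_le_compat_l; lra]. }
    apply (flim_at_infty_comp (fun x => (3 / 8 * atan x - (5 * x ^ 3 + 3 * x) / (8 * (1 + x ^ 2) ^ 2)) / q ^ 5) (fun s => q * s)); trivial.
    apply flim_val with ((3 / 8 * (PI / 2) - (5 * 0 + 3 * 0 ^ 3) * / (8 * (0 ^ 2 + 1) ^ 2)) * / q ^ 5); [ | unfold pinf; field; lra].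
    apply (flim_ext _ (fun x => (3 / 8 * atan x - (5 * / x + 3 * (/ x) ^ 3) * / (8 * ((/ x) ^ 2 + 1) ^ 2)) * / q ^ 5)).
    - apply (infty_intro _ 0). intros x Hx. field. repeat split; try lra; nra.
    - assert (H1 := atan_lim).
      assert (H2 : filterlim (fun x => / (8 * ((/ x) ^ 2 + 1) ^ 2)) (Rbar_locally p_infty) (locally (/ (8 * (0 ^ 2 + 1) ^ 2)))).
      { apply flim_inv; [typeclasses eauto | lra | flims]. }
      flims. }
  assert (HP2b : forall s, 0 < s -> P2 s <= A0 ^ 2 * s).
  { intros s Hs. assert (P2 s - A0 ^ 2 * s <= 0); [ | lra].
    apply (derive_decr_lim0 (fun s => P2 s - A0 ^ 2 * s) (fun s => s ^ 3 * s ^ 3 * bubble 3 s ^ 2 - A0 ^ 2)); trivial.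
    - intros x Hx. apply (is_derive_minus P2 (fun s => A0 ^ 2 * s)); [apply HP2 | ]. eapply is_derive_val; [auto_derive; trivial | ring].
    - intros x Hx. assert (B := bubble_tail_le 3 x Hm ltac:(lra)). fold A0 in B.
      replace (x ^ 3 * x ^ 3 * bubble 3 x ^ 2) with ((x ^ 3 * bubble 3 x) ^ 2) by ring.
      assert ((x ^ 3 * bubble 3 x) ^ 2 <= A0 ^ 2); [ | lra]. apply pow_incr. split; trivial.
      apply Rmult_le_pos; [apply pow_le; lra | left; apply bubble_pos].
    - apply flim_val with (0 - A0 ^ 2 * 0); [flims | ring]. }
  destruct (c_limit 3 Phi lam u u1 c Hm HPhi Hfam) as [Ap [HAp [HApl HL]]]. fold A0 in HL.
  destruct (HPhi 0 ltac:(simpl; lra)) as [f1 Hf].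
  assert (HLp : 0 < A0 / Ap) by now apply Rdiv_lt_0_compat.
  assert (HH0 := poho0_limit (Phi 0) f1 (A0 / Ap) rho Hf HLp Hrho HL Hrl).
  set (H0 := fun r => r ^ 2 * r ^ 3 * (f1 r ^ 2 / 2 - r ^ 2 * Phi 0 r ^ 2 / 2) + 3 / 2 * (r * r ^ 3 * Phi 0 r * f1 r)) in *.
  set (T := 4 * sqrt 15 * rho / PI).
  set (Ninf := A0 ^ 2 * (3 / 4) * rho).
  assert (HTN : T * pinf = Ninf).
  { unfold T, pinf, Ninf. rewrite <- Hq15, HA0q. field. lra. }
  assert (HT : 0 < T).
  { unfold T. apply Rdiv_lt_0_compat; trivial. apply Rmult_lt_0_compat; trivial. rewrite <- Hq15.
    apply Rmult_lt_0_compat; [lra | now apply Rinv_0_lt_compat]. }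
  assert (HAH : filterlim (fun r => Ap ^ 2 * H0 r) (at_right 0) (locally Ninf)).
  { apply flim_val with (Ap ^ 2 * (3 / 4 * (A0 / Ap) ^ 2 * rho)); [ | unfold Ninf; field; lra].
    apply flim_mult; [typeclasses eauto | apply flim_const; typeclasses eauto | exact HH0]. }
  apply (lam_limit_close 3 Phi P0 P2 lam u u1 (fun b => Rpower b (2 / INR 3)) T); trivial.
  intros tau Htau.
  (* Three errors [e] come from [b^2 poho], from [del] and from [P2], one more, [T e], from [P0];
     they are divided by [P0], which exceeds [pinf / 2]. *)
  set (e := tau * pinf / (2 * (3 + T))).
  assert (He : 0 < e) by (apply Rdiv_lt_0_compat; [apply Rmult_lt_0_compat | ]; lra).
  apply flim_eps with (eps := e) in HAH; [ | typeclasses eauto | trivial].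
  destruct (at_right_0_elim _ HAH) as [d0 [Hd0 HAH0]].
  assert (HA02 : 0 < A0 ^ 2) by (apply pow_lt; trivial).
  set (d1 := e / (2 * A0 ^ 2)). assert (Hd1 : 0 < d1) by (apply Rdiv_lt_0_compat; lra).
  exists (Rmin (d0 / 2) d1). split; [apply Rmin_glb_lt; lra | ].
  intros del Hdel. assert (Hm1 := Rmin_l (d0 / 2) d1). assert (Hm2 := Rmin_r (d0 / 2) d1).
  specialize (HAH0 del ltac:(lra)).
  destruct (family_limits 3 Phi lam u u1 c f1 Ap del Hm HPhi Hfam Hf ltac:(lra) HApl) as [LU LU1].
  assert (Ll := lam_to_zero 3 lam u u1 Hm Hg). assert (Lib := inv_beta_lim 3 Hm).
  destruct (mass_bound 3 Hm) as [C [B1 [HC [HB1 Hmass]]]].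
  assert (LK : filterlim (fun b => Rpower (u b del) (4 / INR 3)) (Rbar_locally p_infty) (locally 0)).
  { apply (flim_abs_le _ _ (fun b => C ^ 2 / del ^ 4 * (/ Rpower b (2 / INR 3)) ^ 2)).
    - apply (infty_intro _ B1). intros b Hb. assert (Hb0 : 0 < b) by lra.
      destruct (Hmass b (lam b) (u b) (u1 b) ltac:(lra) (Hg b Hb0)) as [_ Hmb].
      destruct (proj1 (proj2 (Hg b Hb0)) del ltac:(lra)) as [[X1 _] _].
      assert (Hpb := potential_bound 3 b C del (u b del) Hm Hb0 HC ltac:(lra) X1 (Hmb del ltac:(lra))).
      assert (Hk := Rpower_pos (u b del) (4 / INR 3)). assert (Hbe := Rpower_pos b (2 / INR 3)).
      set (beta := Rpower b (2 / INR 3)) in *. set (K := Rpower (u b del) (4 / INR 3)) in *.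
      rewrite Rminus_0_r, Rabs_pos_eq by lra.
      assert (Hd4 : 0 < del ^ 4) by (apply pow_lt; lra).
      apply Rmult_le_reg_l with (del ^ 4); trivial. apply Rle_trans with (1 := Hpb). right. field. lra.
    - apply flim_val with (C ^ 2 / del ^ 4 * 0 ^ 2); [ | ring].
      apply flim_mult; [typeclasses eauto | apply flim_const; typeclasses eauto | ]. apply flim_pow; [typeclasses eauto | exact Lib]. }
  assert (Lh : filterlim (fun b => b ^ 2 * poho 3 (lam b) (u b) (u1 b) del) (Rbar_locally p_infty) (locally (Ap ^ 2 * H0 del))).
  { set (k := 4 / INR 3 + 2).
    apply (flim_ext _ (fun b => del ^ 2 * del ^ 3 * ((b * u1 b del) ^ 2 * / 2 + Rpower (u b del) (4 / INR 3) * (b * u b del) ^ 2 * / k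
      + (lam b - del ^ 2) * (b * u b del) ^ 2 * / 2) + 3 / 2 * (del * del ^ 3 * (b * u b del) * (b * u1 b del)))).
    - apply filter_forall. intros b. unfold poho. fold k. simpl (INR 3 / 2). unfold Rdiv. replace (1 + 1 + 1) with 3 by ring. ring.
    - apply flim_val with (del ^ 2 * del ^ 3 * ((Ap * f1 del) ^ 2 * / 2 + 0 * (Ap * Phi 0 del) ^ 2 * / k
        + (0 - del ^ 2) * (Ap * Phi 0 del) ^ 2 * / 2) + 3 / 2 * (del * del ^ 3 * (Ap * Phi 0 del) * (Ap * f1 del))).
      + assert (Lc : forall x : R, filterlim (fun _ : R => x) (Rbar_locally p_infty) (locally x)) by (intros; apply flim_const; typeclasses eauto).
        apply flim_plus; [typeclasses eauto | apply flim_mult; [typeclasses eauto | apply Lc | ] | apply flim_mult; [typeclasses eauto | apply Lc | ]].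
        * apply flim_plus; [typeclasses eauto | apply flim_plus; [typeclasses eauto | | ] | ].
          -- apply flim_mult; [typeclasses eauto | apply flim_pow; [typeclasses eauto | exact LU1] | apply Lc].
          -- apply flim_mult; [typeclasses eauto | apply flim_mult; [typeclasses eauto | exact LK | apply flim_pow; [typeclasses eauto | exact LU]] | apply Lc].
          -- apply flim_mult; [typeclasses eauto | apply flim_mult; [typeclasses eauto | apply flim_minus; [typeclasses eauto | exact Ll | apply Lc] | apply flim_pow; [typeclasses eauto | exact LU]] | apply Lc].
        * apply flim_mult; [typeclasses eauto | apply flim_mult; [typeclasses eauto | apply Lc | exact LU] | exact LU1].
      + unfold H0. field. unfold k. simpl. lra. }
  apply flim_eps with (eps := e) in Lh; [ | typeclasses eauto | trivial].
  assert (Hbig : forall X, exists B, forall b, B <= b -> X <= del * Rpower b (2 / INR 3)).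
  { intros X. destruct (large_power (2 / INR 3) (X / del)) as [B [_ HB]]; [simpl; lra | ].
    exists B. intros b Hb. specialize (HB b Hb).
    apply Rle_trans with (del * (X / del)); [right; field; lra | apply Rmult_le_compat_l; lra]. }
  assert (LP0 : filterlim (fun b => P0 (del * Rpower b (2 / INR 3))) (Rbar_locally p_infty) (locally pinf)) by now apply flim_at_infty_comp.
  assert (LP0' := LP0).
  apply flim_eps with (eps := e) in LP0; [ | typeclasses eauto | trivial].
  apply flim_eps with (eps := pinf / 2) in LP0'; [ | typeclasses eauto | lra].
  destruct (infty_elim _ 1 (filter_and _ _ Lh (filter_and _ _ LP0 LP0'))) as [B2 [HB2 H2]].
  exists B2. split; [lra | ]. intros b Hb. destruct (H2 b Hb) as [K1 [K2 K3]].
  assert (Hb0 : 0 < b) by lra. assert (Hbe := Rpower_pos b (2 / INR 3)). split; trivial.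
  assert (Hb3 := Rpower_beta 3 b Hm Hb0).
  intros beta. fold beta in K2, K3, Hbe, Hb3.
  set (h := poho 3 (lam b) (u b) (u1 b) del) in *. set (S := del * beta) in *.
  assert (HS : 0 < S) by (apply Rmult_lt_0_compat; lra).
  destruct (moments_pos 3 P0 P2 Hmom) as [HPp _]. destruct (HPp S HS) as [_ HP2p]. specialize (HP2b S HS).
  set (p := P0 S) in *.
  apply Rabs_def2 in K1. apply Rabs_def2 in K2. apply Rabs_def2 in K3. apply Rabs_def2 in HAH0.
  assert (Hp : 0 < p) by lra.
  assert (Hz : 0 <= P2 S / beta <= A0 ^ 2 * del).
  { split; [now apply Rdiv_le_0_compat | ]. apply Rmult_le_reg_r with beta; trivial.
    unfold Rdiv. rewrite Rmult_assoc, Rinv_l, Rmult_1_r by lra. unfold S in HP2b at 2. lra. }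
  assert (Hz2 : 2 * (A0 ^ 2 * del) <= e).
  { apply Rle_trans with (2 * (A0 ^ 2 * d1)); [ | right; unfold d1; field; lra].
    apply Rmult_le_compat_l; [lra | ]. apply Rmult_le_compat_l; lra. }
  fold beta.
  replace ((beta ^ 4 * h + 2 * P2 S) / p / beta - T) with ((b ^ 2 * h + 2 * (P2 S / beta) - T * p) / p)
    by (rewrite <- Hb3; field; lra).
  set (z := P2 S / beta) in *. unfold Rdiv.
  rewrite Rabs_mult, (Rabs_pos_eq (/ p)) by (left; now apply Rinv_0_lt_compat).
  apply Rmult_le_reg_r with p; trivial. rewrite Rmult_assoc, Rinv_l, Rmult_1_r by lra.
  apply Rle_trans with ((3 + T) * e).
  - assert (T * (p - pinf) <= T * e) by (apply Rmult_le_compat_l; lra).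
    assert (T * (pinf - p) <= T * e) by (apply Rmult_le_compat_l; lra).
    apply Rabs_le. lra.
  - replace ((3 + T) * e) with (tau * (pinf / 2)) by (unfold e; field; lra). apply Rmult_le_compat_l; lra.
Qed.

(** * Assembly in the notation of the theorem *)

Lemma Ualg_bubble (m : nat) (b r : R) :
  (3 <= m)%nat -> 0 < b -> Ualg (2 / INR m) b r = b * bubble m (r * Rpower b (2 / INR m)).
Proof.
  intros Hm Hb. assert (HM := INR_ge3 m Hm).
  unfold Ualg, bubble, Rdiv. rewrite Rpower_Ropp. do 2 f_equal. f_equal.
  - replace (2 * (2 * / INR m)) with (2 * / INR m + 2 * / INR m) by ring. rewrite Rpower_plus.
    replace (alpha_p (2 * / INR m)) with (alc m) by (unfold alpha_p, alc; field; lra). ring.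
  - field. lra.
Qed.

Lemma equiv_of_quotient (f g h : R -> R) (l : R) :
  0 < l -> (forall b, 1 < b -> 0 < g b /\ h b = f b / g b) ->
  filterlim h (Rbar_locally p_infty) (locally l) ->
  is_lim (fun b => f b / (l * g b)) p_infty 1.
Proof.
  intros Hl Hg Hh.
  change (filterlim (fun b => f b / (l * g b)) (Rbar_locally p_infty) (locally 1)).
  apply (filterlim_ext_loc (fun b => h b * / l)).
  - exists 1. intros b Hb. destruct (Hg b Hb) as [G E]. rewrite E. field. lra.
  - apply flim_val with (l * / l); [ | field; lra].
    apply flim_mult; [typeclasses eauto | exact Hh | apply flim_const; typeclasses eauto].
Qed.

Lemma lam_asymptotic (m : nat) (Phi : R -> R -> R) (lam : R -> R) (u u1 : R -> R -> R) (c : R -> R) :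
  (3 <= m)%nat -> outer_family m Phi -> ground_family m Phi lam u u1 c ->
  is_lim (fun b => lam b / (Cconst (2 / INR m) * lam_rate (2 / INR m) b)) p_infty 1.
Proof.
  intros Hm HPhi Hfam.
  assert (Hg : forall b, 0 < b -> gstate m (lam b) b (u b) (u1 b)).
  { intros b Hb. destruct (Hfam b Hb) as [phi1 [H _]]. trivial. }
  (* As [p = 2/m], these are the cases [p > 1/2], [p = 1/2] and [p < 1/2]. *)
  assert (Hcase : m = 3%nat \/ m = 4%nat \/ (5 <= m)%nat) by lia.
  destruct Hcase as [E | [E | H5]].
  - subst m. destruct Gamma_constant as [rho [Hrho [Hlim HG]]].
    assert (L5 := lam_five Phi lam u u1 c rho HPhi Hfam Hrho Hlim).
    replace (INR 3) with 3 in * by (simpl; ring).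
    assert (HPI := PI_RGT_0). assert (Hs : 0 < sqrt 15) by (apply sqrt_lt_R0; lra).
    assert (HC : Cconst (2 / 3) = 4 * sqrt 15 * rho / PI).
    { unfold Cconst. destruct (Rlt_dec (1 / 2) (2 / 3)) as [_ | N]; [ | lra].
      replace ((2 / 3 + 1) / (2 * (2 / 3))) with (5 / 4) by field.
      replace ((2 / 3 - 1) / (2 * (2 / 3))) with (- (1 / 4)) by field.
      replace (1 / (2 / 3)) with (3 / 2) by field. replace (2 / (2 / 3)) with 3 by field.
      replace (3 / 2 - 1) with (1 / 2) by field. replace (3 / 2 + 1) with (5 / 2) by field.
      replace (4 * (1 + 2 / 3) / (2 / 3) ^ 2) with 15 by field.
      (* The factor [(4 (1+p)/p^2)^(1/p)] of [Cconst] at [p = 2/3]. *)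
      assert (H15 : Rpower 15 (3 / 2) = 15 * sqrt 15).
      { replace (3 / 2) with (1 + / 2) by field. rewrite Rpower_plus, Rpower_1, Rpower_sqrt by lra. trivial. }
      rewrite H15.
      set (X := Gamma (5 / 4) * Gamma (- (3 / 2)) * Gamma 3) in *.
      replace ((1 + 2 / 3) * Gamma (- (1 / 4)) * Gamma (3 / 2) * Gamma (1 / 2) * Gamma (5 / 2))
        with ((5 / 3) * (Gamma (- (1 / 4)) * Gamma (3 / 2) * Gamma (1 / 2) * Gamma (5 / 2))) by field.
      unfold Rdiv in HG |- *. rewrite Rinv_mult.
      set (Y := / (Gamma (- (1 * / 4)) * _ * _ * _)) in *.
      replace (- X * (/ (5 * / 3) * Y) * (15 * sqrt 15)) with (- 9 * sqrt 15 * (X * Y)) by field.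
      rewrite HG. field. lra. }
    rewrite HC.
    apply equiv_of_quotient with (3 := L5).
    + apply Rdiv_lt_0_compat; trivial. repeat apply Rmult_lt_0_compat; lra.
    + intros b Hb. unfold lam_rate. destruct (Rlt_dec (1 / 2) (2 / 3)) as [_ | N]; [ | lra].
      split; [apply Rpower_pos | ].
      replace (- (2 * (1 - 2 / 3))) with (- (2 / 3)) by field. rewrite Rpower_Ropp.
      field. apply Rgt_not_eq, Rpower_pos.
  - subst m. assert (L6 := lam_six Phi lam u u1 HPhi Hg).
    replace (INR 4) with 4 in * by (simpl; ring).
    assert (HC : Cconst (2 / 4) = 144).
    { unfold Cconst. destruct (Rlt_dec (1 / 2) (2 / 4)); [lra | ].
      destruct (Req_EM_T (2 / 4) (1 / 2)); [trivial | lra]. }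
    rewrite HC. apply equiv_of_quotient with (3 := L6); [lra | ].
    intros b Hb. assert (Hln : 0 < ln b) by (rewrite <- ln_1; apply ln_increasing; lra).
    unfold lam_rate. destruct (Rlt_dec (1 / 2) (2 / 4)); [lra | ].
    destruct (Req_EM_T (2 / 4) (1 / 2)); [ | lra].
    split; [apply Rmult_lt_0_compat; trivial; apply Rinv_0_lt_compat; lra | ].
    replace (Rpower b (2 / 4) ^ 2) with b; [field; lra | ].
    simpl. rewrite Rmult_1_r, <- Rpower_plus. replace (2 / 4 + 2 / 4) with 1 by field.
    now rewrite Rpower_1 by lra.
  - assert (LH := lam_high m Phi lam u u1 H5 HPhi Hg).
    assert (HM5 : 5 <= INR m) by (apply (le_INR 5) in H5; simpl in H5; lra).
    set (M := INR m) in *.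
    assert (Hp : 2 / M < 1 / 2).
    { apply Rmult_lt_reg_r with M; [lra | ]. unfold Rdiv. rewrite Rmult_assoc, Rinv_l by lra. lra. }
    assert (HC : Cconst (2 / M) = 2 * (M + 2) / (alc m * (M - 4))).
    { unfold Cconst. destruct (Rlt_dec (1 / 2) (2 / M)); [lra | ].
      destruct (Req_EM_T (2 / M) (1 / 2)); [lra | ].
      unfold alc. fold M. field. repeat split; lra. }
    rewrite HC. apply equiv_of_quotient with (3 := LH).
    + assert (Ha := alc_pos m Hm). apply Rdiv_lt_0_compat; [lra | apply Rmult_lt_0_compat; lra].
    + intros b Hb. unfold lam_rate. destruct (Rlt_dec (1 / 2) (2 / M)); [lra | ].
      destruct (Req_EM_T (2 / M) (1 / 2)); [lra | ].
      split; [apply Rpower_pos | ].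
      replace (- (2 * (2 / M))) with (- (2 / M) + - (2 / M)) by ring. rewrite Rpower_plus, Rpower_Ropp.
      field. apply Rgt_not_eq, Rpower_pos.
Qed.

Lemma apow_pos (x q : R) : 0 < x -> apow x q = Rpower x q.
Proof.
  intros Hx. unfold apow. rewrite (Rabs_pos_eq x) by lra.
  destruct (Rlt_dec 0 x); [trivial | contradiction].
Qed.

(** The theorem needs [c] as a function of [b]. It is defined for every [b] through [Lim], and
    [gs_ratio_lim] shows that for [b > 0] this is a true limit. *)
Lemma coupling_ratio (m : nat) (Phi : R -> R -> R) (lam : R -> R) (u u1 : R -> R -> R) :
  (3 <= m)%nat -> outer_family m Phi ->
  (forall b, 0 < b -> gstate m (lam b) b (u b) (u1 b)) ->
  ground_family m Phi lam u u1 (fun b => real (Lim (fun r => u b r / Phi (lam b) r) p_infty)).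
Proof.
  intros Hm HPhi Hg b Hb. specialize (Hg b Hb).
  assert (Hl0 := gs_lam_pos m _ b _ _ Hm Hb Hg). assert (Hl1 := gs_lam_lt m _ b _ _ Hg).
  destruct (HPhi (lam b)) as [phi1 Ho]; [lra | ].
  destruct (gs_ratio_lim m _ b _ _ _ _ Hm Hb Hg Ho) as [c [Hc [Hlim Hle]]].
  assert (E : Lim (fun r => u b r / Phi (lam b) r) p_infty = c) by now apply is_lim_unique.
  exists phi1. unfold coupling. rewrite E. simpl. auto.
Qed.

Theorem theorem1p1 (d : nat) (TU : R -> R -> R -> R)
  (lam : R -> R) (u : R -> R -> R) :
  (4 < d)%nat ->
  is_tricomi TU ->
  (forall b, 0 < b -> radial_ground_state d (p_of d) (lam b) b (u b)) ->
  is_lim (fun b => lam b / (Cconst (p_of d) * lam_rate (p_of d) b)) p_infty 1 /\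
  exists (Ap : R) (c : R -> R), 0 < Ap /\
    (forall b, 0 < b ->
       is_lim (fun r => u b r * exp (r ^ 2 / 2) * Rpower r ((INR d - lam b) / 2))
         p_infty (c b)) /\
    is_lim (fun b => c b / (Ap / b)) p_infty 1 /\
    forall a, 0 < a < p_of d / (1 + p_of d) ->
      exists Ba Ca : R, 0 < Ba /\ 0 < Ca /\
        forall b, Ba <= b ->
          (forall r, 0 <= r <= Rpower b (- (p_of d * (1 - a))) ->
             / b * Rabs (u b r - Ualg (p_of d) b r)
               <= Ca * Rpower b (- (2 * p_of d * (1 - a)))) /\
          (forall r, Rpower b (- (p_of d * (1 - a))) <= r <= 1 ->
             Rpower r (2 / p_of d) *
               Rabs (u b r - c b * exp (- (r ^ 2) / 2)
                        * TU (r ^ 2) (kalpha (p_of d) (lam b)) (kbeta (p_of d)))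
               <= Ca * apow (c b) (2 * p_of d + 1)
                     * Rpower b (2 * p_of d * (1 - a))) /\
          (forall r, 1 <= r ->
             Rabs (exp (r ^ 2 / 2) * Rpower r ((INR d - lam b) / 2) * u b r
                   - c b * Rpower r ((INR d - lam b) / 2)
                       * TU (r ^ 2) (kalpha (p_of d) (lam b)) (kbeta (p_of d)))
               <= Ca * apow (c b) (2 * p_of d + 1)).
Proof.
  intros Hd HT Hu.
  destruct d as [ | [ | m]]; [lia | lia | ].
  assert (Hm : (3 <= m)%nat) by lia. assert (HM := INR_ge3 m Hm).
  assert (Hdm : INR (S (S m)) = INR m + 2) by (rewrite !S_INR; ring).
  assert (Hp : p_of (S (S m)) = 2 / INR m) by (unfold p_of; rewrite Hdm; f_equal; ring).
  set (Phi := fun lam r => exp (- (r ^ 2) / 2) * TU (r ^ 2) ((INR m + 2 - lam) / 4) (1 + INR m / 2)).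
  assert (HPhi : outer_family m Phi) by (intros l Hl; now apply tricomi_outer).
  assert (Hg : forall b, 0 < b -> gstate m (lam b) b (u b) (Derive (u b))).
  { intros b Hb. apply radial_gstate; auto. }
  (* The first estimate includes [r = 0], about which [gstate] only records limits. *)
  assert (Hu0 : forall b, 0 < b -> u b 0 = b) by (intros b Hb; apply (Hu b Hb)).
  set (u1 := fun b => Derive (u b)).
  set (c := fun b => real (Lim (fun r => u b r / Phi (lam b) r) p_infty)).
  assert (Hfam : ground_family m Phi lam u u1 c) by now apply coupling_ratio.
  assert (HTU : forall b r, TU (r ^ 2) (kalpha (2 / INR m) (lam b)) (kbeta (2 / INR m))
    = TU (r ^ 2) ((INR m + 2 - lam b) / 4) (1 + INR m / 2)).
  { intros b r. f_equal; [unfold kalpha | unfold kbeta]; field; lra. }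
  rewrite Hp, Hdm. clear Hp Hdm Hd Hu.
  split; [now apply (lam_asymptotic m Phi lam u u1 c) | ].
  destruct (c_limit m Phi lam u u1 c Hm HPhi Hfam) as [Ap [HAp [Hc _]]].
  exists Ap, c. split; trivial. split; [ | split].
  - intros b Hb. destruct (Hfam b Hb) as [phi1 [_ [Ho [_ [Hlim _]]]]].
    change (filterlim (fun r => u b r * exp (r ^ 2 / 2) * Rpower r ((INR m + 2 - lam b) / 2))
      (Rbar_locally p_infty) (locally (c b))).
    (* The weight times [Phi] tends to 1, so weighting [u] amounts, in the limit, to dividing it by
       [Phi]. *)
    assert (HE := proj1 (proj2 Ho)).
    apply (filterlim_ext_loc (fun r => u b r / Phi (lam b) r
      * (exp (r ^ 2 / 2) * Rpower r ((INR m + 2 - lam b) / 2) * Phi (lam b) r))).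
    + exists 0. intros r Hr. assert (H := outer_pos m _ _ _ r Ho Hr). field. lra.
    + apply flim_val with (c b * 1); [ | ring]. apply flim_mult; [typeclasses eauto | exact Hlim | exact HE].
  - change (filterlim (fun b => c b / (Ap / b)) (Rbar_locally p_infty) (locally 1)).
    apply (filterlim_ext_loc (fun b => b * c b * / Ap)).
    + exists 0. intros b Hb. field. lra.
    + apply flim_val with (Ap * / Ap); [ | field; lra].
      apply flim_mult; [typeclasses eauto | exact Hc | apply flim_const; typeclasses eauto].
  - intros a Ha.
    assert (Hpp : 0 < 2 / INR m) by (apply Rdiv_lt_0_compat; lra).
    assert (Ha1 : 0 < a < 1).
    { split; [lra | ]. apply Rlt_trans with (1 := proj2 Ha).
      apply Rmult_lt_reg_r with (1 + 2 / INR m); [lra | ].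
      unfold Rdiv at 1. rewrite Rmult_assoc, Rinv_l; lra. }
    destruct (estimate_inner m a Hm Ha1) as [C1 [B1 [HC1 [HB1 H1]]]].
    destruct (estimate_middle m Phi a Hm HPhi Ha1) as [C2 [B2 [HC2 [HB2 H2]]]].
    destruct (estimate_outer m Phi Hm HPhi) as [C3 [B3 [HC3 [HB3 H3]]]].
    exists (B1 + B2 + B3), (C1 + C2 + C3). split; [lra | split; [lra | ]].
    intros b Hb. assert (Hb0 : 0 < b) by lra.
    destruct (Hfam b Hb0) as [phi1 Hco]. assert (Hcb : 0 < c b) by apply Hco.
    rewrite (apow_pos (c b)) by trivial.
    replace (2 * (2 / INR m) + 1) with (4 / INR m + 1) by (field; lra).
    assert (Q := Rpower_pos (c b) (4 / INR m + 1)).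
    split; [ | split].
    + intros r Hr. rewrite Ualg_bubble by trivial.
      assert (Q1 := Rpower_pos b (- (2 * (2 / INR m) * (1 - a)))).
      destruct (Req_dec r 0) as [-> | Hr0].
      * rewrite Rmult_0_l. unfold bubble.
        replace (1 + alc m * 0 ^ 2) with 1 by ring.
        replace (Rpower 1 (- (INR m / 2))) with 1 by (unfold Rpower; now rewrite ln_1, Rmult_0_r, exp_0).
        rewrite (Hu0 b Hb0), Rmult_1_r, Rminus_diag, Rabs_R0, Rmult_0_r.
        apply Rmult_le_pos; lra.
      * apply Rle_trans with (C1 * Rpower b (- (2 * (2 / INR m) * (1 - a)))).
        -- apply (H1 b (lam b) (u b) (u1 b)); [lra | apply Hco | lra].
        -- apply Rmult_le_compat_r; lra.
    + intros r Hr. assert (Hr0 : 0 < r) by (apply Rlt_le_trans with (2 := proj1 Hr), Rpower_pos).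
      rewrite HTU.
      replace (c b * exp (- (r ^ 2) / 2) * TU (r ^ 2) ((INR m + 2 - lam b) / 4) (1 + INR m / 2))
        with (c b * Phi (lam b) r) by (unfold Phi; ring).
      replace (2 / (2 / INR m)) with (INR m) by (field; lra). rewrite Rpower_pow by trivial.
      assert (Q2 := Rpower_pos b (2 * (2 / INR m) * (1 - a))).
      apply Rle_trans with (1 := H2 b (lam b) (u b) (u1 b) _ phi1 (c b) ltac:(lra) Hco r (proj1 Hr)).
      apply Rmult_le_compat_r; [lra | ]. apply Rmult_le_compat_r; lra.
    + intros r Hr. rewrite HTU.
      assert (Hexp : exp (r ^ 2 / 2) * exp (- (r ^ 2) / 2) = 1).
      { rewrite <- exp_plus. replace (r ^ 2 / 2 + - (r ^ 2) / 2) with 0 by field. apply exp_0. }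
      set (k := (INR m + 2 - lam b) / 2).
      replace (exp (r ^ 2 / 2) * Rpower r k * u b r
        - c b * Rpower r k * TU (r ^ 2) ((INR m + 2 - lam b) / 4) (1 + INR m / 2))
        with (exp (r ^ 2 / 2) * Rpower r k * (u b r - c b * Phi (lam b) r)).
      * rewrite Rabs_mult, Rabs_pos_eq
          by (apply Rmult_le_pos; left; [apply exp_pos | apply Rpower_pos]).
        apply Rle_trans with (1 := H3 b (lam b) (u b) (u1 b) _ phi1 (c b) ltac:(lra) Hco r Hr).
        apply Rmult_le_compat_r; lra.
      * unfold Phi. rewrite Rmult_minus_distr_l. f_equal.
        transitivity (exp (r ^ 2 / 2) * exp (- (r ^ 2) / 2) * (c b * Rpower r k
          * TU (r ^ 2) ((INR m + 2 - lam b) / 4) (1 + INR m / 2))); [ring | ].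
        rewrite Hexp. ring.
Qed.
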